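(* Let $\nu_1,\nu_2>0$. There exists $\eta_1>0$ small enough such that the following holds for the Navier-Stokes-Fourier system $$\partial_tu-\nu_1\Delta_xu=Q_{\mathrm{NS}}(u,u),\quad \partial_t\theta+u\cdot\nabla_x\theta-\nu_2\Delta_x\theta=0,\quad \operatorname{div}_xu=0,\quad\nabla_x(\rho+\theta)=0,$$ with initial data $(\rho_0,u_0,\theta_0)$ satisfying $\operatorname{div}_xu_0=0$ and $\nabla_x(\rho_0+\theta_0)=0$. (1) Torus case $\Omega_x=\mathbb T^3$. For any such initial data $(\rho_0,u_0,\theta_0)\in\mathcal F_x^{-1}(L^1_\xi)$ which is mean-free, i.e. $\int_{\mathbb T^3}\rho_0\,dx=\int_{\mathbb T^3}u_0\,dx=\int_{\mathbb T^3}\theta_0\,dx=0$, and satisfies $\|(\widehat\rho_0,\widehat u_0,\widehat\theta_0)\|_{L^1_\xi}\le\eta_1$, there exists a unique global mild solution $(\rho,u,\theta)\in\mathcal F_x^{-1}(L^1_\xi L^\infty_t\cap L^1_\xi(\langle\xi\rangle)L^2_t)$ which is mean-free for all $t\ge0$ and satisfies the energy estimate $$\|(\widehat\rho,\widehat u,\widehat\theta)\|_{L^1_\xi L^\infty_t}+\|\langle\xi\rangle(\widehat\rho,\widehat u,\widehat\theta)\|_{L^1_\xi L^2_t}\lesssim\|(\widehat\rho_0,\widehat u_0,\widehat\theta_0)\|_{L^1_\xi}.$$ (2) Whole space case $\Omega_x=\mathbb R^3$. Let $p\in(3/2,\infty]$. For any such initial data $(\rho_0,u_0,\theta_0)\in\mathcal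 F_x^{-1}(L^1_\xi\cap L^p_\xi)$ with $\|(\widehat\rho_0,\widehat u_0,\widehat\theta_0)\|_{L^1_\xi}+\|(\widehat\rho_0,\widehat u_0,\widehat\theta_0)\|_{L^p_\xi}\le\eta_1$, there exists a unique global mild solution $(\rho,u,\theta)\in\mathcal F_x^{-1}(L^1_\xi L^\infty_t\cap L^1_\xi(|\xi|)L^2_t\cap L^p_\xi L^\infty_t\cap L^p_\xi(|\xi|)L^2_t)$ satisfying the energy estimate $$\sum_{q\in\{1,p\}}\Big(\|(\widehat\rho,\widehat u,\widehat\theta)\|_{L^q_\xi L^\infty_t}+\||\xi|(\widehat\rho,\widehat u,\widehat\theta)\|_{L^q_\xi L^2_t}\Big)\lesssim\|(\widehat\rho_0,\widehat u_0,\widehat\theta_0)\|_{L^1_\xi}+\|(\widehat\rho_0,\widehat u_0,\widehat\theta_0)\|_{L^p_\xi}.$$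
   Context: $\Omega_x=\mathbb T^3$ (normalized $|\mathbb T^3|=1$, dual $\Omega'_\xi=\mathbb Z^3$) or $\Omega_x=\mathbb R^3$ (dual $\mathbb R^3$); $\widehat{\ }=\mathcal F_x$ is the Fourier transform in $x$; $\langle\xi\rangle=(1+|\xi|^2)^{1/2}$. $L^p_\xi$ is $\ell^p(\mathbb Z^3)$ or $L^p(\mathbb R^3)$; $\|\widehat u\|_{L^p_\xi L^q_t}=\big\|\,\|\widehat u(\cdot,\xi)\|_{L^q_t(0,\infty)}\big\|_{L^p_\xi}$; $L^p_\xi(w)L^2_t$ is the weighted space with norm $\|w(\xi)\widehat u\|_{L^p_\xi L^2_t}$. $\mathcal F_x^{-1}(X)=\{f:\widehat f\in X\}$. The unknowns are $\rho,\theta:\mathbb R_+\times\Omega_x\to\mathbb R$ and $u:\mathbb R_+\times\Omega_x\to\mathbb R^3$. On the torus, ''mean-free'' means that $\rho$, $u$, $\theta$ have zero integral over $\mathbb T^3$. $Q_{\mathrm{NS}}(v,u)=-\frac12\mathbb P(\operatorname{div}(v\otimes u)+\operatorname{div}(u\otimes v))$, $\operatorname{div}(v\otimes u)^j=\sum_{k=1}^3\partial_k(v^ju^k)$, where $\mathbb P$ is the Leray projector: $\mathcal F_x(\mathbb Pf)^j(\xi)=\widehat f^j(\xi)-\frac1{|\xi|^2}\sum_{k=1}^3\xi_j\xi_k\widehat f^k(\xi)$. Mild solution: with $V(t)=e^{t\nu_1\Delta_x}$ and $\overline V(t)=e^{t\nu_2\Delta_x}$, one requires $u(t)=V(t)u_0+\int_0^tV(t-\tau)Q_{\mathrm{NS}}(u(\tau),u(\tau))\,d\tau$,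 $\theta(t)=\overline V(t)\theta_0-\int_0^t\overline V(t-\tau)\operatorname{div}_x(u(\tau)\theta(\tau))\,d\tau$, together with $\operatorname{div}_xu=0$ and $\nabla_x(\rho+\theta)=0$. $A\lesssim B$ means $A\le CB$ with a constant $C>0$ independent of the data. *)

(* Defs.v *)
From HB Require Import structures.
From mathcomp Require Import all_boot all_order all_algebra.
From mathcomp Require Import complex.
From mathcomp Require Import all_classical all_reals all_analysis.

Set Implicit Arguments.
Unset Strict Implicit.
Unset Printing Implicit Defensive.

Import Order.TTheory GRing.Theory Num.Theory.
Import numFieldNormedType.Exports.

Local Open Scope classical_set_scope.
Local Open Scope ring_scope.
Local Open Scope complex_scope.

Definition coord3 (T : Type) (x : T * T * T) (k : 'I_3) : T :=
  match val k with 0%N => x.1.1 | 1%N => x.1.2 | _ => x.2 end.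

Definition R3 (R : realType) : Type :=
  (measurableTypeR R * measurableTypeR R * measurableTypeR R)%type.
HB.instance Definition _ (R : realType) := Measurable.on (R3 R).

Definition leb3 (R : realType) : {measure set (R3 R) -> \bar R} :=
  ((@lebesgue_measure R \x @lebesgue_measure R) \x @lebesgue_measure R)%E.

(* The dual lattice, with its discrete sigma-algebra. *)
Definition Z3 : Type := (int * int * int)%type.
HB.instance Definition _ := Choice.on Z3.
HB.instance Definition _ := isPointed.Build Z3 (0, 0, 0).
HB.instance Definition _ := @isMeasurable.Build default_measure_display
  Z3 discrete_measurable discrete_measurable0
  discrete_measurableC discrete_measurableU.

Section complex_functions.
Context d (T : measurableType d) (R : realType).
Implicit Types (D : set T) (f : T -> R[i]).

Definition cmod (z : R[i]) : R := ComplexField.Normc.normc z.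

Definition cis (y : R) : R[i] := cos y +i* sin y.

Definition cmeasurable D f : Prop :=
  measurable_fun D (fun x => complex.Re (f x)) /\ measurable_fun D (fun x => complex.Im (f x)).

Definition cintegrable (mu : {measure set T -> \bar R}) D f : Prop :=
  mu.-integrable D (fun x => (complex.Re (f x))%:E) /\
  mu.-integrable D (fun x => (complex.Im (f x))%:E).

Definition cintegral (mu : {measure set T -> \bar R}) D f : R[i] :=
  (\int[mu]_(x in D) complex.Re (f x)) +i* (\int[mu]_(x in D) complex.Im (f x)).

End complex_functions.

(* The triple (rho, u, theta): of functions of x when T is [R3 R -> R], of their
   Fourier transforms when T is a type of functions of the frequency. *)
Record state (T : Type) := State { rho : T; vel : 'I_3 -> T; temp : T }.

(* What distinguishes the torus from the whole space: the frequency space with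
   its measure and the real coordinates of a frequency, and the relation
   [transform f F], "f is in F_x^{-1}(L^1_xi) and F is its Fourier transform".
   A function on the torus is a periodic function on R^3. Transforms are
   determined up to null sets of frequencies only, whence a relation. *)
Record fourier_setting (R : realType) := FourierSetting {
  freq_display : measure_display;
  freq : measurableType freq_display;
  freq_measure : {measure set freq -> \bar R};
  freq_coord : freq -> 'I_3 -> R;
  transform : (R3 R -> R) -> (freq -> R[i]) -> Prop }.

Section settings.
Context (R : realType).

(* Normalized Haar measure on T^3 = (R / 2 pi Z)^3, so that the frequencies are
   Z^3 and the derivative in x_k is the multiplication by i xi_k. *)
Definition torus_cell : set (R3 R) :=
  (`[0, 2 * pi] `*` `[0, 2 * pi]) `*` `[0, 2 * pi].

Definition torus_mean (f : R3 R -> R) : R :=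
  (2 * pi) ^- 3 * \int[@leb3 R]_(x in torus_cell) f x.

Definition Z3_coord (xi : Z3) (k : 'I_3) : R := (coord3 xi k)%:~R.

Definition dot (a : 'I_3 -> R) (x : R3 R) : R :=
  \sum_(k < 3) a k * (coord3 x k : R).

Definition fourier_coef (f : R3 R -> R) (xi : Z3) : R[i] :=
  ((2 * pi) ^- 3)%:C *
  cintegral (@leb3 R) torus_cell
    (fun x => (f x)%:C * cis (- dot (Z3_coord xi) x)).

(* A function with summable Fourier coefficients is a.e. equal to the sum of
   its Fourier series; the last condition selects this continuous
   representative (and gives the periodicity). *)
Definition torus_transform (f : R3 R -> R) (F : Z3 -> R[i]) : Prop :=
  [/\ forall xi, F xi = fourier_coef f xi,
      cintegrable (@counting Z3 R) setT F
    & forall x, (f x)%:C =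
        cintegral (@counting Z3 R) setT
          (fun xi => F xi * cis (dot (Z3_coord xi) x))].

(* For f bounded but not integrable the transform F in L^1 is characterized by
   Fourier inversion; f is again the continuous representative. *)
Definition space_transform (f : R3 R -> R) (F : R3 R -> R[i]) : Prop :=
  cintegrable (@leb3 R) setT F /\
  forall x, (f x)%:C =
    ((2 * pi) ^- 3)%:C *
    cintegral (@leb3 R) setT
      (fun xi => F xi * cis (dot (coord3 xi) x)).

Definition torus : fourier_setting R :=
  @FourierSetting R _ Z3 (@counting Z3 R) Z3_coord torus_transform.

Definition whole_space : fourier_setting R :=
  @FourierSetting R _ (R3 R) (@leb3 R) (fun xi k => coord3 xi k)
    space_transform.

Definition mean_free (s : state (R3 R -> R)) : Prop :=
  [/\ torus_mean (rho s) = 0, forall j, torus_mean (vel s j) = 0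
    & torus_mean (temp s) = 0].

End settings.

Section navier_stokes_fourier.
Context (R : realType) (X : fourier_setting R).
Local Notation Xi := (freq X).
Local Notation mu := (freq_measure X).
Implicit Types (s : state (R3 R -> R)) (S : state (Xi -> R[i])) (xi : Xi).
Implicit Types (t nu : R) (p q : \bar R) (w : Xi -> R).

Definition transform_state s S : Prop :=
  [/\ transform (rho s) (rho S),
      forall j, transform (vel s j) (vel S j)
    & transform (temp s) (temp S)].

Definition jointly_measurable (F : R -> Xi -> R[i]) : Prop :=
  cmeasurable [set z : measurableTypeR R * Xi | 0 <= z.1]
    (fun z => F z.1 z.2).

Definition transform_evolution (s : R -> state (R3 R -> R))
    (S : R -> state (Xi -> R[i])) : Prop :=
  [/\ forall t, 0 <= t -> transform_state (s t) (S t),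
      jointly_measurable (fun t => rho (S t)),
      forall j, jointly_measurable (fun t => vel (S t) j)
    & jointly_measurable (fun t => temp (S t))].

Definition sqmod xi : R := \sum_(k < 3) freq_coord xi k ^+ 2.
Definition freq_mod xi : R := Num.sqrt (sqmod xi).
Definition freq_japanese xi : R := Num.sqrt (1 + sqmod xi).

Definition amplitude S xi : R :=
  Num.sqrt (cmod (rho S xi) ^+ 2 + \sum_(j < 3) cmod (vel S j xi) ^+ 2
            + cmod (temp S xi) ^+ 2).

Definition data_norm p S : \bar R := 
  Lnorm mu p (fun xi => (amplitude S xi)%:E).

(* The norm of w (rho^, u^, theta^) in L^p_xi L^q_t, with t in (0, oo). *)
Definition mixed_norm p q w (S : R -> state (Xi -> R[i])) : \bar R :=
  Lnorm mu p (fun xi =>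
    Lnorm (@lebesgue_measure R) q
      ((fun t => (w xi * amplitude (S t) xi)%:E) \_ `]0, +oo[)).

Definition partial_hat (k : 'I_3) (F : Xi -> R[i]) xi : R[i] :=
  (0 +i* freq_coord xi k) * F xi.

Definition div_hat (F : 'I_3 -> Xi -> R[i]) xi : R[i] :=
  \sum_(k < 3) partial_hat k (F k) xi.

(* div u = 0 and grad (rho + theta) = 0, on the Fourier side since the
   solutions need not be differentiable at t = 0. *)
Definition constraints S : Prop :=
  (\forall xi \ae mu, div_hat (vel S) xi = 0) /\
  (forall k, \forall xi \ae mu,
     partial_hat k (fun xi' => rho S xi' + temp S xi') xi = 0).

Definition leray_hat (F : 'I_3 -> Xi -> R[i]) (j : 'I_3) xi : R[i] :=
  F j xi - ((sqmod xi)^-1)%:C *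
    \sum_(k < 3) (freq_coord xi j * freq_coord xi k)%:C * F k xi.

(* The transform of Q_NS(v, u), from those of the tensors v^j u^k and u^j v^k. *)
Definition QNS_hat (VU UV : 'I_3 -> 'I_3 -> Xi -> R[i]) (j : 'I_3) xi : R[i] :=
  - (2^-1)%:C *
  leray_hat (fun i xi' => div_hat (VU i) xi' + div_hat (UV i) xi') j xi.

Definition heat nu t xi : R := expR (- (nu * t * sqmod xi)).

(* F(t) = e^{t nu Delta} F0 + int_0^t e^{(t - tau) nu Delta} G(tau) dtau *)
Definition duhamel nu (F0 : Xi -> R[i]) (G F : R -> Xi -> R[i]) : Prop :=
  forall t, 0 <= t -> \forall xi \ae mu,
    cintegrable (@lebesgue_measure R) `[0, t]
      (fun tau => (heat nu (t - tau) xi)%:C * G tau xi) /\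
    F t xi = (heat nu t xi)%:C * F0 xi +
      cintegral (@lebesgue_measure R) `[0, t]
        (fun tau => (heat nu (t - tau) xi)%:C * G tau xi).

(* S is the Fourier transform of s; UU and UT are those of u (x) u and
   u theta. S0 is the transform of the initial data. *)
Definition mild_solution (nu1 nu2 : R) (S0 : state (Xi -> R[i]))
    (s : R -> state (R3 R -> R)) (S : R -> state (Xi -> R[i])) : Prop :=
  transform_evolution s S /\
  (forall t, 0 <= t -> constraints (S t)) /\
  exists (UU : R -> 'I_3 -> 'I_3 -> Xi -> R[i]) (UT : R -> 'I_3 -> Xi -> R[i]),
    [/\ forall j k,
          jointly_measurable (fun t => UU t j k) /\
          forall t, 0 <= t ->
            transform (fun x => vel (s t) j x * vel (s t) k x) (UU t j k),
        forall k,
          jointly_measurable (fun t => UT t k) /\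
          forall t, 0 <= t ->
            transform (fun x => vel (s t) k x * temp (s t) x) (UT t k),
        forall j, duhamel nu1 (vel S0 j)
          (fun t => QNS_hat (UU t) (UU t) j) (fun t => vel (S t) j)
      & duhamel nu2 (temp S0)
          (fun t xi => - div_hat (UT t) xi) (fun t => temp (S t))].

End navier_stokes_fourier.

Arguments mixed_norm {R X} p%_E q%_E w%_R S.
Arguments data_norm {R X} p%_E S.
Arguments freq_mod {R} X xi.
Arguments freq_japanese {R} X xi.

(* Main.v *)
(* On the Fourier side the system reads
     w(t, xi) = e^{-nu t |xi|^2} w0(xi)
                + int_0^t e^{-nu (t - tau) |xi|^2} L_xi (w(tau) * w(tau))(xi) dtau,
   where w collects the real and imaginary parts of the transforms of u and theta
   and |L_xi| <= C |xi|. Solutions are sought below a(xi) (1 + nu |xi|^2 t)^-2: for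
   the product of two such profiles, at xi - eta and eta, the time integral gives
   back the profile at xi times kappa(xi, eta) = |xi| / max(|xi - eta|, |eta|)^2.
   Hence Picard's iterates are controlled by those of the scalar equation
     a = e0 + C J a,   J a(xi) = int kappa(xi, eta) a(xi - eta) a(eta) deta,
   which does not involve time. On Z^3 the kernel is bounded, so that J acts on
   l^1; on R^3 it is in L^3(deta) uniformly in xi, and Hoelder's inequality with
   Schur's test gives |J a|_q <= C |a|_{3/2} |a|_q, where L^{3/2} lies between L^1
   and L^p. The profile is bounded by 1 and |xi| times it is bounded in L^2_t, which
   yields the mixed norms.

   A mild solution given by its values in x satisfies the same equation almost
   everywhere, by injectivity of the inverse transform and the convolution theorem.
   The L^1_xi norm of the difference of two bounded solutions vanishes by an
   inequality of Gronwall type, weighted by e^{-lambda t}. *)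
Require Import Defs.
From HB Require Import structures.
From mathcomp Require Import all_boot all_order all_algebra.
From mathcomp Require Import complex.
From mathcomp Require Import all_classical all_reals all_analysis.
From mathcomp Require Import measurable_realfun ess_sup_inf ring lra.

Set Implicit Arguments.
Unset Strict Implicit.
Unset Printing Implicit Defensive.

Import Order.TTheory GRing.Theory Num.Theory.
Import numFieldNormedType.Exports.

Local Open Scope classical_set_scope.
Local Open Scope ring_scope.

(** * Measures and integrals *)

(** Two features of the claim shape the argument. The class in which uniqueness holds carries no
    smallness, so a contraction around the small solution does not reach it: the factor |xi| of the
    nonlinearity has to be absorbed by the heat factor for solutions of any size. And eta1 is fixed
    before p, so smallness is measured in one norm only, L^{3/2} on R^3, which the L^1 and L^p norms
    control uniformly in p. This exponent is dual to 3: kappa is homogeneous of degree -1, and such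
    kernels see L^3(R^3) as scale invariant. All other norms enter the iteration linearly.
    Convergence is pointwise in (t, xi), because the increments of the iterates lie below the
    increments of a monotone scalar sequence. Integrals are real, so each transform is split into
    real and imaginary parts, the unknowns of one real system; reality of the fields in x becomes a
    parity under xi -> -xi. The constraint on rho + theta leaves rho free at xi = 0 only, a null set
    on R^3, and settled on the torus by the zero mean. *)

Lemma ge0_le_poweR (R : realType) (r : R) (x y : \bar R) :
  0 <= r -> (0 <= x)%E -> (x <= y)%E -> (x `^ r <= y `^ r)%E.
Proof.
move=> r0 x0 xy; apply: gt0_ler_poweR => //; rewrite in_itv/= ?leey ?andbT//.
exact: le_trans xy.
Qed.

Lemma measurable_invr (R : realType) :
  measurable_fun [set: R] (fun x : R => x^-1).
Proof.
(* The inverse is written as x times the power -1 of x^2, whose base is nonnegative; at 0 both sides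
   are 0. *)
apply: (eq_measurable_fun (fun x : R => x * (x ^+ 2) `^ (-1))).
  move=> x _; rewrite powR_inv1 ?sqr_ge0//.
  by have [->|x0] := eqVneq x 0; rewrite ?mul0r ?invr0// expr2 invfM mulrA divff// mul1r.
apply: measurable_funM => //.
apply: (@measurableT_comp _ _ _ _ _ _ (@powR R ^~ (-1))); first exact: measurable_powR.
exact: measurable_funX.
Qed.

Lemma indic_in (T : Type) (R : pzRingType) (D : set T) x : D x -> \1_D x = 1 :> R.
Proof. by move=> Dx; rewrite indicE mem_set. Qed.

Lemma indic_notin (T : Type) (R : pzRingType) (D : set T) x : ~ D x -> \1_D x = 0 :> R.
Proof. by move=> Dx; rewrite indicE memNset. Qed.

Section integral_lemmas.
Context d (T : measurableType d) (R : realType) (mu : {measure set T -> \bar R}).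

(** The integral of a nonnegative function is a supremum over the simple functions below it, hence
    monotone by inclusion. This form serves the mixed norms: the inner norm in t, as a function of
    the frequency, comes without a proof of measurability. *)
Lemma ge0_le_integral_nomeas (D : set T) (f g : T -> \bar R) :
  (forall x, D x -> 0 <= f x)%E -> (forall x, D x -> f x <= g x)%E ->
  (\int[mu]_(x in D) f x <= \int[mu]_(x in D) g x)%E.
Proof.
move=> f0 fg; rewrite !ge0_integralE//; last first.
  by move=> x Dx; exact: le_trans (f0 x Dx) (fg x Dx).
apply: le_ereal_sup => _ [h hf <-]; exists h => // x.
apply: le_trans (hf x) _; rewrite /patch; case: ifPn => // /set_mem; exact: fg.
Qed.

Lemma ge0_Lnorm_le_nomeas (p : \bar R) (f g : T -> \bar R) : (0 < p)%E ->
  (forall x, 0 <= f x)%E -> (forall x, f x <= g x)%E ->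
  ('N[mu]_p[f] <= 'N[mu]_p[g])%E.
Proof.
move=> p0 f0 fg; have g0 x : (0 <= g x)%E := le_trans (f0 x) (fg x).
rewrite unlock; case: p p0 => [p| |]//=.
- rewrite lte_fin => p0.
  apply: ge0_le_poweR; first by rewrite invr_ge0 ltW.
  + by apply: integral_ge0 => x _; exact: poweR_ge0.
  + apply: ge0_le_integral_nomeas => x _; first exact: poweR_ge0.
    by rewrite !gee0_abs//; apply: ge0_le_poweR => //; exact: ltW.
(* The norm for p = oo is the essential supremum when the whole space has positive measure, and 0 by
   convention otherwise. *)
- move=> _; case: ifP => // _; apply: le_ess_sup.
  by apply: aeW => x /=; rewrite !gee0_abs.
Qed.

Lemma normr_Rintegral_le (D : set T) (f : T -> R) : measurable D ->
  measurable_fun D f ->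
  ((`|\int[mu]_(x in D) f x|)%:E <= \int[mu]_(x in D) (`|f x|)%:E)%E.
Proof.
(* If |f| is not integrable the right-hand side is +oo, whatever default value the real integral
   takes. *)
move=> mD mf; have [fo|] := ltP (\int[mu]_(x in D) (`|f x|)%:E)%E +oo%E; last first.
  by rewrite leye_eq => /eqP ->; rewrite leey.
have fi : mu.-integrable D (EFin \o f).
  by apply/integrableP; split=> //; exact/measurable_EFinP.
rewrite EFin_normr_Rintegral//; apply: le_trans (le_abse_integral _ _ _) _ => //.
exact/measurable_EFinP.
Qed.

Lemma ae_eq_Rintegral (f g : T -> R) :
  measurable_fun setT f -> measurable_fun setT g ->
  (\forall x \ae mu, f x = g x) -> \int[mu]_x f x = \int[mu]_x g x.
Proof.
move=> mf mg fg; rewrite /Rintegral; congr fine; apply: ae_eq_integral => //.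
- exact/measurable_EFinP.
- exact/measurable_EFinP.
- by apply: filterS fg => x -> _.
Qed.

End integral_lemmas.

Section parametric.
Context d1 d2 (T1 : measurableType d1) (T2 : measurableType d2) (R : realType).
Context (m2 : {sigma_finite_measure set T2 -> \bar R}).

Lemma measurable_fun_integral_param (f : T1 * T2 -> \bar R) :
  measurable_fun [set: T1 * T2] f ->
  measurable_fun setT (fun x => \int[m2]_y f (x, y))%E.
Proof.
move=> mf; under eq_fun do rewrite integralE.
apply: emeasurable_funB.
- apply: (eq_measurable_fun (fubini_F m2 f^\+%E)).
    by move=> x _; apply: eq_integral => y _; rewrite !funeposE.
  by apply: measurable_fun_fubini_tonelli_F => //; exact: measurable_funepos.
- apply: (eq_measurable_fun (fubini_F m2 f^\-%E)).
    by move=> x _; apply: eq_integral => y _; rewrite !funenegE.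
  by apply: measurable_fun_fubini_tonelli_F => //; exact: measurable_funeneg.
Qed.

Lemma measurable_fun_Rintegral_param (f : T1 * T2 -> R) :
  measurable_fun [set: T1 * T2] f ->
  measurable_fun setT (fun x => \int[m2]_y f (x, y)).
Proof.
move=> mf; apply: measurableT_comp; first exact: fine_measurable.
exact: (@measurable_fun_integral_param (EFin \o f)) (measurableT_comp _ mf).
Qed.

End parametric.

Section measure_preserving.
Context d (T : measurableType d) (R : realType) (mu : {measure set T -> \bar R}).
Variable phi : T -> T.
Hypotheses (mphi : measurable_fun setT phi)
  (phi_int : forall f : T -> \bar R, measurable_fun setT f -> (forall y, 0 <= f y)%E ->
    (\int[mu]_y f (phi y) = \int[mu]_y f y)%E).

(** The hypothesis on integrals is applied to the indicator of a null set, whose preimage is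
    therefore null. *)
Lemma ae_preserving (P : T -> Prop) : (\forall y \ae mu, P y) ->
  \forall y \ae mu, P (phi y).
Proof.
move=> [N [mN N0 PN]].
have mphiN : measurable (phi @^-1` N) by rewrite -[X in measurable X]setTI; exact: mphi.
exists (phi @^-1` N); split => //; last by move=> y /= nP; apply: PN.
rewrite -[phi @^-1` N]setIT -integral_indic//.
transitivity (\int[mu]_y (\1_N (phi y))%:E)%E.
  apply: eq_integral => y _; rewrite !indicE.
  by rewrite (_ : (y \in phi @^-1` N) = (phi y \in N))//; apply/idP/idP => /set_mem ?; apply/mem_set.
rewrite (phi_int (f := fun y => (\1_N y)%:E)).
- by rewrite integral_indic// setIT.
- exact/measurable_EFinP.
- by move=> y; rewrite lee_fin.
Qed.

Lemma integral_comp (f : T -> \bar R) : measurable_fun setT f ->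
  (\int[mu]_y f (phi y) = \int[mu]_y f y)%E.
Proof.
move=> mf; rewrite integralE [RHS]integralE; congr (_ - _)%E.
- rewrite -(phi_int (measurable_funepos mf) (funepos_ge0 _)).
  by apply: eq_integral => y _; rewrite !funeposE.
- rewrite -(phi_int (measurable_funeneg mf) (funeneg_ge0 _)).
  by apply: eq_integral => y _; rewrite !funenegE.
Qed.

Lemma Rintegral_comp (f : T -> R) : measurable_fun setT f ->
  \int[mu]_y f (phi y) = \int[mu]_y f y.
Proof.
by move=> mf; rewrite /Rintegral (integral_comp (f := EFin \o f))//; exact/measurable_EFinP.
Qed.

End measure_preserving.

#[global] Instance lebesgue_ae_filter (R : realType) :
  Filter (almost_everywhere (@lebesgue_measure R)).
Proof. exact: ae_filter_ringOfSetsType. Qed.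

Lemma integral0_ae d (T : measurableType d) (R : realType)
    (mu : {measure set T -> \bar R}) (f : T -> \bar R) :
  measurable_fun setT f -> (forall x, 0 <= f x)%E -> (\int[mu]_x f x = 0)%E ->
  \forall x \ae mu, f x = 0%E.
Proof.
move=> mf f0 If; have : (\int[mu]_x `|f x| = 0)%E.
  by rewrite -[RHS]If; apply: eq_integral => x _; rewrite gee0_abs.
by move/(ae_eq_integral_abs mu measurableT mf); apply: filterS => x /(_ I).
Qed.

Lemma ae0_integral d (T : measurableType d) (R : realType)
    (mu : {measure set T -> \bar R}) (f : T -> \bar R) :
  measurable_fun setT f -> (\forall x \ae mu, f x = 0%E) -> (\int[mu]_x f x = 0)%E.
Proof.
move=> mf f0; rewrite -(integral0 mu setT); apply: ae_eq_integral => //.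
by apply: filterS f0 => x.
Qed.

(** * Time integrals of the decay profile *)

Section time_kernel.
Context (R : realType).
Local Notation leb := (@lebesgue_measure R).

(** An exponential envelope would not reproduce itself: from |xi - eta|^2 + |eta|^2 >= |xi|^2 / 2
    the product of two heat factors keeps only half of the rate at xi. With algebraic decay,
    dividing the rate by a constant costs a constant factor. The square makes the envelope
    integrable in t, with integral 1 / (nu k^2). *)
Definition profile (nu k t : R) : R := ((1 + nu * k ^+ 2 * t) ^-1) ^+ 2.

Lemma is_derive_affine (b a x : R) :
  is_derive x (1 : R) (fun x : R => b + a * x) a.
Proof.
have H := @is_deriveD _ _ _ (cst b) _ x 1 _ _ _
  (@is_deriveZ _ _ _ id a x 1 _ (is_derive_id x (1 : R))).
apply: (is_derive_eq (H _ (is_derive_cst _ _ _))).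
by rewrite add0r /GRing.scale/= mulr1.
Qed.

Lemma is_derive_inv_affine (b a x : R) : b + a * x != 0 ->
  is_derive x (1 : R) (fun x : R => (b + a * x)^-1) (- a * ((b + a * x)^-1) ^+ 2).
Proof.
move=> nz; have H := @is_deriveV _ _ x _ _ nz (is_derive_affine b a x).
apply: (is_derive_eq H).
by rewrite /GRing.scale/= exprVn mulrC mulNr mulrN.
Qed.

Lemma is_derive_expR_linear (b a x : R) :
  is_derive x (1 : R) (fun x : R => expR (b + a * x)) (a * expR (b + a * x)).
Proof.
have H := @is_derive1_comp R expR (fun x : R => b + a * x) x _ _ (is_derive_expR _) (is_derive_affine b a x).
by apply: (is_derive_eq H); rewrite mulrC.
Qed.

(** The time interval is not split: the integrand is bounded by an exact derivative F', where F(t)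
    has the size of the claim and F(0) >= 0 is dropped. *)
Lemma time_kernel_le (nu k M t : R) : 0 < nu -> 0 <= k -> 0 <= M -> k <= 2 * M ->
  0 <= t ->
  (\int[leb]_(tau in `[0%R, t])
     (k * expR (- (nu * (t - tau) * k ^+ 2)) * profile nu M tau)%:E
   <= (64 / nu * (k / M ^+ 2) * profile nu k t)%:E)%E.
Proof.
move=> nu0 k0 M0 kM t0.
have [->|kn0] := eqVneq k 0.
  rewrite integral0_eq; last by move=> tau _; rewrite !mul0r.
  by rewrite mul0r mulr0 mul0r.
have k1 : 0 < k by rewrite lt_def kn0.
have M1 : 0 < M by lra.
rewrite le_eqVlt in t0; case/orP: t0 => [/eqP <-|t0].
  rewrite set_itv1 integral_set1 lee_fin /profile mulr0 addr0 invr1 expr1n mulr1.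
  by apply: mulr_ge0; apply: divr_ge0; rewrite ?sqr_ge0// ltW.
pose a := nu * k ^+ 2; pose b := nu * M ^+ 2.
have a0 : 0 < a by rewrite mulr_gt0// exprn_gt0.
have b0 : 0 < b by rewrite mulr_gt0// exprn_gt0.
(* The 32 is 2 * 4^2, from (4 + a x)^2 <= 32 + 2 (a x)^2 at the end; 2 - U <= 2 doubles it to 64.
   The shift 4 in V below gives V <= 1/4, so that differentiating V^2 destroys at most half of what
   the exponential contributes. *)
pose K := expR (- (a * t)) * (32 * k / b).
have K0 : 0 < K by rewrite mulr_gt0 ?expR_gt0// divr_gt0// mulr_gt0//.
(* [e^{ax} b U^2] comes from differentiating [2 - U], and [V^2] has the decay of
   the profile at the frequency [k]. *)
pose V (x : R) := (4 + a * x)^-1.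
pose U (x : R) := (1 + b * x)^-1.
pose F (x : R) := K * (expR (a * x) * (V x ^+ 2 * (2 - U x))).
pose f (x : R) := K * (expR (a * x) * (a * (V x ^+ 2 * (2 - U x))
   + (- 2 * a * V x ^+ 3 * (2 - U x) + V x ^+ 2 * (b * U x ^+ 2)))).
have dF (x : R) : 0 <= x -> is_derive x (1 : R) F (f x).
  move=> x0.
  have ax : 0 <= a * x by rewrite mulr_ge0// ltW.
  have bx : 0 <= b * x by rewrite mulr_ge0// ltW.
  have dV : is_derive x (1:R) V (- a * V x ^+ 2).
    by apply: is_derive_inv_affine; lra.
  have dU : is_derive x (1:R) U (- b * U x ^+ 2).
    by apply: is_derive_inv_affine; lra.
  have dE : is_derive x (1:R) (fun x => expR (a * x)) (a * expR (a * x)).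
    have := is_derive_expR_linear 0 a x; rewrite add0r.
    by under eq_fun do rewrite add0r.
  rewrite /F; apply: is_derive_eq.
  rewrite /f /GRing.scale/=; ring.
have cf : {within `[0, t], continuous f}.
  apply: continuous_in_subspaceT => x; rewrite inE/= in_itv/= => /andP[x0 _].
  have ax : 0 <= a * x by rewrite mulr_ge0// ltW.
  have bx : 0 <= b * x by rewrite mulr_ge0// ltW.
  have cV : {for x, continuous V}.
    apply: continuousV; first lra.
    by apply: cvgD; [exact: cvg_cst|apply: cvgM; [exact: cvg_cst|exact: cvg_id]].
  have cU : {for x, continuous U}.
    apply: continuousV; first lra.
    by apply: cvgD; [exact: cvg_cst|apply: cvgM; [exact: cvg_cst|exact: cvg_id]].
  have cE : {for x, continuous (fun x => expR (a * x))}.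
    apply: (@continuous_comp _ _ _ (fun x => a * x) expR).
      by apply: cvgM; [exact: cvg_cst|exact: cvg_id].
    exact: continuous_expR.
  have cc (c : R) : {for x, continuous (fun _ : R => c)} by apply: cst_continuous.
  have c2 : {for x, continuous (fun x => 2 - U x)} by apply: continuousB.
  have cV2 : {for x, continuous (fun x => V x ^+ 2)} by apply: continuousM.
  have cV3 : {for x, continuous (fun x => V x ^+ 3)} by apply: continuousM.
  have cU2 : {for x, continuous (fun x => U x ^+ 2)} by apply: continuousM.
  exact: (cvgM (cc K) (cvgM cE (cvgD (cvgM (cc a) (cvgM cV2 c2))
    (cvgD (cvgM (cvgM (cc (-2 * a)) cV3) c2) (cvgM cV2 (cvgM (cc b) cU2)))))).
have dd : derivable_oo_LRcontinuous F 0 t.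
  split.
  - by move=> x; rewrite in_itv/= => /andP[/ltW x0 _]; case: (dF _ x0).
  - apply: cvg_at_right_filter; apply: differentiable_continuous.
    by apply/derivable1_diffP; case: (dF 0 (lexx _)).
  - apply: cvg_at_left_filter; apply: differentiable_continuous.
    by apply/derivable1_diffP; case: (dF t (ltW t0)).
have F'f : {in `]0, t[, F^`()%classic =1 f}.
  move=> x; rewrite in_itv/= => /andP[/ltW x0 _].
  by rewrite derive1E; have [_ ->] := dF _ x0.
apply: le_trans (_ : \int[leb]_(x in `[0%R, t]) (f x)%:E <= _)%E; last first.
  rewrite (continuous_FTC2 t0 cf dd F'f) -EFinB lee_fin.
  have at0 : 0 <= a * t by rewrite mulr_ge0// ltW.
  have bt0 : 0 <= b * t by rewrite mulr_ge0// ltW.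
  have U01 x : 0 <= b * x -> 0 < U x <= 1.
    move=> bx; rewrite /U invr_gt0 invf_le1; lra.
  have F0 : 0 <= F 0.
    have /andP[_ u1] : 0 < U 0 <= 1 by apply: U01; rewrite mulr0.
    apply: mulr_ge0; first exact: ltW.
    apply: mulr_ge0; first exact: expR_ge0.
    by apply: mulr_ge0; [exact: sqr_ge0|lra].
  apply: le_trans (_ : F t <= _); first by lra.
  rewrite /F /K mulrACA -expRD addNr expR0 mul1r.
  rewrite /profile -/a.
  have -> : 64 / nu * (k / M ^+ 2) * ((1 + a * t)^-1) ^+ 2 =
            32 * k / b * (((1 + a * t)^-1) ^+ 2 * 2).
    by rewrite /b; field; rewrite !gt_eqF//; lra.
  rewrite ler_pM2l ?divr_gt0 ?mulr_gt0//.
  have /andP[u0 u1] := U01 t bt0.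
  apply: ler_pM => //; first exact: sqr_ge0.
  - lra.
  - rewrite lerXn2r ?nnegrE ?invr_ge0; try lra.
    by rewrite /V lef_pV2 ?posrE; lra.
  - lra.
apply: ge0_le_integral_nomeas => x; rewrite /= in_itv/= => /andP[x0 xt].
  rewrite lee_fin; apply: mulr_ge0; last exact: sqr_ge0.
  by apply: mulr_ge0; [exact: ltW|exact: expR_ge0].
rewrite lee_fin /profile -/b.
have -> : expR (- (nu * (t - x) * k ^+ 2)) = expR (- (a * t)) * expR (a * x).
  by rewrite -expRD; congr expR; rewrite /a; ring.
rewrite /f /K -/(U x).
have -> : k * (expR (- (a * t)) * expR (a * x)) * U x ^+ 2 =
   (expR (- (a * t)) * expR (a * x)) * (k * U x ^+ 2) by ring.
set E1 := expR (- (a * t)); set E2 := expR (a * x).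
have E0 : 0 <= E1 * E2 by rewrite mulr_ge0 ?expR_ge0.
rewrite [X in _ <= X](_ : _ = (E1 * E2) * (32 * k / b * (a * (V x ^+ 2 * (2 - U x)) +
  (- 2 * a * V x ^+ 3 * (2 - U x) + V x ^+ 2 * (b * U x ^+ 2))))); last by ring.
apply: ler_wpM2l => //.
have ax : 0 <= a * x by rewrite mulr_ge0// ltW.
have bx : 0 <= b * x by rewrite mulr_ge0// ltW.
have V0 : 0 < V x by rewrite invr_gt0; lra.
have V1 : V x <= 4^-1 by rewrite lef_pV2 ?posrE; lra.
have U0 : 0 < U x by rewrite invr_gt0; lra.
have U1 : U x <= 1 by rewrite invf_le1; lra.
have VE : V x * (4 + a * x) = 1 by rewrite mulVf; lra.
have UE : U x * (1 + b * x) = 1 by rewrite mulVf; lra.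
(* The term in between keeps a / 2 of the derivative of the exponential, because 2 - U >= 1 and 1 -
   2 V >= 1/2. The exponentials have been factored out on both sides. *)
apply: le_trans (_ : 32 * k / b * (V x ^+ 2 * (a / 2 + b * U x ^+ 2)) <= _).
  have kE : k * U x ^+ 2 = 32 * k / b * (b / 32 * U x ^+ 2).
    by field; rewrite gt_eqF.
  rewrite kE ler_pM2l ?divr_gt0 ?mulr_gt0//.
  (* Here k <= 2 M enters. With b x U <= 1 it gives b (a x)^2 U^2 <= a^2 / b <= 4 a, which pays for
     the quadratic part of (4 + a x)^2. *)
  have ab : a <= 4 * b.
    have k4 : k ^+ 2 <= 4 * M ^+ 2.
      have -> : 4 * M ^+ 2 = (2 * M) ^+ 2 by ring.
      by rewrite lerXn2r ?nnegrE; lra.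
    have := ler_wpM2l (ltW nu0) k4; rewrite /a /b; lra.
  have q1 : b * (x * U x) <= 1.
    have : 0 <= U x by exact: ltW.
    lra.
  have q0 : 0 <= b * (x * U x) by apply: mulr_ge0; [exact: ltW|apply: mulr_ge0 => //; exact: ltW].
  have q2 : (b * (x * U x)) ^+ 2 <= 1 by rewrite expr_le1.
  have H1 : b * ((a * x) ^+ 2 * U x ^+ 2) <= 4 * a.
    rewrite -(ler_pM2l b0).
    have -> : b * (b * ((a * x) ^+ 2 * U x ^+ 2)) = a ^+ 2 * (b * (x * U x)) ^+ 2.
      by ring.
    apply: le_trans (_ : a ^+ 2 * 1 <= _); first by rewrite ler_pM2l ?exprn_gt0.
    by rewrite mulr1 expr2; have := ler_wpM2r (ltW a0) ab; lra.
  have H2 : (4 + a * x) ^+ 2 * (b / 32 * U x ^+ 2) <= a / 2 + b * U x ^+ 2.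
    have H3 : (4 + a * x) ^+ 2 <= 32 + 2 * (a * x) ^+ 2.
      have := sqr_ge0 (4 - a * x); rewrite !expr2; lra.
    have b32 : 0 <= b / 32 * U x ^+ 2 by rewrite mulr_ge0 ?sqr_ge0//; lra.
    apply: le_trans (ler_wpM2r b32 H3) _; lra.
  have V2 : 0 <= V x ^+ 2 by exact: sqr_ge0.
  apply: le_trans (ler_wpM2l V2 H2).
  rewrite [X in _ <= X](_ : _ = (V x * (4 + a * x)) ^+ 2 * (b / 32 * U x ^+ 2)).
    by rewrite VE expr1n mul1r.
  by ring.
apply: ler_wpM2l; first by rewrite divr_ge0 ?mulr_ge0// ltW.
have V2 : 0 <= V x ^+ 2 by exact: sqr_ge0.
have -> : a * (V x ^+ 2 * (2 - U x)) + (-2 * a * V x ^+ 3 * (2 - U x) + V x ^+ 2 * (b * U x ^+ 2))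
  = V x ^+ 2 * (a * ((2 - U x) * (1 - 2 * V x)) + b * U x ^+ 2) by ring.
apply: ler_wpM2l => //; rewrite lerD2r ler_pM2l//.
by apply: le_trans (_ : 1 * 2^-1 <= _); [lra|apply: ler_pM; lra].
Qed.

Lemma integral_profile_le (nu k : R) : 0 < nu -> 0 < k ->
  (\int[leb]_(t in `[0%R, +oo[) (profile nu k t ^+ 2)%:E
    <= ((nu * k ^+ 2)^-1)%:E)%E.
Proof.
move=> nu0 k0; pose a := nu * k ^+ 2.
have a0 : 0 < a by rewrite mulr_gt0// exprn_gt0.
pose F (t : R) := - a^-1 * (1 + a * t)^-1.
(* The square is below the profile itself, which has the explicit primitive -1 / (a (1 + a t)). *)
apply: le_trans (_ : \int[leb]_(t in `[0%R, +oo[) (profile nu k t)%:E <= _)%E.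
  apply: ge0_le_integral_nomeas => x /=; rewrite in_itv/= andbT => x0.
    by rewrite lee_fin sqr_ge0.
  have ax : 0 <= a * x by rewrite mulr_ge0// ltW.
  rewrite lee_fin expr2 ler_piMr ?sqr_ge0// /profile -/a.
  by rewrite exprn_ile1 ?invr_ge0 ?invf_le1; lra.
have dF (x : R) : 0 <= x -> is_derive x (1 : R) F (profile nu k x).
  move=> x0; have ax : 0 <= a * x by rewrite mulr_ge0// ltW.
  have nz : 1 + a * x != 0 by lra.
  have H := @is_deriveZ _ _ _ _ (- a^-1) _ _ _ (is_derive_inv_affine nz).
  apply: (is_derive_eq H); rewrite /GRing.scale/= /profile -/a.
  by field; rewrite gt_eqF//=; lra.
rewrite (@ge0_continuous_FTC2y _ _ F _ 0).
- by rewrite /F mulr0 addr0 invr1 mulr1 -EFinB lee_fin sub0r opprK.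
- by move=> x _; exact: sqr_ge0.
- apply: continuous_in_subspaceT => x; rewrite inE/= in_itv/= andbT => x0.
  have ax : 0 <= a * x by rewrite mulr_ge0// ltW.
  have cV : {for x, continuous (fun x => (1 + a * x)^-1)}.
    apply: continuousV; first lra.
    by apply: cvgD; [exact: cvg_cst|apply: cvgM; [exact: cvg_cst|exact: cvg_id]].
  exact: (cvgM cV cV).
- rewrite /F; rewrite [X in _ --> X](_ : 0 = - a^-1 * 0); last by rewrite mulr0.
  apply: cvgM; first exact: cvg_cst.
  apply/gtr0_cvgV0.
    by near=> x; rewrite ltr_pwDl// mulr_ge0// ltW.
  apply: (@ger_cvgy _ _ _ _ (fun x => a * x)).
    by near=> x; rewrite lerDr.
  by apply: gt0_cvgMry => //; exact: cvg_id.
- by move=> x /ltW /dF [].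
- apply: cvg_at_right_filter; apply: differentiable_continuous.
  by apply/derivable1_diffP; case: (dF 0 (lexx _)).
- move=> x; rewrite in_itv/= andbT => /ltW x0.
  by rewrite derive1E; have [_ ->] := dF _ x0.
Unshelve. all: by end_near.
Qed.

End time_kernel.

(** * Frequency groups and the scalar majorant *)

(* An abelian group is encoded by its subtraction; [mod] is a length function. *)
Record freq_group (R : realType) := FreqGroup {
  fg_display : measure_display;
  fg_sort :> measurableType fg_display;
  fg_measure : {sigma_finite_measure set fg_sort -> \bar R};
  fg_sub : fg_sort -> fg_sort -> fg_sort;
  fg_mod : fg_sort -> R;
  fg_subK : forall x y, fg_sub x (fg_sub x y) = y;
  measurable_fg_sub : measurable_fun [set: fg_sort * fg_sort]
    (fun z => fg_sub z.1 z.2);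
  integral_fg_subl : forall (f : fg_sort -> \bar R) x,
    measurable_fun setT f -> (forall y, 0 <= f y)%E ->
    (\int[fg_measure]_y f (fg_sub x y) = \int[fg_measure]_y f y)%E;
  integral_fg_subr : forall (f : fg_sort -> \bar R) y,
    measurable_fun setT f -> (forall x, 0 <= f x)%E ->
    (\int[fg_measure]_x f (fg_sub x y) = \int[fg_measure]_x f x)%E;
  measurable_fg_mod : measurable_fun setT fg_mod;
  fg_mod_ge0 : forall x, 0 <= fg_mod x;
  fg_mod_sub : forall x y, fg_mod x <= fg_mod (fg_sub x y) + fg_mod y }.

Arguments fg_measure {R} f : rename.
Arguments fg_sub {R f} x y : rename.
Arguments fg_mod {R f} x : rename.

Section freq_group_theory.
Context (R : realType) (G : freq_group R).
Local Notation mu := (fg_measure G).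
Local Notation sub := (@fg_sub R G).
Implicit Types (a b f g : G -> R).

Lemma measurable_fg_subl x : measurable_fun setT (sub x).
Proof.
apply: (@measurableT_comp _ _ _ _ _ _ (fun z : G * G => sub z.1 z.2) _ (pair x)).
  exact: measurable_fg_sub.
exact: measurable_pair1.
Qed.

Lemma ae_fg_subl (P : G -> Prop) x : (\forall y \ae mu, P y) ->
  \forall y \ae mu, P (sub x y).
Proof.
by apply: ae_preserving => [|f mf f0]; [exact: measurable_fg_subl|exact: integral_fg_subl].
Qed.

Definition fg_conv a b x : \bar R := (\int[mu]_y (a (sub x y) * b y)%:E)%E.

Lemma measurable_fg_shift (k : G -> G -> R) a b :
  measurable_fun [set: G * G] (fun z => k z.1 z.2) ->
  measurable_fun setT a -> measurable_fun setT b ->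
  measurable_fun [set: G * G] (fun z => k z.1 z.2 * (a (sub z.1 z.2) * b z.2)).
Proof.
move=> mk ma mb; apply: measurable_funM => //; apply: measurable_funM.
  by apply: measurableT_comp => //; exact: measurable_fg_sub.
exact: measurableT_comp.
Qed.

Lemma measurable_fg_conv_pair a b :
  measurable_fun setT a -> measurable_fun setT b ->
  measurable_fun [set: G * G] (fun z => a (sub z.1 z.2) * b z.2).
Proof.
move=> ma mb; apply: measurable_funM.
  by apply: measurableT_comp => //; exact: measurable_fg_sub.
exact: measurableT_comp.
Qed.

Lemma measurable_fg_conv a b :
  measurable_fun setT a -> measurable_fun setT b ->
  measurable_fun setT (fg_conv a b).
Proof.
move=> ma mb; apply: (@measurable_fun_integral_param _ _ _ _ _ mu
  (fun z : G * G => (a (sub z.1 z.2) * b z.2)%:E)).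
apply/measurable_EFinP; exact: measurable_fg_conv_pair.
Qed.

Lemma integral_fg_conv a b :
  measurable_fun setT a -> measurable_fun setT b ->
  (forall x, 0 <= a x) -> (forall x, 0 <= b x) ->
  (\int[mu]_x fg_conv a b x = (\int[mu]_x (a x)%:E) * (\int[mu]_x (b x)%:E))%E.
Proof.
move=> ma mb a0 b0.
rewrite (fubini_tonelli (fun z : G * G => (a (sub z.1 z.2) * b z.2)%:E)); first last.
- by move=> z; rewrite lee_fin mulr_ge0.
- apply/measurable_EFinP; exact: measurable_fg_conv_pair.
rewrite -ge0_integralZl//; last 3 first.
- exact/measurable_EFinP.
- by move=> x _; rewrite lee_fin.
- by apply: integral_ge0 => x _; rewrite lee_fin.
apply: eq_integral => y _ /=.
under eq_integral do rewrite EFinM muleC.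
rewrite ge0_integralZl//; last 3 first.
- apply/measurable_EFinP; apply: measurableT_comp => //.
  apply: (@measurableT_comp _ _ _ _ _ _ (fun z : G * G => sub z.1 z.2) _ (pair^~ y)).
    exact: measurable_fg_sub.
  exact: measurable_pair2.
- by move=> x _; rewrite lee_fin.
- by rewrite lee_fin.
rewrite (@integral_fg_subr R G (fun x => (a x)%:E)) 1?muleC//.
exact/measurable_EFinP.
Qed.

(* |xi| / max(|xi - eta|, |eta|)^2, what is left of the multiplier |xi| after
   the integration in time. *)
Definition kappa x y : R :=
  fg_mod x / (Num.max (fg_mod (sub x y)) (fg_mod y)) ^+ 2.

Lemma kappa_ge0 x y : 0 <= kappa x y.
Proof. by rewrite divr_ge0 ?fg_mod_ge0// sqr_ge0. Qed.

Lemma measurable_kappa : measurable_fun [set: G * G] (fun z => kappa z.1 z.2).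
Proof.
have m1 : measurable_fun [set: G * G] (fun z => fg_mod z.1 : R).
  by apply: measurableT_comp => //; exact: measurable_fg_mod.
have m2 : measurable_fun [set: G * G] (fun z => fg_mod z.2 : R).
  by apply: measurableT_comp => //; exact: measurable_fg_mod.
have m3 : measurable_fun [set: G * G] (fun z => fg_mod (sub z.1 z.2) : R).
  by apply: measurableT_comp; [exact: measurable_fg_mod|exact: measurable_fg_sub].
apply: measurable_funM => //.
apply: (@measurableT_comp _ _ _ _ _ _ (fun r : R => (r ^+ 2)^-1)).
  by apply: measurableT_comp; [exact: measurable_invr|exact: measurable_funX].
exact: measurable_maxr.
Qed.

Definition Jform a x : \bar R :=
  (\int[mu]_y (kappa x y * (a (sub x y) * a y))%:E)%E.

Lemma Jform_ge0 a x : (forall y, 0 <= a y) -> (0 <= Jform a x)%E.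
Proof.
by move=> a0; apply: integral_ge0 => y _; rewrite lee_fin mulr_ge0 ?kappa_ge0 ?mulr_ge0.
Qed.

Lemma measurable_kappa_conv x a b : measurable_fun setT a -> measurable_fun setT b ->
  measurable_fun setT (fun y => kappa x y * (a (sub x y) * b y)).
Proof.
move=> ma mb.
apply: (@measurableT_comp _ _ _ _ _ _
  (fun z : G * G => kappa z.1 z.2 * (a (sub z.1 z.2) * b z.2)) _ (pair x)).
  by apply: measurable_fg_shift => //; exact: measurable_kappa.
exact: measurable_pair1.
Qed.

Lemma measurable_Jform a : measurable_fun setT a -> measurable_fun setT (Jform a).
Proof.
move=> ma; apply: (@measurable_fun_integral_param _ _ _ _ _ mu
  (fun z : G * G => (kappa z.1 z.2 * (a (sub z.1 z.2) * a z.2))%:E)).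
by apply/measurable_EFinP; apply: measurable_fg_shift => //; exact: measurable_kappa.
Qed.

Lemma ae_eq_Jform a b x : measurable_fun setT a -> measurable_fun setT b ->
  (\forall y \ae mu, a y = b y) -> Jform a x = Jform b x.
Proof.
move=> ma mb ab; apply: ae_eq_integral => //.
- apply/measurable_EFinP; exact: measurable_kappa_conv.
- apply/measurable_EFinP; exact: measurable_kappa_conv.
- by apply: filterS2 ab (ae_fg_subl x ab) => y -> -> _.
Qed.

Lemma le_Jform a b x : measurable_fun setT a -> measurable_fun setT b ->
  (forall y, 0 <= a y) -> (forall y, 0 <= b y) ->
  (\forall y \ae mu, a y <= b y) -> (Jform a x <= Jform b x)%E.
Proof.
move=> ma mb a0 b0 ab; apply: ae_ge0_le_integral => //.
- by move=> y _; rewrite lee_fin mulr_ge0 ?kappa_ge0 ?mulr_ge0.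
- apply/measurable_EFinP; exact: measurable_kappa_conv.
- by move=> y _; rewrite lee_fin mulr_ge0 ?kappa_ge0 ?mulr_ge0.
- apply/measurable_EFinP; exact: measurable_kappa_conv.
- apply: filterS2 ab (ae_fg_subl x ab) => y h1 h2 _.
  by rewrite lee_fin ler_wpM2l ?kappa_ge0// ler_pM.
Qed.

End freq_group_theory.

(** * Norms under scaling and monotone limits *)

Lemma LnormZl d (T : measurableType d) (R : realType) (mu : {measure set T -> \bar R})
    (q : \bar R) (f : T -> \bar R) (C : R) : 0 < C -> (0 < q)%E -> measurable_fun setT f ->
  ('N[mu]_q[(fun x => C%:E * f x)] = C%:E * 'N[mu]_q[f])%E.
Proof.
move=> C0 q0 mf; rewrite unlock; case: q q0 => [q|_|//].
- rewrite lte_fin => q0.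
  under eq_integral do rewrite abseM poweRM ?abse_ge0//.
  rewrite ge0_integralZl//; last 3 first.
  + apply: (@measurableT_comp _ _ _ _ _ _ (@poweR R ^~ q)); first exact: measurable_poweR.
    exact: measurableT_comp.
  + by move=> x _; exact: poweR_ge0.
  + exact: poweR_ge0.
  rewrite poweRM ?poweR_ge0 ?integral_ge0//; last by move=> x _; exact: poweR_ge0.
  by rewrite -poweRrM mulfV ?gt_eqF// gee0_abs ?lee_fin ?(ltW C0)// poweRe1 ?lee_fin ?(ltW C0).
- case: ifP => [h|_]; last by rewrite mule0.
  rewrite -ess_sup_pZl//; congr ess_sup; apply/funext => x /=.
  by rewrite abseM gee0_abs// lee_fin ltW.
Qed.

Lemma nondecreasing_cvg_ge (R : realType) (u : R^nat) (l : R) :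
  {homo u : n m / (n <= m)%N >-> n <= m} -> u @ \oo --> l -> forall n, u n <= l.
Proof.
move=> nd ul n; have <- : limn u = l by exact: cvg_lim.
by apply: nondecreasing_cvgn_le => //; exact: cvgP ul.
Qed.

Lemma cvg_le_cst (R : realType) (u : R^nat) (l c : R) :
  u @ \oo --> l -> (forall n, u n <= c) -> l <= c.
Proof. by move=> ul uc; apply: (cvgr_to_le ul); apply: nearW. Qed.

Lemma cvg_ge_cst (R : realType) (u : R^nat) (l c : R) :
  u @ \oo --> l -> (forall n, c <= u n) -> c <= l.
Proof. by move=> ul uc; apply: (cvgr_to_ge ul); apply: nearW. Qed.

(** Monotonicity does the work of continuity: the limit of the powers is at most l^p, and its power
    1/p is an upper bound of the u_n, hence of l. *)
Lemma nondecreasing_cvg_powR (R : realType) (u : R^nat) (l p : R) : 0 < p ->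
  (forall n, 0 <= u n) ->
  {homo u : n m / (n <= m)%N >-> n <= m} -> u @ \oo --> l ->
  u n `^ p @[n --> \oo] --> l `^ p.
Proof.
move=> p0 u0 nd ul; have ule := nondecreasing_cvg_ge nd ul.
have l0 : 0 <= l := le_trans (u0 0%N) (ule 0%N).
have pV : 0 <= p^-1 by rewrite invr_ge0 ltW.
have ndp : {homo (fun n => u n `^ p) : n m / (n <= m)%N >-> n <= m}.
  by move=> n m nm; apply: ge0_ler_powR; rewrite ?nnegrE// ?nd// ltW.
have cv : cvgn (fun n => u n `^ p).
  apply: nondecreasing_is_cvgn => //; exists (l `^ p) => _ [n _ <-].
  by apply: ge0_ler_powR; rewrite ?nnegrE// ltW.
suff -> : l `^ p = limn (fun n => u n `^ p) by [].
have pK (x : R) : 0 <= x -> (x `^ p) `^ p^-1 = x.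
  by move=> x0; rewrite -powRrM mulfV ?gt_eqF// powRr1.
have pK' (x : R) : 0 <= x -> (x `^ p^-1) `^ p = x.
  by move=> x0; rewrite -powRrM mulVf ?gt_eqF// powRr1.
apply/eqP; rewrite eq_le; apply/andP; split; last first.
  by apply: (cvg_le_cst cv) => n; apply: ge0_ler_powR; rewrite ?nnegrE// ltW.
have L0 : 0 <= limn (fun n => u n `^ p).
  by apply: (cvg_ge_cst cv) => n; exact: powR_ge0.
rewrite -[leRHS]pK'//; apply: ge0_ler_powR; rewrite ?nnegrE ?powR_ge0//.
  exact: ltW.
apply: (cvg_le_cst ul) => n; rewrite -[leLHS]pK//.
apply: ge0_ler_powR; rewrite ?nnegrE ?powR_ge0//.
exact: (nondecreasing_cvg_ge ndp cv).
Qed.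

Section Lnorm_monotone.
Context d (T : measurableType d) (R : realType) (mu : {measure set T -> \bar R}).

(** Carries uniform bounds on the iterates over to their limit: monotone convergence of the p-th
    powers for finite p, a countable union of null sets for p = oo. *)
Lemma Lnorm_lim_le (p : \bar R) (f : (T -> R)^nat) (g : T -> R) (B : \bar R) :
  (1 <= p)%E -> (0 <= B)%E ->
  (forall n, measurable_fun setT (f n)) ->
  (forall n x, 0 <= f n x) ->
  (forall x, {homo f^~ x : n m / (n <= m)%N >-> n <= m}) ->
  (forall x, f n x @[n --> \oo] --> g x) ->
  (forall n, 'N[mu]_p[EFin \o f n] <= B)%E -> ('N[mu]_p[EFin \o g] <= B)%E.
Proof.
move=> p1 B0 mf f0 f_nd fg.
have g0 x : 0 <= g x by exact: cvg_ge_cst (fg x) (f0^~ x).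
rewrite unlock; case: p p1 => [p| |//].
- rewrite lee_fin => p1; have p0 : 0 < p by lra.
  have H (x : \bar R) : (0 <= x)%E -> ((x `^ p^-1 <= B) <-> (x <= B `^ p))%E.
    move=> x0; split => h.
    - by have := ge0_le_poweR (ltW p0) (poweR_ge0 x p^-1) h; rewrite -poweRrM mulVf ?gt_eqF// poweRe1.
    - have := @ge0_le_poweR _ p^-1 _ _ _ x0 h; rewrite -poweRrM mulfV ?gt_eqF// poweRe1//.
      by apply; rewrite invr_ge0 ltW.
  have I0 (h : T -> R) : (0 <= \int[mu]_x (`|(EFin \o h) x| `^ p))%E.
    by apply: integral_ge0 => x _; exact: poweR_ge0.
  move=> fB; apply/H => //.
  have fB' n : (\int[mu]_x (f n x `^ p)%:E <= B `^ p)%E.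
    have /H := fB n; move=> /(_ (I0 _)); apply: le_trans.
    by apply: ge0_le_integral_nomeas => x _ /=; rewrite ?lee_fin ?powR_ge0// ger0_norm.
  have ndp x : {homo (fun n => (f n x `^ p)%:E) : n m / (n <= m)%N >-> (n <= m)%E}.
    by move=> n m nm; rewrite lee_fin; apply: ge0_ler_powR; rewrite ?nnegrE// ?f_nd// ltW.
  have mp n : measurable_fun setT (fun x => (f n x `^ p)%:E).
    by apply/measurable_EFinP; apply: (@measurableT_comp _ _ _ _ _ _ (@powR R ^~ p)).
  have cv x : (f n x `^ p)%:E @[n --> \oo] --> (g x `^ p)%:E.
    by apply: cvg_EFin; [exact: nearW|exact: nondecreasing_cvg_powR].
  have -> : (\int[mu]_x (`|(EFin \o g) x| `^ p) = \int[mu]_x (limn (fun n => (f n x `^ p)%:E)))%E.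
    apply: eq_integral => x _; rewrite (cvg_lim _ (cv x))//=.
    by rewrite ger0_norm.
  rewrite (@monotone_convergence _ _ _ mu setT _ (fun n x => (f n x `^ p)%:E))//.
  + by apply: lime_le; [apply: ereal_nondecreasing_is_cvgn => n m nm;
      apply: ge0_le_integral => // x _; [rewrite lee_fin powR_ge0|exact: ndp]|exact: nearW].
  + by move=> n x _; rewrite lee_fin powR_ge0.
- case: ifP => // _ _ fB; apply/ess_supP.
  have : \forall x \ae mu, forall n, ((f n x)%:E <= B)%E.
    apply: ae_foralln => n; have /ess_supP := fB n.
    by apply: filterS => x /=; rewrite ger0_norm.
  apply: filterS => x /= fxB; rewrite ger0_norm//.
  have cv : (f n x)%:E @[n --> \oo] --> (g x)%:E.
    by apply: cvg_EFin; [exact: nearW|exact: fg].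
  by rewrite -(cvg_lim _ cv)//; apply: lime_le; [exact: cvgP cv|exact: nearW].
Qed.

End Lnorm_monotone.

(** * Monotone iteration of the scalar equation *)

Section majorant.
Context (R : realType) (G : freq_group R).
Local Notation mu := (fg_measure G).
Local Notation sub := (@fg_sub R G).

(** J is quadratic, but the bound is linear in L^q, the other factor being taken in L^r. Smallness
    in L^r alone then closes the iteration in every L^q; r is 1 on the torus and 3/2 on R^3. *)
Definition J_bounded (r : \bar R) (c : R) (q : \bar R) : Prop :=
  forall a : G -> R, measurable_fun setT a -> (forall x, 0 <= a x) ->
  ('N[mu]_q[Jform a] <= c%:E * 'N[mu]_r[EFin \o a] * 'N[mu]_q[EFin \o a])%E.

(** Where J is infinite, [fine] returns 0. This can happen on a null set only, which
    [majorant_exists] removes. *)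
Fixpoint picard_majorant (e0 : G -> R) (C : R) (n : nat) : G -> R :=
  if n is n'.+1 then
    fun x => e0 x + C * fine (Jform (picard_majorant e0 C n') x)
  else fun=> 0.

Lemma J_ae_fin (a : G -> R) : measurable_fun setT a -> (forall x, 0 <= a x) ->
  (\int[mu]_x Jform a x < +oo)%E -> \forall x \ae mu, (Jform a x < +oo)%E.
Proof.
move=> ma a0 Joo.
have iJ : mu.-integrable setT (Jform a).
  apply/integrableP; split; first exact: measurable_Jform.
  by under eq_integral do rewrite gee0_abs ?Jform_ge0//.
have := integrable_ae measurableT iJ.
by apply: filterS => x /(_ I); rewrite ge0_fin_numE// Jform_ge0.
Qed.

Section bounds.
Variables (r : \bar R) (c C : R) (e0 : G -> R).
Hypotheses (r1 : (1 <= r)%E) (c0 : 0 < c) (C0 : 0 < C).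
Hypotheses (me : measurable_fun setT e0) (e00 : forall x, 0 <= e0 x).
Hypothesis Jr : J_bounded r c r.
Hypothesis e_small : ('N[mu]_r[EFin \o e0] <= ((4 * c * C)^-1)%:E)%E.
Local Notation b := (picard_majorant e0 C).

Lemma picard_majorant_ge0 n x : 0 <= b n x.
Proof.
elim: n x => [//|n IH] x /=; apply: addr_ge0 => //.
by apply: mulr_ge0; [exact: ltW|exact/fine_ge0/Jform_ge0].
Qed.

Lemma measurable_picard_majorant n : measurable_fun setT (b n).
Proof.
elim: n => [|n IH] /=; first exact: measurable_cst.
apply: measurable_funD => //; apply: measurable_funM => //.
apply: measurableT_comp; first exact: fine_measurable.
exact: measurable_Jform.
Qed.

Lemma Lnorm_picard_step q n : (1 <= q)%E -> J_bounded r c q ->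
  ('N[mu]_q[EFin \o b n.+1] <= 'N[mu]_q[EFin \o e0] +
    (C * c)%:E * 'N[mu]_r[EFin \o b n] * 'N[mu]_q[EFin \o b n])%E.
Proof.
move=> q1 Jq; have q0 : (0 < q)%E by apply: lt_le_trans q1; rewrite lte_fin.
have mJ : measurable_fun setT (fun x => fine (Jform (b n) x)).
  apply: measurableT_comp; first exact: fine_measurable.
  exact/measurable_Jform/measurable_picard_majorant.
have mCJ : measurable_fun setT (fun x => C * fine (Jform (b n) x)).
  exact: measurable_funM.
apply: le_trans (eminkowski mu me mCJ q1) _; apply: leeD => //.
apply: le_trans (_ : C%:E * 'N[mu]_q[Jform (b n)] <= _)%E; last first.
  rewrite EFinM -!muleA lee_pmul2l ?lte_fin// muleA.
  by apply: Jq; [exact: measurable_picard_majorant|exact: picard_majorant_ge0].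
have J0 x : (0 <= Jform (b n) x)%E by apply: Jform_ge0; exact: picard_majorant_ge0.
apply: le_trans (_ : 'N[mu]_q[(fun x => C%:E * Jform (b n) x)] <= _)%E.
  apply: ge0_Lnorm_le_nomeas => // x /=.
    by rewrite lee_fin mulr_ge0 ?fine_ge0// ltW.
  rewrite EFinM lee_pmul2l ?lte_fin//.
  have := J0 x; case: (Jform (b n) x) => //= s _; exact: leey.
rewrite LnormZl//; exact/measurable_Jform/measurable_picard_majorant.
Qed.

(** With x = |e0|_r <= 1 / (4 c C), the recursion y -> x + c C y^2 preserves y <= 2 x. Given this,
    the recursion in L^q is linear with factor c C |b_n|_r <= 1/2, and preserves the ball of radius
    2 |e0|_q. *)
Lemma Lnorm_picard_le q : (1 <= q)%E -> J_bounded r c q ->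
  forall n, ('N[mu]_q[EFin \o b n] <= 2%:E * 'N[mu]_q[EFin \o e0])%E.
Proof.
suff H q' : (1 <= q')%E -> J_bounded r c q' ->
  (forall n, ('N[mu]_r[EFin \o b n] <= 2%:E * 'N[mu]_r[EFin \o e0])%E) ->
  forall n, ('N[mu]_q'[EFin \o b n] <= 2%:E * 'N[mu]_q'[EFin \o e0])%E.
  move=> q1 Jq; apply: H => // n; elim: n => [|n IH].
    rewrite [X in 'N[mu]_r[X]%E](_ : _ = cst 0%E)// Lnorm0 ?mule_ge0 ?Lnorm_ge0//.
    by rewrite gt_eqF//; apply: lt_le_trans r1; rewrite lte_fin.
  apply: le_trans (Lnorm_picard_step n r1 Jr) _.
  have Nfin : 'N[mu]_r[EFin \o e0]%E \is a fin_num.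
    by rewrite ge0_fin_numE ?Lnorm_ge0//; apply: le_lt_trans e_small _; rewrite ltry.
  have Nbfin : 'N[mu]_r[EFin \o b n]%E \is a fin_num.
    rewrite ge0_fin_numE ?Lnorm_ge0//; apply: le_lt_trans IH _.
    by rewrite lte_mul_pinfty// -ge0_fin_numE ?Lnorm_ge0.
  have := Lnorm_ge0 mu r (EFin \o b n); have := Lnorm_ge0 mu r (EFin \o e0).
  move: e_small IH; rewrite -(fineK Nfin) -(fineK Nbfin).
  set x := fine _; set y := fine _; rewrite -!EFinM -EFinD !lee_fin => hx hy x0 y0.
  have Cc0 : 0 < C * c by rewrite mulr_gt0.
  have h1 : (C * c) * x <= 4^-1.
    apply: le_trans (ler_wpM2l (ltW Cc0) hx) _.
    by rewrite le_eqVlt; apply/orP; left; apply/eqP; field; rewrite !gt_eqF.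
  have h2 : C * c * y * y <= (C * c) * (2 * x) * (2 * x).
    apply: ler_pM => //; first by apply: mulr_ge0 => //; exact: ltW.
    by apply: ler_wpM2l => //; exact: ltW.
  have h3 : C * c * (2 * x) * (2 * x) = 4 * ((C * c * x) * x) by ring.
  have h4 := ler_wpM2r x0 h1; lra.
move=> q1 Jq br; elim=> [|n IH].
  rewrite [X in 'N[mu]_q'[X]%E](_ : _ = cst 0%E)// Lnorm0 ?mule_ge0 ?Lnorm_ge0//.
  by rewrite gt_eqF//; apply: lt_le_trans q1; rewrite lte_fin.
apply: le_trans (Lnorm_picard_step n q1 Jq) _.
have [eoo|] := ltP ('N[mu]_q'[EFin \o e0]%E) +oo%E; last first.
  by rewrite leye_eq => /eqP ->; rewrite mulry gtr0_sg// mul1e leey.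
have Nfin : 'N[mu]_q'[EFin \o e0]%E \is a fin_num.
  by rewrite ge0_fin_numE ?Lnorm_ge0.
have Nbfin : 'N[mu]_q'[EFin \o b n]%E \is a fin_num.
  rewrite ge0_fin_numE ?Lnorm_ge0//; apply: le_lt_trans IH _.
  by rewrite lte_mul_pinfty.
have h1 : ((C * c)%:E * 'N[mu]_r[EFin \o b n] <= 2^-1%:E)%E.
  apply: le_trans (_ : (C * c)%:E * (2%:E * ((4 * c * C)^-1)%:E) <= _)%E.
    rewrite lee_pmul2l ?lte_fin ?mulr_gt0//.
    by apply: le_trans (br n) _; rewrite lee_pmul2l.
  rewrite -!EFinM lee_fin le_eqVlt; apply/orP; left; apply/eqP.
  by field; rewrite !gt_eqF.
apply: le_trans (leeD (lexx _) (lee_wpmul2r (Lnorm_ge0 mu q' _) h1)) _.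
move: IH; rewrite -(fineK Nfin) -(fineK Nbfin) -!EFinM -EFinD !lee_fin.
set x := fine _; set y := fine _; lra.
Qed.

(** Monotonicity, finiteness and the recursion hold almost everywhere for the raw iterates. All of
    them are cut off outside a single set [D] of full measure, so that the system can afterwards be
    treated pointwise: the properties hold on [D] and everything vanishes elsewhere. J does not see
    the cut-off. Finiteness of the convolution of [a] with itself makes all convolutions below it
    converge absolutely. *)
Lemma majorant_exists : J_bounded r c 1 -> ('N[mu]_1[EFin \o e0] < +oo)%E ->
  exists (a_ : (G -> R)^nat) (a : G -> R) (D : set G),
  [/\ measurable D, mu (~` D) = 0%E,
      (forall n, measurable_fun setT (a_ n)) /\ measurable_fun setT a,
      (forall x, a_ 0%N x = 0) /\
      (forall n x, 0 <= a_ n x) /\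
      (forall n x, a_ n x <= a_ n.+1 x) /\
      (forall x, a_ n x @[n --> \oo] --> a x) /\
      (forall x, ~ D x -> a x = 0)
    & [/\ (forall n x, D x -> ((a_ n.+1 x)%:E = (e0 x)%:E + C%:E * Jform (a_ n) x)%E),
         (forall x, D x -> ((a x)%:E = (e0 x)%:E + C%:E * Jform a x)%E),
         (forall x, D x -> (fg_conv a a x < +oo)%E)
       & forall q, (1 <= q)%E -> J_bounded r c q ->
         ('N[mu]_q[EFin \o a] <= 2%:E * 'N[mu]_q[EFin \o e0])%E ] ].
Proof.
move=> J1 e1.
have b0 n x : 0 <= b n x := picard_majorant_ge0 n x.
have mb n : measurable_fun setT (b n) := measurable_picard_majorant n.
have Nb n : ('N[mu]_1[EFin \o b n] <= 2%:E * 'N[mu]_1[EFin \o e0])%E.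
  exact: Lnorm_picard_le.
have N1 (f : G -> R) : (forall x, 0 <= f x) -> ('N[mu]_1[EFin \o f] = \int[mu]_x (f x)%:E)%E.
  by move=> f0; rewrite Lnorm1; apply: eq_integral => x _ /=; rewrite ger0_norm.
have Boo : (2%:E * 'N[mu]_1[EFin \o e0] < +oo)%E.
  by rewrite lte_mul_pinfty.
have Jfin : \forall x \ae mu, forall n, (Jform (b n) x < +oo)%E.
  apply: ae_foralln => n; apply: J_ae_fin => //.
  have -> : (\int[mu]_x Jform (b n) x = 'N[mu]_1[Jform (b n)])%E.
    by rewrite Lnorm1; apply: eq_integral => x _; rewrite gee0_abs ?Jform_ge0.
  apply: le_lt_trans (J1 _ (mb n) (b0 n)) _.
  have h0 : ('N[mu]_r[EFin \o b n] < +oo)%E.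
    apply: le_lt_trans (Lnorm_picard_le r1 Jr n) _; rewrite lte_mul_pinfty//.
    by apply: le_lt_trans e_small _; rewrite ltry.
  have h1 : 'N[mu]_r[EFin \o b n]%E \is a fin_num by rewrite ge0_fin_numE ?Lnorm_ge0.
  have h2 : 'N[mu]_1[EFin \o b n]%E \is a fin_num.
    by rewrite ge0_fin_numE ?Lnorm_ge0//; exact: le_lt_trans (Nb n) Boo.
  by rewrite -(fineK h1) -(fineK h2) -!EFinM ltry.
have bS n x : (Jform (b n) x < +oo)%E ->
    ((b n.+1 x)%:E = (e0 x)%:E + C%:E * Jform (b n) x)%E.
  by move=> h; rewrite /= EFinD EFinM fineK// ge0_fin_numE// Jform_ge0.
have b_nd : \forall x \ae mu, forall n, b n x <= b n.+1 x.
  apply: ae_foralln; elim=> [|n IH]; first by apply: aeW => x; exact: b0.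
  apply: filterS Jfin => x h; rewrite -lee_fin !bS// leeD2l// lee_pmul2l ?lte_fin//.
  exact: le_Jform.
have [N1' [mN1 N10 PN1]] : \forall x \ae mu, (forall n, (Jform (b n) x < +oo)%E) /\
    (forall n, b n x <= b n.+1 x) by apply: filterS2 Jfin b_nd.
have D1P x : (~` N1') x -> (forall n, (Jform (b n) x < +oo)%E) /\
    (forall n, b n x <= b n.+1 x).
  by move=> D1x; apply: contrapT => nP; apply/D1x/PN1.
(* A first cut-off makes the sequence monotone at every point, hence convergent in the extended
   reals. Later [D] also excludes the points where the limit or its convolution with itself is
   infinite. *)
pose A n x := b n x * \1_(~` N1') x.
have mA n : measurable_fun setT (A n).
  by apply: measurable_funM => //; apply: measurable_indic; exact: measurableC.
have A0 n x : 0 <= A n x by rewrite mulr_ge0.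
have A_nd x : {homo A^~ x : n m / (n <= m)%N >-> n <= m}.
  apply: homo_leq => [//|? ? ?|n]; first exact: le_trans.
  have [h|h] := pselect ((~` N1') x); last by rewrite /A indic_notin ?mulr0.
  by rewrite /A indic_in// !mulr1; case: (D1P _ h).
pose L x : \bar R := limn (fun n => (A n x)%:E).
have cvL x : (A n x)%:E @[n --> \oo] --> L x.
  by apply: ereal_nondecreasing_is_cvgn => n m nm; rewrite lee_fin A_nd.
have mEA n : measurable_fun setT (fun x => (A n x)%:E) by exact/measurable_EFinP.
have mL : measurable_fun setT L.
  by apply: (emeasurable_fun_cvg (fun n x => (A n x)%:E)) => // x _; exact: cvL.
have L0 x : (0 <= L x)%E.
  by apply: lime_ge; [exact: cvL|apply: nearW => n; rewrite lee_fin].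
have Loo : (\int[mu]_x L x < +oo)%E.
  apply: le_lt_trans Boo.
  rewrite (@monotone_convergence _ _ _ mu setT _ (fun n x => (A n x)%:E))//; last 2 first.
  - by move=> n x _; rewrite lee_fin.
  - by move=> x _ n m nm; rewrite lee_fin A_nd.
  apply: lime_le.
    apply: ereal_nondecreasing_is_cvgn => n m nm.
    by apply: ge0_le_integral_nomeas => x _; rewrite lee_fin// A_nd.
  apply: nearW => n; apply: le_trans (Nb n); rewrite N1//.
  apply: ge0_le_integral_nomeas => x _; rewrite lee_fin//.
  by rewrite /A indicE ler_piMr// lern1 leq_b1.
have Lfin : \forall x \ae mu, L x \is a fin_num.
  have iL : mu.-integrable setT L.
    by apply/integrableP; split => //; under eq_integral do rewrite gee0_abs//.
  by apply: filterS (integrable_ae measurableT iL) => x; exact.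
pose E x := fine (L x).
have mE : measurable_fun setT E by apply: measurableT_comp mL; exact: fine_measurable.
have E0 x : 0 <= E x by exact: fine_ge0.
have Eoo : (\int[mu]_x (E x)%:E < +oo)%E.
  apply: le_lt_trans Loo; apply: ge0_le_integral_nomeas => x _; rewrite ?lee_fin//.
  by rewrite /E; have := L0 x; case: (L x) => //= *; exact: leey.
have convfin : \forall x \ae mu, (fg_conv E E x < +oo)%E.
  have c00 x : (0 <= fg_conv E E x)%E.
    by apply: integral_ge0 => y _; rewrite lee_fin mulr_ge0.
  have iL : mu.-integrable setT (fg_conv E E).
    apply/integrableP; split; first exact: measurable_fg_conv.
    under eq_integral do rewrite gee0_abs//.
    rewrite integral_fg_conv//.
    have : (\int[mu]_x (E x)%:E)%E \is a fin_num.
      by rewrite ge0_fin_numE// integral_ge0// => x _; rewrite lee_fin.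
    by move=> /fineK <-; rewrite -EFinM ltry.
  apply: filterS (integrable_ae measurableT iL) => x /(_ I).
  by rewrite ge0_fin_numE.
have [N [mN N0 PN]] : \forall x \ae mu, [/\ (~` N1') x, L x \is a fin_num & (fg_conv E E x < +oo)%E].
  apply: filterS3 Lfin convfin (_ : \forall x \ae mu, (~` N1') x) => //.
  by exists N1'; split => // x /= /contrapT.
pose D := ~` N.
have DP x : D x -> [/\ (~` N1') x, L x \is a fin_num & (fg_conv E E x < +oo)%E].
  by move=> Dx; apply: contrapT => nP; apply/Dx/PN.
have mD : measurable D by exact: measurableC.
have aeD : \forall x \ae mu, \1_D x = 1 :> R.
  by exists N; split => // x /= h; apply: contrapT => Nx; apply: h; rewrite indicE mem_set.
have D01 x : \1_D x <= 1 :> R by rewrite indicE lern1 leq_b1.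
have inD x : D x -> \1_D x = 1 :> R by move=> Dx; rewrite indicE mem_set.
have ninD x : ~ D x -> \1_D x = 0 :> R by move=> Dx; rewrite indicE memNset.
pose a_ n x := b n x * \1_D x; pose a x := E x * \1_D x.
have ma_ n : measurable_fun setT (a_ n) by exact: measurable_funM.
have ma : measurable_fun setT a by exact: measurable_funM.
have a_0 n x : 0 <= a_ n x by rewrite mulr_ge0.
have a0 x : 0 <= a x by rewrite mulr_ge0.
have a_S n x : a_ n x <= a_ n.+1 x.
  have [Dx|Dx] := pselect (D x); last by rewrite /a_ ninD ?mulr0.
  rewrite /a_ inD// !mulr1; by case: (DP _ Dx) => /D1P [].
have a_nd x : {homo a_^~ x : n m / (n <= m)%N >-> n <= m}.
  by apply: homo_leq => [//|? ? ?|n]; [exact: le_trans|exact: a_S].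
have acv x : a_ n x @[n --> \oo] --> a x.
  have [Dx|Dx] := pselect (D x); last first.
    rewrite /a ninD// mulr0 (_ : a_^~ x = fun=> 0); first exact: cvg_cst.
    by apply/funext => n; rewrite /a_ ninD// mulr0.
  have [D1x Lx _] := DP _ Dx.
  rewrite /a inD// mulr1.
  have -> : a_^~ x = fine \o (fun n => (A n x)%:E).
    apply/funext => n /=; rewrite /a_ inD// /A indicE mem_set//.
  by apply: fine_cvg; rewrite fineK.
have JE n x : Jform (a_ n) x = Jform (b n) x.
  by apply: ae_eq_Jform => //; apply: filterS aeD => y; rewrite /a_ => ->; rewrite mulr1.
have a_JE n x : D x -> ((a_ n.+1 x)%:E = (e0 x)%:E + C%:E * Jform (a_ n) x)%E.
  move=> Dx; rewrite JE -bS; last by case: (DP _ Dx) => /D1P [].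
  by rewrite /a_ inD// mulr1.
exists a_, a, D; split => //.
- by rewrite /D setCK.
- split; [|split; [|split; [|split]]] => //.
  + by move=> x; rewrite /a_ /= mul0r.
  + by move=> x Dx; rewrite /a ninD// mulr0.
- split => //.
  + move=> x Dx.
    have Jcv : Jform (a_ n) x @[n --> \oo] --> Jform a x.
      have cvJ y : (kappa x y * (a_ n (sub x y) * a_ n y))%:E @[n --> \oo] -->
          (kappa x y * (a (sub x y) * a y))%:E.
        apply: cvg_EFin; first exact: nearW.
        by apply: cvgM; [exact: cvg_cst|apply: cvgM; exact: acv].
      have -> : Jform a x = (\int[mu]_y limn (fun n => (kappa x y * (a_ n (sub x y) * a_ n y))%:E))%E.
        by apply: eq_integral => y _; rewrite (cvg_lim _ (cvJ y)).
      apply: cvg_monotone_convergence => //.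
      * by move=> n; apply/measurable_EFinP; exact: measurable_kappa_conv.
      * by move=> n y _; rewrite lee_fin mulr_ge0 ?kappa_ge0// mulr_ge0.
      * move=> y _ n m nm; rewrite lee_fin ler_wpM2l ?kappa_ge0//.
        by apply: ler_pM => //; exact: a_nd.
    (* By the recursion J a_n also tends to the real number (a - e0) / C. Uniqueness of the limit
       gives finiteness of J a and the equation at once. *)
    have JE' : Jform (a_ n) x @[n --> \oo] --> ((C^-1 * (a x - e0 x))%:E)%E.
      rewrite (_ : (fun n => Jform (a_ n) x) = (fun n => (C^-1 * (a_ n.+1 x - e0 x))%:E)).
        apply: cvg_EFin; first exact: nearW.
        apply: cvgM; first exact: cvg_cst.
        apply: cvgB; last exact: cvg_cst.
        by rewrite (cvg_shiftS (a_^~ x)); exact: acv.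
      apply/funext => n; have := a_JE n x Dx.
      have : (Jform (a_ n) x) \is a fin_num.
        rewrite ge0_fin_numE ?Jform_ge0// JE.
        by case: (DP _ Dx) => /D1P [].
      move=> /fineK <-; rewrite -EFinM -EFinD => -[->]; congr EFin.
      by field; rewrite gt_eqF.
    rewrite (cvg_unique _ Jcv JE')//.
    by rewrite -EFinM -EFinD; congr EFin; field; rewrite gt_eqF.
  + move=> x Dx; case: (DP _ Dx) => _ _; apply: le_lt_trans.
    apply: ge0_le_integral_nomeas => y _; rewrite lee_fin ?mulr_ge0//.
    by apply: ler_pM => //; rewrite /a ler_piMr.
  + move=> q q1 Jq; apply: (@Lnorm_lim_le _ _ _ mu q a_) => //.
      by rewrite mule_ge0 ?Lnorm_ge0.
    move=> n; apply: le_trans (Lnorm_picard_le q1 Jq n).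
    apply: ge0_Lnorm_le_nomeas => //.
    * by apply: lt_le_trans q1; rewrite lte_fin.
    * by move=> x; rewrite lee_fin.
    * by move=> x /=; rewrite lee_fin /a_ ler_piMr.
Qed.

End bounds.

End majorant.

(** * Quadratic systems: existence *)

Section duhamel_term.
Context (R : realType) (G : freq_group R).
Local Notation mu := (fg_measure G).
Local Notation leb := (@lebesgue_measure R).
Local Notation sub := (@fg_sub R G).

Definition jointly (F : R -> G -> R) : Prop :=
  measurable_fun [set: measurableTypeR R * G] (fun z => F z.1 z.2).

Definition conv2 (f g : G -> R) (x : G) : R := \int[mu]_y (f (sub x y) * g y).

Definition heatk (nu s : R) (x : G) : R := expR (- (nu * s * fg_mod x ^+ 2)).

Definition duhamel_term (nu : R) (F : R -> G -> R) (t : R) (x : G) : R :=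
  \int[leb]_(tau in `[0%R, t]) (heatk nu (t - tau) x * F tau x).

Lemma jointlyl F t : jointly F -> measurable_fun setT (F t).
Proof.
move=> mF; apply: (measurableT_comp mF (g := pair (t : measurableTypeR R))).
exact: measurable_pair1.
Qed.

Lemma jointlyr F x : jointly F ->
  measurable_fun [set: measurableTypeR R] (fun t => F t x).
Proof. by move=> mF; apply: (measurableT_comp mF (g := pair^~ x)); exact: measurable_pair2. Qed.

Lemma jointly_conv2 F H : jointly F -> jointly H ->
  jointly (fun t x => conv2 (F t) (H t) x).
Proof.
move=> mF mH; apply: (@measurable_fun_Rintegral_param _ _ _ _ _ mu
  (fun z : (measurableTypeR R * G) * G =>
    F z.1.1 (sub z.1.2 z.2) * H z.1.1 z.2)).
have m11 : measurable_fun [set: (measurableTypeR R * G) * G] (fun z => z.1.1).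
  exact: measurableT_comp.
have m12 : measurable_fun [set: (measurableTypeR R * G) * G] (fun z => z.1.2).
  exact: measurableT_comp.
apply: measurable_funM.
  apply: (measurableT_comp mF (g := fun z : (measurableTypeR R * G) * G =>
    (z.1.1, sub z.1.2 z.2))).
  apply: measurable_fun_pair => //.
  apply: (measurableT_comp (@measurable_fg_sub R G)
    (g := fun z : (measurableTypeR R * G) * G => (z.1.2, z.2))).
  exact: measurable_fun_pair.
apply: (measurableT_comp mH (g := fun z : (measurableTypeR R * G) * G =>
    (z.1.1, z.2))).
exact: measurable_fun_pair.
Qed.

Lemma jointly_heatk nu : jointly (heatk nu).
Proof.
apply: measurableT_comp; first exact: measurable_expR.
apply: measurableT_comp => //; apply: measurable_funM.
  by apply: measurable_funM => //.
apply: measurable_funX; apply: measurableT_comp => //; exact: measurable_fg_mod.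
Qed.

Lemma jointly_duhamel_term nu F : jointly F -> jointly (duhamel_term nu F).
Proof.
move=> mF.
(* The domain of integration depends on t. Moved into the integrand, it leaves an integral with
   parameters over a fixed space. *)
have -> : duhamel_term nu F = fun t x => \int[leb]_tau
   (if (0 <= tau) && (tau <= t) then heatk nu (t - tau) x * F tau x else 0).
  apply/funext => t; apply/funext => x; rewrite /duhamel_term Rintegral_mkcond.
  apply: eq_Rintegral => tau _; rewrite patchE.
  have -> // : (tau \in `[0, t]%classic) = (0 <= tau) && (tau <= t).
  by apply/idP/idP => [/set_mem|h]; rewrite ?inE/= in_itv.
apply: (@measurable_fun_Rintegral_param _ _ _ _ _ leb
  (fun z : (measurableTypeR R * G) * measurableTypeR R =>
    if (0 <= z.2) && (z.2 <= z.1.1) then heatk nu (z.1.1 - z.2) z.1.2 * F z.2 z.1.2 else 0)).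
have m11 : measurable_fun [set: (measurableTypeR R * G) * measurableTypeR R] (fun z => z.1.1).
  exact: measurableT_comp.
have m12 : measurable_fun [set: (measurableTypeR R * G) * measurableTypeR R] (fun z => z.1.2).
  exact: measurableT_comp.
apply: measurable_fun_ifT => //.
- by apply: measurable_and; apply: measurable_fun_ler.
- apply: measurable_funM.
    apply: (measurableT_comp (@jointly_heatk nu)
      (g := fun z : (measurableTypeR R * G) * measurableTypeR R =>
        (z.1.1 - z.2 : measurableTypeR R, z.1.2))).
    by apply: measurable_fun_pair => //; exact: measurable_funB.
  apply: (measurableT_comp mF (g := fun z : (measurableTypeR R * G) * measurableTypeR R =>
    (z.2, z.1.2))).
  exact: measurable_fun_pair.
Qed.

Definition mmax (x y : G) : R := Num.max (fg_mod (sub x y)) (fg_mod y).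

Lemma mmax_ge0 x y : 0 <= mmax x y.
Proof. by rewrite le_max fg_mod_ge0. Qed.

Lemma fg_mod_le_mmax x y : fg_mod x <= 2 * mmax x y.
Proof.
apply: le_trans (fg_mod_sub x y) _; rewrite mulrC mulr_natr mulr2n.
by apply: lerD; rewrite le_max lexx ?orbT.
Qed.

Lemma measurable_mmax x : measurable_fun setT (mmax x).
Proof.
apply: measurable_maxr; last exact: measurable_fg_mod.
by apply: measurableT_comp; [exact: measurable_fg_mod|exact: measurable_fg_subl].
Qed.

Section bound.
Variables (nu : R) (nu0 : 0 < nu).

Lemma profile_ge0 k t : 0 <= profile nu k t.
Proof. exact: sqr_ge0. Qed.

Lemma profile_le1 k t : 0 <= t -> profile nu k t <= 1.
Proof.
move=> t0; have h : 0 <= nu * k ^+ 2 * t.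
  by apply: mulr_ge0 => //; apply: mulr_ge0; [exact: ltW|exact: sqr_ge0].
by rewrite exprn_ile1 ?invr_ge0 ?invf_le1; lra.
Qed.

(** One factor is at most 1 and is dropped. The decay of the larger frequency survives, and that
    frequency is at least half of |xi|. *)
Lemma profileM_le k l t : 0 <= k -> 0 <= l -> 0 <= t ->
  profile nu k t * profile nu l t <= profile nu (Num.max k l) t.
Proof.
move=> k0 l0 t0; have [kl|lk] := leP k l.
  by rewrite ler_piMl ?profile_ge0 ?profile_le1.
by rewrite ler_piMr ?profile_ge0 ?profile_le1.
Qed.

Lemma measurable_profile2 (f : G -> R) : measurable_fun setT f ->
  measurable_fun [set: measurableTypeR R * G] (fun z => profile nu (f z.2) z.1).
Proof.
move=> mf; apply: measurable_funX; apply: measurableT_comp; first exact: measurable_invr.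
apply: measurable_funD => //; apply: measurable_funM => //.
by apply: measurable_funM => //; apply: measurable_funX; apply: measurableT_comp.
Qed.

(** Tonelli, then [time_kernel_le] at each fixed eta with M = [mmax x y]. The factor |xi| / M^2 that
    it leaves is the origin of kappa. *)
Lemma time_fubini (w : G -> R) x t : measurable_fun setT w -> (forall y, 0 <= w y) ->
  0 <= t ->
  (\int[leb]_(tau in `[0%R, t]) \int[mu]_y
     (w y * (fg_mod x * heatk nu (t - tau) x * profile nu (mmax x y) tau))%:E <=
   \int[mu]_y ((64 / nu * profile nu (fg_mod x) t) * (kappa x y * w y))%:E)%E.
Proof.
move=> mw w0 t0.
pose f (z : measurableTypeR R * G) := ((\1_(`[0, t]%classic) z.1) *
  (w z.2 * (fg_mod x * heatk nu (t - z.1) x * profile nu (mmax x z.2) z.1)))%:E.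
have f0 z : (0 <= f z)%E.
  rewrite lee_fin; apply: mulr_ge0 => //; apply: mulr_ge0 => //.
  by apply: mulr_ge0; [apply: mulr_ge0; [exact: fg_mod_ge0|exact: expR_ge0]|exact: profile_ge0].
have mf : measurable_fun [set: measurableTypeR R * G] f.
  apply/measurable_EFinP; apply: measurable_funM.
    by apply: measurableT_comp => //; exact: measurable_indic.
  apply: measurable_funM; first exact: measurableT_comp.
  apply: measurable_funM; last by apply: measurable_profile2; exact: measurable_mmax.
  apply: measurable_funM => //.
  apply: (measurableT_comp (f := fun s : measurableTypeR R => heatk nu (t - s) x)) => //.
  apply: (measurableT_comp (jointlyr x (@jointly_heatk nu)) (g := fun s : measurableTypeR R => t - s)).
  exact: measurable_funB.
rewrite [leLHS](_ : _ = (\int[leb]_tau \int[mu]_y f (tau, y))%E); last first.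
  rewrite integral_mkcond; apply: eq_integral => tau _; rewrite patchE /f.
  case: ifPn => [/set_mem h|/negP h].
    by apply: eq_integral => y _ /=; rewrite indic_in// mul1r.
  rewrite integral0_eq// => y _ /=; rewrite indic_notin ?mul0r//.
  by move=> h'; apply: h; rewrite inE.
rewrite (fubini_tonelli f)//.
apply: ge0_le_integral_nomeas => y _.
  by apply: integral_ge0 => tau _.
rewrite [leLHS](_ : _ = ((w y)%:E * \int[leb]_(tau in `[0%R, t])
  (fg_mod x * expR (- (nu * (t - tau) * fg_mod x ^+ 2)) * profile nu (mmax x y) tau)%:E)%E).
  rewrite [leRHS](_ : _ = ((w y)%:E * (64 / nu * (fg_mod x / mmax x y ^+ 2) * profile nu (fg_mod x) t)%:E)%E).
    apply: lee_wpmul2l; first by rewrite lee_fin.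
    apply: time_kernel_le => //; [exact: fg_mod_ge0|exact: mmax_ge0|exact: fg_mod_le_mmax].
  by rewrite -EFinM; congr EFin; rewrite /kappa /mmax; ring.
rewrite -ge0_integralZl//; last 3 first.
- apply/measurable_EFinP; apply: measurable_funTS.
  apply: measurable_funM; last first.
    apply: (measurableT_comp (@measurable_profile2 (mmax x) (measurable_mmax x)) (g := pair^~ y)).
    exact: measurable_pair2.
  apply: measurable_funM => //.
  apply: (measurableT_comp (jointlyr x (@jointly_heatk nu)) (g := fun s : measurableTypeR R => t - s)).
  exact: measurable_funB.
- move=> tau _; rewrite lee_fin; apply: mulr_ge0; last exact: profile_ge0.
  by apply: mulr_ge0; [exact: fg_mod_ge0|exact: expR_ge0].
- by rewrite lee_fin.
rewrite [RHS]integral_mkcond; apply: eq_integral => tau _; rewrite patchE /f/=.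
case: ifPn => [/set_mem h|/negP h]; first by rewrite indic_in// mul1r -EFinM.
by rewrite indic_notin ?mul0r// => h'; apply: h; rewrite inE.
Qed.

(* [F] is the source at the frequency [x]; [w] is the product of two envelopes. *)
Lemma duhamel_term_le (nu' c : R) (F : R -> G -> R) (w : G -> R) x t :
  nu <= nu' -> 0 <= c -> jointly F -> measurable_fun setT w -> (forall y, 0 <= w y) ->
  0 <= t ->
  (forall tau, 0 <= tau -> ((`|F tau x|)%:E <= \int[mu]_y
     (w y * (c * fg_mod x * profile nu (mmax x y) tau))%:E)%E) ->
  (\int[mu]_y (kappa x y * w y)%:E < +oo)%E ->
  leb.-integrable `[0, t] (fun tau => (heatk nu' (t - tau) x * F tau x)%:E) /\
  `|duhamel_term nu' F t x| <= c * (64 / nu) * fine (\int[mu]_y (kappa x y * w y)%:E) *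
     profile nu (fg_mod x) t.
Proof.
move=> nunu' c0 mF mw w0 t0 Fw Joo.
have J0 : (0 <= \int[mu]_y (kappa x y * w y)%:E)%E.
  by apply: integral_ge0 => y _; rewrite lee_fin mulr_ge0 ?kappa_ge0.
have mK : measurable_fun setT (fun y => kappa x y * w y).
  apply: measurable_funM => //.
  by apply: (measurableT_comp (@measurable_kappa R G) (g := pair x)); exact: measurable_pair1.
have mheat : measurable_fun [set: measurableTypeR R] (fun tau => heatk nu' (t - tau) x).
  apply: (measurableT_comp (jointlyr x (@jointly_heatk nu')) (g := fun s : measurableTypeR R => t - s)).
  exact: measurable_funB.
have mhF : measurable_fun `[0, t]%classic (fun tau => heatk nu' (t - tau) x * F tau x).
  by apply: measurable_funTS; apply: measurable_funM => //; exact: jointlyr.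
have main : (\int[leb]_(tau in `[0%R, t]) (`|heatk nu' (t - tau) x * F tau x|)%:E <=
  (c * (64 / nu) * fine (\int[mu]_y (kappa x y * w y)%:E) * profile nu (fg_mod x) t)%:E)%E.
  have mP tau : measurable_fun setT (fun y => profile nu (mmax x y) tau).
    apply: (measurableT_comp (@measurable_profile2 (mmax x) (measurable_mmax x)) (g := pair (tau : measurableTypeR R))).
    exact: measurable_pair1.
  apply: (@le_trans _ _ (c%:E * \int[leb]_(tau in `[0%R, t]) \int[mu]_y
     (w y * (fg_mod x * heatk nu (t - tau) x * profile nu (mmax x y) tau))%:E)%E).
    rewrite -ge0_integralZl//; last 2 first.
    - apply: measurable_funTS.
      apply: (@measurable_fun_integral_param _ _ (measurableTypeR R) G R mu
        (fun z => (w z.2 * (fg_mod x * heatk nu (t - z.1) x * profile nu (mmax x z.2) z.1))%:E)).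
      apply/measurable_EFinP; apply: measurable_funM; first exact: measurableT_comp.
      apply: measurable_funM; last by apply: measurable_profile2; exact: measurable_mmax.
      apply: measurable_funM => //.
      apply: (measurableT_comp (f := fun s : measurableTypeR R => heatk nu (t - s) x)) => //.
      apply: (measurableT_comp (jointlyr x (@jointly_heatk nu)) (g := fun s : measurableTypeR R => t - s)).
      exact: measurable_funB.
    - move=> tau _; apply: integral_ge0 => y _; rewrite lee_fin; apply: mulr_ge0 => //.
      by apply: mulr_ge0; [apply: mulr_ge0; [exact: fg_mod_ge0|exact: expR_ge0]|exact: profile_ge0].
    apply: ge0_le_integral_nomeas => tau; rewrite /= in_itv/= => /andP[tau0 taut].
      by rewrite lee_fin.
    rewrite normrM EFinM.
    apply: (@le_trans _ _ ((heatk nu (t - tau) x)%:E * \int[mu]_y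
      (w y * (c * fg_mod x * profile nu (mmax x y) tau))%:E)%E).
      (* A larger viscosity makes the heat factor smaller, so the heat factor of nu' is replaced by
         that of nu <= nu', the rate of the envelope. *)
      apply: lee_pmul => //; rewrite ?lee_fin//; last exact: Fw.
      rewrite ger0_norm ?expR_ge0// ler_expR lerN2.
      by rewrite ler_wpM2r ?sqr_ge0// ler_wpM2r// subr_ge0.
    rewrite -!ge0_integralZl//; first 1 last.
    - apply/measurable_EFinP; apply: measurable_funM => //; apply: measurable_funM => //.
    - move=> y _; rewrite lee_fin; apply: mulr_ge0 => //.
      by apply: mulr_ge0; [apply: mulr_ge0; [exact: fg_mod_ge0|exact: expR_ge0]|exact: profile_ge0].
    - apply/measurable_EFinP; apply: measurable_funM => //; apply: measurable_funM => //.
    - move=> y _; rewrite lee_fin; apply: mulr_ge0 => //.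
      by apply: mulr_ge0; [apply: mulr_ge0; [by []|exact: fg_mod_ge0]|exact: profile_ge0].
    - by rewrite lee_fin expR_ge0.
    apply: ge0_le_integral_nomeas => y _; rewrite -!EFinM lee_fin.
      apply: mulr_ge0; first exact: expR_ge0.
      by apply: mulr_ge0 => //; apply: mulr_ge0; [apply: mulr_ge0; [by []|exact: fg_mod_ge0]|exact: profile_ge0].
    lra.
  apply: (@le_trans _ _ (c%:E * \int[mu]_y ((64 / nu * profile nu (fg_mod x) t) * (kappa x y * w y))%:E)%E).
    by apply: lee_wpmul2l; [rewrite lee_fin|exact: time_fubini].
  under eq_integral do rewrite EFinM.
  rewrite ge0_integralZl//; last 3 first.
  - exact/measurable_EFinP.
  - by move=> y _; rewrite lee_fin mulr_ge0 ?kappa_ge0.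
  - by rewrite lee_fin; apply: mulr_ge0; [apply: divr_ge0 => //; exact: ltW|exact: profile_ge0].
  rewrite -[X in (_ * (_ * X))%E]fineK ?ge0_fin_numE// -!EFinM lee_fin.
  lra.
split.
  apply/integrableP; split; first exact/measurable_EFinP.
  by apply: le_lt_trans main _; rewrite ltry.
rewrite -lee_fin; apply: le_trans main.
exact: normr_Rintegral_le.
Qed.

End bound.
End duhamel_term.

(** * Difference estimates for quadratic systems *)

Section quadratic_system.
Context (R : realType) (G : freq_group R) (I : finType).
Local Notation mu := (fg_measure G).
Local Notation leb := (@lebesgue_measure R).
Local Notation sub := (@fg_sub R G).
Implicit Types (W : I -> R -> G -> R) (t : R) (x y : G).

(** [L i x] turns the matrix of all convolutions of two components at x into the source of the i-th
    equation. The first clause is linearity in the form in which two sources are compared; the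
    factor |xi| in the second is the derivative in the nonlinearity. *)
Definition quadratic_multiplier (c0 : R) (L : I -> G -> (I -> I -> R) -> R) : Prop :=
  [/\ forall i x c c', L i x (fun j k => c j k - c' j k) = L i x c - L i x c',
      forall i x c, `|L i x c| <= c0 * fg_mod x * \sum_(p : I * I) `|c p.1 p.2|
    & forall i (c : I -> I -> R -> G -> R), (forall j k, jointly (c j k)) ->
        jointly (fun t x => L i x (fun j k => c j k t x))].

Definition nrm W t x : R := \sum_i `|W i t x|.

Definition source (L : I -> G -> (I -> I -> R) -> R) W i t x : R :=
  L i x (fun j k => conv2 (W j t) (W k t) x).

Definition solves (nu : I -> R) L (W0 : I -> G -> R) W i t x : Prop :=
  leb.-integrable `[0, t]
    (fun tau => (heatk (nu i) (t - tau) x * source L W i tau x)%:E) /\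
  W i t x = heatk (nu i) t x * W0 i x + duhamel_term (nu i) (source L W i) t x.

Lemma nrm_ge0 W t x : 0 <= nrm W t x.
Proof. exact: sumr_ge0. Qed.

Lemma le_nrm W i t x : `|W i t x| <= nrm W t x.
Proof. by rewrite /nrm (bigD1 i)//= lerDl sumr_ge0. Qed.

Lemma sum_pairM (f g : I -> R) :
  \sum_(p : I * I) f p.1 * g p.2 = (\sum_i f i) * (\sum_i g i).
Proof. by rewrite big_distrlr/= pair_big. Qed.

(** The algebra behind the majorant method: a' b' - a b = (a' - a) b' + a (b' - b), and the same
    identity holds for A' B' - A B on the right. *)
Lemma sum_mulB_le (a a' b b' : I -> R) (A A' B B' : R) :
  \sum_i `|a i| <= A -> \sum_i `|a' i - a i| <= A' - A ->
  \sum_i `|b' i| <= B' -> \sum_i `|b' i - b i| <= B' - B ->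
  \sum_(p : I * I) `|a' p.1 * b' p.2 - a p.1 * b p.2| <= A' * B' - A * B.
Proof.
move=> aA aA' bB bB'.
apply: le_trans (_ : \sum_(p : I * I) (`|a' p.1 - a p.1| * `|b' p.2|
    + `|a p.1| * `|b' p.2 - b p.2|) <= _).
  apply: ler_sum => p _; rewrite -!normrM.
  rewrite [X in `|X| <= _](_ : _ = (a' p.1 - a p.1) * b' p.2 + a p.1 * (b' p.2 - b p.2)).
    exact: ler_normD.
  by ring.
rewrite big_split/= (sum_pairM (fun i => `|a' i - a i|) (fun i => `|b' i|)).
rewrite (sum_pairM (fun i => `|a i|) (fun i => `|b' i - b i|)).
have h1 : (\sum_i `|a' i - a i|) * (\sum_i `|b' i|) <= (A' - A) * B'.
  by apply: ler_pM => //; exact: sumr_ge0.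
have h2 : (\sum_i `|a i|) * (\sum_i `|b' i - b i|) <= A * (B' - B).
  by apply: ler_pM => //; exact: sumr_ge0.
lra.
Qed.

Section estimates.
Variables (nu0 c0 : R) (nu : I -> R) (L : I -> G -> (I -> I -> R) -> R).
Hypotheses (nu0_gt0 : 0 < nu0) (nu_ge : forall i, nu0 <= nu i).
Hypotheses (c0_ge0 : 0 <= c0) (qL : quadratic_multiplier c0 L).
Local Notation h := (fun x t => profile nu0 (fg_mod x) t).

Lemma jointly_source W i : (forall j, jointly (W j)) -> jointly (source L W i).
Proof.
move=> mW; case: qL => _ _; apply => j k; exact: jointly_conv2.
Qed.

Definition dominated W (b : G -> R) : Prop :=
  [/\ forall i, jointly (W i), measurable_fun setT b, forall x, 0 <= b x
    & forall t x, 0 <= t -> nrm W t x <= b x * h x t].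

(** Increments of the fields lie below increments of the scalar majorants. Summed along the
    iteration, this turns convergence of the majorants into convergence of the fields. *)
Definition close W' W (b' b : G -> R) : Prop :=
  (forall x, b x <= b' x) /\
  forall t x, 0 <= t -> nrm (fun i t x => W' i t x - W i t x) t x <= (b' x - b x) * h x t.

Lemma integrable_conv2 W b t x j k : dominated W b -> 0 <= t ->
  (fg_conv b b x < +oo)%E ->
  mu.-integrable setT (fun y => (W j t (sub x y) * W k t y)%:E).
Proof.
move=> [mW mb b0 Wb] t0 boo; apply/integrableP; split.
  apply/measurable_EFinP; apply: measurable_funM; last exact: jointlyl.
  by apply: measurableT_comp; [exact: jointlyl|exact: measurable_fg_subl].
apply: le_lt_trans boo; apply: ge0_le_integral_nomeas => y _; first exact: abse_ge0.
rewrite abse_EFin lee_fin normrM; apply: ler_pM => //.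
- apply: le_trans (le_nrm _ _ _ _) _; apply: le_trans (Wb _ _ t0) _.
  by rewrite ler_piMr ?profile_le1.
- apply: le_trans (le_nrm _ _ _ _) _; apply: le_trans (Wb _ _ t0) _.
  by rewrite ler_piMr ?profile_le1.
Qed.

Lemma conv2B_le W' W b' b t x : dominated W' b' -> dominated W b ->
  close W' W b' b -> 0 <= t -> (fg_conv b' b' x < +oo)%E ->
  ((\sum_(p : I * I) `|conv2 (W' p.1 t) (W' p.2 t) x - conv2 (W p.1 t) (W p.2 t) x|)%:E <=
   \int[mu]_y ((b' (sub x y) * b' y - b (sub x y) * b y) *
     profile nu0 (mmax x y) t)%:E)%E.
Proof.
move=> dW' dW [bb' WW'] t0 b'oo.
have [mW' mb' b'0 Wb'] := dW'; have [mW mb b0 Wb] := dW.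
have boo : (fg_conv b b x < +oo)%E.
  apply: le_lt_trans b'oo; apply: ge0_le_integral_nomeas => y _; rewrite lee_fin.
    exact: mulr_ge0.
  exact: ler_pM.
have mp (j k : I) V : (forall i, jointly (V i)) -> measurable_fun setT (fun y => V j t (sub x y) * V k t y).
  move=> mV; apply: measurable_funM; last exact: jointlyl.
  by apply: measurableT_comp; [exact: jointlyl|exact: measurable_fg_subl].
rewrite -sumEFin.
apply: (@le_trans _ _ (\sum_(p : I * I) \int[mu]_y
    (`|W' p.1 t (sub x y) * W' p.2 t y - W p.1 t (sub x y) * W p.2 t y|)%:E)%E).
  apply: lee_sum => p _; rewrite /conv2 -RintegralB//; first last.
  - exact: integrable_conv2 dW _ _.
  - exact: integrable_conv2 dW' _ _.
  by apply: normr_Rintegral_le => //; apply: measurable_funB; exact: mp.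
rewrite -ge0_integral_sum//; last first.
  by move=> p; apply/measurable_EFinP; apply: measurableT_comp => //; apply: measurable_funB; exact: mp.
apply: ge0_le_integral_nomeas => y _; first by rewrite sumEFin lee_fin; exact: sumr_ge0.
rewrite sumEFin lee_fin.
apply: (@le_trans _ _ ((b' (sub x y) * h (sub x y) t) * (b' y * h y t)
   - (b (sub x y) * h (sub x y) t) * (b y * h y t))).
  apply: (@sum_mulB_le (fun i => W i t (sub x y)) (fun i => W' i t (sub x y))
    (fun i => W i t y) (fun i => W' i t y)).
  - exact: Wb.
  - by rewrite -mulrBl; exact: WW'.
  - exact: Wb'.
  - by rewrite -mulrBl; exact: WW'.
rewrite (_ : _ - _ = (b' (sub x y) * b' y - b (sub x y) * b y) *
  (h (sub x y) t * h y t)); last by ring.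
apply: ler_wpM2l; first by rewrite subr_ge0; apply: ler_pM.
by apply: profileM_le => //; exact: fg_mod_ge0.
Qed.

Lemma sourceB_le W' W b' b i t x : dominated W' b' -> dominated W b ->
  close W' W b' b -> 0 <= t -> (fg_conv b' b' x < +oo)%E ->
  ((`|source L W' i t x - source L W i t x|)%:E <=
   \int[mu]_y ((b' (sub x y) * b' y - b (sub x y) * b y) *
     (c0 * fg_mod x * profile nu0 (mmax x y) t))%:E)%E.
Proof.
move=> dW' dW cWW' t0 b'oo; have [Lsub Lle _] := qL.
have [mW' mb' b'0 _] := dW'; have [mW mb b0 _] := dW; have [bb' _] := cWW'.
rewrite /source -Lsub; apply: le_trans (_ : (_ : R)%:E <= _)%E.
  by rewrite lee_fin; exact: Lle.
rewrite EFinM.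
apply: le_trans (lee_wpmul2l _ (conv2B_le dW' dW cWW' t0 b'oo)) _.
  by rewrite lee_fin mulr_ge0 ?fg_mod_ge0.
rewrite -ge0_integralZl//; last 3 first.
- apply/measurable_EFinP; apply: measurable_funM.
    apply: measurable_funB; apply: measurable_funM => //;
      by apply: measurableT_comp; [|exact: measurable_fg_subl].
  apply: (measurableT_comp (measurable_profile2 nu0 (measurable_mmax x)) (g := pair (t : measurableTypeR R))).
  exact: measurable_pair1.
- move=> y _; rewrite lee_fin; apply: mulr_ge0; last exact: profile_ge0.
  by rewrite subr_ge0; apply: ler_pM.
- by rewrite lee_fin mulr_ge0 ?fg_mod_ge0.
apply: ge0_le_integral_nomeas => y _; rewrite -EFinM lee_fin; last by lra.
apply: mulr_ge0; first by rewrite mulr_ge0 ?fg_mod_ge0.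
apply: mulr_ge0; last exact: profile_ge0.
by rewrite subr_ge0; apply: ler_pM.
Qed.

Lemma dominated0 : dominated (fun _ _ _ => 0) (fun=> 0).
Proof.
split => //.
- by move=> i; exact: measurable_cst.
- by move=> t x _; rewrite /nrm big1 ?mul0r// => i _; rewrite normr0.
Qed.

(** Bounds on a single source are difference bounds against the zero field. *)
Lemma close0 W b : dominated W b -> close W (fun _ _ _ => 0) b (fun=> 0).
Proof.
move=> [_ _ b0 Wb]; split => // t x t0.
by rewrite /nrm; under eq_bigr do rewrite subr0; rewrite subr0; exact: Wb.
Qed.

Lemma source0 i t x : source L (fun _ _ _ => 0) i t x = 0.
Proof.
have [Lsub _ _] := qL; rewrite /source.
have := Lsub i x (fun _ _ => 0) (fun _ _ => 0); rewrite subrr.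
set u := conv2 _ _ x; have -> : u = 0.
  by rewrite /u /conv2; under eq_Rintegral do rewrite mul0r; rewrite /Rintegral integral0.
by move=> ->; rewrite subrr.
Qed.

Lemma integrable_source W b i t x : dominated W b -> 0 <= t ->
  (fg_conv b b x < +oo)%E -> (Jform b x < +oo)%E ->
  leb.-integrable `[0, t] (fun tau => (heatk (nu i) (t - tau) x * source L W i tau x)%:E).
Proof.
move=> dW t0 boo Joo; have [mW mb b0 Wb] := dW.
have := @duhamel_term_le R G nu0 nu0_gt0 (nu i) c0 (source L W i)
  (fun y => b (sub x y) * b y) x t (nu_ge i) c0_ge0 (jointly_source i mW).
case => //.
- apply: measurable_funM => //.
  by apply: measurableT_comp => //; exact: measurable_fg_subl.
- by move=> y; exact: mulr_ge0.
- move=> tau tau0; have := sourceB_le i dW dominated0 (close0 dW) tau0 boo.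
  rewrite source0 subr0 => H; apply: le_trans H _.
  rewrite le_eqVlt; apply/orP; left; apply/eqP; apply: eq_integral => y _.
  by rewrite mulr0 subr0.
Qed.

(** The factor in front of J b' - J b is the constant C of the scalar equation: |I| equations, c0
    from the multiplier and 64 / nu0 from the time integral. *)
Lemma duhamelB_le W' W b' b t x : dominated W' b' -> dominated W b ->
  close W' W b' b -> 0 <= t -> (fg_conv b' b' x < +oo)%E -> (Jform b' x < +oo)%E ->
  \sum_i `|duhamel_term (nu i) (source L W' i) t x - duhamel_term (nu i) (source L W i) t x|
   <= #|I|%:R * (c0 * (64 / nu0)) * (fine (Jform b' x) - fine (Jform b x)) * h x t.
Proof.
move=> dW' dW cWW' t0 b'oo J'oo.
have [mW' mb' b'0 Wb'] := dW'; have [mW mb b0 Wb] := dW; have [bb' WW'] := cWW'.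
have mbb (f : G -> R) : measurable_fun setT f -> measurable_fun setT (fun y => f (sub x y) * f y).
  by move=> mf; apply: measurable_funM => //; apply: measurableT_comp => //; exact: measurable_fg_subl.
have boo : (fg_conv b b x < +oo)%E.
  apply: le_lt_trans b'oo; apply: ge0_le_integral_nomeas => y _; rewrite lee_fin.
    exact: mulr_ge0.
  exact: ler_pM.
have Joo : (Jform b x < +oo)%E.
  by apply: le_lt_trans J'oo; apply: le_Jform => //; exact: aeW.
pose w y := b' (sub x y) * b' y - b (sub x y) * b y.
have mw : measurable_fun setT w by apply: measurable_funB; exact: mbb.
have w0 y : 0 <= w y by rewrite subr_ge0; apply: ler_pM.
have mkw : measurable_fun setT (fun y => kappa x y * w y).
  apply: measurable_funM => //.
  by apply: (measurableT_comp (@measurable_kappa R G) (g := pair x)); exact: measurable_pair1.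
have JE : (Jform b' x = \int[mu]_y (kappa x y * w y)%:E + Jform b x)%E.
  rewrite -ge0_integralD//; last 4 first.
  - by move=> y _; rewrite lee_fin mulr_ge0 ?kappa_ge0.
  - exact/measurable_EFinP.
  - by move=> y _; rewrite lee_fin mulr_ge0 ?kappa_ge0// mulr_ge0.
  - by apply/measurable_EFinP; exact: measurable_kappa_conv.
  by apply: eq_integral => y _; rewrite -EFinD; congr EFin; rewrite /w; ring.
have Jw0 : (0 <= \int[mu]_y (kappa x y * w y)%:E)%E.
  by apply: integral_ge0 => y _; rewrite lee_fin mulr_ge0 ?kappa_ge0.
have Jw : (\int[mu]_y (kappa x y * w y)%:E < +oo)%E.
  by apply: le_lt_trans J'oo; rewrite JE leeDl// Jform_ge0.
have fE : fine (\int[mu]_y (kappa x y * w y)%:E) = fine (Jform b' x) - fine (Jform b x).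
  have f1 : (\int[mu]_y (kappa x y * w y)%:E)%E \is a fin_num by rewrite ge0_fin_numE.
  have f2 : Jform b x \is a fin_num by rewrite ge0_fin_numE// Jform_ge0.
  by rewrite JE (fineD f1 f2) addrK.
apply: (@le_trans _ _ (\sum_(i in I) (c0 * (64 / nu0) * (fine (Jform b' x) - fine (Jform b x)) * h x t))); last first.
  by rewrite sumr_const -[leLHS]mulr_natl !mulrA.
apply: ler_sum => i _.
have mS : jointly (fun tau x => source L W' i tau x - source L W i tau x).
  by apply: measurable_funB; exact: jointly_source.
rewrite -fE.
have -> : duhamel_term (nu i) (source L W' i) t x - duhamel_term (nu i) (source L W i) t x
   = duhamel_term (nu i) (fun tau x => source L W' i tau x - source L W i tau x) t x.
  rewrite /duhamel_term -RintegralB//; last 2 first.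
  - exact: integrable_source dW' _ _ _.
  - exact: integrable_source dW _ _ _.
  by apply: eq_Rintegral => tau _; rewrite mulrBr.
have := @duhamel_term_le R G nu0 nu0_gt0 (nu i) c0 _ w x t (nu_ge i) c0_ge0 mS mw w0 t0.
case => // tau tau0; exact: sourceB_le.
Qed.

End estimates.
End quadratic_system.

Lemma cvg_sumr (R : realType) (I : finType) (u : I -> R^nat) (l : I -> R) :
  (forall i, u i n @[n --> \oo] --> l i) -> \sum_i u i n @[n --> \oo] --> \sum_i l i.
Proof.
move=> ul; elim: (index_enum I) => [|i s IH].
  by rewrite big_nil; under eq_fun do rewrite big_nil; exact: cvg_cst.
by rewrite big_cons; under eq_fun do rewrite big_cons; exact: cvgD.
Qed.

(** * Picard iteration below the majorant *)

Section picard.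
Context (R : realType) (G : freq_group R) (I : finType).
Local Notation mu := (fg_measure G).
Local Notation leb := (@lebesgue_measure R).
Local Notation sub := (@fg_sub R G).
Variables (nu0 c0 : R) (nu : I -> R) (L : I -> G -> (I -> I -> R) -> R).
Variables (W0 : I -> G -> R) (e0 : G -> R).
Hypotheses (nu0_gt0 : 0 < nu0) (nu_ge : forall i, nu0 <= nu i).
Hypotheses (c0_ge0 : 0 <= c0) (qL : quadratic_multiplier c0 L).
Hypotheses (mW0 : forall i, measurable_fun setT (W0 i)).
Hypothesis W0_le : forall x, 4 * (\sum_i `|W0 i x|) <= e0 x.
Local Notation h := (fun x t => profile nu0 (fg_mod x) t).

(** Origin of the 4 in [W0_le]: from 1 + s/2 <= e^{s/2} follows (1 + s)^2 <= (2 e^{s/2})^2 = 4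
    e^s. *)
Lemma heatk_le_profile nu' t (x : G) : nu0 <= nu' -> 0 <= t ->
  heatk nu' t x <= 4 * h x t.
Proof.
move=> nn t0; pose s := nu0 * fg_mod x ^+ 2 * t.
have s0 : 0 <= s by apply: mulr_ge0 => //; apply: mulr_ge0; [exact: ltW|exact: sqr_ge0].
apply: (@le_trans _ _ (expR (- s))).
  rewrite ler_expR lerN2 /s mulrAC ler_wpM2r ?sqr_ge0//.
  by rewrite ler_wpM2r.
have e1 : 1 + s / 2 <= expR (s / 2) by exact: expR_ge1Dx.
have e2 : (1 + s) ^+ 2 <= 4 * expR s.
  have -> : expR s = expR (s / 2) ^+ 2 by rewrite -expRM_natl; congr expR; field.
  have -> : 4 * expR (s / 2) ^+ 2 = (2 * expR (s / 2)) ^+ 2 by ring.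
  by rewrite lerXn2r ?nnegrE; lra.
rewrite expRN /profile -/s exprVn.
have s1 : 0 < (1 + s) ^+ 2 by apply: exprn_gt0; lra.
by rewrite ler_pdivlMr// mulrC ler_pdivrMr ?expR_gt0.
Qed.

(** The cut-offs at t < 0 and outside [D] make each iterate a total, jointly measurable function
    that vanishes where the majorant does. *)
Definition picard_step (D : set G) (W : I -> R -> G -> R) (i : I) (t : R) (x : G) : R :=
  \1_(`[0, +oo[%classic) t *
  (\1_D x * (heatk (nu i) t x * W0 i x + duhamel_term (nu i) (source L W i) t x)).

Fixpoint picard D n : I -> R -> G -> R :=
  if n is n'.+1 then picard_step D (picard D n') else fun _ _ _ => 0.

Lemma jointly_picard_step D W : measurable D -> (forall i, jointly (W i)) ->
  forall i, jointly (picard_step D W i).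
Proof.
move=> mD mW i; apply: measurable_funM.
  by apply: measurableT_comp => //; exact: measurable_indic.
apply: measurable_funM.
  by apply: measurableT_comp => //; exact: measurable_indic.
apply: measurable_funD.
  apply: measurable_funM; first exact: jointly_heatk.
  exact: measurableT_comp.
by apply: jointly_duhamel_term; exact: (jointly_source qL).
Qed.

Local Notation C := (#|I|%:R * (c0 * (64 / nu0))).
Variables (a_ : (G -> R)^nat) (a : G -> R) (D : set G).
Hypotheses (mD : measurable D) (ma_ : forall n, measurable_fun setT (a_ n))
  (ma : measurable_fun setT a) (a_00 : forall x, a_ 0%N x = 0)
  (a_ge0 : forall n x, 0 <= a_ n x) (a_S : forall n x, a_ n x <= a_ n.+1 x)
  (a_cvg : forall x, a_ n x @[n --> \oo] --> a x) (aND : forall x, ~ D x -> a x = 0)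
  (a_JE : forall n x, D x -> ((a_ n.+1 x)%:E = (e0 x)%:E + C%:E * Jform (a_ n) x)%E)
  (aJE : forall x, D x -> ((a x)%:E = (e0 x)%:E + C%:E * Jform a x)%E)
  (a_conv : forall x, D x -> (fg_conv a a x < +oo)%E)
  (aJoo : forall x, D x -> (Jform a x < +oo)%E).
Local Notation W_ := (picard D).

Let a_nd x : {homo a_^~ x : n m / (n <= m)%N >-> n <= m}.
Proof. by apply: homo_leq => [//|? ? ?|n]; [exact: le_trans|exact: a_S]. Qed.

Let a_le n x : a_ n x <= a x.
Proof. exact: (nondecreasing_cvg_ge (a_nd x) (@a_cvg x) n). Qed.

Let a0 x : 0 <= a x. Proof. exact: le_trans (a_ge0 0%N x) (a_le 0%N x). Qed.

Let a_0ND n x : ~ D x -> a_ n x = 0.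
Proof. by move=> Dx; apply/eqP; rewrite eq_le a_ge0 -(aND Dx) a_le. Qed.

Let convn n x : D x -> (fg_conv (a_ n) (a_ n) x < +oo)%E.
Proof.
move=> Dx; apply: le_lt_trans (a_conv Dx).
apply: ge0_le_integral_nomeas => y _; rewrite lee_fin; first exact: mulr_ge0.
exact: ler_pM.
Qed.

Let Jn n x : D x -> (Jform (a_ n) x < +oo)%E.
Proof.
move=> Dx; apply: le_lt_trans (aJoo Dx); apply: le_Jform => //.
exact: aeW.
Qed.

Let a_E n x : D x -> a_ n.+1 x = e0 x + C * fine (Jform (a_ n) x).
Proof.
move=> Dx; have := a_JE n Dx.
by rewrite -[X in (_ * X)%E]fineK ?ge0_fin_numE ?Jform_ge0 ?Jn// -EFinM -EFinD => -[].
Qed.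

Let aE x : D x -> a x = e0 x + C * fine (Jform a x).
Proof.
move=> Dx; have := aJE Dx.
by rewrite -[X in (_ * X)%E]fineK ?ge0_fin_numE ?Jform_ge0 ?aJoo// -EFinM -EFinD => -[].
Qed.

Let step_in W i t x : 0 <= t -> D x -> picard_step D W i t x =
  heatk (nu i) t x * W0 i x + duhamel_term (nu i) (source L W i) t x.
Proof. by move=> t0 Dx; rewrite /picard_step !indic_in ?mul1r//= in_itv/= t0. Qed.

Let step_out W i t x : ~ D x -> picard_step D W i t x = 0.
Proof. by move=> Dx; rewrite /picard_step (indic_notin _ Dx) mul0r mulr0. Qed.

(** The two claims feed each other. Domination of W_n plus closeness of W_{n+1} dominates W_{n+1};
    [duhamelB_le] then bounds the next increment, since a_{n+2} - a_{n+1} = C (J a_{n+1} - J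
    a_n). *)
Lemma picard_close n : dominated nu0 (W_ n) (a_ n) /\
  close nu0 (W_ n.+1) (W_ n) (a_ n.+1) (a_ n).
Proof.
have dS m : dominated nu0 (W_ m) (a_ m) -> close nu0 (W_ m.+1) (W_ m) (a_ m.+1) (a_ m) ->
    dominated nu0 (W_ m.+1) (a_ m.+1).
  move=> [mW _ _ Wa] [_ WW]; split => //.
  - exact: jointly_picard_step.
  - move=> t x t0; have h1 := Wa _ x t0; have h2 := WW _ x t0.
    apply: (@le_trans _ _ (nrm (W_ m) t x + nrm (fun i t x => W_ m.+1 i t x - W_ m i t x) t x)).
      rewrite /nrm -big_split/=; apply: ler_sum => i _.
      by rewrite -[X in `|X| <= _](addrNK (W_ m i t x)) addrC ler_normD.
    lra.
elim: n => [|n [dn cn]].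
  split.
    have [? ? ? ?] := @dominated0 R G I nu0; split => //.
    by move=> t x t0; rewrite a_00; rewrite /nrm big1 ?mul0r// => i _; rewrite normr0.
  split => [x|t x t0]; first exact: a_S.
  rewrite a_00 subr0.
  have [Dx|Dx] := pselect (D x); last first.
    rewrite a_0ND// mul0r /nrm big1// => i _.
    by rewrite [W_ 1]/= step_out// subr0 normr0.
  rewrite a_E// (_ : a_ 0%N = fun=> 0); last by apply/funext.
  have -> : Jform (fun=> 0) x = 0%E :> \bar R.
    by rewrite /Jform; under eq_integral do rewrite !mulr0; rewrite integral0.
  rewrite mulr0 addr0; apply: le_trans (ler_wpM2r (profile_ge0 _ _ _) (W0_le x)).
  rewrite -mulrA mulrCA mulr_suml; apply: ler_sum => i _.
  rewrite subr0 [W_ 1]/= step_in//.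
  have -> : duhamel_term (nu i) (source L (fun _ _ _ => 0) i) t x = 0.
    rewrite /duhamel_term; under eq_Rintegral do rewrite (source0 qL) mulr0.
    by rewrite /Rintegral integral0.
  rewrite addr0 normrM mulrC ler_wpM2l// ger0_norm ?expR_ge0//.
  exact: heatk_le_profile.
have dn1 := dS _ dn cn; split => //; split => [x|t x t0]; first exact: a_S.
have [Dx|Dx] := pselect (D x); last first.
  rewrite !a_0ND// subr0 mul0r /nrm big1// => i _.
  by rewrite [W_ n.+2]/= [W_ n.+1]/= !step_out// subr0 normr0.
rewrite !a_E// opprD addrACA subrr add0r -mulrBr.
apply: le_trans (duhamelB_le nu0_gt0 nu_ge c0_ge0 qL dn1 dn cn t0 (convn _ Dx) (Jn _ Dx)).
apply: ler_sum => i _.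
rewrite (_ : W_ n.+2 i t x = picard_step D (W_ n.+1) i t x)//.
rewrite [X in `|_ - X| <= _](_ : _ = picard_step D (W_ n) i t x)// !step_in//.
by rewrite opprD addrACA subrr add0r.
Qed.

Let W_diff n m t x : 0 <= t ->
  nrm (fun i t x => W_ (n + m)%N i t x - W_ n i t x) t x <= (a_ (n + m)%N x - a_ n x) * h x t.
Proof.
move=> t0; elim: m => [|m IH].
  by rewrite addn0 subrr mul0r /nrm big1// => j _; rewrite subrr normr0.
have [_ [_ /(_ _ x t0) H]] := picard_close (n + m)%N.
apply: (@le_trans _ _ (nrm (fun i t x => W_ (n + m).+1 i t x - W_ (n + m)%N i t x) t x
   + nrm (fun i t x => W_ (n + m)%N i t x - W_ n i t x) t x)).
  rewrite /nrm -big_split/=; apply: ler_sum => j _; rewrite addnS.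
  rewrite [X in `|X| <= _](_ : _ = (W_ (n + m).+1 j t x - W_ (n + m)%N j t x) +
    (W_ (n + m)%N j t x - W_ n j t x)); last by ring.
  exact: ler_normD.
rewrite addnS; lra.
Qed.

Let W_cvg i t x : 0 <= t -> cvgn (fun n => W_ n i t x).
Proof.
move=> t0.
have cva : cvgn (fun n => a_ n x * h x t).
  by apply: is_cvgM; [exact: cvgP (@a_cvg x)|exact: is_cvg_cst].
have H n : `|W_ n.+1 i t x - W_ n i t x| <= (a_ n.+1 x - a_ n x) * h x t.
  have [_ [_ /(_ _ x t0)]] := picard_close n; apply: le_trans.
  exact: (le_nrm (fun i t x => W_ n.+1 i t x - W_ n i t x)).
(* The increment bound says precisely that W_n + a_n h is nondecreasing in n. It is bounded, so it
   converges, and so does W_n after subtraction of a_n h. *)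
have : cvgn (fun n => W_ n i t x + a_ n x * h x t).
  apply: nondecreasing_is_cvgn.
    apply: homo_leq => [//|? ? ?|n]; first exact: le_trans.
    by have := H n; rewrite ler_norml => /andP[+ _]; lra.
  exists (2 * a x) => _ [n _ <-].
  have [[_ _ _ /(_ _ x t0) Wa] _] := picard_close n.
  have h1 := le_trans (ler_norm _) (le_trans (le_nrm (W_ n) i t x) Wa).
  have h2 : a_ n x * h x t <= a x.
    by rewrite -[leRHS]mulr1; apply: ler_pM; rewrite ?profile_ge0 ?profile_le1.
  lra.
move=> cvs; rewrite (_ : (fun n => _) = fun n => (W_ n i t x + a_ n x * h x t) - a_ n x * h x t).
  exact: is_cvgB.
by apply/funext => n; rewrite addrK.
Qed.

Definition picard_lim i t x : R := \1_(`[0, +oo[%classic) t * limn (fun n => W_ n i t x).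

Let W_neg n i t x : t < 0 -> W_ n i t x = 0.
Proof.
case: n => [//|n] t0; rewrite /= /picard_step indic_notin ?mul0r//= in_itv/= andbT.
by rewrite leNgt t0.
Qed.

Let lim_cvg i t x : W_ n i t x @[n --> \oo] --> picard_lim i t x.
Proof.
have [t0|t0] := leP 0 t.
  by rewrite /picard_lim indic_in ?mul1r; [exact: W_cvg|rewrite /= in_itv/= t0].
rewrite /picard_lim indic_notin ?mul0r; last by rewrite /= in_itv/= andbT leNgt t0.
by under eq_fun do rewrite W_neg//; exact: cvg_cst.
Qed.

Lemma jointly_picard_lim i : jointly (picard_lim i).
Proof.
apply: (measurable_fun_cvg (h := fun n z => W_ n i z.1 z.2)).
  by move=> n; have [[mW _ _ _] _] := picard_close n; exact: mW.
by move=> z _; exact: lim_cvg.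
Qed.

Lemma picard_lim_close n : close nu0 picard_lim (W_ n) a (a_ n).
Proof.
split=> [//|t x t0].
have cv : nrm (fun i t x => W_ (n + m)%N i t x - W_ n i t x) t x @[m --> \oo] -->
    nrm (fun i t x => picard_lim i t x - W_ n i t x) t x.
  rewrite /nrm; apply: cvg_sumr => i.
  apply: cvg_norm; apply: cvgB; last exact: cvg_cst.
  have := @lim_cvg i t x; rewrite -(cvg_shiftn n (fun m => W_ m i t x)).
  by under eq_fun do rewrite addnC.
apply: (cvg_le_cst cv) => m; apply: le_trans; first exact: W_diff.
by rewrite ler_wpM2r ?profile_ge0// lerB.
Qed.

Lemma picard_lim_dominated : dominated nu0 picard_lim a.
Proof.
split => //; first exact: jointly_picard_lim.
move=> t x t0; have [_ /(_ t x t0)] := picard_lim_close 0%N.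
rewrite a_00 subr0 (_ : (fun i t x => _) = picard_lim)//.
by apply/funext => i; apply/funext => s; apply/funext => y; rewrite subr0.
Qed.

Lemma picard_lim_solves i t x : D x -> 0 <= t -> solves nu L W0 picard_lim i t x.
Proof.
move=> Dx t0; split.
  exact: (integrable_source nu0_gt0 nu_ge c0_ge0 qL i picard_lim_dominated t0 (a_conv Dx) (aJoo Dx)).
apply/eqP; rewrite -subr_eq0 -normr_le0.
(* The defect of the equation is bounded for every n by two terms, the distance of the limit to
   W_{n+1} and that of the two Duhamel terms, each at most a - a_{n+1}. *)
have cv : 2 * (a x - a_ n.+1 x) @[n --> \oo] --> (2 * (a x - a x) : R).
  apply: cvgM; first exact: cvg_cst; apply: cvgB; first exact: cvg_cst.
  by rewrite (cvg_shiftS (a_^~ x)); exact: (@a_cvg x).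
rewrite subrr mulr0 in cv; apply: (cvg_ge_cst cv) => n.
have [dn _] := picard_close n.
have [_ /(_ t x t0) h1] := picard_lim_close n.+1.
have h2 := duhamelB_le nu0_gt0 nu_ge c0_ge0 qL picard_lim_dominated dn
  (picard_lim_close n) t0 (a_conv Dx) (aJoo Dx).
have h3 : C * (fine (Jform a x) - fine (Jform (a_ n) x)) = a x - a_ n.+1 x.
  by rewrite a_E// aE//; ring.
rewrite h3 in h2.
have h4 : (a x - a_ n.+1 x) * h x t <= a x - a_ n.+1 x.
  by rewrite ler_piMr ?profile_le1// subr_ge0.
set S := picard_lim i t x; set B := duhamel_term _ _ _ _ in h2 *.
have h5 := le_nrm (fun i t x => picard_lim i t x - W_ n.+1 i t x) i t x.
have h6 : `|duhamel_term (nu i) (source L picard_lim i) t x - duhamel_term (nu i) (source L (W_ n) i) t x|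
   <= a x - a_ n.+1 x.
  apply: le_trans _ (le_trans h2 h4).
  by rewrite (bigD1 i)//= lerDl sumr_ge0.
rewrite [W_ n.+1]/= step_in// in h5.
rewrite /S /B.
have aux (s u v v' : R) : s - (u + v) = (s - (u + v')) - (v - v') by ring.
rewrite (aux _ _ _ (duhamel_term (nu i) (source L (W_ n) i) t x)).
apply: le_trans (ler_normB _ _) _.
have := le_trans h5 (le_trans h1 h4); rewrite /=; lra.
Qed.

Section symmetry.
Variables (neg : G -> G) (sg : I -> R).
Hypotheses (mneg : measurable_fun setT neg)
  (neg_int : forall f : G -> \bar R, measurable_fun setT f -> (forall y, 0 <= f y)%E ->
    (\int[mu]_y f (neg y) = \int[mu]_y f y)%E)
  (neg_sub : forall x y, sub (neg x) (neg y) = neg (sub x y))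
  (neg_mod : forall x, fg_mod (neg x) = fg_mod x :> R)
  (L_neg : forall i x c, L i (neg x) (fun j k => sg j * sg k * c j k) = sg i * L i x c)
  (W0_neg : forall i, \forall x \ae mu, W0 i (neg x) = sg i * W0 i x)
  (aeD : \forall x \ae mu, D x).

Let conv2_neg W b t x j k : dominated nu0 W b -> 0 <= t -> (fg_conv b b x < +oo)%E ->
  (forall i, \forall y \ae mu, W i t (neg y) = sg i * W i t y) ->
  conv2 (W j t) (W k t) (neg x) = sg j * sg k * conv2 (W j t) (W k t) x.
Proof.
move=> dW t0 boo symW; have [mW _ _ _] := dW.
have mF y : measurable_fun setT (fun z => W j t (sub y z) * W k t z).
  apply: measurable_funM; last exact: jointlyl.
  by apply: measurableT_comp; [exact: jointlyl|exact: measurable_fg_subl].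
rewrite /conv2 -RintegralZl//; last exact: (integrable_conv2 nu0_gt0 j k dW t0 boo).
rewrite -(Rintegral_comp neg_int (mF (neg x))).
apply: ae_eq_Rintegral.
- exact: (measurableT_comp (mF (neg x)) mneg).
- exact: measurable_funM.
- apply: filterS2 (ae_fg_subl x (symW j)) (symW k) => y h1 h2.
  by rewrite neg_sub h1 h2; ring.
Qed.

(** The parity is proved on the iterates, since the equation determines them explicitly. It holds
    almost everywhere in xi, because neither the data nor [D] need be symmetric exactly. *)
Let picard_neg n i t : 0 <= t ->
  \forall x \ae mu, W_ n i t (neg x) = sg i * W_ n i t x.
Proof.
elim: n i t => [|n IH] i t t0; first by apply: aeW => x; rewrite mulr0.
have aeDn := ae_preserving mneg neg_int aeD.
apply: filterS3 aeD aeDn (W0_neg i) => x Dx Dnx W0x.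
have [dn _] := picard_close n; have [mW _ _ _] := dn.
rewrite (_ : W_ n.+1 i t (neg x) = picard_step D (W_ n) i t (neg x))//.
rewrite (_ : W_ n.+1 i t x = picard_step D (W_ n) i t x)// !step_in//.
rewrite mulrDr W0x; congr (_ + _); first by rewrite /heatk neg_mod [RHS]mulrCA.
rewrite /duhamel_term -RintegralZl//; last first.
  exact: (integrable_source nu0_gt0 nu_ge c0_ge0 qL i dn t0 (convn _ Dx) (Jn _ Dx)).
apply: eq_Rintegral => tau; rewrite inE/= in_itv/= => /andP[tau0 _].
rewrite /heatk neg_mod [RHS]mulrCA; congr (_ * _).
rewrite /source -L_neg; congr (L i (neg x) _).
apply/funext => j; apply/funext => k.
rewrite (conv2_neg j k dn tau0 (convn _ Dx)) => [|l]; last exact: IH.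
by [].
Qed.

Lemma picard_lim_neg i t : 0 <= t ->
  \forall x \ae mu, picard_lim i t (neg x) = sg i * picard_lim i t x.
Proof.
move=> t0; have H : \forall x \ae mu, forall n, W_ n i t (neg x) = sg i * W_ n i t x.
  by apply: ae_foralln => n; exact: picard_neg.
apply: filterS H => x Wx.
have c1 := @lim_cvg i t (neg x).
have c2 : W_ n i t (neg x) @[n --> \oo] --> sg i * picard_lim i t x.
  by under eq_fun do rewrite Wx; apply: cvgM; [exact: cvg_cst|exact: lim_cvg].
exact: (cvg_unique _ c1 c2).
Qed.

End symmetry.
End picard.

(** * Quadratic systems: uniqueness *)

Lemma integral_expR_tail (R : realType) (b c s : R) : 0 < c ->
  (\int[@lebesgue_measure R]_(t in `[s, +oo[) (expR (b + - c * t))%:E =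
    (expR (b + - c * s) / c)%:E)%E.
Proof.
move=> c0; pose F (t : R) := - c^-1 * expR (b + - c * t).
have dF (x : R) : is_derive x (1 : R) F (expR (b + - c * x)).
  have H := @is_deriveZ _ _ _ _ (- c^-1) _ _ _ (is_derive_expR_linear b (- c) x).
  by apply: (is_derive_eq H); rewrite /GRing.scale/=; field; rewrite gt_eqF.
have cE : continuous (fun x : R => expR (b + - c * x)).
  move=> x; apply: continuous_comp; last exact: continuous_expR.
  by apply: cvgD; [exact: cvg_cst|apply: cvgM; [exact: cvg_cst|exact: cvg_id]].
rewrite (@ge0_continuous_FTC2y _ _ F _ 0).
- by rewrite -EFinB; congr EFin; rewrite /F sub0r mulNr opprK mulrC.
- by move=> x _; exact: expR_ge0.
- exact: continuous_subspaceT.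
- rewrite /F; rewrite [X in _ --> X](_ : 0 = - c^-1 * 0); last by rewrite mulr0.
  apply: cvgM; first exact: cvg_cst.
  rewrite (_ : (fun x => expR (b + - c * x)) = (fun y => expR (- y)) \o (fun x => c * x - b)); last first.
    by apply/funext => x /=; congr expR; ring.
  apply: cvg_comp; last exact: cvgr_expR.
  apply: (cvg_comp (fun x => c * x) (fun y => y - b)); last exact: cvg_addrr.
  by apply: gt0_cvgMry => //; exact: cvg_id.
- by move=> x _; case: (dF x).
- apply: cvg_at_right_filter; apply: differentiable_continuous.
  by apply/derivable1_diffP; case: (dF s).
- by move=> x _; rewrite derive1E; have [_ ->] := dF x.
Qed.

(** * A Gronwall inequality with a lost derivative *)

Section gronwall.
Context (R : realType) (G : freq_group R).
Local Notation mu := (fg_measure G).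
Local Notation leb := (@lebesgue_measure R).
Variables (nu0 M : R) (v N : R -> G -> R) (K : R -> G -> \bar R).
Hypotheses (nu0_gt0 : 0 < nu0) (M_ge0 : 0 <= M).
Hypotheses (mv : jointly v) (mN : jointly N) (mK : forall t, measurable_fun setT (K t)).
Hypotheses (v0 : forall t x, 0 <= v t x) (N0 : forall t x, 0 <= N t x)
  (K0 : forall t x, (0 <= K t x)%E).
Hypothesis v_le : forall t, 0 <= t -> \forall x \ae mu,
  ((v t x)%:E <= \int[leb]_(tau in `[0%R, t]) (heatk nu0 (t - tau) x * N tau x)%:E)%E.
Hypothesis N_le : \forall t \ae leb, 0 <= t -> \forall x \ae mu,
  ((N t x)%:E <= (fg_mod x)%:E * K t x)%E.
Hypothesis K_le : \forall t \ae leb, 0 <= t ->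
  (\int[mu]_x K t x <= M%:E * \int[mu]_x (v t x)%:E)%E.
Hypothesis v_bounded : \forall t \ae leb, 0 <= t -> (\int[mu]_x (v t x)%:E <= M%:E)%E.

(** The contraction factor will be M / (2 s), at most 1/2; the summand 1 keeps s positive when M =
    0. *)
Let s : R := M + 1.
(* Chosen so that [2 s |xi| <= lam + nu0 |xi|^2]: integrated in time against the
   weight e^{-lam t}, the Duhamel inequality becomes a contraction by 1/2. *)
Let lam : R := s ^+ 2 / nu0.
Let s_gt0 : 0 < s. Proof. by rewrite /s ltr_wpDl. Qed.
Let lam_gt0 : 0 < lam. Proof. by rewrite divr_gt0// exprn_gt0. Qed.
Let den_gt0 (x : G) : 0 < lam + nu0 * fg_mod x ^+ 2.
Proof. by rewrite ltr_pwDl// mulr_ge0 ?sqr_ge0// ltW. Qed.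

(** Completing the square: lam + nu0 k^2 - 2 s k = (s - nu0 k)^2 / nu0. The left-hand side is k
    times the Laplace transform of the heat factor at lam, so the heat factor pays for the lost
    derivative. *)
Let resolvent_le (x : G) : fg_mod x / (lam + nu0 * fg_mod x ^+ 2) <= (2 * s)^-1.
Proof.
rewrite ler_pdivrMr// mulrC ler_pdivlMr ?mulr_gt0// -subr_ge0.
rewrite (_ : _ - _ = (s - nu0 * fg_mod x) ^+ 2 / nu0).
  by rewrite divr_ge0 ?sqr_ge0// ltW.
by rewrite /lam; field; rewrite gt_eqF.
Qed.

(** The weighted Duhamel integrand on the triangle 0 <= tau <= t, as a function of all three
    variables, so that Tonelli can integrate in t before tau. *)
Let g (z : (measurableTypeR R * G) * measurableTypeR R) : \bar R :=
  (if (0 <= z.2) && (z.2 <= z.1.1) then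
    expR (- (lam * z.1.1)) * (heatk nu0 (z.1.1 - z.2) z.1.2 * N z.2 z.1.2) else 0)%:E.

Let mg : measurable_fun setT g.
Proof.
have m11 : measurable_fun [set: (measurableTypeR R * G) * measurableTypeR R] (fun z => z.1.1).
  exact: measurableT_comp.
have m12 : measurable_fun [set: (measurableTypeR R * G) * measurableTypeR R] (fun z => z.1.2).
  exact: measurableT_comp.
apply/measurable_EFinP; apply: measurable_fun_ifT => //.
  by apply: measurable_and; apply: measurable_fun_ler.
apply: measurable_funM.
  apply: measurableT_comp => //; apply: measurableT_comp => //.
  exact: measurable_funM.
apply: measurable_funM.
  apply: (measurableT_comp (@jointly_heatk R G nu0)
    (g := fun z : (measurableTypeR R * G) * measurableTypeR R =>
      (z.1.1 - z.2 : measurableTypeR R, z.1.2))).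
  by apply: measurable_fun_pair => //; exact: measurable_funB.
apply: (measurableT_comp mN (g := fun z : (measurableTypeR R * G) * measurableTypeR R =>
  (z.2, z.1.2))).
exact: measurable_fun_pair.
Qed.

Let g0 z : (0 <= g z)%E.
Proof. by rewrite /g; case: ifP => // _; rewrite lee_fin !mulr_ge0 ?expR_ge0. Qed.

Let mg1 : measurable_fun setT (fun z => \int[leb]_tau g (z, tau))%E.
Proof. exact: measurable_fun_integral_param. Qed.

Let g_int t x : 0 <= t -> (\int[leb]_tau g ((t, x), tau) = (expR (- (lam * t)))%:E *
  \int[leb]_(tau in `[0%R, t]) (heatk nu0 (t - tau) x * N tau x)%:E)%E.
Proof.
move=> t0; rewrite -ge0_integralZl//; last 2 first.
- apply/measurable_EFinP; apply: measurable_funTS; apply: measurable_funM.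
    apply: (measurableT_comp (jointlyr x (@jointly_heatk R G nu0)) (g := fun u : measurableTypeR R => t - u)).
    exact: measurable_funB.
  exact: jointlyr.
- by move=> tau _; rewrite lee_fin mulr_ge0 ?expR_ge0.
rewrite [RHS]integral_mkcond; apply: eq_integral => tau _; rewrite patchE /g/=.
have -> : (tau \in `[0, t]%classic) = (0 <= tau) && (tau <= t).
  by apply/idP/idP => [/set_mem|h]; rewrite ?inE/= in_itv.
by case: ifP.
Qed.

Let V (z : measurableTypeR R * G) : \bar R :=
  (if 0 <= z.1 then expR (- (lam * z.1)) * v z.1 z.2 else 0)%:E.

Let mV : measurable_fun setT V.
Proof.
apply/measurable_EFinP; apply: measurable_fun_ifT => //.
  by apply: measurable_fun_ler.
apply: measurable_funM => //.
by apply: measurableT_comp => //; apply: measurableT_comp => //; exact: measurable_funM.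
Qed.

Let V0 z : (0 <= V z)%E.
Proof. by rewrite /V; case: ifP => // _; rewrite lee_fin mulr_ge0 ?expR_ge0. Qed.

Let V_int t : 0 <= t -> (\int[mu]_x V (t, x) = (expR (- (lam * t)))%:E * \int[mu]_x (v t x)%:E)%E.
Proof.
move=> t0; rewrite -ge0_integralZl//.
- by apply: eq_integral => x _; rewrite /V/= t0.
- by apply/measurable_EFinP; exact: jointlyl.
- by move=> x _; rewrite lee_fin.
Qed.

Let V_neg t x : t < 0 -> V (t, x) = 0%E.
Proof. by move=> t0; rewrite /V/= leNgt t0. Qed.

Let V_le_g : (\int[leb]_t \int[mu]_x V (t, x) <= \int[leb]_t \int[mu]_x \int[leb]_tau g ((t, x), tau))%E.
Proof.
apply: ge0_le_integral_nomeas => t _; first exact: integral_ge0.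
have [t0|t0] := leP 0 t; last first.
  rewrite integral0_eq//; last by move=> x _; exact: V_neg.
  by apply: integral_ge0 => x _; exact: integral_ge0.
apply: ae_ge0_le_integral => //.
- by apply: (measurableT_comp mV (g := pair (t : measurableTypeR R))); exact: measurable_pair1.
- by move=> x _; exact: integral_ge0.
- by apply: (measurableT_comp mg1 (g := pair (t : measurableTypeR R))); exact: measurable_pair1.
- apply: filterS (v_le t0) => x h _; rewrite g_int// /V/= t0 EFinM.
  by apply: lee_wpmul2l => //; rewrite lee_fin expR_ge0.
Qed.

Let g2 (z : measurableTypeR R * G) : \bar R :=
  (if 0 <= z.1 then expR (- (lam * z.1)) * ((lam + nu0 * fg_mod z.2 ^+ 2)^-1 * N z.1 z.2) else 0)%:E.

Let mg2 : measurable_fun setT g2.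
Proof.
apply/measurable_EFinP; apply: measurable_fun_ifT => //.
  by apply: measurable_fun_ler.
apply: measurable_funM => //.
  by apply: measurableT_comp => //; apply: measurableT_comp => //; exact: measurable_funM.
apply: measurable_funM => //.
apply: measurableT_comp; first exact: measurable_invr.
apply: measurable_funD => //; apply: measurable_funM => //; apply: measurable_funX.
by apply: measurableT_comp => //; exact: measurable_fg_mod.
Qed.

Let g20 z : (0 <= g2 z)%E.
Proof. by rewrite /g2; case: ifP => // _; rewrite lee_fin !mulr_ge0 ?expR_ge0// invr_ge0 ltW. Qed.

(** For fixed tau the integrand is an exponential in t on [tau, oo[ with rate lam + nu0 |x|^2, and
    its integral there is explicit. *)
Let g_int_t tau x : (\int[leb]_t g ((t, x), tau) <= g2 (tau, x))%E.
Proof.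
have [t0|t0] := leP 0 tau; last first.
  by rewrite integral0_eq// => t _; rewrite /g/= leNgt t0.
pose c := lam + nu0 * fg_mod x ^+ 2.
pose b := nu0 * fg_mod x ^+ 2 * tau.
rewrite [leLHS](_ : _ = (\int[leb]_(t in `[tau, +oo[) ((N tau x)%:E * (expR (b + - c * t))%:E))%E); last first.
  rewrite [RHS]integral_mkcond; apply: eq_integral => t _; rewrite patchE /g/= t0/=.
  have -> : (t \in `[tau, +oo[%classic) = (tau <= t).
    by apply/idP/idP => [/set_mem|h]; rewrite ?inE/= in_itv/= andbT.
  case: ifP => // _; rewrite -EFinM mulrA /heatk -expRD mulrC; congr (_ * expR _)%:E.
  by rewrite /b /c; ring.
rewrite ge0_integralZl//; last 2 first.
- apply/measurable_EFinP; apply: measurable_funTS; apply: measurableT_comp => //.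
  by apply: measurable_funD => //; exact: measurable_funM.
- by rewrite lee_fin.
rewrite (integral_expR_tail b tau (den_gt0 x)).
rewrite -EFinM /g2/= t0 lee_fin le_eqVlt; apply/orP; left; apply/eqP.
have -> : b + - (lam + nu0 * fg_mod x ^+ 2) * tau = - (lam * tau) by rewrite /b; ring.
by ring.
Qed.

Let Psi : \bar R := (\int[leb]_t \int[mu]_x V (t, x))%E.

Let Psi_le_g2 : (Psi <= \int[leb]_tau \int[mu]_x g2 (tau, x))%E.
Proof.
apply: le_trans V_le_g _.
rewrite (fubini_tonelli (fun z : measurableTypeR R * G => \int[leb]_tau g (z, tau))%E)//; last first.
  by move=> z; exact: integral_ge0.
rewrite (fubini_tonelli g2)//.
apply: ge0_le_integral_nomeas => x _.
  by apply: integral_ge0 => t _; exact: integral_ge0.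
rewrite (fubini_tonelli (fun z : measurableTypeR R * measurableTypeR R => g ((z.1, x), z.2)))//; last first.
  apply: (measurableT_comp mg (g := fun z : measurableTypeR R * measurableTypeR R => ((z.1, x), z.2))).
  by apply: measurable_fun_pair => //; apply: measurable_fun_pair.
by apply: ge0_le_integral_nomeas => tau _ ; [exact: integral_ge0|exact: g_int_t].
Qed.

(** The source N costs |xi| K; the resolvent turns |xi| into 1 / (2 s), and integrating K costs
    M. *)
Let Psi_half : (Psi <= 2^-1%:E * Psi)%E.
Proof.
apply: le_trans Psi_le_g2 _; rewrite -ge0_integralZl//; last 2 first.
- by apply: measurable_fun_integral_param.
- by move=> t _; exact: integral_ge0.
apply: ae_ge0_le_integral => //.
- by move=> t _; exact: integral_ge0.
- exact: measurable_fun_integral_param.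
- by move=> t _; apply: mule_ge0; [rewrite lee_fin|exact: integral_ge0].
- by apply: measurable_funeM; exact: measurable_fun_integral_param.
apply: filterS2 N_le K_le => t Nt Kt _.
have [t0|t0] := leP 0 t; last first.
  rewrite integral0_eq; last by move=> x _; rewrite /g2/= leNgt t0.
  by apply: mule_ge0; [rewrite lee_fin|exact: integral_ge0].
rewrite V_int//.
apply: (@le_trans _ _ (\int[mu]_x ((expR (- (lam * t)) / (2 * s))%:E * K t x))%E).
  apply: ae_ge0_le_integral => //.
  - by apply: (measurableT_comp mg2 (g := pair (t : measurableTypeR R))); exact: measurable_pair1.
  - by move=> x _; apply: mule_ge0 => //; rewrite lee_fin divr_ge0 ?expR_ge0// ltW// mulr_gt0.
  - exact: measurable_funeM.
  - apply: filterS (Nt t0) => x h _.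
    rewrite /g2/= t0 !EFinM -!muleA; apply: lee_wpmul2l; first by rewrite lee_fin expR_ge0.
    apply: le_trans (lee_wpmul2l _ h) _; first by rewrite lee_fin invr_ge0 ltW.
    rewrite muleA; apply: lee_wpmul2r => //.
    by rewrite -EFinM lee_fin mulrC resolvent_le.
rewrite ge0_integralZl//; last by rewrite lee_fin divr_ge0 ?expR_ge0// ltW// mulr_gt0.
apply: le_trans (lee_wpmul2l _ (Kt t0)) _.
  by rewrite lee_fin divr_ge0 ?expR_ge0// ltW// mulr_gt0.
rewrite !muleA -!EFinM; apply: lee_wpmul2r; first by apply: integral_ge0 => x _; rewrite lee_fin.
rewrite lee_fin [leRHS]mulrC -mulrA; apply: ler_wpM2l; first exact: expR_ge0.
rewrite invfM -mulrA -[leRHS]mulr1; apply: ler_wpM2l => //.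
by rewrite mulrC ler_pdivrMr//; rewrite /s; lra.
Qed.

(** Psi <= Psi / 2 forces Psi = 0 once Psi is finite, which follows from [v_bounded] and the decay
    of the weight. *)
Let Psi0 : Psi = 0%E.
Proof.
have P0 : (0 <= Psi)%E by apply: integral_ge0 => t _; exact: integral_ge0.
have Poo : (Psi < +oo)%E.
  apply: (@le_lt_trans _ _ (\int[leb]_t
      (M%:E * (\1_(`[0, +oo[%classic) t * expR (0 + - lam * t))%:E))%E).
    apply: ae_ge0_le_integral => //.
    - by move=> t _; exact: integral_ge0.
    - exact: measurable_fun_integral_param.
    - by move=> t _; rewrite -EFinM lee_fin mulr_ge0// mulr_ge0 ?expR_ge0.
    - apply: measurable_funeM; apply/measurable_EFinP; apply: measurable_funM => //.
      by apply: measurableT_comp => //; apply: measurable_funD => //; exact: measurable_funM.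
    - apply: filterS v_bounded => t vt _.
      have [t0|t0] := leP 0 t; last first.
        rewrite integral0_eq; last by move=> x _; rewrite V_neg.
        by rewrite -EFinM lee_fin mulr_ge0// mulr_ge0 ?expR_ge0.
      rewrite V_int// indic_in; last by rewrite /= in_itv/= t0.
      rewrite mul1r muleC add0r mulNr; apply: lee_wpmul2r (vt t0).
      by rewrite lee_fin expR_ge0.
  rewrite ge0_integralZl//; last first.
    apply/measurable_EFinP; apply: measurable_funM => //.
    by apply: measurableT_comp => //; apply: measurable_funD => //; exact: measurable_funM.
  rewrite [X in (_ * X)%E](_ : _ = \int[leb]_(t in `[0%R, +oo[) (expR (0 + - lam * t))%:E)%E; last first.
      rewrite [RHS]integral_mkcond; apply: eq_integral => t _; rewrite patchE indicE.
      by case: ifP => _; rewrite ?mul1r ?mul0r.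
  by rewrite integral_expR_tail// -EFinM ltry.
have Pf : Psi \is a fin_num by rewrite ge0_fin_numE.
move: Psi_half P0; rewrite -(fineK Pf) -EFinM !lee_fin => h1 h2.
by congr EFin; apply/eqP; rewrite eq_le h2 andbT; lra.
Qed.

(** Psi = 0 gives v = 0 at almost every time. Then the source vanishes at almost every time, and the
    Duhamel inequality, which ignores null sets of times, yields v = 0 at every time. *)
Lemma gronwall_eq0 t : 0 <= t -> \forall x \ae mu, v t x = 0.
Proof.
move=> t0.
have v_eq0 : \forall tau \ae leb, 0 <= tau -> (\int[mu]_x (v tau x)%:E = 0)%E.
  have : \forall tau \ae leb, (\int[mu]_x V (tau, x) = 0)%E.
    apply: integral0_ae => //; first exact: measurable_fun_integral_param.
    by move=> tau; exact: integral_ge0.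
  apply: filterS => tau + tau0; rewrite V_int// => /eqP.
  by rewrite mule_eq0 eqe gt_eqF ?expR_gt0//= => /eqP.
have N_eq0 : \forall tau \ae leb, 0 <= tau -> \forall x \ae mu, N tau x = 0.
  apply: filterS3 v_eq0 N_le K_le => tau h1 h2 h3 tau0.
  have IK : (\int[mu]_x K tau x = 0)%E.
    by apply/eqP; rewrite eq_le integral_ge0// andbT -(mule0 M%:E) -[X in (M%:E * X)%E]h1// h3.
  apply: filterS2 (integral0_ae (mK tau) (K0 tau) IK) (h2 tau0) => x ->.
  by rewrite mule0 lee_fin => H; apply/eqP; rewrite eq_le H N0.
have mgt : measurable_fun [set: G * measurableTypeR R] (fun z => g ((t, z.1), z.2)).
  apply: (measurableT_comp mg (g := fun z : G * measurableTypeR R => ((t : measurableTypeR R, z.1), z.2))).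
  by apply: measurable_fun_pair => //; apply: measurable_fun_pair.
have I0 : (\int[mu]_x \int[leb]_tau g ((t, x), tau) = 0)%E.
  rewrite (fubini_tonelli (fun z : G * measurableTypeR R => g ((t, z.1), z.2)))//.
  apply: ae0_integral.
    have := @measurable_fun_integral_param _ _ _ _ _ mu
      (fun z : measurableTypeR R * G => g ((t, z.2), z.1)); apply.
    apply: (measurableT_comp mgt (g := fun z : measurableTypeR R * G => (z.2, z.1))).
    exact: measurable_fun_pair.
  apply: filterS N_eq0 => tau Ntau; have [tau0|tau0] := leP 0 tau; last first.
    by rewrite integral0_eq// => x _; rewrite /g/= leNgt tau0.
  apply: ae0_integral.
    by apply: (measurableT_comp mgt (g := pair^~ (tau : measurableTypeR R))); exact: measurable_pair2.
  by apply: filterS (Ntau tau0) => x Nx; rewrite /g/= Nx !mulr0; case: ifP.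
have H : \forall x \ae mu, (\int[leb]_tau g ((t, x), tau) = 0)%E.
  apply: integral0_ae => //; last by move=> x; exact: integral_ge0.
  exact: measurable_fun_integral_param mgt.
apply: filterS2 H (v_le t0) => x; rewrite g_int// => /eqP.
rewrite mule_eq0 eqe gt_eqF ?expR_gt0//= => /eqP ->.
by rewrite lee_fin => h; apply/eqP; rewrite eq_le h v0.
Qed.

End gronwall.

(** * Uniqueness among bounded solutions *)

Section uniqueness.
Context (R : realType) (G : freq_group R) (I : finType).
Local Notation mu := (fg_measure G).
Local Notation leb := (@lebesgue_measure R).
Local Notation sub := (@fg_sub R G).
Variables (nu0 c0 M : R) (nu : I -> R) (L : I -> G -> (I -> I -> R) -> R).
Variables (W0 : I -> G -> R) (W W' : I -> R -> G -> R).
Hypotheses (nu0_gt0 : 0 < nu0) (nu_ge : forall i, nu0 <= nu i).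
Hypotheses (c0_ge0 : 0 <= c0) (qL : quadratic_multiplier c0 L) (M_ge0 : 0 <= M).
Hypotheses (mW : forall i, jointly (W i)) (mW' : forall i, jointly (W' i)).
Hypotheses (W_bounded : \forall t \ae leb, 0 <= t -> (\int[mu]_x (nrm W t x)%:E <= M%:E)%E)
  (W'_bounded : \forall t \ae leb, 0 <= t -> (\int[mu]_x (nrm W' t x)%:E <= M%:E)%E).
Hypotheses (W_solves : forall i t, 0 <= t -> \forall x \ae mu, solves nu L W0 W i t x)
  (W'_solves : forall i t, 0 <= t -> \forall x \ae mu, solves nu L W0 W' i t x).

Let w i t x := W i t x - W' i t x.
Let v := nrm w.
Let N t x := \sum_i `|source L W i t x - source L W' i t x|.
Let a t x := nrm W t x + nrm W' t x.
Let B : R := #|I|%:R * c0.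
(** Comes from W W - W' W' = w W + W' w, where both W and W' are bounded by [a] and w by [v]. *)
Let K t x : \bar R := (B%:E * (fg_conv (v t) (a t) x + fg_conv (a t) (v t) x))%E.

Let B_ge0 : 0 <= B. Proof. exact: mulr_ge0. Qed.

Let jointly_nrm (U : I -> R -> G -> R) : (forall i, jointly (U i)) -> jointly (nrm U).
Proof.
move=> mU; apply: measurable_sum => i; apply: measurableT_comp => //; exact: mU.
Qed.

Let mv : jointly v.
Proof. by apply: jointly_nrm => i; apply: measurable_funB; [exact: mW|exact: mW']. Qed.

Let ma : jointly a.
Proof. by apply: measurable_funD; exact: jointly_nrm. Qed.

Let v_ge0 t x : 0 <= v t x. Proof. exact: nrm_ge0. Qed.
Let a_ge0 t x : 0 <= a t x. Proof. by rewrite addr_ge0// nrm_ge0. Qed.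

Let v_le_a t x : v t x <= a t x.
Proof. by rewrite /v /a /nrm -big_split/=; apply: ler_sum => i _; exact: ler_normB. Qed.

Let mK t : measurable_fun setT (K t).
Proof.
by apply: measurable_funeM; apply: emeasurable_funD; apply: measurable_fg_conv; exact: jointlyl.
Qed.

Let conv_ge0 (f g : G -> R) x : (forall y, 0 <= f y) -> (forall y, 0 <= g y) -> (0 <= fg_conv f g x)%E.
Proof. by move=> f0 g0; apply: integral_ge0 => y _; rewrite lee_fin mulr_ge0. Qed.

Let K_ge0 t x : (0 <= K t x)%E.
Proof. by rewrite mule_ge0 ?lee_fin// adde_ge0// conv_ge0. Qed.

Let v_duhamel t : 0 <= t -> \forall x \ae mu,
  ((v t x)%:E <= \int[leb]_(tau in `[0%R, t]) (heatk nu0 (t - tau) x * N tau x)%:E)%E.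
Proof.
move=> t0.
have s1 : \forall x \ae mu, forall i, solves nu L W0 W i t x.
  by apply: filter_forall => i; exact: W_solves.
have s2 : \forall x \ae mu, forall i, solves nu L W0 W' i t x.
  by apply: filter_forall => i; exact: W'_solves.
apply: filterS2 s1 s2 => x h1 h2.
have mS U i : (forall i, jointly (U i)) ->
    measurable_fun `[0%R, t] (fun tau : measurableTypeR R => heatk (nu i) (t - tau) x * source L U i tau x).
  move=> mU; apply: measurable_funTS; apply: measurable_funM.
    apply: (measurableT_comp (jointlyr x (@jointly_heatk R G (nu i))) (g := fun u : measurableTypeR R => t - u)).
    exact: measurable_funB.
  by apply: jointlyr; exact: (jointly_source qL).
apply: (@le_trans _ _ (\sum_i \int[leb]_(tau in `[0%R, t])
    (`|heatk (nu i) (t - tau) x * source L W i tau x - heatk (nu i) (t - tau) x * source L W' i tau x|)%:E)%E).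
  rewrite /v /nrm -sumEFin; apply: lee_sum => i _.
  have [i1 e1] := h1 i; have [i2 e2] := h2 i.
  rewrite /w e1 e2 opprD addrACA subrr add0r /duhamel_term -RintegralB//.
  apply: normr_Rintegral_le => //.
  by apply: measurable_funB; exact: mS.
rewrite -ge0_integral_sum//; last first.
  move=> i; apply/measurable_EFinP; apply: measurableT_comp => //.
  by apply: measurable_funB; exact: mS.
apply: ge0_le_integral_nomeas => tau /=; rewrite in_itv/= => /andP[tau0 taut].
  by rewrite sumEFin lee_fin sumr_ge0.
rewrite sumEFin lee_fin /N mulr_sumr; apply: ler_sum => i _.
rewrite -mulrBr normrM ger0_norm ?expR_ge0//; apply: ler_wpM2r => //.
rewrite ler_expR lerN2; apply: ler_wpM2r; first exact: sqr_ge0.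
by apply: ler_wpM2r => //; rewrite subr_ge0.
Qed.

Let a_bounded : \forall t \ae leb, 0 <= t -> (\int[mu]_x (a t x)%:E <= (2 * M)%:E)%E.
Proof.
apply: filterS2 W_bounded W'_bounded => t h1 h2 t0.
under eq_integral do rewrite EFinD.
rewrite ge0_integralD//; last 4 first.
- by move=> x _; rewrite lee_fin nrm_ge0.
- by apply/measurable_EFinP; apply: jointlyl; exact: jointly_nrm.
- by move=> x _; rewrite lee_fin nrm_ge0.
- by apply/measurable_EFinP; apply: jointlyl; exact: jointly_nrm.
rewrite mulrC mulr_natr mulr2n EFinD; apply: leeD; [exact: h1|exact: h2].
Qed.

Let v_le_inta t : (\int[mu]_x (v t x)%:E <= \int[mu]_x (a t x)%:E)%E.
Proof. by apply: ge0_le_integral_nomeas => x _; rewrite lee_fin. Qed.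

Let N_source_le : \forall t \ae leb, 0 <= t -> \forall x \ae mu,
  ((N t x)%:E <= (fg_mod x)%:E * K t x)%E.
Proof.
apply: filterS a_bounded => t aM t0.
have mat : measurable_fun setT (a t) by exact: jointlyl.
have mvt : measurable_fun setT (v t) by exact: jointlyl.
have convoo : \forall x \ae mu, (fg_conv (a t) (a t) x < +oo)%E.
  have H : mu.-integrable setT (fg_conv (a t) (a t)).
    apply/integrableP; split; first exact: measurable_fg_conv.
    under eq_integral do rewrite gee0_abs ?conv_ge0//.
    rewrite integral_fg_conv//; apply: lte_mul_pinfty.
    - by apply: integral_ge0 => x _; rewrite lee_fin.
    - by rewrite ge0_fin_numE ?(le_lt_trans (aM t0)) ?ltry//; apply: integral_ge0 => x _; rewrite lee_fin.
    - by rewrite (le_lt_trans (aM t0)) ?ltry.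
  have := integrable_ae measurableT H.
  by apply: filterS => x /(_ Logic.I); rewrite ge0_fin_numE ?conv_ge0.
apply: filterS convoo => x xoo.
have mp (U : I -> R -> G -> R) j k : (forall i, jointly (U i)) -> measurable_fun setT (fun y => U j t (sub x y) * U k t y).
  move=> mU; apply: measurable_funM; last exact: jointlyl.
  by apply: measurableT_comp; [exact: jointlyl|exact: measurable_fg_subl].
have intp (U : I -> R -> G -> R) j k : (forall i, jointly (U i)) ->
    (forall i y, `|U i t y| <= a t y) -> mu.-integrable setT (fun y => (U j t (sub x y) * U k t y)%:E).
  move=> mU Ua; apply/integrableP; split; first by apply/measurable_EFinP; exact: mp.
  apply: le_lt_trans xoo; apply: ge0_le_integral_nomeas => y _; first exact: abse_ge0.
  by rewrite abse_EFin lee_fin normrM; apply: ler_pM.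
have Wa i y : `|W i t y| <= a t y.
  by apply: le_trans (le_nrm W i t y) _; rewrite lerDl nrm_ge0.
have W'a i y : `|W' i t y| <= a t y.
  by apply: le_trans (le_nrm W' i t y) _; rewrite lerDr nrm_ge0.
have main : ((\sum_(p : I * I) `|conv2 (W p.1 t) (W p.2 t) x - conv2 (W' p.1 t) (W' p.2 t) x|)%:E <=
    fg_conv (v t) (a t) x + fg_conv (a t) (v t) x)%E.
  rewrite /fg_conv -ge0_integralD//; last 4 first.
  - by move=> y _; rewrite lee_fin mulr_ge0.
  - apply/measurable_EFinP; apply: measurable_funM => //.
    by apply: measurableT_comp => //; exact: measurable_fg_subl.
  - by move=> y _; rewrite lee_fin mulr_ge0.
  - apply/measurable_EFinP; apply: measurable_funM => //.
    by apply: measurableT_comp => //; exact: measurable_fg_subl.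
  rewrite -sumEFin.
  apply: (@le_trans _ _ (\sum_(p : I * I) \int[mu]_y
    (`|W p.1 t (sub x y) * W p.2 t y - W' p.1 t (sub x y) * W' p.2 t y|)%:E)%E).
    apply: lee_sum => p _; rewrite /conv2 -RintegralB//; [|exact: intp|exact: intp].
    by apply: normr_Rintegral_le => //; apply: measurable_funB; exact: mp.
  rewrite -ge0_integral_sum//; last first.
    by move=> p; apply/measurable_EFinP; apply: measurableT_comp => //; apply: measurable_funB; exact: mp.
  apply: ge0_le_integral_nomeas => y _; first by rewrite sumEFin lee_fin sumr_ge0.
  rewrite sumEFin -EFinD lee_fin.
  apply: (@le_trans _ _ (\sum_(p : I * I) (`|w p.1 t (sub x y)| * `|W p.2 t y|
      + `|W' p.1 t (sub x y)| * `|w p.2 t y|))).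
    apply: ler_sum => p _; rewrite -!normrM.
    rewrite [X in `|X| <= _](_ : _ = w p.1 t (sub x y) * W p.2 t y + W' p.1 t (sub x y) * w p.2 t y).
      exact: ler_normD.
    by rewrite /w; ring.
  rewrite big_split/= (sum_pairM (fun i => `|w i t (sub x y)|) (fun i => `|W i t y|)).
  rewrite (sum_pairM (fun i => `|W' i t (sub x y)|) (fun i => `|w i t y|)).
  apply: lerD; apply: ler_pM => //; try exact: nrm_ge0; rewrite /a; [rewrite lerDl|rewrite lerDr]; exact: nrm_ge0.
have [Lsub Lle _] := qL.
apply: le_trans (_ : (#|I|%:R * (c0 * fg_mod x))%:E * (\sum_(p : I * I)
    `|conv2 (W p.1 t) (W p.2 t) x - conv2 (W' p.1 t) (W' p.2 t) x|)%:E <= _)%E.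
  rewrite -EFinM lee_fin -mulrA mulr_natl -sumr_const; apply: ler_sum => i _.
  by rewrite /source -Lsub; exact: Lle.
rewrite /K muleA -(EFinM (fg_mod x)).
rewrite (_ : fg_mod x * B = #|I|%:R * (c0 * fg_mod x)); last by rewrite /B; ring.
by apply: lee_wpmul2l => //; rewrite lee_fin !mulr_ge0 ?fg_mod_ge0.
Qed.

(** One constant for two hypotheses of the Gronwall inequality: 4 B M bounds the integral of K in
    terms of that of v, and 2 M bounds the integral of v itself. *)
Let M2 : R := 4 * B * M + 2 * M.

Let M2_ge0 : 0 <= M2.
Proof. by rewrite addr_ge0 ?mulr_ge0. Qed.

Let K_int_le : \forall t \ae leb, 0 <= t ->
  (\int[mu]_x K t x <= M2%:E * \int[mu]_x (v t x)%:E)%E.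
Proof.
apply: filterS a_bounded => t aM t0.
have mat : measurable_fun setT (a t) by exact: jointlyl.
have mvt : measurable_fun setT (v t) by exact: jointlyl.
have Iv0 : (0 <= \int[mu]_x (v t x)%:E)%E by apply: integral_ge0 => x _; rewrite lee_fin.
rewrite ge0_integralZl//; last 2 first.
- by apply: emeasurable_funD; exact: measurable_fg_conv.
- by move=> x _; rewrite adde_ge0// conv_ge0.
rewrite ge0_integralD//; last 4 first.
- by move=> x _; rewrite conv_ge0.
- exact: measurable_fg_conv.
- by move=> x _; rewrite conv_ge0.
- exact: measurable_fg_conv.
rewrite !integral_fg_conv//.
move: (aM t0) Iv0; set Ia := (\int[mu]_x (a t x)%:E)%E; set Iv := (\int[mu]_x (v t x)%:E)%E => aM2 Iv0.
rewrite (muleC Iv).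
apply: (@le_trans _ _ (B%:E * ((4 * M)%:E * Iv))%E).
  apply: lee_wpmul2l => //.
  rewrite (_ : 4 * M = 2 * M + 2 * M); last by ring.
  have M20 : (0 <= (2 * M)%:E)%E by rewrite lee_fin mulr_ge0.
  by rewrite EFinD (ge0_muleDl Iv M20 M20); apply: leeD; apply: lee_wpmul2r.
rewrite muleA -EFinM; apply: lee_wpmul2r => //; rewrite lee_fin /M2.
rewrite (_ : B * (4 * M) = 4 * B * M); last by ring.
by rewrite lerDl mulr_ge0.
Qed.

Lemma solves_unique i t : 0 <= t -> \forall x \ae mu, W i t x = W' i t x.
Proof.
move=> t0.
have mN : jointly N.
  apply: measurable_sum => j; apply: measurableT_comp => //.
  by apply: measurable_funB; exact: (jointly_source qL).
have N_ge0 s x : 0 <= N s x by exact: sumr_ge0.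
have vb : \forall s \ae leb, 0 <= s -> (\int[mu]_x (v s x)%:E <= M2%:E)%E.
  apply: filterS a_bounded => s h s0; apply: le_trans (v_le_inta s) (le_trans (h s0) _).
  by rewrite lee_fin /M2 lerDr !mulr_ge0.
have := gronwall_eq0 nu0_gt0 M2_ge0 mv mN mK v_ge0 N_ge0 K_ge0 v_duhamel N_source_le K_int_le vb t0.
apply: filterS => x vx; apply/eqP; rewrite -subr_eq0 -normr_le0 -vx.
exact: (le_nrm w).
Qed.

End uniqueness.

(** * Frequencies of the torus and of the whole space *)

Lemma sigma_finite_prod d1 d2 (T1 : measurableType d1) (T2 : measurableType d2)
    (R : realType) (m1 : {sigma_finite_measure set T1 -> \bar R})
    (m2 : {sigma_finite_measure set T2 -> \bar R}) :
  sigma_finite setT (m1 \x m2)%E.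
Proof.
have /sigma_finiteP[F [TF /= ndF Foo]] := sigma_finiteT m1.
have /sigma_finiteP[G [TG /= ndG Goo]] := sigma_finiteT m2.
exists (fun n => F n `*` G n); last first.
  move=> k; split; first by apply: measurableX; [case: (Foo k)|case: (Goo k)].
  rewrite product_measure1E; [|by case: (Foo k)|by case: (Goo k)].
  by rewrite lte_mul_pinfty ?ge0_fin_numE; case: (Foo k); case: (Goo k).
apply/seteqP; split=> // -[x y] _.
have [i _ Fx] : (\bigcup_i F i) x by rewrite -TF.
have [j _ Gy] : (\bigcup_i G i) y by rewrite -TG.
exists (maxn i j) => //; split.
- exact: (subsetPset _ _ (ndF _ _ (leq_maxl i j))).
- exact: (subsetPset _ _ (ndG _ _ (leq_maxr i j))).
Qed.

Definition prod_sf d1 d2 (T1 : measurableType d1) (T2 : measurableType d2)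
    (R : realType) (m1 : {sigma_finite_measure set T1 -> \bar R})
    (m2 : {sigma_finite_measure set T2 -> \bar R}) :
    {sigma_finite_measure set (T1 * T2)%type -> \bar R} :=
  HB.pack_for {sigma_finite_measure set (T1 * T2)%type -> \bar R} (m1 \x m2)%E
   (Measure_isSigmaFinite.Build _ _ _ (m1 \x m2)%E (sigma_finite_prod m1 m2)).

Section preserving.
Context d (T : measurableType d) (R : realType).

Definition preserving (mu : {measure set T -> \bar R}) (phi : T -> T) : Prop :=
  measurable_fun setT phi /\
  forall f : T -> \bar R, measurable_fun setT f -> (forall y, 0 <= f y)%E ->
    (\int[mu]_y f (phi y) = \int[mu]_y f y)%E.

Lemma preserving_measure (mu : {measure set T -> \bar R}) phi :
  measurable_fun setT phi ->
  (forall A, measurable A -> mu (phi @^-1` A) = mu A) -> preserving mu phi.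
Proof.
move=> mphi muE; split => // f mf f0.
rewrite -[LHS](@ge0_integral_pushforward _ _ _ _ _ phi mphi mu setT f)//.
by apply: eq_measure_integral => A mA _; exact: muE.
Qed.

End preserving.

Lemma preserving_prod d1 d2 (T1 : measurableType d1) (T2 : measurableType d2)
    (R : realType) (m1 : {sigma_finite_measure set T1 -> \bar R})
    (m2 : {sigma_finite_measure set T2 -> \bar R}) phi1 phi2 :
  preserving m1 phi1 -> preserving m2 phi2 ->
  preserving (prod_sf m1 m2) (fun z => (phi1 z.1, phi2 z.2)).
Proof.
move=> [mphi1 pphi1] [mphi2 pphi2].
have mphi : measurable_fun [set: T1 * T2] (fun z => (phi1 z.1, phi2 z.2)).
  apply: measurable_fun_pair.
    exact: (measurableT_comp mphi1 (g := fst)).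
  exact: (measurableT_comp mphi2 (g := snd)).
split => // f mf f0; rewrite /prod_sf.
rewrite [LHS](fubini_tonelli1 (m1 := m1) (m2 := m2) (fun y => f (phi1 y.1, phi2 y.2)))//; last first.
  exact: (measurableT_comp mf mphi).
rewrite [RHS](fubini_tonelli1 (m1 := m1) (m2 := m2) f mf f0) /fubini_F/=.
rewrite -(pphi1 (fun x => \int[m2]_y f (x, y))%E); last 2 first.
- exact: measurable_fun_integral_param.
- by move=> x; exact: integral_ge0.
apply: eq_integral => x _.
rewrite (pphi2 (fun y => f (phi1 x, y)))//.
by apply: (measurableT_comp mf (g := pair (phi1 x))); exact: measurable_pair1.
Qed.

Section lebesgue_preserving.
Context (R : realType).
Local Notation leb := (@lebesgue_measure R).
Implicit Type c : R.

(** Lebesgue measure is determined by its values on half-open intervals, so the push-forward needs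
    to be tested on these alone. *)
Lemma lebesgue_preserving (phi : measurableTypeR R -> measurableTypeR R) :
  measurable_fun setT phi ->
  (forall a b : R, leb (phi @^-1` `]a, b]) = leb (`]a, b] : set R)) ->
  preserving leb phi.
Proof.
move=> mphi phiE; apply: preserving_measure => // A mA.
have H := @lebesgue_measure_unique R (pushforward leb phi).
have {}H := H mphi; rewrite /pushforward in H; rewrite [RHS]H// => X [[a b] _ <-]; exact/esym/phiE.
Qed.

Lemma preserving_shift c : preserving leb (fun t => t - c).
Proof.
apply: lebesgue_preserving => [|a b]; first exact: measurable_funB.
rewrite (_ : _ @^-1` _ = `]a + c, b + c]%classic); last first.
  by apply/seteqP; split => x /=; rewrite !in_itv/= ltrBrDr lerBlDr.
rewrite !lebesgue_measure_itv/= !lte_fin ltrD2r; case: ifPn => // _.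
by rewrite -!EFinB; congr EFin; ring.
Qed.

Lemma preserving_reflect c : preserving leb (fun t => c - t).
Proof.
apply: lebesgue_preserving => [|a b]; first exact: measurable_funB.
rewrite (_ : _ @^-1` _ = `[c - b, c - a[%classic); last first.
  apply/seteqP; split => x /=; rewrite !in_itv/= => /andP[h1 h2]; apply/andP; split; lra.
rewrite !lebesgue_measure_itv/= !lte_fin ltrD2l ltrN2; case: ifPn => // _.
by rewrite -!EFinB; congr EFin; ring.
Qed.

End lebesgue_preserving.

Section triples.
Context (V : zmodType).
Implicit Types x y : V * V * V.

Definition sub3 x y : V * V * V := (x.1.1 - y.1.1, x.1.2 - y.1.2, x.2 - y.2).
Definition zero3 : V * V * V := (0, 0, 0).

Lemma coord3_sub x y k : coord3 (sub3 x y) k = coord3 x k - coord3 y k.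
Proof. by rewrite /coord3; case: (val k) => [|[|n]]. Qed.

Lemma sub3K x y : sub3 x (sub3 x y) = y.
Proof. by case: y => [[a b] c]; rewrite /sub3/= !subKr. Qed.

Lemma sub3_neg x y : sub3 (sub3 zero3 x) (sub3 zero3 y) = sub3 zero3 (sub3 x y).
Proof. by rewrite /sub3/= !sub0r !opprB !opprK ![- _ + _]addrC. Qed.

End triples.

Section freq_mod_theory.
Context (R : realType) (X : fourier_setting R).
Implicit Types x y z : freq X.

Lemma sqmod_ge0 x : 0 <= sqmod x.
Proof. by apply: sumr_ge0 => k _; exact: sqr_ge0. Qed.

Lemma freq_mod_ge0 x : 0 <= freq_mod X x. Proof. exact: sqrtr_ge0. Qed.

Lemma freq_mod_sqr x : freq_mod X x ^+ 2 = sqmod x.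
Proof. by rewrite sqr_sqrtr// sqmod_ge0. Qed.

Lemma freq_coord_le x k : `|freq_coord x k| <= freq_mod X x.
Proof.
rewrite -(ler_sqr (x := `|_|)) ?nnegrE ?freq_mod_ge0// freq_mod_sqr real_normK ?num_real//.
by rewrite /sqmod (bigD1 k)//= lerDl sumr_ge0// => j _; exact: sqr_ge0.
Qed.

Lemma freq_mod_add x y z :
  (forall k, freq_coord x k = freq_coord z k + freq_coord y k) ->
  freq_mod X x <= freq_mod X z + freq_mod X y.
Proof.
move=> h; have A := freq_mod_ge0 z; have B := freq_mod_ge0 y.
rewrite -ler_sqr ?nnegrE ?freq_mod_ge0 ?addr_ge0// sqrrD !freq_mod_sqr.
have CS : \sum_(k < 3) freq_coord z k * freq_coord y k <= freq_mod X z * freq_mod X y.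
  rewrite -sqrtrM ?sqmod_ge0//.
  apply: le_trans (ler_norm _) _; rewrite -sqrtr_sqr ler_sqrt ?mulr_ge0 ?sqmod_ge0//.
  rewrite /sqmod !big_ord_recl !big_ord0 !addr0.
  rewrite -subr_ge0; set a1 := freq_coord z _; set a2 := freq_coord z _; set a3 := freq_coord z _.
  set b1 := freq_coord y _; set b2 := freq_coord y _; set b3 := freq_coord y _.
  (* Lagrange's identity: the defect in the Cauchy-Schwarz inequality is the squared length of the
     cross product. *)
  rewrite (_ : _ - _ = (a1 * b2 - a2 * b1) ^+ 2 + (a1 * b3 - a3 * b1) ^+ 2 + (a2 * b3 - a3 * b2) ^+ 2); last by ring.
  by rewrite !addr_ge0 ?sqr_ge0.
rewrite (_ : sqmod x = sqmod z + 2 * (\sum_(k < 3) freq_coord z k * freq_coord y k) + sqmod y).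
  lra.
by rewrite /sqmod mulr_sumr -!big_split/=; apply: eq_bigr => k _; rewrite h; ring.
Qed.

Lemma measurable_sqmod : (forall k, measurable_fun setT (fun x : freq X => freq_coord x k)) ->
  measurable_fun setT (@sqmod R X).
Proof. by move=> mc; apply: measurable_sum => k; apply: measurable_funX. Qed.

Lemma measurable_freq_mod : (forall k, measurable_fun setT (fun x : freq X => freq_coord x k)) ->
  measurable_fun setT (freq_mod X).
Proof.
move=> mc; apply: measurableT_comp; last exact: measurable_sqmod.
by apply: continuous_measurable_fun; exact: sqrt_continuous.
Qed.

End freq_mod_theory.

Section whole_space_group.
Context (R : realType).
Local Notation leb := (@lebesgue_measure R).
Local Notation X := (whole_space R).

(** Convertible to [leb3], with the sigma-finiteness that Tonelli asks for; the settings of the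
    theorem are recovered by computation. *)
Definition leb3s : {sigma_finite_measure set (R3 R) -> \bar R} :=
  prod_sf (prod_sf leb leb) leb.

Lemma measurable_coord3 k : measurable_fun setT (fun x : R3 R => coord3 x k : R).
Proof.
rewrite /coord3; case: (val k) => [|[|n]].
- exact: (measurableT_comp measurable_fst measurable_fst).
- exact: (measurableT_comp measurable_snd measurable_fst).
- exact: measurable_snd.
Qed.

Lemma preserving_sub3l (x : R3 R) : preserving leb3s (sub3 (x : R * R * R)).
Proof.
have H := @preserving_prod _ _ _ _ R leb leb _ _
  (preserving_reflect (x.1.1 : R)) (preserving_reflect (x.1.2 : R)).
exact: (@preserving_prod _ _ _ _ R (prod_sf leb leb) leb _ _ H (preserving_reflect (x.2 : R))).
Qed.

Lemma preserving_sub3r (y : R3 R) : preserving leb3s (fun x : R3 R => sub3 (x : R * R * R) y).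
Proof.
have H := @preserving_prod _ _ _ _ R leb leb _ _
  (preserving_shift (y.1.1 : R)) (preserving_shift (y.1.2 : R)).
exact: (@preserving_prod _ _ _ _ R (prod_sf leb leb) leb _ _ H (preserving_shift (y.2 : R))).
Qed.

Lemma measurable_sub3 : measurable_fun [set: R3 R * R3 R]
  (fun z => sub3 (z.1 : R * R * R) z.2 : R3 R).
Proof.
have m k1 : measurable_fun [set: R3 R * R3 R] (fun z => coord3 z.1 k1 - coord3 z.2 k1 : measurableTypeR R).
  apply: measurable_funB.
    exact: (measurableT_comp (measurable_coord3 k1) measurable_fst).
  exact: (measurableT_comp (measurable_coord3 k1) measurable_snd).
apply: measurable_fun_pair; last exact: (m (@Ordinal 3 2 isT)).
apply: measurable_fun_pair; [exact: (m (@Ordinal 3 0 isT))|exact: (m (@Ordinal 3 1 isT))].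
Qed.

Lemma freq_mod_sub3 (x y : R3 R) :
  freq_mod X x <= freq_mod X (sub3 (x : R * R * R) y) + freq_mod X y.
Proof.
by apply: freq_mod_add => k; rewrite /= (coord3_sub (x : R * R * R)) subrK.
Qed.

Definition space_group : freq_group R :=
  @FreqGroup R _ (R3 R) leb3s (fun x y => sub3 (x : R * R * R) y) (freq_mod X)
    (@sub3K R) measurable_sub3
    (fun f x => (preserving_sub3l x).2 f) (fun f y => (preserving_sub3r y).2 f)
    (measurable_freq_mod (X := X) measurable_coord3) (@freq_mod_ge0 R X) freq_mod_sub3.

End whole_space_group.

Section torus_group.
Context (R : realType).
Local Notation X := (torus R).

Lemma measurable_Z3 (A : set Z3) : measurable A. Proof. by []. Qed.

Lemma countable_Z3 : countable [set: Z3].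
Proof. exact: (@countableP (int * int * int)%type). Qed.

(** Z^3 is countable and discrete, so a preimage is a countable union of slices, each times a
    point. *)
Lemma measurable_Z3_prod d (T : measurableType d) d' (T' : measurableType d') (f : T * Z3 -> T') :
  (forall k, measurable_fun setT (fun t => f (t, k))) -> measurable_fun setT f.
Proof.
move=> mf _ A mA; rewrite setTI.
rewrite (_ : _ @^-1` _ = \bigcup_k (((fun t => f (t, k)) @^-1` A) `*` [set k])); last first.
  apply/seteqP; split => [[t k] /= Atk|[t k] [k' _ /= [h ->]]//].
  by exists k.
apply: countable_bigcupT_measurable; first exact: countable_Z3.
move=> k; apply: measurableX => //.
by rewrite -[X in measurable X]setTI; exact: mf.
Qed.

Lemma sigma_finite_Z3 : sigma_finite [set: Z3] (@counting Z3 R).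
Proof.
pose f (x : Z3) : nat := pickle (x : int * int * int).
have f_inj : injective f by exact: (pcan_inj (@pickleK (int * int * int)%type)).
exists (fun n => f @^-1` `I_n).
  by apply/seteqP; split => // x _; exists (f x).+1 => //=.
move=> n; split => //.
have fin : finite_set (f @^-1` `I_n).
  by apply: finite_preimage => // x y _ _; exact: f_inj.
by rewrite /counting asboolT// ltry.
Qed.

Definition counting_Z3 : {sigma_finite_measure set Z3 -> \bar R} :=
  HB.pack_for {sigma_finite_measure set Z3 -> \bar R} (@counting Z3 R)
    (@Measure_isSigmaFinite.Build _ _ _ (@counting Z3 R) sigma_finite_Z3).

Lemma preserving_counting (phi psi : Z3 -> Z3) : cancel phi psi -> cancel psi phi ->
  preserving counting_Z3 phi.
Proof.
move=> phiK psiK; apply: preserving_measure => // A _.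
have cA : (phi @^-1` A #= A)%card.
  apply/card_set_bijP; exists phi; split => // [x y _ _ /(can_inj phiK)//|y Ay].
  by exists (psi y); rewrite /= psiK.
rewrite /= /counting; have [fA|fA] := pselect (finite_set A).
  have fpA : finite_set (phi @^-1` A) by rewrite (eq_finite_set cA).
  by rewrite !asboolT//; move/(fcard_eq fpA fA) : cA => ->.
by rewrite !asboolF// (eq_finite_set cA).
Qed.

Lemma preserving_Z3_subl (x : Z3) : preserving counting_Z3 (fun y => sub3 (x : int * int * int) y).
Proof. by apply: preserving_counting (fun y => sub3 (x : int * int * int) y) _ _ => y; exact: sub3K. Qed.

Lemma preserving_Z3_subr (y : Z3) : preserving counting_Z3 (fun x : Z3 => sub3 (x : int * int * int) y).
Proof.
apply: (preserving_counting (psi := fun x : Z3 => sub3 (x : int * int * int) (sub3 (0, 0, 0) y)));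
  by move=> [[a b] c]; rewrite /sub3/= !sub0r !opprK ?subrK ?addrK.
Qed.

Lemma measurable_Z3_sub : measurable_fun [set: Z3 * Z3]
  (fun z => sub3 (z.1 : int * int * int) z.2 : Z3).
Proof. by apply: measurable_Z3_prod. Qed.

Lemma freq_mod_Z3_sub (x y : Z3) :
  freq_mod X x <= freq_mod X (sub3 (x : int * int * int) y) + freq_mod X y.
Proof.
apply: freq_mod_add => k.
by rewrite /= /Z3_coord (coord3_sub (x : int * int * int)) intrB subrK.
Qed.

Definition torus_group : freq_group R :=
  @FreqGroup R _ Z3 counting_Z3 (fun x y => sub3 (x : int * int * int) y) (freq_mod X)
    (@sub3K int) measurable_Z3_sub
    (fun f x => (preserving_Z3_subl x).2 f) (fun f y => (preserving_Z3_subr y).2 f)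
    (measurable_freq_mod (X := X) (fun k => (fun _ _ _ => measurable_Z3 _))) (@freq_mod_ge0 R X) freq_mod_Z3_sub.

End torus_group.

(** * Schur's test and the bounds for J *)

Section schur.
Context d (T : measurableType d) (R : realType).
Variables (mu : {sigma_finite_measure set T -> \bar R}) (P : T -> T -> R) (A : R).
Hypotheses (mP : measurable_fun [set: T * T] (fun z => P z.1 z.2))
  (P0 : forall x y, 0 <= P x y) (A0 : 0 <= A)
  (row : forall x, (\int[mu]_y (P x y)%:E <= A%:E)%E)
  (column : forall y, (\int[mu]_x (P x y)%:E <= A%:E)%E).

Let mPr x : measurable_fun setT (P x).
Proof. by apply: (measurableT_comp mP (g := pair x)); exact: measurable_pair1. Qed.

Let mPl y : measurable_fun setT (P^~ y).
Proof. by apply: (measurableT_comp mP (g := pair^~ y)); exact: measurable_pair2. Qed.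

Definition schur_op (b : T -> R) (x : T) : \bar R := (\int[mu]_y (P x y * b y)%:E)%E.

(** Hoelder for the splitting P = P^{1/q'} P^{1/q}. The first factor is controlled by the row bound,
    and the q-th power of its norm is at most A^{q/q'} = A^{q-1}. *)
Lemma schur_op_poweR (q : R) (b : T -> R) x : 1 <= q ->
  measurable_fun setT b -> (forall y, 0 <= b y) ->
  (schur_op b x `^ q <= (A `^ (q - 1))%:E * \int[mu]_y (P x y * b y `^ q)%:E)%E.
Proof.
rewrite le_eqVlt => /orP[/eqP <-|q1] mb b0.
  rewrite subrr powRr0 mul1e poweRe1; last first.
    by apply: integral_ge0 => y _; rewrite lee_fin mulr_ge0.
  rewrite le_eqVlt; apply/orP; left; apply/eqP; apply: eq_integral => y _.
  by rewrite powRr1.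
have q0 : 0 < q by lra.
pose q' := q / (q - 1).
have q10 : 0 < q - 1 by lra.
have q'0 : 0 < q' by rewrite divr_gt0.
pose f y := P x y `^ q'^-1.
pose g y := P x y `^ q^-1 * b y.
have qq' : q'^-1 + q^-1 = 1 by rewrite /q'; field; rewrite !gt_eqF.
have mf : measurable_fun setT f.
  by apply: (measurableT_comp (f := @powR R ^~ q'^-1)) => //; exact: measurable_powR.
have mg : measurable_fun setT g.
  apply: measurable_funM => //.
  by apply: (measurableT_comp (f := @powR R ^~ q^-1)) => //; exact: measurable_powR.
have := hoelder mu mf mg q'0 q0 qq'.
rewrite Lnorm1 (_ : (\int[mu]_y `|(EFin \o (f \* g)%R) y| = schur_op b x)%E); last first.
  apply: eq_integral => y _; rewrite /= ger0_norm ?mulr_ge0 ?powR_ge0//.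
  by rewrite /f /g mulrA -powRD ?qq' ?powRr1 ?oner_eq0//=; apply/implyP => /eqP.
move=> H; have H0 : (0 <= schur_op b x)%E.
  by apply: integral_ge0 => y _; rewrite lee_fin mulr_ge0.
apply: le_trans (ge0_le_poweR (ltW q0) H0 H) _.
rewrite poweRM ?Lnorm_ge0//.
have -> : ('N[mu]_q%:E[EFin \o g] `^ q = \int[mu]_y (P x y * b y `^ q)%:E)%E.
  rewrite poweR_Lnorm ?gt_eqF//; apply: eq_integral => y _.
  rewrite /=; congr EFin.
  rewrite ger0_norm ?mulr_ge0 ?powR_ge0// powRM ?powR_ge0//.
  by rewrite -powRrM mulVf ?gt_eqF// powRr1.
apply: lee_wpmul2r.
  by apply: integral_ge0 => y _; rewrite lee_fin mulr_ge0// powR_ge0.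
have -> : q = q' * (q - 1) by rewrite /q'; field; rewrite gt_eqF.
rewrite poweRrM poweR_Lnorm ?gt_eqF//.
rewrite [X in (X `^ _)%E](_ : _ = \int[mu]_y (P x y)%:E)%E; last first.
  apply: eq_integral => y _; rewrite /=; congr EFin.
  by rewrite ger0_norm ?powR_ge0// -powRrM mulVf ?gt_eqF// powRr1.
rewrite (_ : q' * (q - 1) - 1 = q - 1); last by rewrite /q'; field; rewrite gt_eqF.
rewrite -poweR_EFin; apply: ge0_le_poweR; [exact: ltW| |exact: row].
by apply: integral_ge0 => y _; rewrite lee_fin.
Qed.

(** After Tonelli the column bound contributes one more factor A to the A^{q-1} coming from the
    rows. *)
Let schur_fin (q : R) (b : T -> R) : 1 <= q ->
  measurable_fun setT b -> (forall y, 0 <= b y) ->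
  (\int[mu]_x (schur_op b x `^ q) <= (A `^ q)%:E * \int[mu]_y (b y `^ q)%:E)%E.
Proof.
move=> q1 mb b0; have q0 : 0 < q by lra.
have mbq : measurable_fun setT (fun y => b y `^ q).
  by apply: (measurableT_comp (f := @powR R ^~ q)) => //; exact: measurable_powR.
have mPb : measurable_fun [set: T * T] (fun z => (P z.1 z.2 * b z.2 `^ q)%:E).
  by apply/measurable_EFinP; apply: measurable_funM => //; exact: (measurableT_comp mbq measurable_snd).
apply: (@le_trans _ _ (\int[mu]_x ((A `^ (q - 1))%:E * \int[mu]_y (P x y * b y `^ q)%:E))%E).
  apply: ge0_le_integral_nomeas => x _; first exact: poweR_ge0.
  exact: schur_op_poweR.
rewrite ge0_integralZl//; last 3 first.
- exact: (measurable_fun_integral_param mu mPb).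
- by move=> x _; apply: integral_ge0 => y _; rewrite lee_fin mulr_ge0// powR_ge0.
- by rewrite lee_fin powR_ge0.
rewrite (fubini_tonelli (fun z => (P z.1 z.2 * b z.2 `^ q)%:E) mPb); last first.
  by move=> z; rewrite lee_fin mulr_ge0// powR_ge0.
apply: (@le_trans _ _ ((A `^ (q - 1))%:E * \int[mu]_y (A%:E * (b y `^ q)%:E))%E).
  apply: lee_wpmul2l; first by rewrite lee_fin powR_ge0.
  apply: ge0_le_integral_nomeas => y _.
    by apply: integral_ge0 => x _; rewrite lee_fin mulr_ge0// powR_ge0.
  rewrite /=; under eq_integral do rewrite EFinM muleC.
  rewrite ge0_integralZl//; last 3 first.
  - by apply/measurable_EFinP.
  - by move=> x _; rewrite lee_fin.
  - by rewrite lee_fin powR_ge0.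
  by rewrite muleC; apply: lee_wpmul2r; rewrite ?lee_fin ?powR_ge0.
rewrite ge0_integralZl//; last 2 first.
- exact/measurable_EFinP.
- by move=> x _; rewrite lee_fin powR_ge0.
rewrite muleA -EFinM.
have [->|An0] := eqVneq A 0; first by rewrite mulr0 mul0e mule_ge0 ?lee_fin ?powR_ge0//; apply: integral_ge0 => y _; rewrite lee_fin powR_ge0.
rewrite -[X in _ * X]powRr1// -powRD; last by rewrite An0 implybT.
by rewrite subrK.
Qed.

Lemma schur_bound (q : \bar R) (b : T -> R) : (1 <= q)%E ->
  measurable_fun setT b -> (forall y, 0 <= b y) ->
  ('N[mu]_q[schur_op b] <= A%:E * 'N[mu]_q[EFin \o b])%E.
Proof.
case: q => [q| |//]; last first.
  move=> _ mb b0; rewrite unlock; case: ifPn => [h|_]; last by rewrite mule0.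
  apply/ess_supP; apply: aeW => x /=.
  set s := ess_sup _ _.
  have s0 : (0 <= s)%E by apply: ess_sup_gee => //; apply: aeW => y; exact: abse_ge0.
  have H0 : (0 <= schur_op b x)%E.
    by apply: integral_ge0 => y _; rewrite lee_fin mulr_ge0.
  rewrite gee0_abs//.
  have bs : \forall y \ae mu, ((b y)%:E <= s)%E.
    by apply: filterS (ess_sup_ge mu (abse \o (EFin \o b))) => y /=; rewrite ger0_norm.
  apply: (@le_trans _ _ (\int[mu]_y ((P x y)%:E * s))%E).
    apply: ae_ge0_le_integral => //.
    - by move=> y _; rewrite lee_fin mulr_ge0.
    - by apply/measurable_EFinP; exact: measurable_funM.
    - by move=> y _; rewrite mule_ge0 ?lee_fin.
    - by apply: emeasurable_funM => //; exact/measurable_EFinP.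
    - apply: filterS bs => y bys _; rewrite EFinM; apply: lee_wpmul2l => //.
      by rewrite lee_fin.
  under eq_integral do rewrite muleC.
  rewrite ge0_integralZl//; last 2 first.
  - exact/measurable_EFinP.
  - by move=> y _; rewrite lee_fin.
  by rewrite muleC; apply: lee_wpmul2r.
rewrite lee_fin => q1 mb b0; have q0 : 0 < q by lra.
rewrite unlock.
have -> : (\int[mu]_x (`|schur_op b x| `^ q) = \int[mu]_x (schur_op b x `^ q))%E.
  apply: eq_integral => x _; rewrite gee0_abs//.
  by apply: integral_ge0 => y _; rewrite lee_fin mulr_ge0.
have -> : (\int[mu]_x (`|(EFin \o b) x| `^ q) = \int[mu]_x (b x `^ q)%:E)%E.
  by apply: eq_integral => x _; rewrite /= ger0_norm.
apply: (@le_trans _ _ (((A `^ q)%:E * \int[mu]_y (b y `^ q)%:E) `^ q^-1)%E).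
  apply: ge0_le_poweR; [by rewrite invr_ge0 ltW| |exact: schur_fin].
  by apply: integral_ge0 => x _; exact: poweR_ge0.
rewrite poweRM ?lee_fin ?powR_ge0//; last first.
  by apply: integral_ge0 => x _; rewrite lee_fin powR_ge0.
by rewrite poweR_EFin -powRrM mulfV ?gt_eqF// powRr1.
Qed.

End schur.

Section Jform_bounds.
Context (R : realType) (G : freq_group R).
Local Notation mu := (fg_measure G).
Local Notation sub := (@fg_sub R G).

Lemma kappa_sub (x y : G) : kappa x (sub x y) = kappa x y.
Proof. by rewrite /kappa fg_subK maxC. Qed.

Lemma kappa_le (x y : G) : 0 < fg_mod y -> kappa x y <= 2 / fg_mod y.
Proof.
move=> y0; have M0 : 0 < mmax x y by apply: lt_le_trans y0 _; rewrite le_max lexx orbT.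
rewrite /kappa -/(mmax x y) ler_pdivrMr ?exprn_gt0//.
apply: le_trans (fg_mod_le_mmax x y) _.
rewrite expr2 mulrA ler_pM2r// mulrAC ler_pdivlMr// ler_pM2l//.
by rewrite le_max lexx orbT.
Qed.

(* By symmetry in (xi - eta, eta) one may integrate over |xi - eta| <= |eta|. *)
Definition half_kernel (a : G -> R) (x y : G) : R :=
  2 * (kappa x y * (if fg_mod (sub x y) <= fg_mod y then a (sub x y) else 0)).

Lemma half_kernel_ge0 a x y : (forall z, 0 <= a z) -> 0 <= half_kernel a x y.
Proof. by move=> a0; rewrite mulr_ge0// mulr_ge0 ?kappa_ge0//; case: ifP. Qed.

Lemma measurable_half_kernel a : measurable_fun setT a ->
  measurable_fun [set: G * G] (fun z => half_kernel a z.1 z.2).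
Proof.
move=> ma; apply: measurable_funM => //; apply: measurable_funM; first exact: measurable_kappa.
apply: measurable_fun_ifT => //.
- apply: measurable_fun_ler.
    by apply: measurableT_comp; [exact: measurable_fg_mod|exact: measurable_fg_sub].
  by apply: measurableT_comp => //; exact: measurable_fg_mod.
- by apply: measurableT_comp => //; exact: measurable_fg_sub.
Qed.

(** On R^3, at fixed eta and large xi, kappa is of order 1 / |xi|, whose cube is not integrable at
    infinity: the columns of the full kernel are not controlled by the L^{3/2} norm of [a]. The half
    kernel confines xi - eta to a ball. *)
Lemma Jform_le_half (a : G -> R) (x : G) : measurable_fun setT a -> (forall z, 0 <= a z) ->
  (Jform a x <= schur_op mu (half_kernel a) a x)%E.
Proof.
move=> ma a0; pose F y := kappa x y * (if fg_mod (sub x y) <= fg_mod y then a (sub x y) else 0) * a y.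
have F0 y : 0 <= F y by rewrite mulr_ge0// mulr_ge0 ?kappa_ge0//; case: ifP.
have mF : measurable_fun setT F.
  apply: measurable_funM => //.
  have H := measurable_half_kernel ma.
  rewrite (_ : (fun y => _) = fun y => 2^-1 * half_kernel a x y); last first.
    by apply/funext => y; rewrite /half_kernel mulKf.
  apply: measurable_funM => //; apply: (measurableT_comp H (g := pair x)).
  exact: measurable_pair1.
(* The factor 2 in the half kernel is split into F and its image under eta -> xi - eta, which has
   the same integral. Together the two cover both orderings of |xi - eta| and |eta|. *)
rewrite (_ : schur_op mu (half_kernel a) a x = \int[mu]_y (F y)%:E + \int[mu]_y (F (sub x y))%:E)%E.
  rewrite -ge0_integralD//; last 4 first.
  - by move=> y _; rewrite lee_fin.
  - exact/measurable_EFinP.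
  - by move=> y _; rewrite lee_fin.
  - by apply/measurable_EFinP; apply: measurableT_comp => //; exact: measurable_fg_subl.
  apply: ge0_le_integral_nomeas => y _.
    by rewrite lee_fin mulr_ge0 ?kappa_ge0// mulr_ge0.
  rewrite -EFinD lee_fin /F kappa_sub fg_subK.
  move: (kappa x y) (kappa_ge0 x y) => k k0; rewrite -!mulrA -mulrDr.
  apply: ler_wpM2l => //.
  case: (lerP (fg_mod (sub x y)) (fg_mod y)) => [h|/ltW ->].
    by rewrite lerDl mulr_ge0//; case: ifP.
  by rewrite mul0r add0r mulrC.
rewrite (integral_fg_subl (f := fun y => (F y)%:E)); [|exact/measurable_EFinP|by move=> y; rewrite lee_fin].
rewrite -ge0_integralD//; [|by move=> y _; rewrite lee_fin|exact/measurable_EFinP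
  |by move=> y _; rewrite lee_fin|exact/measurable_EFinP].
by apply: eq_integral => y _; rewrite -EFinD /half_kernel /F; congr EFin; ring.
Qed.

Lemma Lnorm_sub (q : R) (a : G -> R) (x : G) : measurable_fun setT a ->
  'N[mu]_q%:E[EFin \o (fun y => a (sub x y))]%E = 'N[mu]_q%:E[EFin \o a]%E.
Proof.
move=> ma; rewrite unlock; congr poweR.
apply: (integral_fg_subl (f := fun y => (`|(a y)%:E| `^ q)%E)).
  apply: (measurableT_comp (f := @poweR R ^~ q)); first exact: measurable_poweR.
  by apply: measurableT_comp => //; exact/measurable_EFinP.
by move=> y; exact: poweR_ge0.
Qed.

End Jform_bounds.

Lemma ge0_integral_prodM d1 d2 (T1 : measurableType d1) (T2 : measurableType d2)
    (R : realType) (m1 : {sigma_finite_measure set T1 -> \bar R})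
    (m2 : {sigma_finite_measure set T2 -> \bar R}) (f : T1 -> R) (g : T2 -> R) :
  measurable_fun setT f -> measurable_fun setT g ->
  (forall x, 0 <= f x) -> (forall y, 0 <= g y) ->
  (\int[prod_sf m1 m2]_z (f z.1 * g z.2)%:E =
    (\int[m1]_x (f x)%:E) * \int[m2]_y (g y)%:E)%E.
Proof.
move=> mf mg f0 g0.
have mfg : measurable_fun [set: T1 * T2] (fun z => (f z.1 * g z.2)%:E).
  apply/measurable_EFinP; apply: measurable_funM.
    exact: (measurableT_comp mf measurable_fst).
  exact: (measurableT_comp mg measurable_snd).
rewrite [LHS](fubini_tonelli1 (m1 := m1) (m2 := m2) (fun z => (f z.1 * g z.2)%:E) mfg); last first.
  by move=> z; rewrite lee_fin mulr_ge0.
rewrite /fubini_F/= muleC -ge0_integralZl//; last 3 first.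
- exact/measurable_EFinP.
- by move=> x _; rewrite lee_fin.
- by apply: integral_ge0 => y _; rewrite lee_fin.
apply: eq_integral => x _.
under eq_integral do rewrite EFinM.
rewrite ge0_integralZl//; [by rewrite muleC|exact/measurable_EFinP
  |by move=> y _; rewrite lee_fin|by rewrite lee_fin].
Qed.

(** * Bounds for J on the whole space *)

Section whole_space_bounds.
Context (R : realType).
Local Notation leb := (@lebesgue_measure R).
Local Notation G := (space_group R).
Local Notation mu := (fg_measure G).
Local Notation sub := (@fg_sub R G).

Lemma integral_cube (f : R -> R) : measurable_fun setT f -> (forall x, 0 <= f x) ->
  (\int[leb3s R]_x (f x.1.1 * f x.1.2 * f x.2)%:E = (\int[leb]_t (f t)%:E) ^+ 3)%E.
Proof.
move=> mf f0.
have mf2 : measurable_fun [set: R * R] (fun z => f z.1 * f z.2).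
  apply: measurable_funM.
    exact: (measurableT_comp mf measurable_fst).
  exact: (measurableT_comp mf measurable_snd).
have f20 (z : R * R) : 0 <= f z.1 * f z.2 by rewrite mulr_ge0.
rewrite (@ge0_integral_prodM _ _ _ _ R (prod_sf leb leb) leb _ _ mf2 mf f20 f0).
by rewrite (@ge0_integral_prodM _ _ _ _ R leb leb _ _ mf mf f0 f0) !expeS expe0 mule1 muleA.
Qed.

Lemma integral_even (f : R -> R) : measurable_fun setT f -> (forall x, 0 <= f x) ->
  (forall x, f (- x) = f x) ->
  (\int[leb]_t (f t)%:E <= 2%:E * \int[leb]_(t in `[0%R, +oo[) (f t)%:E)%E.
Proof.
move=> mf f0 fN; pose g (t : R) := \1_(`[0, +oo[%classic) t * f t.
have mg : measurable_fun setT g by apply: measurable_funM.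
have g0 t : 0 <= g t by rewrite mulr_ge0.
have -> : (\int[leb]_(t in `[0%R, +oo[) (f t)%:E = \int[leb]_t (g t)%:E)%E.
  rewrite integral_mkcond; apply: eq_integral => t _; rewrite patchE /g indicE.
  by case: ifP => _; rewrite ?mul1r ?mul0r.
have -> : (2%:E * \int[leb]_t (g t)%:E = \int[leb]_t (g t)%:E + \int[leb]_t (g (0 - t))%:E)%E.
  rewrite ((preserving_reflect (0 : R)).2 (fun t => (g t)%:E)); last 2 first.
  - exact/measurable_EFinP.
  - by move=> y; rewrite lee_fin.
  by rewrite -mule2n mule_natl.
rewrite -ge0_integralD//; [|by move=> y _; rewrite lee_fin|exact/measurable_EFinP
  |by move=> y _; rewrite lee_fin|]; last first.
  by apply/measurable_EFinP; apply: measurableT_comp => //; exact: measurable_funB.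
apply: ge0_le_integral_nomeas => t _; first by rewrite lee_fin.
rewrite -EFinD lee_fin /g sub0r fN !indicE !mem_setE !in_itv/= !andbT oppr_ge0.
by have [t0|/ltW ->] := leP 0 t; rewrite ?mul1r ?lerDl ?lerDr ?mulr_ge0//.
Qed.

Lemma integral_inv_max_sq (r : R) : 0 < r ->
  (\int[leb]_t ((Num.max r `|t|) ^- 2)%:E <= (8 / r)%:E)%E.
Proof.
(* The 4 is the price of r + |t| <= 2 max(r, |t|), and the integral of (r + |t|)^-2 over the line is
   2 / r. *)
move=> r0; pose f (t : R) := 4 * ((r + `|t|)^-1) ^+ 2.
have mf : measurable_fun [set: measurableTypeR R] f.
  apply: measurable_funM => //; apply: measurable_funX; apply: measurableT_comp; first exact: measurable_invr.
  by apply: measurable_funD => //; exact: measurableT_comp.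
have f0 t : 0 <= f t by rewrite mulr_ge0// sqr_ge0.
apply: (@le_trans _ _ (\int[leb]_t (f t)%:E)%E).
  apply: ge0_le_integral_nomeas => t _; first by rewrite lee_fin invr_ge0 sqr_ge0.
  have M0 : 0 < Num.max r `|t| by rewrite lt_max r0.
  have rt0 : 0 < r + `|t| by rewrite ltr_pwDl.
  have rt : r + `|t| <= 2 * Num.max r `|t|.
    by rewrite mulrC mulr_natr mulr2n; apply: lerD; rewrite le_max lexx ?orbT.
  rewrite lee_fin /f exprVn -[leLHS]mul1r ler_pdivrMr ?exprn_gt0// mulrAC ler_pdivlMr ?exprn_gt0// mul1r.
  rewrite (_ : 4 * _ ^+ 2 = (2 * Num.max r `|t|) ^+ 2); last by ring.
  by rewrite lerXn2r// nnegrE ltW// mulr_gt0.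
apply: le_trans (integral_even mf f0 _) _; first by move=> x; rewrite /f normrN.
pose F (t : R) := - 4 * (r + 1 * t)^-1.
pose fp (t : R) := 4 * ((r + 1 * t)^-1) ^+ 2.
have -> : (\int[leb]_(t in `[0%R, +oo[) (f t)%:E = \int[leb]_(t in `[0%R, +oo[) (fp t)%:E)%E.
  apply: eq_integral => t; rewrite inE/= in_itv/= andbT => t0.
  by rewrite /f /fp ger0_norm// mul1r.
have nz (x : R) : 0 <= x -> r + 1 * x != 0 by move=> x0; rewrite mul1r gt_eqF// ltr_pwDl.
have dF (x : R) : 0 <= x -> is_derive x (1 : R) F (fp x).
  move=> x0; have H := @is_deriveZ _ _ _ _ (- 4) _ _ _ (is_derive_inv_affine (nz x x0)).
  by apply: (is_derive_eq H); rewrite /GRing.scale/= /fp; ring.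
rewrite (@ge0_continuous_FTC2y _ _ F _ 0).
- rewrite /F mulr0 addr0 -EFinB sub0r -EFinM lee_fin le_eqVlt; apply/orP; left; apply/eqP.
  by field; rewrite gt_eqF.
- by move=> x _; rewrite mulr_ge0// sqr_ge0.
- apply: continuous_in_subspaceT => x; rewrite inE/= in_itv/= andbT => x0.
  have cV : {for x, continuous (fun x : R => (r + 1 * x)^-1)}.
    apply: continuousV; first exact: nz.
    by apply: cvgD; [exact: cvg_cst|apply: cvgM; [exact: cvg_cst|exact: cvg_id]].
  apply: cvgM; [exact: cvg_cst|exact: (cvgM cV cV)].
- rewrite /F; rewrite [X in _ --> X](_ : 0 = - 4 * 0); last by rewrite mulr0.
  apply: cvgM; first exact: cvg_cst.
  apply/gtr0_cvgV0.
    by near=> x; rewrite mul1r ltr_pwDl.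
  apply: (@ger_cvgy _ _ _ _ (fun x => x)).
    by near=> x; rewrite mul1r lerDr ltW.
  exact: cvg_id.
- by move=> x /ltW /dF [].
- apply: cvg_at_right_filter; apply: differentiable_continuous.
  by apply/derivable1_diffP; case: (dF 0 (lexx _)).
- move=> x; rewrite in_itv/= andbT => /ltW x0.
  by rewrite derive1E; have [_ ->] := dF _ x0.
Unshelve. all: by end_near.
Qed.

Lemma coord3_le_mod (x : R3 R) : [/\ `|x.1.1| <= fg_mod (x : G) , `|x.1.2| <= fg_mod (x : G)
  & `|x.2| <= fg_mod (x : G)] :> Prop.
Proof.
split.
- exact: (@freq_coord_le R (whole_space R) x (@Ordinal 3 0 isT)).
- exact: (@freq_coord_le R (whole_space R) x (@Ordinal 3 1 isT)).
- exact: (@freq_coord_le R (whole_space R) x (@Ordinal 3 2 isT)).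
Qed.

Lemma measurable_inv_max (r : R) :
  measurable_fun [set: measurableTypeR R] (fun t : R => (Num.max r `|t|) ^- 2).
Proof.
apply: measurableT_comp; first exact: measurable_invr.
by apply: measurable_funX; apply: measurable_maxr => //; exact: measurableT_comp.
Qed.

(** With M the maximum in kappa and r = |x| / 2, one has M >= r and M >= |y_i| for each coordinate.
    So M^-6 is bounded by the product of the three factors max(r, |y_i|)^-2, and the integral by (2
    r)^3 (8 / r)^3 = 16^3: by scaling, r disappears. *)
Lemma integral_kappa3 (x : G) : (\int[mu]_y (kappa x y ^+ 3)%:E <= (16 ^+ 3)%:E)%E.
Proof.
have [x0|x0] := eqVneq (fg_mod x : R) 0.
  rewrite integral0_eq => [|y _]; first by rewrite lee_fin exprn_ge0.
  by rewrite /kappa x0 mul0r expr0n.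
have xgt : 0 < (fg_mod x : R) by rewrite lt_def x0 fg_mod_ge0.
pose r : R := fg_mod x / 2; have r0 : 0 < r by rewrite divr_gt0.
pose f (t : R) := (Num.max r `|t|) ^- 2.
have f0 t : 0 <= f t by rewrite invr_ge0 sqr_ge0.
have mf : measurable_fun [set: measurableTypeR R] f by exact: measurable_inv_max.
apply: (@le_trans _ _ (\int[leb3s R]_y (((2 * r) ^+ 3)%:E * (f y.1.1 * f y.1.2 * f y.2)%:E))%E).
  apply: ge0_le_integral_nomeas => y _; first by rewrite lee_fin exprn_ge0// kappa_ge0.
  rewrite -EFinM lee_fin /kappa -/(mmax x y).
  have rM : r <= mmax x y by rewrite /r ler_pdivrMr// mulrC fg_mod_le_mmax.
  have M0 : 0 < mmax x y by exact: lt_le_trans rM.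
  have fM t : `|t| <= fg_mod y -> (mmax x y ^+ 2)^-1 <= f t.
    have t0 : 0 < Num.max r `|t| by rewrite lt_max r0.
    move=> ty; rewrite /f lef_pV2 ?posrE ?exprn_gt0//.
    by rewrite lerXn2r ?nnegrE ?(ltW M0) ?(ltW t0)// ge_max rM/= (le_trans ty)// le_max lexx orbT.
  have [y1 y2 y3] := coord3_le_mod y.
  rewrite (_ : 2 * r = fg_mod x); last by rewrite /r mulrC divfK.
  rewrite expr_div_n ler_wpM2l ?exprn_ge0 ?fg_mod_ge0//.
  rewrite [leLHS](_ : _ = (mmax x y ^+ 2)^-1 * (mmax x y ^+ 2)^-1 * (mmax x y ^+ 2)^-1); last first.
    by move: (mmax x y ^+ 2) => m; rewrite -exprVn !exprS expr0 mulr1 mulrA.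
  have MV : 0 <= (mmax x y ^+ 2)^-1 by rewrite invr_ge0 sqr_ge0.
  by apply: ler_pM => //; [rewrite mulr_ge0|apply: ler_pM => //; exact: fM|exact: fM].
rewrite ge0_integralZl//; last 3 first.
- apply/measurable_EFinP; apply: measurable_funM.
    apply: measurable_funM.
      exact: (measurableT_comp mf (measurable_coord3 (@Ordinal 3 0 isT))).
    exact: (measurableT_comp mf (measurable_coord3 (@Ordinal 3 1 isT))).
  exact: (measurableT_comp mf (measurable_coord3 (@Ordinal 3 2 isT))).
- by move=> y _; rewrite lee_fin !mulr_ge0.
- by rewrite lee_fin exprn_ge0// mulr_ge0// ltW.
rewrite integral_cube//.
have I0 : (0 <= \int[leb]_t (f t)%:E)%E by apply: integral_ge0 => t _; rewrite lee_fin.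
have := integral_inv_max_sq r0; rewrite -/f => If.
apply: (@le_trans _ _ (((2 * r) ^+ 3)%:E * ((8 / r)%:E ^+ 3))%E).
  apply: lee_wpmul2l; first by rewrite lee_fin exprn_ge0// mulr_ge0// ltW.
  rewrite !expeS expe0 !mule1.
  by apply: lee_pmul => //; [exact: mule_ge0|apply: lee_pmul].
rewrite -EFin_expe -EFinM lee_fin le_eqVlt; apply/orP; left; apply/eqP.
by field; rewrite gt_eqF.
Qed.

Lemma integral_ball (rho : R) : 0 <= rho ->
  (\int[mu]_x ((\1_[set x : G | fg_mod x <= rho] x : R))%:E <= ((2 * rho) ^+ 3)%:E)%E.
Proof.
move=> rho0; pose f (t : R) : R := \1_(`[- rho, rho]%classic) t.
have f0 t : 0 <= f t by [].
have mf : measurable_fun [set: measurableTypeR R] f by exact: measurable_indic.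
apply: (@le_trans _ _ (\int[leb3s R]_y (f y.1.1 * f y.1.2 * f y.2)%:E)%E).
  apply: ge0_le_integral_nomeas => y _; first by rewrite lee_fin.
  rewrite lee_fin; have [yr|yr] := pselect (fg_mod (y : G) <= rho); last first.
    by rewrite indic_notin// !mulr_ge0.
  have [y1 y2 y3] := coord3_le_mod y.
  have H (t : R) : `|t| <= fg_mod (y : G) -> f t = 1.
    by move=> h; rewrite /f indic_in//= in_itv/= -ler_norml (le_trans h).
  by rewrite !H// !mulr1 indicE; case: (_ \in _).
rewrite integral_cube// (_ : \int[leb]_t (f t)%:E = (2 * rho)%:E)%E; first by rewrite -EFin_expe.
rewrite /f (integral_indic leb)// setIT.
rewrite [LHS](lebesgue_measure_itv `[- rho, rho])/= lte_fin.
case: ltP => h; first by rewrite -EFinB; congr EFin; ring.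
by have -> : rho = 0 by [lra|]; rewrite mulr0.
Qed.

Local Notation N32 a := ('N[mu]_(3 / 2)%:E[EFin \o a])%E.

Lemma hoelder3 (f g : G -> R) : measurable_fun setT f -> measurable_fun setT g ->
  (forall x, 0 <= f x) -> (forall x, 0 <= g x) -> forall M : R, 0 <= M ->
  (\int[mu]_x (f x ^+ 3)%:E <= (M ^+ 3)%:E)%E ->
  (\int[mu]_x (f x * g x)%:E <= M%:E * N32 g)%E.
Proof.
move=> mf mg f0 g0 M M0 fM.
have H : (3 : R)^-1 + (3 / 2)^-1 = 1 by field.
have := @hoelder _ _ _ mu _ _ 3 (3 / 2) mf mg _ _ H.
rewrite Lnorm1 => /(_ _ _)/[!ltr0n]/(_ isT); rewrite divr_gt0// => /(_ isT) h.
apply: (@le_trans _ _ ('N[mu]_3%:E[EFin \o f] * N32 g)%E).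
  apply: le_trans h; rewrite le_eqVlt; apply/orP; left; apply/eqP.
  by apply: eq_integral => x _; rewrite /= ger0_norm// mulr_ge0.
apply: lee_wpmul2r; first exact: Lnorm_ge0.
rewrite unlock.
have -> : (\int[mu]_x (`|(EFin \o f) x| `^ 3) = \int[mu]_x (f x ^+ 3)%:E)%E.
  by apply: eq_integral => x _; rewrite /= ger0_norm// powR_mulrn.
apply: le_trans (ge0_le_poweR _ _ fM) _; first by [].
  by apply: integral_ge0 => x _; rewrite lee_fin exprn_ge0.
by rewrite poweR_EFin -powR_mulrn// -powRrM mulfV// powRr1.
Qed.

(** 32 = 2 * 16, the factor of the half kernel times the L^3 bound on kappa. *)
Let row_bound (a : G -> R) x : measurable_fun setT a -> (forall y, 0 <= a y) ->
  (\int[mu]_y (half_kernel a x y)%:E <= 32%:E * N32 a)%E.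
Proof.
move=> ma a0.
have mk : measurable_fun setT (kappa x : G -> R).
  by apply: (measurableT_comp (@measurable_kappa R G) (g := pair x)); exact: measurable_pair1.
have ms : measurable_fun setT (fun y => a (sub x y)).
  by apply: measurableT_comp => //; exact: measurable_fg_subl.
have k0 y : 0 <= kappa x y :> R by exact: kappa_ge0.
apply: (@le_trans _ _ (2%:E * \int[mu]_y (kappa x y * a (sub x y))%:E)%E).
  rewrite -ge0_integralZl//; last 2 first.
  - by apply/measurable_EFinP; exact: measurable_funM.
  - by move=> y _; rewrite lee_fin mulr_ge0.
  apply: ge0_le_integral_nomeas => y _; first by rewrite lee_fin half_kernel_ge0.
  rewrite -EFinM lee_fin ler_wpM2l// ler_wpM2l//.
  by case: ifP.
apply: le_trans (lee_wpmul2l _ (hoelder3 mk ms k0 (fun y => a0 _) _ (integral_kappa3 x))) _ => //.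
rewrite (Lnorm_sub (3 / 2) x ma) muleA -EFinM; apply: lee_wpmul2r; first exact: Lnorm_ge0.
by rewrite lee_fin -natrM.
Qed.

(** On the support kappa is at most 2 / |eta|, and Hoelder on the ball of radius |eta| bounds the
    integral of [a] there by 2 |eta| times its L^{3/2} norm. The powers of |eta| cancel and leave 8,
    less than the 32 of the rows. *)
Let column_bound (a : G -> R) y : measurable_fun setT a -> (forall x, 0 <= a x) ->
  (\int[mu]_x (half_kernel a x y)%:E <= 32%:E * N32 a)%E.
Proof.
move=> ma a0.
have A0 : (0 <= 32%:E * N32 a)%E by rewrite mule_ge0 ?lee_fin// Lnorm_ge0.
have [y0|y0] := eqVneq (fg_mod y : R) 0.
  rewrite integral0_eq// => x _; rewrite /half_kernel y0.
  case: ifPn => [xy|_]; last by rewrite !mulr0.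
  have -> : kappa x y = 0 :> R; last by rewrite mul0r mulr0.
  have sx : fg_mod (sub x y) = 0 :> R by apply/eqP; rewrite eq_le fg_mod_ge0 xy.
  by rewrite /kappa y0 sx maxxx expr0n invr0 mulr0.
have ygt : 0 < (fg_mod y : R) by rewrite lt_def y0 fg_mod_ge0.
pose one (z : G) : R := \1_[set z : G | fg_mod z <= fg_mod y] z.
have mone : measurable_fun setT one.
  apply: measurable_indic; rewrite -[X in measurable X]setTI.
  exact: measurable_fun_le (@measurable_fg_mod R G) (measurable_cst _).
have one0 z : 0 <= one z by [].
apply: (@le_trans _ _ ((4 / fg_mod y)%:E * \int[mu]_z (one z * a z)%:E)%E).
  rewrite -(integral_fg_subr (f := fun z => (one z * a z)%:E) y); last 2 first.
  - by apply/measurable_EFinP; exact: measurable_funM.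
  - by move=> z; rewrite lee_fin mulr_ge0.
  have msr : measurable_fun setT (fun x : G => sub x y).
    apply: (measurableT_comp (@measurable_fg_sub R G) (g := pair^~ y)).
    exact: measurable_pair2.
  rewrite -ge0_integralZl//; last 3 first.
  - apply/measurable_EFinP; apply: (measurableT_comp (f := fun z => one z * a z)) msr.
    exact: measurable_funM.
  - by move=> z _; rewrite lee_fin mulr_ge0.
  - by rewrite lee_fin divr_ge0// ltW.
  apply: ge0_le_integral_nomeas => x _; first by rewrite lee_fin half_kernel_ge0.
  rewrite -EFinM lee_fin /half_kernel.
  have -> : (if fg_mod (sub x y) <= fg_mod y then a (sub x y) else 0) = one (sub x y) * a (sub x y).
    by case: ifP => h; [rewrite /one indic_in ?mul1r|rewrite /one indic_notin ?mul0r//= h].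
  rewrite mulrA ler_wpM2r ?mulr_ge0//.
  rewrite (_ : 4 / _ = 2 * (2 / fg_mod y)); last by ring.
  by rewrite ler_wpM2l// kappa_le.
have H3 : (\int[mu]_x (one x ^+ 3)%:E <= ((2 * fg_mod y) ^+ 3)%:E)%E.
  apply: le_trans (integral_ball (ltW ygt)); rewrite le_eqVlt; apply/orP; left; apply/eqP.
  by apply: eq_integral => z _; congr EFin; rewrite /one indicE; case: (_ \in _); rewrite ?expr1n ?expr0n.
apply: le_trans (lee_wpmul2l _ (hoelder3 mone ma one0 a0 _ H3)) _.
- by rewrite lee_fin divr_ge0// ltW.
- by rewrite mulr_ge0// ltW.
rewrite muleA -EFinM; apply: lee_wpmul2r; first exact: Lnorm_ge0.
rewrite lee_fin (_ : 4 / fg_mod y * (2 * fg_mod y) = 8); first by rewrite ler_nat.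
by field; rewrite gt_eqF.
Qed.

Lemma J_bounded_space (q : \bar R) : (1 <= q)%E -> J_bounded G (3 / 2)%:E 32 q.
Proof.
move=> q1 a ma a0; have q0 : (0 < q)%E by apply: lt_le_trans q1; rewrite lte_fin.
have [Aoo|] := ltP (N32 a)%E +oo%E; last first.
  (* With an infinite L^{3/2} norm the right-hand side is +oo, unless the L^q norm is 0 and the
     convention oo * 0 = 0 applies. But then [a] vanishes almost everywhere and its L^{3/2} norm is
     0. *)
  rewrite leye_eq => /eqP Aoo; rewrite Aoo.
  rewrite gt0_muley ?lte_fin// gt0_mulye ?leey// lt_neqAle Lnorm_ge0 andbT.
  apply/eqP => /esym N0.
  have a_eq0 := Lnorm_eq0_eq0 (_ : measurable_fun setT (EFin \o a)) q0 N0.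
  have : (N32 a = 0)%E.
    rewrite unlock ae0_integral ?poweR0r ?invr_eq0//.
    - apply: (measurableT_comp (f := @poweR R ^~ (3 / 2))); first exact: measurable_poweR.
      by apply: measurableT_comp => //; exact/measurable_EFinP.
    - have H : \forall x \ae mu, a x = 0.
        by apply: filterS (a_eq0 _) => [x /(_ Logic.I) []|]//; exact/measurable_EFinP.
      by apply: filterS H => x /= ->; rewrite normr0 powR0.
  by rewrite Aoo.
have A0 := Lnorm_ge0 mu (3 / 2)%:E (EFin \o a).
have Afin : (N32 a)%E \is a fin_num by rewrite ge0_fin_numE.
pose A : R := 32 * fine (N32 a)%E.
have AE : (A%:E = 32%:E * N32 a)%E by rewrite /A EFinM fineK.
apply: (@le_trans _ _ ('N[mu]_q[schur_op mu (half_kernel a) a])%E).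
  apply: ge0_Lnorm_le_nomeas => // x; first exact: Jform_ge0.
  exact: Jform_le_half.
rewrite -AE; apply: schur_bound => //.
- exact: measurable_half_kernel.
- by move=> x y; exact: half_kernel_ge0.
- by rewrite mulr_ge0// fine_ge0.
- by move=> x; rewrite AE; exact: row_bound.
- by move=> y; rewrite AE; exact: column_bound.
Qed.

End whole_space_bounds.

(** * Bounds for J on the torus *)

Section torus_bounds.
Context (R : realType).
Local Notation G := (torus_group R).
Local Notation mu := (fg_measure G).

Lemma torus_mod_ge1 (x : G) : fg_mod x != 0 :> R -> 1 <= fg_mod x :> R.
Proof.
move=> x0; rewrite -(@ler_sqr R) ?nnegrE ?fg_mod_ge0// expr1n.
rewrite [X in _ <= X ^+ 2]/fg_mod /= freq_mod_sqr.
have : exists k, Z3_coord R x k != 0.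
  apply: contrapT => H; case/negP: x0; rewrite /= /freq_mod /sqmod big1 ?sqrtr0// => k _.
  apply/eqP; rewrite expf_eq0/=; apply: contrapT => h; apply: H; exists k; exact/negP.
move=> [k xk]; rewrite /sqmod (bigD1 k)//= ler_wpDr ?sumr_ge0// => [j _|]; first exact: sqr_ge0.
move: xk; rewrite /Z3_coord intr_eq0 => xk.
rewrite -rmorphXn/= -[X in X <= _]/(1%:~R) ler_int.
by case: (coord3 x k) xk => [[|n]|n].
Qed.

(** kappa <= 2 / M, and M >= 1 as the length of a nonzero integer vector; when M = 0, division by
    zero makes kappa vanish. *)
Lemma torus_kappa_le (x y : G) : kappa x y <= 2 :> R.
Proof.
have [M0|M0] := eqVneq (mmax x y : R) 0.
  by rewrite /kappa -/(mmax x y) M0 expr0n invr0 mulr0.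
have M1 : 1 <= mmax x y :> R.
  have : mmax x y = fg_mod (fg_sub x y) :> R \/ mmax x y = fg_mod y :> R.
    by rewrite /mmax; case: leP => _; [right|left].
  by move=> [] E; rewrite E in M0 *; exact: torus_mod_ge1.
have Mgt : 0 < mmax x y :> R by exact: lt_le_trans M1.
rewrite /kappa -/(mmax x y) ler_pdivrMr ?exprn_gt0//.
apply: le_trans (fg_mod_le_mmax x y) _; rewrite ler_pM2l// expr2.
by rewrite -[X in X <= _]mul1r ler_pM2r.
Qed.

Lemma J_bounded_torus : J_bounded G 1 2 1.
Proof.
move=> a ma a0; rewrite !Lnorm1.
have -> : (\int[mu]_x `|Jform a x| = \int[mu]_x Jform a x)%E.
  by apply: eq_integral => x _; rewrite gee0_abs// Jform_ge0.
have -> : (\int[mu]_x `|(EFin \o a) x| = \int[mu]_x (a x)%:E)%E.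
  by apply: eq_integral => x _; rewrite /= ger0_norm.
rewrite -muleA -integral_fg_conv// -ge0_integralZl//; last first.
  by move=> x _; apply: integral_ge0 => y _; rewrite lee_fin mulr_ge0.
apply: ge0_le_integral_nomeas => x _; first exact: Jform_ge0.
rewrite -ge0_integralZl//; last first.
  by move=> y _; rewrite lee_fin mulr_ge0.
apply: ge0_le_integral_nomeas => y _; first by rewrite lee_fin mulr_ge0 ?kappa_ge0 ?mulr_ge0.
by rewrite -EFinM lee_fin ler_wpM2r ?mulr_ge0// torus_kappa_le.
Qed.

End torus_bounds.

(** * Injectivity of the Fourier transforms *)

Lemma ae_fine_integral d (T : measurableType d) (R : realType)
    (m : {measure set T -> \bar R}) (g : T -> \bar R) :
  measurable_fun setT g -> (\forall x \ae m, g x \is a fin_num) ->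
  (\int[m]_x (fine (g x))%:E = \int[m]_x g x)%E.
Proof.
move=> mg gfin; apply: ae_eq_integral => //.
  by apply/measurable_EFinP; apply: measurableT_comp => //; exact: fine_measurable.
by apply: filterS gfin => x gx _; rewrite fineK.
Qed.

Lemma ae_fin_num d (T : measurableType d) (R : realType)
    (m : {measure set T -> \bar R}) (g : T -> \bar R) :
  measurable_fun setT g -> (forall x, 0 <= g x)%E -> (\int[m]_x g x < +oo)%E ->
  \forall x \ae m, (g x < +oo)%E.
Proof.
move=> mg g0 goo.
have ig : m.-integrable setT g.
  by apply/integrableP; split => //; under eq_integral do rewrite gee0_abs//.
by apply: filterS (integrable_ae measurableT ig) => x /(_ Logic.I); rewrite ge0_fin_numE.
Qed.

Lemma ae_Rintegral_fin d1 d2 (T1 : measurableType d1) (T2 : measurableType d2) (R : realType)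
    (m1 : {sigma_finite_measure set T1 -> \bar R})
    (m2 : {sigma_finite_measure set T2 -> \bar R}) (f : T1 * T2 -> R) :
  measurable_fun setT f -> (\int[m1]_x \int[m2]_y (`|f (x, y)|)%:E < +oo)%E ->
  m1.-integrable setT (fun x => (\int[m2]_y f (x, y))%:E) /\
  (\int[m1]_x (\int[m2]_y f (x, y))%:E = \int[m1]_x \int[m2]_y (f (x, y))%:E)%E.
Proof.
move=> mf foo.
have mef : measurable_fun setT (EFin \o f) by exact/measurable_EFinP.
have maf : measurable_fun setT (fun z => (`|f z|)%:E).
  by apply/measurable_EFinP; exact: measurableT_comp.
have mfx x : measurable_fun setT (fun y => f (x, y)).
  by apply: (measurableT_comp mf (g := pair x)); exact: measurable_pair1.
split.
  apply/integrableP; split.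
    by apply/measurable_EFinP; exact: measurable_fun_Rintegral_param.
  apply: le_lt_trans foo; apply: ge0_le_integral_nomeas => x _; first exact: abse_ge0.
  exact: normr_Rintegral_le.
rewrite -(ae_fine_integral (m := m1) (g := fun x => \int[m2]_y (f (x, y))%:E)%E)//.
  exact: (measurable_fun_integral_param m2 mef).
have H : \forall x \ae m1, (\int[m2]_y (`|f (x, y)|)%:E < +oo)%E.
  apply: ae_fin_num => //; first exact: (measurable_fun_integral_param m2 maf).
  by move=> x; apply: integral_ge0 => y _; rewrite lee_fin.
apply: filterS H => x xoo; apply: integrable_fin_num => //.
by apply/integrableP; split => //; exact/measurable_EFinP.
Qed.

(** Inner integrals may diverge on a null set, where the real integral takes a default value.
    [ae_Rintegral_fin] shows that this does not alter the outer integral, on either side. *)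
Lemma Rintegral_fubini d1 d2 (T1 : measurableType d1) (T2 : measurableType d2) (R : realType)
    (m1 : {sigma_finite_measure set T1 -> \bar R})
    (m2 : {sigma_finite_measure set T2 -> \bar R}) (f : T1 * T2 -> R) :
  measurable_fun setT f -> (\int[m1]_x \int[m2]_y (`|f (x, y)|)%:E < +oo)%E ->
  \int[m1]_x \int[m2]_y f (x, y) = \int[m2]_y \int[m1]_x f (x, y).
Proof.
move=> mf foo.
have maf : measurable_fun setT (fun z => (`|f z|)%:E).
  by apply/measurable_EFinP; exact: measurableT_comp.
have foo' : (\int[m2]_y \int[m1]_x (`|f (x, y)|)%:E < +oo)%E.
  by rewrite -(fubini_tonelli (fun z : T1 * T2 => (`|f z|)%:E) maf (fun z => _)).
have intf : (m1 \x m2)%E.-integrable setT (EFin \o f).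
  apply/integrableP; split; first exact/measurable_EFinP.
  rewrite [ltLHS](fubini_tonelli1 (m1 := m1) (m2 := m2) (fun z => (`|f z|)%:E) maf) => [|z].
    exact: foo.
  by rewrite lee_fin.
have mf' : measurable_fun setT (fun z : T2 * T1 => f (z.2, z.1)).
  by apply: (measurableT_comp mf (g := fun z : T2 * T1 => (z.2, z.1))); exact: measurable_fun_pair.
have [_ E1] := ae_Rintegral_fin mf foo.
have [_ E2] := @ae_Rintegral_fin _ _ _ _ _ m2 m1 (fun z => f (z.2, z.1)) mf' foo'.
by rewrite /Rintegral; congr fine; rewrite -[LHS]/(\int[m1]_x (\int[m2]_y f (x, y))%:E)%E
  -[RHS]/(\int[m2]_y (\int[m1]_x f (x, y))%:E)%E E1 E2; exact: (Fubini intf).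
Qed.

Lemma integrable_Rmul_bounded d (T : measurableType d) (R : realType)
    (m : {measure set T -> \bar R}) (f g : T -> R) (K : R) :
  m.-integrable setT (EFin \o f) -> measurable_fun setT g -> (forall x, `|g x| <= K) ->
  m.-integrable setT (EFin \o (fun x => f x * g x)).
Proof.
move=> intf mg gK; have mf := (measurable_EFinP _ _).1 (measurable_int _ intf).
apply: (@le_integrable _ _ _ m setT measurableT (EFin \o (fun x => f x * g x)) (fun x => (K%:E * (f x)%:E)%E)).
- by apply/measurable_EFinP; exact: measurable_funM.
- move=> x _; rewrite /= lee_fin !normrM mulrC ler_wpM2r//.
  exact: le_trans (gK x) (ler_norm _).
- exact: integrableZl.
Qed.

(** * Fejer's kernel, and trapezoids as cosine integrals *)

Section fejer.
Context (R : realType).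
Local Notation leb := (@lebesgue_measure R).
Implicit Types (t u : R).

Lemma sin_norm_le u : `|sin u| <= `|u|.
Proof.
have H (v : R) : 0 <= v -> `|sin v| <= v.
  move=> v0.
  have [|c _] := @MVT_segment R sin cos 0 v v0 (fun x _ => is_derive_sin x).
    by apply: continuous_subspaceT => x; exact: continuous_sin.
  by rewrite sin0 !subr0 => ->; rewrite normrM (ger0_norm v0) ler_piMl// cos_max.
have [u0|u0] := leP 0 u; first by rewrite (ger0_norm u0) H.
by rewrite -normrN -sinN (ltr0_norm u0) H// oppr_ge0 ltW.
Qed.

Lemma one_sub_cos u : 1 - cos u = 2 * sin (u / 2) ^+ 2.
Proof.
have -> : cos u = cos ((u / 2) *+ 2) by congr cos; rewrite -mulr_natr divfK.
rewrite cos_mulr2n sin2cos2; ring.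
Qed.

Definition fejer u : R := (1 - cos u) * (u ^+ 2)^-1.

Lemma fejer_ge0 u : 0 <= fejer u.
Proof. by rewrite mulr_ge0 ?invr_ge0 ?sqr_ge0// subr_ge0 cos_le1. Qed.

Lemma fejer_le u : fejer u <= 2 * (Num.max 1 `|u|) ^- 2.
Proof.
have [u1|u1] := leP `|u| 1; last first.
  rewrite real_normK ?num_real// ler_wpM2r ?invr_ge0 ?sqr_ge0//.
  have := cos_geN1 u; lra.
rewrite expr1n invr1 mulr1 /fejer.
have [->|un0] := eqVneq u 0; first by rewrite expr0n invr0 mulr0.
have u2 : 0 < u ^+ 2 by rewrite exprn_even_gt0.
rewrite ler_pdivrMr// one_sub_cos ler_wpM2l//.
rewrite -[leLHS]real_normK ?num_real// -[leRHS]real_normK ?num_real//.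
rewrite lerXn2r ?nnegrE//; apply: le_trans (sin_norm_le _) _.
rewrite normrM (ger0_norm (x := 2^-1)) ?invr_ge0//; have := normr_ge0 u; lra.
Qed.

Lemma measurable_cosR : measurable_fun [set: measurableTypeR R] (@cos R).
Proof. by apply: continuous_measurable_fun; exact: continuous_cos. Qed.

Lemma measurable_sinR : measurable_fun [set: measurableTypeR R] (@sin R).
Proof. by apply: continuous_measurable_fun; exact: continuous_sin. Qed.

Lemma measurable_inv_sq : measurable_fun [set: measurableTypeR R] (fun u : R => (u ^+ 2)^-1).
Proof. by apply: measurableT_comp; [exact: measurable_invr|exact: measurable_funX]. Qed.

Lemma measurable_fejer : measurable_fun [set: measurableTypeR R] fejer.
Proof.
apply: measurable_funM; last exact: measurable_inv_sq.
by apply: measurable_funB => //; exact: measurable_cosR.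
Qed.

Lemma integrable_inv_max_sq (K : R) (f : R -> R) :
  measurable_fun [set: measurableTypeR R] f -> (forall u, `|f u| <= K * (Num.max 1 `|u|) ^- 2) ->
  leb.-integrable setT (EFin \o f).
Proof.
move=> mf fK; apply/integrableP; split; first exact/measurable_EFinP.
have K0 : 0 <= K.
  by have := le_trans (normr_ge0 _) (fK 0); rewrite normr0 max_l// expr1n invr1 mulr1.
apply: (@le_lt_trans _ _ (\int[leb]_u (K%:E * ((Num.max 1 `|u|) ^- 2)%:E))%E).
  apply: ge0_le_integral_nomeas => u _; first exact: abse_ge0.
  by rewrite /= lee_fin.
rewrite ge0_integralZl//; last first.
  by apply/measurable_EFinP; exact: measurable_inv_max.
apply: le_lt_trans (lee_wpmul2l _ (integral_inv_max_sq ltr01)) _; first by rewrite lee_fin.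
by rewrite -EFinM ltry.
Qed.

Lemma integrable_fejer : leb.-integrable setT (EFin \o fejer).
Proof.
apply: (@integrable_inv_max_sq 2); first exact: measurable_fejer.
by move=> u; rewrite ger0_norm ?fejer_ge0 ?fejer_le.
Qed.

Definition fejer_mass : R := \int[leb]_u fejer u.

(** With mass zero the kernel would vanish almost everywhere, but it is positive on ]0, pi[: cos u =
    1 would force sin u = 0 there. *)
Lemma fejer_mass_gt0 : 0 < fejer_mass.
Proof.
have m0 : 0 <= fejer_mass by apply: Rintegral_ge0 => u _; exact: fejer_ge0.
rewrite lt_neqAle m0 andbT; apply/eqP => /esym Z.
have : (\int[leb]_u (fejer u)%:E = 0)%E.
  have := integrable_fin_num measurableT integrable_fejer.
  by move/fineK => <-; rewrite -[RHS]/(0%R%:E) -Z.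
move=> I0; have H : \forall u \ae leb, (fejer u)%:E = 0%E.
  apply: integral0_ae I0; first by apply/measurable_EFinP; exact: measurable_fejer.
  by move=> u; rewrite lee_fin fejer_ge0.
case: H => N [mN N0 HN].
have : (leb (`]0%R, pi[%classic : set R) <= leb N)%E.
  apply: le_measure; rewrite ?inE//.
  move=> u /=; rewrite in_itv/= => /andP[u0 upi]; apply: HN => /= -[].
  apply/eqP; rewrite gt_eqF// mulr_gt0 ?invr_gt0 ?exprn_gt0// subr_gt0 lt_neqAle cos_le1 andbT.
  apply/eqP => c1; have := sin_gt0_pi (x := u); rewrite u0 upi => /(_ isT).
  have := cos2Dsin2 u; rewrite c1 expr1n; nra.
by rewrite N0 lebesgue_measure_itv/= lte_fin pi_gt0 sube0 lee_fin leNgt pi_gt0.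
Qed.

Lemma lebesgue_scale (t : R) (f : R -> \bar R) : 0 < t ->
  measurable_fun [set: measurableTypeR R] f -> (forall u, 0 <= f u)%E ->
  (t%:E * \int[leb]_u f (t * (u : R))%R = \int[leb]_u f u)%E.
Proof.
move=> t0 mf f0; pose phi (u : measurableTypeR R) : measurableTypeR R := t * u.
have mphi : measurable_fun setT phi by exact: measurable_funM.
pose r : {nonneg R} := NngNum (ltW t0).
have -> : (\int[leb]_u f (t * (u : R))%R = \int[pushforward leb phi]_u f u)%E.
  by rewrite [RHS](@ge0_integral_pushforward _ _ _ _ _ phi mphi leb setT f).
have mphiE : (\int[mscale r (pushforward leb phi)]_u f u = t%:E * \int[pushforward leb phi]_u f u)%E.
  by move=> m; apply: ge0_integral_mscale.
rewrite -(mphiE mphi); apply: eq_measure_integral => A mA _.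
have H := @lebesgue_measure_unique R (mscale r (pushforward leb phi)).
have {}H := H mphi; apply/esym/H => // X [[a b] _ <-].
rewrite /= /mscale/= /pushforward.
rewrite (_ : _ @^-1` _ = `]a / t, b / t]%classic); last first.
  by apply/seteqP; split => x /=; rewrite !in_itv/= ltr_pdivrMr// ler_pdivlMr// mulrC.
rewrite !lebesgue_measure_itv/= !lte_fin ltr_pM2r ?invr_gt0//; case: ifPn => // _.
  by rewrite -!EFinB -EFinM; congr EFin; field; rewrite gt_eqF.
by rewrite mule0.
Qed.

(** By the substitution y -> |t| y the integral is |t| times its value at t = 1. *)
Lemma fejer_abs t :
  leb.-integrable setT (EFin \o (fun y => (1 - cos (y * t)) * (y ^+ 2)^-1)) /\
  \int[leb]_y ((1 - cos (y * t)) * (y ^+ 2)^-1) = fejer_mass * `|t|.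
Proof.
have [->|tn0] := eqVneq t 0.
  have -> : (fun y : R => (1 - cos (y * 0)) * (y ^+ 2)^-1) = (fun=> 0).
    by apply/funext => y; rewrite mulr0 cos0 subrr mul0r.
  split; last by rewrite normr0 mulr0 /Rintegral integral0.
  exact: integrable0.
have t0 : 0 < `|t| by rewrite normr_gt0.
have E y : (1 - cos (y * t)) * (y ^+ 2)^-1 = t ^+ 2 * fejer (`|t| * y).
  rewrite /fejer [cos (`|t| * y)](_ : _ = cos (y * t)); last first.
    by have [h|h] := leP 0 t; [rewrite ger0_norm|rewrite ltr0_norm// mulNr cosN]; rewrite // mulrC.
  rewrite exprMn real_normK ?num_real// (invfM (t ^+ 2)).
  have H : t ^+ 2 / t ^+ 2 = 1 by rewrite mulfV ?sqrf_eq0.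
  by move: (1 - cos _) (y ^- 2) => A Y; rewrite -[LHS]mul1r -H; ring.
have H := lebesgue_scale t0 (f := EFin \o fejer).
have {H} : (`|t|%:E * \int[leb]_u (fejer (`|t| * u))%:E = \int[leb]_u (fejer u)%:E)%E.
  apply: H; first by apply/measurable_EFinP; exact: measurable_fejer.
  by move=> u; rewrite lee_fin fejer_ge0.
have := integrable_fin_num measurableT integrable_fejer; move/fineK => mE.
rewrite -[X in _ = X]mE -/fejer_mass => tE.
have mft : measurable_fun [set: measurableTypeR R] (fun u => fejer (`|t| * u)).
  by apply: (measurableT_comp measurable_fejer); exact: measurable_funM.
have I0 : (0 <= \int[leb]_u (fejer (`|t| * u))%:E)%E.
  by apply: integral_ge0 => u _; rewrite lee_fin fejer_ge0.
have Ifin : (\int[leb]_u (fejer (`|t| * u))%:E)%E \is a fin_num.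
  rewrite ge0_fin_numE// ltNge leye_eq; apply/eqP => Ioo.
  by move: tE; rewrite Ioo gt0_muley ?lte_fin.
have If : leb.-integrable setT (EFin \o (fun u => fejer (`|t| * u))).
  apply/integrableP; split; first exact/measurable_EFinP.
  under eq_integral do rewrite /= ger0_norm ?fejer_ge0//.
  by rewrite -ge0_fin_numE.
under [X in _ /\ X = _]eq_Rintegral do rewrite E.
rewrite (_ : (fun y => _) = fun y => t ^+ 2 * fejer (`|t| * y)); last by apply/funext => y; rewrite E.
split.
  rewrite (_ : EFin \o _ = (fun y => (t ^+ 2)%:E * (fejer (`|t| * y))%:E)%E); first exact: integrableZl.
  by apply/funext.
rewrite RintegralZl//.
have : `|t| * \int[leb]_u fejer (`|t| * u) = fejer_mass.
  by apply: EFin_inj; rewrite EFinM /Rintegral fineK.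
move=> <-; rewrite -real_normK ?num_real//; ring.
Qed.

End fejer.

Lemma Rintegral_dominated_eq0 d (T : measurableType d) (R : realType)
    (mu : {measure set T -> \bar R}) (f_ : (T -> R)^nat) (g A : T -> R) :
  (forall n, measurable_fun setT (f_ n)) -> measurable_fun setT g ->
  (forall x, f_ n x @[n --> \oo] --> g x) -> mu.-integrable setT (EFin \o A) ->
  (forall n x, `|f_ n x| <= `|A x|) -> (forall n, \int[mu]_x f_ n x = 0) ->
  \int[mu]_x g x = 0.
Proof.
move=> mf mg fg iA fA f0.
have mfE n : measurable_fun setT (EFin \o f_ n) by exact/measurable_EFinP.
have mgE : measurable_fun setT (EFin \o g) by exact/measurable_EFinP.
have iAE : mu.-integrable setT (fun x => (`|A x|)%:E) by exact: integrable_abse iA.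
have cE : \forall x \ae mu, setT x -> (EFin \o f_ n) x @[n --> \oo] --> (EFin \o g) x.
  by apply: aeW => x _; apply: cvg_EFin; [exact: nearW|exact: fg].
have bE : \forall x \ae mu, forall n, setT x -> (`|(EFin \o f_ n) x| <= (`|A x|)%:E)%E.
  by apply: aeW => x n _; rewrite lee_fin.
have [_ _ H] := dominated_convergence measurableT mfE mgE cE iAE bE.
have E0 n : (\int[mu]_x (f_ n x)%:E = 0)%E.
  have ifn : mu.-integrable setT (EFin \o f_ n).
    by apply: le_integrable iAE => // x _; rewrite /= lee_fin normr_id.
  have := integrable_fin_num measurableT ifn; move/fineK => <-.
  by rewrite -[RHS]/(0%:E); congr EFin; exact: f0.
have {}H : (0%E : \bar R) @[n --> \oo] --> (\int[mu]_x (g x)%:E)%E.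
  by move: H; under eq_fun do rewrite E0.
by rewrite /Rintegral (cvg_unique _ H (cvg_cst 0%E)).
Qed.

Section trapezoid.
Context (R : realType).
Local Notation leb := (@lebesgue_measure R).
Implicit Types (a b dl t y : R).

(* |t| is a superposition of cosines by [fejer_abs], hence so are the trapezoids,
   which approximate the indicators of intervals. *)
Definition trapezoid a b dl t : R :=
  (`|t - a| - `|t - a - dl| - `|t - b| + `|t - b - dl|) / (2 * dl).

Lemma trapezoid_le1 a b dl t : 0 < dl -> `|trapezoid a b dl t| <= 1.
Proof.
move=> d0; have d20 : 0 < 2 * dl by rewrite mulr_gt0.
rewrite normrM normfV (gtr0_norm d20) ler_pdivrMr// mul1r.
have H s : `| `|s| - `|s - dl| | <= dl.
  by apply: le_trans (ler_dist_dist _ _) _; rewrite opprB addrC subrK gtr0_norm.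
have := H (t - a); have := H (t - b).
move: (`|t - a|) (`|t - a - dl|) (`|t - b|) (`|t - b - dl|) => u1 u2 u3 u4.
rewrite !ler_norml => /andP[h1 h2] /andP[h3 h4]; apply/andP; split; lra.
Qed.

Lemma trapezoid_out a b dl t : 0 < dl -> a <= b -> t <= a -> trapezoid a b dl t = 0.
Proof.
move=> d0 ab ta; rewrite /trapezoid !ler0_norm; [|lra..].
by rewrite (_ : _ + _ = 0) ?mul0r//; ring.
Qed.

Lemma trapezoid_plateau a b dl t : 0 < dl -> a + dl <= t -> t <= b ->
  trapezoid a b dl t = 1.
Proof.
move=> d0 at_ tb; rewrite /trapezoid ger0_norm; last lra.
rewrite ger0_norm; last lra.
rewrite ler0_norm; last lra.
rewrite ler0_norm; last lra.
by field; rewrite gt_eqF.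
Qed.

Lemma trapezoid_out_right a b dl t : 0 < dl -> a <= b -> b + dl <= t -> trapezoid a b dl t = 0.
Proof.
move=> d0 ab ta; rewrite /trapezoid !ger0_norm; [|lra..].
by rewrite (_ : _ + _ = 0) ?mul0r//; ring.
Qed.

(** Both ramps lie to the right, of a and of b respectively, so the trapezoid is 0 at a and 1 at b
    for small dl. The limit is a half-open interval, and these are stable under intersection and
    generate the Borel sets. *)
Lemma trapezoid_cvg a b t : a <= b ->
  trapezoid a b (n.+1%:R^-1) t @[n --> \oo] --> (\1_(`]a, b]%classic) t : R).
Proof.
move=> ab; have d0 n : 0 < (n.+1%:R^-1 : R) by rewrite invr_gt0.
have small (e : R) : 0 < e -> \forall n \near \oo, n.+1%:R^-1 <= e.
  move=> e0; near=> n; apply: ltW; near: n; exact: near_infty_natSinv_lt (PosNum e0).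
apply: cvg_near_cst.
have [ta|ta] := leP t a.
  apply: nearW => n; rewrite trapezoid_out// indic_notin//= in_itv/= => /andP[h _].
  by move: (lt_le_trans h ta); rewrite ltxx.
have [tb|tb] := leP t b.
  rewrite indic_in/=; last by rewrite in_itv/= ta.
  have ta0 : 0 < t - a by rewrite subr_gt0.
  apply: filterS (small _ ta0) => n /=; move: (n.+1%:R^-1 : R) (d0 n) => e e0 h.
  by apply: trapezoid_plateau => //; lra.
have tb0 : 0 < t - b by rewrite subr_gt0.
apply: filterS (small _ tb0) => n /=; move: (n.+1%:R^-1 : R) (d0 n) => e e0 h.
rewrite trapezoid_out_right//; last lra.
by rewrite indic_notin//= in_itv/= => /andP[_]; rewrite leNgt tb.
Unshelve. all: by end_near.
Qed.

(** Up to a constant, the cosine transform of the trapezoid around its centre (a + b + dl) / 2: the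
    four cosines coming from its four absolute values combine by [trapezoid_trig]. The two sines
    make the weight bounded near 0, and y^-2 makes it integrable at infinity. *)
Definition trapezoid_weight a b dl y : R :=
  4 * sin (y * (dl / 2)) * sin (y * ((a - b) / 2)) * (y ^+ 2)^-1.

Lemma measurable_trapezoid_weight a b dl :
  measurable_fun [set: measurableTypeR R] (trapezoid_weight a b dl).
Proof.
apply: measurable_funM; last exact: measurable_inv_sq.
apply: measurable_funM; [apply: measurable_funM => //|];
  by apply: (measurableT_comp (@measurable_sinR R)); exact: measurable_funM.
Qed.

Lemma integrable_trapezoid_weight a b dl :
  leb.-integrable setT (EFin \o trapezoid_weight a b dl).
Proof.
apply: (@integrable_inv_max_sq _ (4 + `|dl| * `|a - b|)).
  exact: measurable_trapezoid_weight.
move=> y; rewrite /trapezoid_weight !normrM (ger0_norm (x := 4))// normfV.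
rewrite (ger0_norm (sqr_ge0 y)).
have K0 : 0 <= `|dl| * `|a - b| by rewrite mulr_ge0.
have s1 := sin_max (y * (dl / 2)); have s2 := sin_max (y * ((a - b) / 2)).
have [y1|y1] := leP 1 `|y|.
  apply: ler_pM; rewrite ?mulr_ge0 ?invr_ge0 ?sqr_ge0//; last first.
    by rewrite real_normK ?num_real.
  apply: (@le_trans _ _ 4); last by rewrite lerDl.
  rewrite -[leRHS]mulr1; apply: ler_pM; rewrite ?mulr_ge0//.
  by rewrite -[leRHS]mulr1; apply: ler_pM.
rewrite expr1n invr1 mulr1.
have [->|yn0] := eqVneq y 0.
  by rewrite expr0n/= invr0 mulr0 addr_ge0.
have y2 : 0 < y ^+ 2 by rewrite exprn_even_gt0.
rewrite ler_pdivrMr//.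
have t1 := sin_norm_le (y * (dl / 2)); have t2 := sin_norm_le (y * ((a - b) / 2)).
apply: (@le_trans _ _ (4 * `|y * (dl / 2)| * `|y * ((a - b) / 2)|)).
  by apply: ler_pM; rewrite ?mulr_ge0//; apply: ler_pM.
rewrite !normrM (ger0_norm (x := 2^-1))// -[leRHS]/(_ * _) -(real_normK (num_real y)).
move: (`|dl|) (`|a - b|) K0 (`|y|) (normr_ge0 y) => u v uv0 w w0.
rewrite (_ : 4 * _ * _ = u * v * w ^+ 2); last by field.
by rewrite ler_wpM2r ?sqr_ge0// lerDr.
Qed.

Lemma trapezoid_trig (P Q S : R) :
  cos (S - Q + P) - cos (S - Q - P) - cos (S + Q + P) + cos (S + Q - P) =
  4 * sin P * sin Q * cos S.
Proof. by rewrite !(cosB, cosD, sinB, sinD); ring. Qed.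

Lemma trapezoid_integral a b dl t : 0 < dl ->
  \int[leb]_y (trapezoid_weight a b dl y * cos (y * (t - (a + b + dl) / 2))) =
  - (2 * dl * fejer_mass R) * trapezoid a b dl t.
Proof.
move=> d0; pose f s y := (1 - cos (y * s)) * (y ^+ 2)^-1.
have [i1 e1] := fejer_abs (t - a); have [i2 e2] := fejer_abs (t - a - dl).
have [i3 e3] := fejer_abs (t - b); have [i4 e4] := fejer_abs (t - b - dl).
transitivity (\int[leb]_y (((f (t - a - dl) y - f (t - a) y) + f (t - b) y) - f (t - b - dl) y)).
  apply: eq_Rintegral => y _; rewrite /f /trapezoid_weight.
  have := trapezoid_trig (y * (dl / 2)) (y * ((a - b) / 2)) (y * (t - (a + b + dl) / 2)).
  have -> : y * (t - (a + b + dl) / 2) - y * ((a - b) / 2) + y * (dl / 2) = y * (t - a) by field.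
  have -> : y * (t - (a + b + dl) / 2) - y * ((a - b) / 2) - y * (dl / 2) = y * (t - a - dl) by field.
  have -> : y * (t - (a + b + dl) / 2) + y * ((a - b) / 2) + y * (dl / 2) = y * (t - b) by field.
  have -> : y * (t - (a + b + dl) / 2) + y * ((a - b) / 2) - y * (dl / 2) = y * (t - b - dl) by field.
  move: (y ^+ 2)^-1 => Y H.
  rewrite mulrAC -H; ring.
have i21 := integrableB measurableT i2 i1.
have i213 := integrableD measurableT i21 i3.
rewrite (RintegralB measurableT i213 i4) (RintegralD measurableT i21 i3).
rewrite (RintegralB measurableT i2 i1).
rewrite e1 e2 e3 e4 /trapezoid; field; rewrite gt_eqF//.
Qed.

End trapezoid.

(** * Integrable functions with vanishing Fourier integrals *)

Section null_transform.
Context d (T : measurableType d) (R : realType).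
Context (mu : {sigma_finite_measure set T -> \bar R}).
Context (q : 'I_3 -> T -> R) (mq : forall k, measurable_fun setT (q k)).
Local Notation leb := (@lebesgue_measure R).
Implicit Types (A : T -> R) (x : 'I_3 -> R).

Definition phase x (c : R) (xi : T) : R := \sum_(k < 3) x k * q k xi + c.

(** The free phase c includes the sines. It also makes the class stable under multiplication by
    cosines of a coordinate, hence by trapezoids and finally by indicators of Borel sets. *)
Definition null_transform A : Prop :=
  mu.-integrable setT (EFin \o A) /\ forall x c, \int[mu]_xi (A xi * cos (phase x c xi)) = 0.

Lemma measurable_cos_phase x c : measurable_fun setT (fun xi => cos (phase x c xi)).
Proof.
apply: (measurableT_comp (@measurable_cosR R)); apply: measurable_funD => //.
by apply: measurable_sum => k; exact: measurable_funM.
Qed.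

Lemma integrable_cos_phase A x c : mu.-integrable setT (EFin \o A) ->
  mu.-integrable setT (EFin \o (fun xi => A xi * cos (phase x c xi))).
Proof.
move=> iA; apply: (integrable_Rmul_bounded iA (K := 1)); first exact: measurable_cos_phase.
by move=> xi; exact: cos_max.
Qed.

Lemma integrable_indicM A (E : set T) : measurable E -> mu.-integrable setT (EFin \o A) ->
  mu.-integrable setT (EFin \o (fun xi => A xi * \1_E xi)).
Proof.
move=> mE iA; apply: (integrable_Rmul_bounded iA (K := 1)); first exact: measurable_indic.
by move=> xi; rewrite indicE; case: (_ \in _); rewrite ?normr1 ?normr0.
Qed.

Lemma phase_shift x c k y m xi :
  cos (phase x c xi) * cos (y * (q k xi - m)) =
  2^-1 * cos (phase (fun j => x j + (if j == k then y else 0)) (c - y * m) xi)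
  + 2^-1 * cos (phase (fun j => x j - (if j == k then y else 0)) (c + y * m) xi).
Proof.
have sum1 : \sum_(j < 3) (if j == k then y else 0) * q j xi = y * q k xi.
  rewrite (bigD1 k)//= eqxx big1 ?addr0// => j /negbTE ->; exact: mul0r.
rewrite [phase (fun j => x j + _) _ _](_ : _ = phase x c xi + y * (q k xi - m)); last first.
  by rewrite /phase; under eq_bigr do rewrite mulrDl; rewrite big_split/= sum1; ring.
rewrite [phase (fun j => x j - _) _ _](_ : _ = phase x c xi - y * (q k xi - m)); last first.
  by rewrite /phase; under eq_bigr do rewrite mulrBl; rewrite sumrB/= sum1; ring.
by rewrite cosD cosB; field.
Qed.

(** The trapezoid is replaced by its cosine integral and the integrals are exchanged. For each y the
    product of two cosines is a sum of two cosines of shifted phases, against which A integrates to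
    0. *)
Lemma null_transform_trapezoid A x c k a b dl : 0 < dl -> null_transform A ->
  \int[mu]_xi (A xi * cos (phase x c xi) * trapezoid a b dl (q k xi)) = 0.
Proof.
move=> d0 [iA A0]; pose m := (a + b + dl) / 2.
have iA' := integrable_cos_phase x c iA.
have mA : measurable_fun setT A := (measurable_EFinP _ _).1 (measurable_int _ iA).
pose F (z : T * measurableTypeR R) := A z.1 * cos (phase x c z.1) *
  (trapezoid_weight a b dl z.2 * cos (z.2 * (q k z.1 - m))).
have mF : measurable_fun setT F.
  apply: measurable_funM.
    apply: (measurableT_comp (f := fun xi => A xi * cos (phase x c xi)) _ measurable_fst).
    by apply: measurable_funM => //; exact: measurable_cos_phase.
  apply: measurable_funM.
    exact: (measurableT_comp (measurable_trapezoid_weight a b dl) measurable_snd).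
  apply: (measurableT_comp (@measurable_cosR R)); apply: measurable_funM => //.
  by apply: measurable_funB => //; exact: measurableT_comp.
have wfin : (\int[leb]_y (`|trapezoid_weight a b dl y|)%:E < +oo)%E.
  by have /integrableP[_] := integrable_trapezoid_weight a b dl.
have Foo : (\int[mu]_xi \int[leb]_y (`|F (xi, y)|)%:E < +oo)%E.
  have Wfin : (\int[leb]_y (`|trapezoid_weight a b dl y|)%:E)%E \is a fin_num.
    by rewrite ge0_fin_numE// integral_ge0// => y _; rewrite lee_fin.
  apply: (@le_lt_trans _ _ (\int[mu]_xi ((`|A xi|)%:E * \int[leb]_y (`|trapezoid_weight a b dl y|)%:E))%E).
    apply: ge0_le_integral_nomeas => xi _.
      by apply: integral_ge0 => y _; rewrite lee_fin.
    rewrite -ge0_integralZl//; last first.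
      apply/measurable_EFinP; apply: measurableT_comp => //.
      exact: measurable_trapezoid_weight.
    apply: ge0_le_integral_nomeas => y _; first by rewrite lee_fin.
    rewrite -EFinM lee_fin /F !normrM; apply: ler_pM; rewrite ?mulr_ge0//.
      by rewrite -[leRHS]mulr1 ler_wpM2l// cos_max.
    by rewrite -[leRHS]mulr1 ler_wpM2l// cos_max.
  rewrite -(fineK Wfin); under eq_integral do rewrite muleC.
  rewrite ge0_integralZl//; last 2 first.
  - by apply/measurable_EFinP; exact: measurableT_comp.
  - by rewrite lee_fin fine_ge0// integral_ge0// => y _; rewrite lee_fin.
  by rewrite lte_mul_pinfty//; [rewrite lee_fin fine_ge0// integral_ge0// => y _; rewrite lee_fin
    |have /integrableP[_] := iA].
have := Rintegral_fubini (m1 := mu) (m2 := leb) mF Foo.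
have -> : \int[leb]_y \int[mu]_xi F (xi, y) = 0.
  rewrite (_ : (fun y => _) = fun=> 0); first by rewrite /Rintegral integral0.
  apply/funext => y; rewrite /F/=.
  pose x1 j := x j + (if j == k then y else 0).
  pose x2 j := x j - (if j == k then y else 0).
  pose f1 xi := A xi * cos (phase x1 (c - y * m) xi).
  pose f2 xi := A xi * cos (phase x2 (c + y * m) xi).
  have j1 : mu.-integrable setT (EFin \o f1) by exact: integrable_cos_phase.
  have j2 : mu.-integrable setT (EFin \o f2) by exact: integrable_cos_phase.
  rewrite (_ : (fun xi => _) = fun xi => (trapezoid_weight a b dl y / 2) * (f1 xi + f2 xi)); last first.
    apply/funext => xi; have := phase_shift x c k y m xi.
    rewrite -/x1 -/x2 /f1 /f2; move: (cos (phase x1 _ _)) (cos (phase x2 _ _)) => u1 u2.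
    move: (cos (phase x c xi)) (cos (y * _)) => v1 v2 H.
    transitivity (trapezoid_weight a b dl y * (A xi * (v1 * v2))); first by ring.
    by rewrite H; field.
  have j12 := integrableD measurableT j1 j2.
  rewrite (RintegralZl (f := fun xi => f1 xi + f2 xi) _ measurableT j12).
  by rewrite (RintegralD measurableT j1 j2) /f1 /f2 !A0 addr0 mulr0.
have E xi : \int[leb]_y F (xi, y) = - (2 * dl * fejer_mass R) *
    (A xi * cos (phase x c xi) * trapezoid a b dl (q k xi)).
  rewrite /F/= RintegralZl//; last first.
    apply: (integrable_Rmul_bounded (integrable_trapezoid_weight a b dl) (K := 1)).
      apply: (measurableT_comp (@measurable_cosR R)); exact: measurable_funM.
    by move=> y; exact: cos_max.
  by rewrite trapezoid_integral//; ring.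
under eq_Rintegral do rewrite E.
rewrite RintegralZl//; last first.
  apply: (integrable_Rmul_bounded iA' (K := 1)); last by move=> xi; exact: trapezoid_le1.
  rewrite /trapezoid; apply: measurable_funM => //.
  have mn (s : R) : measurable_fun setT (fun xi => `|q k xi - s|).
    by apply: measurableT_comp => //; exact: measurable_funB.
  have mn2 (s s' : R) : measurable_fun setT (fun xi => `|q k xi - s - s'|).
    by apply: measurableT_comp => //; apply: measurable_funB => //; exact: measurable_funB.
  by apply: measurable_funD => //; apply: measurable_funB => //; apply: measurable_funB.
move/eqP; rewrite mulf_eq0 oppr_eq0 !mulf_eq0 (gt_eqF d0) (gt_eqF (fejer_mass_gt0 R)).
by rewrite pnatr_eq0/= => /eqP.
Qed.

Lemma null_transform_itv A k a b : null_transform A ->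
  null_transform (fun xi => A xi * \1_(q k @^-1` `]a, b]%classic) xi).
Proof.
move=> nA; have [iA A0] := nA.
have mA : measurable_fun setT A := (measurable_EFinP _ _).1 (measurable_int _ iA).
have mE : measurable (q k @^-1` `]a, b]%classic).
  by rewrite -[X in measurable X]setTI; exact: mq.
split=> [|x c]; first exact: integrable_indicM.
have [ba|ab] := ltP b a.
  rewrite (_ : (fun xi => _) = fun=> 0); first by rewrite /Rintegral integral0.
  apply/funext => xi; rewrite indic_notin ?mulr0 ?mul0r//= in_itv/= => /andP[h1 h2].
  by have := lt_le_trans h1 (le_trans h2 (ltW ba)); rewrite ltxx.
pose f n xi := A xi * cos (phase x c xi) * trapezoid a b (n.+1%:R^-1) (q k xi).
have d0 n : 0 < (n.+1%:R^-1 : R) by rewrite invr_gt0.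
have iA' := integrable_cos_phase x c iA.
have mf n : measurable_fun setT (f n).
  apply: measurable_funM; first by apply: measurable_funM => //; exact: measurable_cos_phase.
  rewrite /trapezoid; apply: measurable_funM => //.
  have mn (s : R) : measurable_fun setT (fun xi => `|q k xi - s|).
    by apply: measurableT_comp => //; exact: measurable_funB.
  have mn2 (s s' : R) : measurable_fun setT (fun xi => `|q k xi - s - s'|).
    by apply: measurableT_comp => //; apply: measurable_funB => //; exact: measurable_funB.
  by apply: measurable_funD => //; apply: measurable_funB => //; apply: measurable_funB.
pose g xi := A xi * \1_(q k @^-1` `]a, b]%classic) xi * cos (phase x c xi).
have mg : measurable_fun setT g.
  by apply: measurable_funM; [exact: measurable_funM|exact: measurable_cos_phase].
have fg xi : f n xi @[n --> \oo] --> g xi.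
  rewrite /g mulrAC; apply: cvgM; first exact: cvg_cst.
  exact: trapezoid_cvg.
apply: (Rintegral_dominated_eq0 mf mg fg iA) => n; last exact: null_transform_trapezoid.
move=> xi; rewrite /f normrM -[leRHS]mulr1; apply: ler_pM; rewrite ?mulr_ge0//.
  by rewrite normrM -[leRHS]mulr1 ler_wpM2l// cos_max.
exact: trapezoid_le1.
Qed.

(** By the pi-lambda theorem: the sets over whose preimage the given function integrates to 0 are
    closed under complements and disjoint unions. The map [phi] is arbitrary so as to serve for one
    coordinate and for several. *)
Lemma null_transform_dynkin A d' (T' : measurableType d') (phi : T -> T') (G : set (set T')) :
  measurable_fun setT phi -> d'.-measurable = <<s G >> -> setI_closed G ->
  null_transform A ->
  (forall E, G E -> null_transform (fun xi => A xi * \1_(phi @^-1` E) xi)) ->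
  forall E, measurable E -> null_transform (fun xi => A xi * \1_(phi @^-1` E) xi).
Proof.
move=> mphi mG GI nA GA E mE; have [iA A0] := nA.
have mpre F : measurable F -> measurable (phi @^-1` F).
  by move=> mF; rewrite -[X in measurable X]setTI; exact: mphi.
split=> [|x c]; first by apply: integrable_indicM => //; exact: mpre.
pose f xi := A xi * cos (phase x c xi).
have iF : mu.-integrable setT (EFin \o f) by exact: integrable_cos_phase.
have fE F : \int[mu]_xi (A xi * \1_(phi @^-1` F) xi * cos (phase x c xi)) =
    \int[mu]_(xi in phi @^-1` F) f xi.
  rewrite [RHS]Rintegral_mkcond; apply: eq_Rintegral => xi _; rewrite patchE indicE /f.
  by case: ifP => _; rewrite ?mulr1 ?mulr0 ?mul0r.
rewrite fE; have : <<s G >> E by rewrite -mG.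
move: E {mE}; apply: (@dynkin_induction _ _ G (fun E => \int[mu]_(xi in phi @^-1` E) f xi = 0)) => //.
- by rewrite preimage_setT; exact: A0.
- by move=> F GF; rewrite -fE; have [_] := GA F GF; apply.
- move=> F mF F0; rewrite preimage_setC.
  have : \int[mu]_xi f xi = 0 by exact: A0.
  rewrite -(setvU (phi @^-1` F)) Rintegral_setU//; last 4 first.
  + by apply: measurableC; exact: mpre.
  + exact: mpre.
  + by rewrite setvU.
  + by rewrite disj_set2E setICl.
  by rewrite F0 addr0.
- move=> F mF tF F0; rewrite preimage_bigcup /Rintegral.
  rewrite integral_bigcup//; last 3 first.
  + apply/trivIsetP => i j _ _ ij; rewrite -preimage_setI.
    by move/trivIsetP : tF => /(_ _ _ Logic.I Logic.I ij) ->; rewrite preimage_set0.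
  + by move=> k; exact: mpre.
  + by apply: integrableS iF => //; apply: bigcup_measurable => k _; exact: mpre.
  rewrite eseries0// => i _ _.
  have iFi : mu.-integrable (phi @^-1` F i) (EFin \o f) by apply: integrableS iF => //; exact: mpre.
  have := integrable_fin_num (mpre _ (mF i)) iFi; move/fineK => <-.
  by rewrite -[RHS]/(0%:E); congr EFin; exact: F0.
Qed.

Lemma null_transform_borel A k : null_transform A -> forall E : set (measurableTypeR R), measurable E ->
  null_transform (fun xi => A xi * \1_(q k @^-1` E) xi).
Proof.
move=> nA; apply: (null_transform_dynkin (G := @ocitv R)) => //; first exact: ocitvI.
by move=> _ [[a b] _ <-]; exact: null_transform_itv.
Qed.

(** The indicator of a rectangle is a product of two indicators, applied one after the other. The
    second acts on a function already cut off by the first, hence the quantification over all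
    [B]. *)
Lemma null_transform_prod A d1 d2 (T1 : measurableType d1) (T2 : measurableType d2)
    (phi1 : T -> T1) (phi2 : T -> T2) :
  measurable_fun setT phi1 -> measurable_fun setT phi2 ->
  (forall B, null_transform B -> forall E, measurable E -> null_transform (fun xi => B xi * \1_(phi1 @^-1` E) xi)) ->
  (forall B, null_transform B -> forall E, measurable E -> null_transform (fun xi => B xi * \1_(phi2 @^-1` E) xi)) ->
  null_transform A -> forall E, measurable E ->
  null_transform (fun xi => A xi * \1_((fun xi => (phi1 xi, phi2 xi)) @^-1` E) xi).
Proof.
move=> m1 m2 n1 n2 nA.
apply: (null_transform_dynkin (G := [set A `*` B | A in measurable & B in measurable])) => //.
- exact: measurable_fun_pair.
- by rewrite measurable_prod_measurableType.
- move=> _ _ [X1 mX1 [X2 mX2 <-]] [Y1 mY1 [Y2 mY2 <-]]; rewrite -setXI.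
  by exists (X1 `&` Y1); [exact: measurableI|exists (X2 `&` Y2); [exact: measurableI|]].
- move=> _ [E1 mE1 [E2 mE2 <-]].
  rewrite (_ : (fun xi => _) = fun xi => A xi * \1_(phi1 @^-1` E1) xi * \1_(phi2 @^-1` E2) xi); last first.
    apply/funext => xi; rewrite -mulrA; congr (_ * _); rewrite -[RHS]/((\1_(_ @^-1` E1) \* \1_(_ @^-1` E2)) xi) -indicI.
    by [].
  by apply: n2 => //; exact: n1.
Qed.

End null_transform.

(** Three coordinates reach every Borel set E of R^3. The class applied to A 1_E with phase zero
    says that the integral of A over E vanishes. *)
Lemma null_transform_eq0 (R : realType) (A : R3 R -> R) :
  null_transform (leb3s R) (fun k (xi : R3 R) => coord3 xi k : R) A ->
  \forall xi \ae leb3s R, A xi = 0.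
Proof.
pose q k (xi : R3 R) : R := coord3 xi k.
have mq k : measurable_fun setT (q k) by exact: measurable_coord3.
move=> nA; have [iA _] := nA.
have b k B := @null_transform_borel _ _ _ (leb3s R) q mq B k.
have b01 := fun B nB => @null_transform_prod _ _ _ (leb3s R) q mq B _ _ _ _ _ _
  (mq (@Ordinal 3 0 isT)) (mq (@Ordinal 3 1 isT)) (b _) (b _) nB.
have m01 : measurable_fun setT (fun xi => (q (@Ordinal 3 0 isT) xi, q (@Ordinal 3 1 isT) xi)).
  by apply: measurable_fun_pair; exact: mq.
have b012 := @null_transform_prod _ _ _ (leb3s R) q mq A _ _ _ _ _ _
  m01 (mq (@Ordinal 3 2 isT)) b01 (b _) nA.
have H : ae_eq (leb3s R) setT (EFin \o A) (cst 0%E).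
  apply: integral_ae_eq => // E _ mE.
  have [iAE /(_ (fun=> 0) 0)] := b012 E mE.
  have -> : (fun xi => (q (@Ordinal 3 0 isT) xi, q (@Ordinal 3 1 isT) xi, q (@Ordinal 3 2 isT) xi)) @^-1` E = E.
    by apply/seteqP; split => [[[? ?] ?]|[[? ?] ?]].
  rewrite (_ : (fun xi => _) = fun xi => A xi * \1_E xi); last first.
    by apply/funext => xi; rewrite /phase big1 ?addr0 ?cos0 ?mulr1// => k _; rewrite mul0r.
  move=> E0; rewrite integral0 integral_mkcond.
  have -> : (EFin \o A) \_ E = EFin \o (fun xi => A xi * \1_E xi).
    by apply/funext => xi; rewrite patchE /= indicE; case: ifP => _; rewrite ?mulr1 ?mulr0.
  have iAE' := integrable_indicM mE iA.
  have := integrable_fin_num measurableT iAE'; move/fineK => <-.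
  by rewrite -[RHS]/(0%:E); congr EFin.
by apply: filterS H => xi /(_ Logic.I) [].
Qed.

Lemma Rintegral_prodM d1 d2 (T1 : measurableType d1) (T2 : measurableType d2)
    (R : realType) (m1 : {sigma_finite_measure set T1 -> \bar R})
    (m2 : {sigma_finite_measure set T2 -> \bar R}) (f : T1 -> R) (g : T2 -> R) :
  m1.-integrable setT (EFin \o f) -> m2.-integrable setT (EFin \o g) ->
  (prod_sf m1 m2).-integrable setT (EFin \o (fun z => f z.1 * g z.2)) /\
  \int[prod_sf m1 m2]_z (f z.1 * g z.2) = (\int[m1]_x f x) * \int[m2]_y g y.
Proof.
move=> i1 i2.
have mf : measurable_fun setT f := (measurable_EFinP _ _).1 (measurable_int _ i1).
have mg : measurable_fun setT g := (measurable_EFinP _ _).1 (measurable_int _ i2).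
have mfg : measurable_fun [set: T1 * T2] (fun z => f z.1 * g z.2).
  apply: measurable_funM.
    exact: (measurableT_comp mf measurable_fst).
  exact: (measurableT_comp mg measurable_snd).
have i12 : (prod_sf m1 m2).-integrable setT (EFin \o (fun z => f z.1 * g z.2)).
  apply/integrableP; split; first exact/measurable_EFinP.
  have := @ge0_integral_prodM _ _ _ _ R m1 m2 (fun x => `|f x|) (fun y => `|g y|).
  move=> /(_ (measurableT_comp _ mf) (measurableT_comp _ mg)) H.
  rewrite (_ : \int[prod_sf m1 m2]_z _ = (\int[m1]_x (`|f x|)%:E) * (\int[m2]_y (`|g y|)%:E))%E.
    have /integrableP[_ f1] := i1; have /integrableP[_ g1] := i2.
    apply: lte_mul_pinfty => //; first by apply: integral_ge0 => x _; rewrite lee_fin.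
    by rewrite ge0_fin_numE//; apply: integral_ge0 => x _; rewrite lee_fin.
  rewrite -H//; apply: eq_integral => z _; by rewrite /= normrM.
split=> //.
rewrite /Rintegral [X in fine X](_ : _ = (\int[m1]_x f x)%:E * (\int[m2]_y g y)%:E)%E//.
rewrite -[LHS](integral12_prod_meas1 (m1 := m1) (m2 := m2) i12) /fubini_F/=.
under eq_integral do under eq_integral do rewrite EFinM.
have fi1 := integrable_fin_num measurableT i1; have fi2 := integrable_fin_num measurableT i2.
rewrite /Rintegral !fineK//.
under eq_integral do rewrite integralZl//.
rewrite -{1}(fineK fi2).
under eq_integral do rewrite muleC.
by rewrite integralZl// fineK// muleC.
Qed.

(** * Orthogonality on the torus cell and Fourier inversion *)

Section orthogonality.
Context (R : realType).
Local Notation leb := (@lebesgue_measure R).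
Local Notation twopi := (2 * pi : R).
Implicit Types (k : int) (m : Z3).

Lemma sincos_int2pi k : sin (k%:~R * twopi) = 0 /\ cos (k%:~R * twopi) = 1.
Proof.
have H (n : nat) : sin (n%:R * twopi) = 0 /\ cos (n%:R * twopi) = 1.
  elim: n => [|n [s c]]; first by rewrite mul0r sin0 cos0.
  have E : n.+1%:R * twopi = n%:R * twopi + pi *+ 2.
    by rewrite -mulr_natl -natr1; ring.
  rewrite E; move: (@cos2pi R) (@sin2pi R); move: (pi *+ 2) => p2 c2 s2.
  by rewrite sinD cosD s c c2 s2; split; ring.
case: k => n; first exact: H.
rewrite NegzE rmorphN/= mulNr sinN cosN; have [-> ->] := H n.+1.
by rewrite oppr0.
Qed.

Definition cell_cos k (t : R) : R := \1_(`[0, twopi]%classic) t * cos (k%:~R * t).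
Definition cell_sin k (t : R) : R := \1_(`[0, twopi]%classic) t * sin (k%:~R * t).

Let twopi_gt0 : 0 < twopi. Proof. by rewrite mulr_gt0// pi_gt0. Qed.

Let integrable_cell (f : R -> R) : measurable_fun [set: measurableTypeR R] f -> (forall t, `|f t| <= 1) ->
  leb.-integrable setT (EFin \o (fun t => \1_(`[0, twopi]%classic) t * f t)).
Proof.
move=> mf f1.
have i1 : leb.-integrable setT (EFin \o (\1_(`[0, twopi]%classic) : R -> R)).
  apply/integrableP; split; first by apply/measurable_EFinP; exact: measurable_indic.
  rewrite (_ : \int[leb]_t _ = \int[leb]_t (\1_(`[0, twopi]%classic) t)%:E)%E; last first.
    by apply: eq_integral => t _; rewrite /= ger0_norm.
  rewrite (integral_indic leb)// setIT.
  by rewrite [ltLHS](lebesgue_measure_itv `[0, twopi])/= lte_fin twopi_gt0 -EFinB ltry.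
exact: (integrable_Rmul_bounded i1 mf f1).
Qed.

Lemma integrable_cell_cos k : leb.-integrable setT (EFin \o cell_cos k).
Proof.
apply: integrable_cell; last by move=> t; exact: cos_max.
by apply: (measurableT_comp (@measurable_cosR R)); exact: measurable_funM.
Qed.

Lemma integrable_cell_sin k : leb.-integrable setT (EFin \o cell_sin k).
Proof.
apply: integrable_cell; last by move=> t; exact: sin_max.
by apply: (measurableT_comp (@measurable_sinR R)); exact: measurable_funM.
Qed.

Let cellE (f : R -> R) : \int[leb]_t (\1_(`[0, twopi]%classic) t * f t) =
  \int[leb]_(t in `[0, twopi]) f t.
Proof.
rewrite [RHS]Rintegral_mkcond; apply: eq_Rintegral => t _; rewrite patchE indicE.
by case: ifP => _; rewrite ?mul1r ?mul0r.
Qed.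

Let is_derive_sin_lin (a x : R) : is_derive x (1 : R) (fun t => sin (0 + a * t)) (a * cos (0 + a * x)).
Proof.
have H := @is_derive1_comp R sin (fun x : R => 0 + a * x) x _ _ (is_derive_sin _) (is_derive_affine 0 a x).
by apply: (is_derive_eq H); rewrite mulrC.
Qed.

Let is_derive_cos_lin (a x : R) : is_derive x (1 : R) (fun t => cos (0 + a * t)) (- a * sin (0 + a * x)).
Proof.
have H := @is_derive1_comp R cos (fun x : R => 0 + a * x) x _ _ (is_derive_cos _) (is_derive_affine 0 a x).
by apply: (is_derive_eq H); ring.
Qed.

Let FTC (f F : R -> R) : continuous f -> (forall x, is_derive x (1 : R) F (f x)) ->
  \int[leb]_(t in `[0, twopi]) f t = F twopi - F 0.
Proof.
move=> cf dF; rewrite /Rintegral (@continuous_FTC2 _ f F)//.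
- exact: continuous_subspaceT.
- split.
  + by move=> x _; case: (dF x).
  + apply: cvg_at_right_filter; apply: differentiable_continuous.
    by apply/derivable1_diffP; case: (dF 0).
  + apply: cvg_at_left_filter; apply: differentiable_continuous.
    by apply/derivable1_diffP; case: (dF twopi).
- by move=> x _; rewrite derive1E; have [_ ->] := dF x.
Qed.

Lemma integral_cell_cos k : \int[leb]_t cell_cos k t = twopi * (k == 0)%:R.
Proof.
rewrite cellE; have [->|k0] := eqVneq k 0.
  under eq_Rintegral do rewrite mul0r cos0.
  have cf : continuous (fun _ : R => 1 : R) by move=> x; exact: cvg_cst.
  have dF (x : R) : is_derive x (1 : R) (fun t : R => t) 1 by exact: is_derive_id.
  by rewrite (FTC cf dF) subr0 mulr1.
have kn0 : k%:~R != 0 :> R by rewrite intr_eq0.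
have cf : continuous (fun t : R => cos (k%:~R * t)).
  move=> x; apply: continuous_comp; last exact: continuous_cos.
  by apply: cvgM; [exact: cvg_cst|exact: cvg_id].
have dF (x : R) : is_derive x (1 : R) (fun t : R => k%:~R^-1 * sin (0 + k%:~R * t)) (cos (k%:~R * x)).
  have H := @is_deriveZ _ _ _ _ (k%:~R^-1) _ _ _ (is_derive_sin_lin k%:~R x).
  by apply: (is_derive_eq H); rewrite /GRing.scale/= add0r mulKf.
by rewrite (FTC cf dF) mulr0 !add0r sin0 (sincos_int2pi k).1 !mulr0 subrr.
Qed.

Lemma integral_cell_sin k : \int[leb]_t cell_sin k t = 0.
Proof.
rewrite cellE; have [->|k0] := eqVneq k 0.
  under eq_Rintegral do rewrite mul0r sin0.
  by rewrite /Rintegral integral0.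
have kn0 : k%:~R != 0 :> R by rewrite intr_eq0.
have cf : continuous (fun t : R => sin (k%:~R * t)).
  move=> x; apply: continuous_comp; last exact: continuous_sin.
  by apply: cvgM; [exact: cvg_cst|exact: cvg_id].
have dF (x : R) : is_derive x (1 : R) (fun t : R => - k%:~R^-1 * cos (0 + k%:~R * t)) (sin (k%:~R * x)).
  have H := @is_deriveZ _ _ _ _ (- k%:~R^-1) _ _ _ (is_derive_cos_lin k%:~R x).
  by apply: (is_derive_eq H); rewrite /GRing.scale/= add0r mulNr mulNr mulrN opprK mulKf.
by rewrite (FTC cf dF) mulr0 !add0r cos0 (sincos_int2pi k).2 subrr.
Qed.

Definition cell_mode (c : R) m (x : R3 R) : R :=
  \1_(@torus_cell R) x * cos (dot (Z3_coord R m) x + c).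

Lemma cell_mode_integral c m :
  (leb3s R).-integrable setT (EFin \o cell_mode c m) /\
  \int[leb3s R]_x cell_mode c m x = twopi ^+ 3 * (m == (0, 0, 0))%:R * cos c.
Proof.
case: m => [[k0 k1] k2].
(* The cosine and sine of the first two summands of the phase, on the two-dimensional cell. The
   addition formulas then reduce everything to products of one-dimensional integrals. *)
pose C2 (z : R * R) := cell_cos k0 z.1 * cell_cos k1 z.2 - cell_sin k0 z.1 * cell_sin k1 z.2.
pose S2 (z : R * R) := cell_sin k0 z.1 * cell_cos k1 z.2 + cell_cos k0 z.1 * cell_sin k1 z.2.
have [icc ecc] := Rintegral_prodM (integrable_cell_cos k0) (integrable_cell_cos k1).
have [iss ess] := Rintegral_prodM (integrable_cell_sin k0) (integrable_cell_sin k1).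
have [isc esc] := Rintegral_prodM (integrable_cell_sin k0) (integrable_cell_cos k1).
have [ics ecs] := Rintegral_prodM (integrable_cell_cos k0) (integrable_cell_sin k1).
have iC2 : (prod_sf leb leb).-integrable setT (EFin \o C2) := integrableB measurableT icc iss.
have iS2 : (prod_sf leb leb).-integrable setT (EFin \o S2) := integrableD measurableT isc ics.
have eC2 : \int[prod_sf leb leb]_z C2 z = twopi ^+ 2 * ((k0 == 0) && (k1 == 0))%:R.
  rewrite (RintegralB measurableT icc iss) ecc ess !integral_cell_cos !integral_cell_sin.
  by case: (k0 == 0); case: (k1 == 0); rewrite /=; ring.
have eS2 : \int[prod_sf leb leb]_z S2 z = 0.
  by rewrite (RintegralD measurableT isc ics) esc ecs !integral_cell_sin; ring.
have [jcc fcc] := Rintegral_prodM iC2 (integrable_cell_cos k2).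
have [jss fss] := Rintegral_prodM iS2 (integrable_cell_sin k2).
have [jsc fsc] := Rintegral_prodM iS2 (integrable_cell_cos k2).
have [jcs fcs] := Rintegral_prodM iC2 (integrable_cell_sin k2).
have j1 := integrableB measurableT jcc jss; have j2 := integrableD measurableT jsc jcs.
have mE : cell_mode c (k0, k1, k2) = fun x : R3 R =>
   (C2 x.1 * cell_cos k2 x.2 - S2 x.1 * cell_sin k2 x.2) * cos c
   - (S2 x.1 * cell_cos k2 x.2 + C2 x.1 * cell_sin k2 x.2) * sin c.
  apply/funext => -[[x0 x1] x2]; rewrite /cell_mode /C2 /S2 /cell_cos /cell_sin/=.
  rewrite /dot /Z3_coord !big_ord_recl big_ord0 /coord3/= addr0 addrA.
  have -> : \1_(@torus_cell R) (x0, x1, x2) = \1_(`[0, twopi]%classic) x0 * \1_(`[0, twopi]%classic) x1 * \1_(`[0, twopi]%classic) x2 :> R.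
    rewrite !indicE /torus_cell !in_setX/=.
    by do 3 case: (_ \in `[0, _]%classic); rewrite /= ?mulr1 ?mulr0.
  rewrite !(cosD, sinD).
  have idem (D : set R) (t : R) : \1_D t * \1_D t = \1_D t :> R.
    by rewrite indicE; case: (_ \in _); rewrite ?mulr1 ?mulr0.
  ring.
have i1 := integrableZr measurableT (cos c) j1.
have i2 := integrableZr measurableT (sin c) j2.
have i12 := integrableB measurableT i1 i2.
rewrite mE; split; first exact: i12.
rewrite (RintegralB measurableT i1 i2).
rewrite (RintegralZr _ measurableT j1) (RintegralZr _ measurableT j2).
rewrite (RintegralB measurableT jcc jss) (RintegralD measurableT jsc jcs).
rewrite fcc fss fsc fcs eC2 eS2 integral_cell_cos integral_cell_sin.
have -> : ((k0, k1, k2) == (0, 0, 0) :> Z3) = [&& k0 == 0, k1 == 0 & k2 == 0].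
  by rewrite -[LHS]/([&& [&& k0 == 0 & k1 == 0] & k2 == 0]) andbA.
by case: (k0 == 0); case: (k1 == 0); case: (k2 == 0); rewrite /=; ring.
Qed.

End orthogonality.

Section torus_inversion.
Local Open Scope complex_scope.
Context (R : realType).
Local Notation twopi := (2 * pi : R).

Lemma integral_counting_point (g : Z3 -> R) (eta : Z3) :
  \int[counting_Z3 R]_xi (g xi * (xi == eta)%:R) = g eta.
Proof.
have E xi : g xi * (xi == eta)%:R = g eta * \1_[set eta] xi.
  have [->|/eqP ne] := eqVneq xi eta; first by rewrite indic_in.
  by rewrite indic_notin// !mulr0.
under eq_Rintegral do rewrite E.
have c1 : counting_Z3 R [set eta] = 1%E.
  by rewrite /= /counting asboolT// fset_set1 finmap.cardfs1.
rewrite RintegralZl//; last first.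
  apply/integrableP; split; first by apply/measurable_EFinP.
  rewrite (_ : \int[counting_Z3 R]_xi _ = \int[counting_Z3 R]_xi (\1_[set eta] xi)%:E)%E; last first.
    by apply: eq_integral => t _; rewrite /= ger0_norm.
  by rewrite integral_indic// setIT; rewrite [ltLHS]c1 ltry.
by rewrite /Rintegral integral_indic// setIT [X in fine X]c1 mulr1.
Qed.

(** For summable F the coefficient formula follows from the series by orthogonality; the exchange is
    justified by summability and the finite measure of the cell. Thus the synthesis formula alone
    characterizes [torus_transform], as on R^3. *)
Lemma torus_inversion (f : R3 R -> R) (F : Z3 -> R[i]) :
  cintegrable (@counting Z3 R) setT F ->
  (forall x, (f x)%:C = cintegral (@counting Z3 R) setT
     (fun xi => F xi * cis (dot (Z3_coord R xi) x))) ->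
  forall eta, F eta = fourier_coef f eta.
Proof.
move=> [iRe iIm] fE eta.
pose a xi := complex.Re (F xi); pose b xi := complex.Im (F xi).
have iA : (counting_Z3 R).-integrable setT (EFin \o a) by exact: iRe.
have iB : (counting_Z3 R).-integrable setT (EFin \o b) by exact: iIm.
pose d (xi : Z3) : Z3 := sub3 (xi : int * int * int) eta.
pose th xi x : R := dot (Z3_coord R xi) x.
have dotE xi x : th (d xi) x = th xi x - th eta x.
  rewrite /th /dot -sumrB; apply: eq_bigr => k _.
  by rewrite /Z3_coord (coord3_sub (xi : int * int * int)) intrB mulrBl.
have ib (g : Z3 -> R) (u : Z3 -> R) : (counting_Z3 R).-integrable setT (EFin \o g) ->
    (forall xi, `|u xi| <= 1) -> (counting_Z3 R).-integrable setT (EFin \o (fun xi => g xi * u xi)).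
  by move=> ig u1; exact: (integrable_Rmul_bounded ig _ u1).
have RE x : f x = \int[counting_Z3 R]_xi (a xi * cos (th xi x) - b xi * sin (th xi x)).
  have /(congr1 (@complex.Re R)) := fE x; rewrite /= => ->.
  by apply: eq_Rintegral => xi _; rewrite /a /b /th; case: (F xi) => u v.
have IE x : 0 = \int[counting_Z3 R]_xi (a xi * sin (th xi x) + b xi * cos (th xi x)).
  have /(congr1 (@complex.Im R)) := fE x; rewrite /= => ->.
  by apply: eq_Rintegral => xi _; rewrite /a /b /th; case: (F xi) => u v.
have i1 x : (counting_Z3 R).-integrable setT (EFin \o (fun xi => a xi * cos (th xi x) - b xi * sin (th xi x))).
  exact: (integrableB measurableT (ib _ _ iA (fun xi => cos_max _)) (ib _ _ iB (fun xi => sin_max _))).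
have i2 x : (counting_Z3 R).-integrable setT (EFin \o (fun xi => a xi * sin (th xi x) + b xi * cos (th xi x))).
  exact: (integrableD measurableT (ib _ _ iA (fun xi => sin_max _)) (ib _ _ iB (fun xi => cos_max _))).
(* The free phase yields both parts of F eta from one identity: c = 0 for the real part, c = - pi /
   2 for the imaginary part. *)
have key c : \int[leb3s R]_x (\1_(@torus_cell R) x * (f x * cos (th eta x - c))) =
    twopi ^+ 3 * (a eta * cos c - b eta * sin c).
  pose H (z : R3 R * Z3) := a z.2 * cell_mode c (d z.2) z.1 + b z.2 * cell_mode (c + pi / 2) (d z.2) z.1.
  have mH : measurable_fun setT H.
    apply: measurable_Z3_prod => k; rewrite /H/=; apply: measurable_funD; (apply: measurable_funM; first exact: measurable_cst).
    - have [i _] := cell_mode_integral c (d k); exact: ((measurable_EFinP _ _).1 (measurable_int _ i)).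
    - have [i _] := cell_mode_integral (c + pi / 2) (d k); exact: ((measurable_EFinP _ _).1 (measurable_int _ i)).
  have HE x : \int[counting_Z3 R]_xi H (x, xi) = \1_(@torus_cell R) x * (f x * cos (th eta x - c)).
    (* The term with factor 0 stands for the imaginary part of the series, which vanishes as f is
       real; it completes the addition formula for the shifted phase. *)
    transitivity (\1_(@torus_cell R) x * (f x * cos (th eta x - c) + 0 * sin (th eta x - c))); last by ring.
    rewrite {1}RE (IE x) -(RintegralZr _ measurableT (i1 x)) -(RintegralZr _ measurableT (i2 x)).
    have j1 := integrableZr measurableT (cos (th eta x - c)) (i1 x).
    have j2 := integrableZr measurableT (sin (th eta x - c)) (i2 x).
    rewrite -(RintegralD measurableT j1 j2) -(RintegralZl _ measurableT (integrableD measurableT j1 j2)).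
    apply: eq_Rintegral => xi _; rewrite /H /cell_mode/= -/(th _ _) dotE.
    rewrite -[th xi x - th eta x + (c + pi / 2)]addrA [X in cos X](_ : _ = (th xi x - (th eta x - c))); last by ring.
    rewrite [in RHS]/=.
    have -> : th xi x + (- th eta x + (c + pi / 2)) = th xi x - (th eta x - c) + pi / 2 by ring.
    rewrite cosDpihalf; move: (th eta x - c) => u; rewrite cosB sinB; ring.
  have abfin : (\int[counting_Z3 R]_xi (`|a xi| + `|b xi|)%:E < +oo)%E.
    under eq_integral do rewrite EFinD.
    rewrite ge0_integralD//; apply: lte_add_pinfty.
    - by have /integrableP[] := iA.
    - by have /integrableP[] := iB.
  have leb_cell : (leb3s R (@torus_cell R) < +oo)%E.
    have [i _] := @cell_mode_integral R 0 (0, 0, 0).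
    have /integrableP[_] := i.
    rewrite (_ : \int[leb3s R]_x _ = \int[leb3s R]_x (\1_(@torus_cell R) x)%:E)%E.
      rewrite integral_indic ?setIT//.
      by apply: measurableX => //; apply: measurableX.
    have dot0 x : dot (Z3_coord R (0, 0, 0)) x = 0.
      by rewrite /dot big1// => j _; rewrite /Z3_coord /coord3; case: (val j) => [|[|n]]; rewrite mul0r.
    by apply: eq_integral => x _; rewrite /= /cell_mode dot0 addr0 cos0 mulr1 ger0_norm.
  have Hoo : (\int[leb3s R]_x \int[counting_Z3 R]_xi (`|H (x, xi)|)%:E < +oo)%E.
    apply: (@le_lt_trans _ _ (\int[leb3s R]_x ((\int[counting_Z3 R]_xi (`|a xi| + `|b xi|)%:E) *
        (\1_(@torus_cell R) x)%:E))%E).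
      apply: ge0_le_integral_nomeas => x _; first by apply: integral_ge0 => xi _; rewrite lee_fin.
      rewrite muleC -ge0_integralZl//.
      apply: ge0_le_integral_nomeas => xi _; first by rewrite lee_fin.
      rewrite -EFinM lee_fin /H; apply: le_trans (ler_normD _ _) _.
      have cb c' : `|cell_mode c' (d xi) x| <= \1_(@torus_cell R) x.
        by rewrite normrM ger0_norm// ler_piMr// cos_max.
      rewrite mulrDr; apply: lerD; rewrite normrM mulrC; exact: ler_wpM2r.
    have abf : (\int[counting_Z3 R]_xi (`|a xi| + `|b xi|)%:E)%E \is a fin_num.
      by rewrite ge0_fin_numE//; apply: integral_ge0 => xi _; rewrite lee_fin addr_ge0.
    rewrite ge0_integralZl//; last 2 first.
    - apply/measurable_EFinP; apply: measurable_indic.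
      by apply: measurableX => //; apply: measurableX.
    - by apply: integral_ge0 => xi _; rewrite lee_fin addr_ge0.
    rewrite integral_indic ?setIT//; last by apply: measurableX => //; apply: measurableX.
    by apply: lte_mul_pinfty => //; apply: integral_ge0 => xi _; rewrite lee_fin addr_ge0.
  transitivity (\int[leb3s R]_x \int[counting_Z3 R]_xi H (x, xi)).
    by apply: eq_Rintegral => x _; rewrite HE.
  rewrite (Rintegral_fubini mH Hoo).
  transitivity (\int[counting_Z3 R]_xi ((twopi ^+ 3 * (a xi * cos c - b xi * sin c)) * (xi == eta)%:R)).
    apply: eq_Rintegral => xi _; rewrite /H/=.
    have [k1 e1] := cell_mode_integral c (d xi).
    have [k2 e2] := cell_mode_integral (c + pi / 2) (d xi).
    have k1' := integrableZl measurableT (a xi) k1.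
    have k2' := integrableZl measurableT (b xi) k2.
    rewrite (RintegralD measurableT k1' k2') (RintegralZl _ measurableT k1) (RintegralZl _ measurableT k2).
    rewrite e1 e2 cosDpihalf.
    have -> : (d xi == (0, 0, 0)) = (xi == eta).
      apply/eqP/eqP => [|->]; last first.
        by rewrite /d; case: (eta) => [[? ?] ?]; rewrite /sub3/= !subrr.
      rewrite /d; case: (xi) (eta) => [[x0 x1] x2] [[y0 y1] y2] [].
      by move=> /eqP + /eqP + /eqP; rewrite !subr_eq0 => /eqP -> /eqP -> /eqP ->.
    by ring.
  by rewrite (integral_counting_point (fun xi => twopi ^+ 3 * (a xi * cos c - b xi * sin c))).
have tp0 : twopi ^+ 3 != 0 by rewrite expf_neq0// mulf_neq0// gt_eqF// pi_gt0.
have cellI g : \int[@leb3 R]_(x in @torus_cell R) g x = \int[leb3s R]_x (\1_(@torus_cell R) x * g x).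
  rewrite [LHS]Rintegral_mkcond; apply: eq_Rintegral => x _; rewrite patchE indicE.
  by case: ifP => _; rewrite ?mul1r ?mul0r.
rewrite /fourier_coef /cintegral.
have -> : \int[@leb3 R]_(x in @torus_cell R) complex.Re ((f x)%:C * cis (- dot (Z3_coord R eta) x)) = twopi ^+ 3 * a eta.
  rewrite cellI; have := key 0; rewrite cos0 sin0 mulr1 mulr0 subr0 => <-.
  apply: eq_Rintegral => x _; rewrite /= subr0 -/(th _ _) cosN mul0r subr0.
  by [].
have -> : \int[@leb3 R]_(x in @torus_cell R) complex.Im ((f x)%:C * cis (- dot (Z3_coord R eta) x)) = twopi ^+ 3 * b eta.
  rewrite cellI; have := key (- (pi / 2)).
  rewrite cosN sinN cos_pihalf sin_pihalf mulr0 sub0r mulrN1 !opprK => <-.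
  apply: eq_Rintegral => x _; rewrite /= -/(th _ _) cosDpihalf sinN mul0r addr0.
  by [].
rewrite /a /b; case: (F eta) => u v; simpc.
by rewrite /= !(mulrA _ (twopi ^+ 3)) !mulVf// !mul1r.
Qed.

End torus_inversion.

(** * Products and convolutions *)

Local Open Scope complex_scope.

(** What the proof uses of Z^3 and R^3 alike. The transform is known through the synthesis formula,
    whose normalization [fo_const] is 1 on Z^3 and (2 pi)^-3 on R^3; a product of functions has
    transform [fo_const] times the convolution. *)
Record fourier_group (R : realType) := FourierGroup {
  fo_group :> freq_group R;
  fo_coord : fo_group -> 'I_3 -> R;
  fo_tr : (R3 R -> R) -> (fo_group -> R[i]) -> Prop;
  fo_const : R;
  fo_neg : fo_group -> fo_group;
  measurable_fo_coord : forall k, measurable_fun setT (fun x => fo_coord x k);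
  fo_coord_sub : forall x y k, fo_coord (fg_sub x y) k = fo_coord x k - fo_coord y k;
  fo_modE : forall x, fg_mod x = Num.sqrt (\sum_(k < 3) fo_coord x k ^+ 2);
  fo_neg_preserving : preserving (fg_measure fo_group) fo_neg;
  fo_neg_sub : forall x y, fg_sub (fo_neg x) (fo_neg y) = fo_neg (fg_sub x y);
  fo_coord_neg : forall x k, fo_coord (fo_neg x) k = - fo_coord x k;
  fo_const_neq0 : fo_const != 0;
  fo_trP : forall f F, fo_tr f F <->
    cintegrable (fg_measure fo_group) setT F /\
    forall x, (f x)%:C = fo_const%:C *
      cintegral (fg_measure fo_group) setT (fun xi => F xi * cis (dot (fo_coord xi) x));
  fo_inj : forall F, cintegrable (fg_measure fo_group) setT F ->
    (forall x, cintegral (fg_measure fo_group) setT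
      (fun xi => F xi * cis (dot (fo_coord xi) x)) = 0) ->
    \forall xi \ae fg_measure fo_group, F xi = 0 }.

Arguments fo_coord {R} X x k : rename.
Arguments fo_tr {R} X f F : rename.
Arguments fo_neg {R} X x : rename.
Arguments fo_const {R} X : rename.

Definition fo_setting (R : realType) (X : fourier_group R) : fourier_setting R :=
  @FourierSetting R _ X (fg_measure X) (fo_coord X) (fo_tr X).

Section complex_parts.
Context (R : realType).
Implicit Types (z w : R[i]) (r : R).

Lemma Re_mul z w : complex.Re (z * w) =
  complex.Re z * complex.Re w - complex.Im z * complex.Im w.
Proof. by case: z w => a b [c d]. Qed.

Lemma Im_mul z w : complex.Im (z * w) =
  complex.Re z * complex.Im w + complex.Im z * complex.Re w.
Proof. by case: z w => a b [c d]. Qed.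

Lemma Re_mulC r z : complex.Re (r%:C * z) = r * complex.Re z.
Proof. by rewrite Re_mul/= mul0r subr0. Qed.

Lemma Im_mulC r z : complex.Im (r%:C * z) = r * complex.Im z.
Proof. by rewrite Im_mul/= mul0r addr0. Qed.

Lemma complexP z w : complex.Re z = complex.Re w -> complex.Im z = complex.Im w -> z = w.
Proof. by case: z w => a b [c d] /= -> ->. Qed.

Lemma ReD z w : complex.Re (z + w) = complex.Re z + complex.Re w.
Proof. by case: z w => a b [c d]. Qed.

Lemma ImD z w : complex.Im (z + w) = complex.Im z + complex.Im w.
Proof. by case: z w => a b [c d]. Qed.

Lemma ReN z : complex.Re (- z) = - complex.Re z.
Proof. by case: z. Qed.

Lemma ImN z : complex.Im (- z) = - complex.Im z.
Proof. by case: z. Qed.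

Lemma Re_conj z : complex.Re (conjc z) = complex.Re z.
Proof. by case: z. Qed.

Lemma Im_conj z : complex.Im (conjc z) = - complex.Im z.
Proof. by case: z. Qed.

End complex_parts.

Section convolution.
Context (R : realType) (G : freq_group R).
Local Notation mu := (fg_measure G).
Local Notation sub := (@fg_sub R G).
Implicit Types (u v : G -> R).

Lemma measurable_of_integrable u : mu.-integrable setT (EFin \o u) -> measurable_fun setT u.
Proof. by move=> iu; exact: ((measurable_EFinP _ _).1 (measurable_int _ iu)). Qed.

Lemma integral_norm_fin u : mu.-integrable setT (EFin \o u) ->
  (\int[mu]_x (`|u x|)%:E < +oo)%E.
Proof. by move=> /integrableP[]. Qed.

Lemma conv_norm_fin u v : mu.-integrable setT (EFin \o u) -> mu.-integrable setT (EFin \o v) ->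
  (\int[mu]_x \int[mu]_y (`|u (sub x y) * v y|)%:E < +oo)%E.
Proof.
move=> iu iv; have mu_ := measurable_of_integrable iu; have mv := measurable_of_integrable iv.
under eq_integral do under eq_integral do rewrite normrM.
have := @integral_fg_conv R G (fun x => `|u x|) (fun x => `|v x|).
rewrite /fg_conv => ->//; [|exact: measurableT_comp|exact: measurableT_comp].
apply: lte_mul_pinfty; [|rewrite ge0_fin_numE|exact: integral_norm_fin].
- by apply: integral_ge0 => x _; rewrite lee_fin.
- exact: integral_norm_fin.
- by apply: integral_ge0 => x _; rewrite lee_fin.
Qed.

Lemma ae_conv_integrable u v : mu.-integrable setT (EFin \o u) -> mu.-integrable setT (EFin \o v) ->
  \forall x \ae mu, mu.-integrable setT (fun y => (u (sub x y) * v y)%:E).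
Proof.
move=> iu iv; have mu_ := measurable_of_integrable iu; have mv := measurable_of_integrable iv.
have mc := measurable_fg_conv_pair mu_ mv.
have mca : measurable_fun [set: G * G] (fun z => (`|u (sub z.1 z.2) * v z.2|)%:E).
  by apply/measurable_EFinP; exact: measurableT_comp.
have H : \forall x \ae mu, (\int[mu]_y (`|u (sub x y) * v y|)%:E < +oo)%E.
  apply: ae_fin_num; last exact: conv_norm_fin.
    exact: (measurable_fun_integral_param mu mca).
  by move=> x; apply: integral_ge0 => y _; rewrite lee_fin.
apply: filterS H => x xoo; apply/integrableP; split => //.
apply/measurable_EFinP; apply: measurable_funM => //.
by apply: measurableT_comp => //; exact: measurable_fg_subl.
Qed.

Lemma conv2_integral u v : mu.-integrable setT (EFin \o u) -> mu.-integrable setT (EFin \o v) ->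
  mu.-integrable setT (EFin \o conv2 u v) /\
  \int[mu]_x conv2 u v x = (\int[mu]_x u x) * (\int[mu]_x v x).
Proof.
move=> iu iv; have mu_ := measurable_of_integrable iu; have mv := measurable_of_integrable iv.
have mc := measurable_fg_conv_pair mu_ mv.
have coo := conv_norm_fin iu iv.
split; first exact: (ae_Rintegral_fin mc coo).1.
rewrite /conv2 (Rintegral_fubini mc coo)/=.
transitivity (\int[mu]_y ((\int[mu]_x u x) * v y)).
  apply: eq_Rintegral => y _.
  have ius : mu.-integrable setT (EFin \o (fun x => u (sub x y))).
    have msr : measurable_fun setT (fun x : G => sub x y).
      by apply: (measurableT_comp (@measurable_fg_sub R G) (g := pair^~ y)); exact: measurable_pair2.
    apply/integrableP; split; first by apply/measurable_EFinP; exact: measurableT_comp.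
    rewrite (integral_fg_subr (f := fun x => (`|u x|)%:E))//; first exact: integral_norm_fin.
      by apply/measurable_EFinP; exact: measurableT_comp.
  rewrite RintegralZr//; congr (_ * _).
  exact: (Rintegral_comp (fun f mf f0 => integral_fg_subr y mf f0) mu_).
by rewrite RintegralZl.
Qed.

Definition cconv (F H : G -> R[i]) (x : G) : R[i] :=
  (conv2 (fun y => complex.Re (F y)) (fun y => complex.Re (H y)) x
   - conv2 (fun y => complex.Im (F y)) (fun y => complex.Im (H y)) x) +i*
  (conv2 (fun y => complex.Re (F y)) (fun y => complex.Im (H y)) x
   + conv2 (fun y => complex.Im (F y)) (fun y => complex.Re (H y)) x).

End convolution.

(** * Synthesis, products and reality *)

Section synthesis.
Context (R : realType) (X : fourier_group R).
Local Notation mu := (fg_measure X).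
Local Notation sub := (@fg_sub R X).
Local Notation c := (fo_const X).
Local Notation coord := (fo_coord X).
Local Notation tr := (fo_tr X).
Implicit Types (F H : X -> R[i]) (f g : R3 R -> R) (x : R3 R).
Local Notation theta x := (fun xi => dot (coord xi) x).

Let re_mode F x xi := complex.Re (F xi) * cos (theta x xi) - complex.Im (F xi) * sin (theta x xi).
Let im_mode F x xi := complex.Re (F xi) * sin (theta x xi) + complex.Im (F xi) * cos (theta x xi).

Let measurable_theta x : measurable_fun setT (theta x).
Proof.
by apply: measurable_sum => k; apply: measurable_funM => //; exact: measurable_fo_coord.
Qed.

Let measurable_cos_theta x : measurable_fun setT (fun xi => cos (theta x xi)).
Proof. by apply: (measurableT_comp (@measurable_cosR R)); exact: measurable_theta. Qed.

Let measurable_sin_theta x : measurable_fun setT (fun xi => sin (theta x xi)).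
Proof. by apply: (measurableT_comp (@measurable_sinR R)); exact: measurable_theta. Qed.

Let integrable_cos u x : mu.-integrable setT (EFin \o u) ->
  mu.-integrable setT (EFin \o (fun xi => u xi * cos (theta x xi))).
Proof.
move=> iu; apply: (integrable_Rmul_bounded iu (measurable_cos_theta x) (K := 1)).
by move=> xi; exact: cos_max.
Qed.

Let integrable_sin u x : mu.-integrable setT (EFin \o u) ->
  mu.-integrable setT (EFin \o (fun xi => u xi * sin (theta x xi))).
Proof.
move=> iu; apply: (integrable_Rmul_bounded iu (measurable_sin_theta x) (K := 1)).
by move=> xi; exact: sin_max.
Qed.

Let integrable_re F x : cintegrable mu setT F -> mu.-integrable setT (EFin \o re_mode F x).
Proof. by move=> [i1 i2]; exact: (integrableB measurableT (integrable_cos x i1) (integrable_sin x i2)). Qed.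

Let integrable_im F x : cintegrable mu setT F -> mu.-integrable setT (EFin \o im_mode F x).
Proof. by move=> [i1 i2]; exact: (integrableD measurableT (integrable_sin x i1) (integrable_cos x i2)). Qed.

Let cintegral_modes F x : cintegral mu setT (fun xi => F xi * cis (theta x xi)) =
  (\int[mu]_xi re_mode F x xi) +i* (\int[mu]_xi im_mode F x xi).
Proof.
by apply: complexP; apply: eq_Rintegral => xi _; rewrite ?Re_mul ?Im_mul.
Qed.

Lemma synth_modes f F : tr f F <-> cintegrable mu setT F /\
  forall x, f x = c * \int[mu]_xi re_mode F x xi /\ \int[mu]_xi im_mode F x xi = 0.
Proof.
split=> [/fo_trP|] [iF H]; [|apply/fo_trP]; split => // x.
  have := H x; rewrite cintegral_modes => E; split.
    by have := congr1 (@complex.Re R) E; rewrite Re_mulC.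
  have := congr1 (@complex.Im R) E; rewrite Im_mulC/= => /esym/eqP.
  by rewrite mulf_eq0 (negbTE (fo_const_neq0 X))/= => /eqP.
have [h1 h2] := H x; rewrite cintegral_modes; apply: complexP.
  by rewrite Re_mulC h1.
by rewrite Im_mulC h2 mulr0.
Qed.

Lemma tr_integrable f F : tr f F -> cintegrable mu setT F.
Proof. by case/fo_trP. Qed.

Lemma tr_ext f f' F F' : tr f F -> tr f' F' -> (\forall xi \ae mu, F xi = F' xi) -> f = f'.
Proof.
move=> /synth_modes[iF h] /synth_modes[iF' h'] FF'; apply/funext => x.
rewrite (h x).1 (h' x).1; congr (_ * _); apply: ae_eq_Rintegral.
- by have := measurable_of_integrable (integrable_re x iF).
- by have := measurable_of_integrable (integrable_re x iF').
- by apply: filterS FF' => xi E; rewrite /re_mode E.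
Qed.

Lemma tr_inj f F F' : tr f F -> tr f F' -> \forall xi \ae mu, F xi = F' xi.
Proof.
move=> /synth_modes[[i1 i2] h] /synth_modes[[i1' i2'] h'].
have iB : cintegrable mu setT (fun xi => F xi - F' xi).
  split; rewrite /=.
    apply: (eq_integrable measurableT (fun xi => _) _ _ (integrableB measurableT i1 i1')).
    by move=> xi _; rewrite /= ReD ReN.
  apply: (eq_integrable measurableT (fun xi => _) _ _ (integrableB measurableT i2 i2')).
  by move=> xi _; rewrite /= ImD ImN.
have := fo_inj iB; move=> H.
have {H} : \forall xi \ae mu, F xi - F' xi = 0.
  apply: H => x; rewrite cintegral_modes; apply: complexP => /=.
    rewrite (_ : re_mode _ x = fun xi => re_mode F x xi - re_mode F' x xi); last first.
      by apply/funext => xi; rewrite /re_mode ReD ReN ImD ImN; ring.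
    have jF : cintegrable mu setT F by split.
    have jF' : cintegrable mu setT F' by split.
    rewrite (RintegralB measurableT (integrable_re x jF) (integrable_re x jF')).
    have := (h x).1; rewrite (h' x).1 => /(mulfI (fo_const_neq0 X)) ->.
    by rewrite subrr.
  rewrite (_ : im_mode _ x = fun xi => im_mode F x xi - im_mode F' x xi); last first.
    by apply/funext => xi; rewrite /im_mode ReD ReN ImD ImN; ring.
  have jF : cintegrable mu setT F by split.
  have jF' : cintegrable mu setT F' by split.
  rewrite (RintegralB measurableT (integrable_im x jF) (integrable_im x jF')).
  by rewrite (h x).2 (h' x).2 subrr.
by apply: filterS => xi /eqP; rewrite subr_eq0 => /eqP.
Qed.

Lemma theta_neg x xi : theta x (fo_neg X xi) = - theta x xi.
Proof.
by rewrite /dot -sumrN; apply: eq_bigr => k _; rewrite fo_coord_neg mulNr.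
Qed.

Definition synth F x : R := c * complex.Re (cintegral mu setT (fun xi => F xi * cis (theta x xi))).

(** Hermitian symmetry makes the imaginary part of the integrand odd in xi. Its integral equals its
    own opposite, so the synthesized function is real. *)
Lemma tr_synth F : cintegrable mu setT F ->
  (\forall xi \ae mu, F (fo_neg X xi) = conjc (F xi)) -> tr (synth F) F.
Proof.
move=> iF hF; apply/synth_modes; split => // x; split.
  by rewrite /synth cintegral_modes.
have [mneg neg_int] := fo_neg_preserving X.
have mI := measurable_of_integrable (integrable_im x iF).
have : \int[mu]_xi im_mode F x xi = - \int[mu]_xi im_mode F x xi.
  rewrite -{1}(Rintegral_comp neg_int mI).
  rewrite -[RHS]mulN1r -(RintegralZl _ measurableT (integrable_im x iF)).
  apply: ae_eq_Rintegral; first exact: measurableT_comp.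
    exact: measurable_funM.
  apply: filterS hF => xi E.
  by rewrite /im_mode E theta_neg sinN cosN Re_conj Im_conj; ring.
lra.
Qed.

(** The conjugate of F(-xi) synthesizes the same real function f; injectivity concludes. *)
Lemma tr_hermitian f F : tr f F -> \forall xi \ae mu, F (fo_neg X xi) = conjc (F xi).
Proof.
move=> trF; have /synth_modes[iF h] := trF.
have [mneg neg_int] := fo_neg_preserving X.
have [i1 i2] := iF.
have int_neg (u : X -> R) : mu.-integrable setT (EFin \o u) ->
    mu.-integrable setT (EFin \o (fun xi => u (fo_neg X xi))).
  move=> iu; have mu_ := measurable_of_integrable iu.
  apply/integrableP; split; first by apply/measurable_EFinP; exact: measurableT_comp.
  rewrite (neg_int (fun xi => (`|u xi|)%:E)); first exact: integral_norm_fin.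
    by apply/measurable_EFinP; exact: measurableT_comp.
  by move=> xi; rewrite lee_fin.
suff trF' : tr f (fun xi => conjc (F (fo_neg X xi))).
  apply: filterS (tr_inj trF trF') => xi ->.
  by case: (F (fo_neg X xi)) => u v /=; rewrite opprK.
apply/synth_modes; split.
  split.
    rewrite (_ : (fun xi => _) = EFin \o (fun xi => complex.Re (F (fo_neg X xi)))); last first.
      by apply/funext => xi /=; rewrite Re_conj.
    exact: (int_neg (fun xi => complex.Re (F xi))).
  rewrite (_ : (fun xi => _) = (fun xi => - (complex.Im (F (fo_neg X xi)))%:E)%E); last first.
    by apply/funext => xi /=; rewrite Im_conj.
  by apply: integrableN; exact: (int_neg (fun xi => complex.Im (F xi))).
move=> x; have [h1 h2] := h x; split.
  rewrite h1 -(Rintegral_comp neg_int (measurable_of_integrable (integrable_re x iF))).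
  congr (_ * _); apply: eq_Rintegral => xi _.
  by rewrite /re_mode theta_neg sinN cosN Re_conj Im_conj; ring.
transitivity (- \int[mu]_xi im_mode F x xi); last by rewrite h2 oppr0.
rewrite -[RHS]mulN1r -(RintegralZl _ measurableT (integrable_im x iF)).
rewrite -(Rintegral_comp neg_int (f := fun xi => -1 * im_mode F x xi)); last first.
  by apply: measurable_funM => //; exact: measurable_of_integrable (integrable_im x iF).
apply: eq_Rintegral => xi _.
by rewrite /im_mode theta_neg sinN cosN Re_conj Im_conj; ring.
Qed.

Lemma cintegrable_cconv F H : cintegrable mu setT F -> cintegrable mu setT H ->
  cintegrable mu setT (cconv F H).
Proof.
move=> [iF1 iF2] [iH1 iH2].
have [c1 _] := conv2_integral iF1 iH1; have [c2 _] := conv2_integral iF2 iH2.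
have [c3 _] := conv2_integral iF1 iH2; have [c4 _] := conv2_integral iF2 iH1.
by split; [exact: (integrableB measurableT c1 c2)|exact: (integrableD measurableT c3 c4)].
Qed.

Lemma cintegrableZ (r : R) F : cintegrable mu setT F ->
  cintegrable mu setT (fun xi => r%:C * F xi).
Proof.
move=> [i1 i2]; split.
  rewrite (_ : (fun xi => _) = (fun xi => r%:E * (complex.Re (F xi))%:E)%E); first exact: integrableZl.
  by apply/funext => xi; rewrite Re_mulC.
rewrite (_ : (fun xi => _) = (fun xi => r%:E * (complex.Im (F xi))%:E)%E); first exact: integrableZl.
by apply/funext => xi; rewrite Im_mulC.
Qed.

(** The phase is additive in xi, so multiplying a convolution by the mode is convolving the two
    functions multiplied by it; and the integral of a convolution is the product of the integrals.
    The identity of modes holds at almost every xi, where all the convolution integrals converge. *)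
Lemma tr_mul f g F H : tr f F -> tr g H ->
  tr (fun x => f x * g x) (fun xi => c%:C * cconv F H xi).
Proof.
move=> /synth_modes[iF hf] /synth_modes[iH hg]; apply/synth_modes.
have iC := cintegrable_cconv iF iH.
split; first exact: cintegrableZ.
move=> x; have [f1 f2] := hf x; have [g1 g2] := hg x.
have [rr err] := conv2_integral (integrable_re x iF) (integrable_re x iH).
have [ii eii] := conv2_integral (integrable_im x iF) (integrable_im x iH).
have [ri eri] := conv2_integral (integrable_re x iF) (integrable_im x iH).
have [ir eir] := conv2_integral (integrable_im x iF) (integrable_re x iH).
have [iF1 iF2] := iF; have [iH1 iH2] := iH.
have aeI : \forall xi \ae mu,
    re_mode (cconv F H) x xi = conv2 (re_mode F x) (re_mode H x) xi - conv2 (im_mode F x) (im_mode H x) xi /\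
    im_mode (cconv F H) x xi = conv2 (re_mode F x) (im_mode H x) xi + conv2 (im_mode F x) (re_mode H x) xi.
  have b1 := ae_conv_integrable (integrable_re x iF) (integrable_re x iH).
  have b2 := ae_conv_integrable (integrable_im x iF) (integrable_im x iH).
  have b3 := ae_conv_integrable (integrable_re x iF) (integrable_im x iH).
  have b4 := ae_conv_integrable (integrable_im x iF) (integrable_re x iH).
  have a1 := ae_conv_integrable iF1 iH1; have a2 := ae_conv_integrable iF2 iH2.
  have a3 := ae_conv_integrable iF1 iH2; have a4 := ae_conv_integrable iF2 iH1.
  near=> xi.
  have B1 : mu.-integrable setT (fun y => (re_mode F x (sub xi y) * re_mode H x y)%:E) by near: xi.
  have B2 : mu.-integrable setT (fun y => (im_mode F x (sub xi y) * im_mode H x y)%:E) by near: xi.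
  have B3 : mu.-integrable setT (fun y => (re_mode F x (sub xi y) * im_mode H x y)%:E) by near: xi.
  have B4 : mu.-integrable setT (fun y => (im_mode F x (sub xi y) * re_mode H x y)%:E) by near: xi.
  have A1 : mu.-integrable setT (fun y => (complex.Re (F (sub xi y)) * complex.Re (H y))%:E) by near: xi.
  have A2 : mu.-integrable setT (fun y => (complex.Im (F (sub xi y)) * complex.Im (H y))%:E) by near: xi.
  have A3 : mu.-integrable setT (fun y => (complex.Re (F (sub xi y)) * complex.Im (H y))%:E) by near: xi.
  have A4 : mu.-integrable setT (fun y => (complex.Im (F (sub xi y)) * complex.Re (H y))%:E) by near: xi.
  have thE y : theta x xi = theta x (sub xi y) + theta x y.
    by rewrite /dot -big_split/=; apply: eq_bigr => k _; rewrite fo_coord_sub -mulrDl subrK.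
  have D12 := integrableB measurableT A1 A2; have D34 := integrableD measurableT A3 A4.
  rewrite /conv2 -(RintegralB measurableT B1 B2) -(RintegralD measurableT B3 B4).
  rewrite /re_mode /im_mode /cconv /conv2/=.
  rewrite -(RintegralB measurableT A1 A2) -(RintegralD measurableT A3 A4).
  rewrite -!(RintegralZr _ measurableT D12) -!(RintegralZr _ measurableT D34).
  split.
    rewrite -(RintegralB measurableT (integrableZr measurableT _ D12) (integrableZr measurableT _ D34)).
    by apply: eq_Rintegral => y _; rewrite (thE y) cosD sinD; ring.
  rewrite -(RintegralD measurableT (integrableZr measurableT _ D12) (integrableZr measurableT _ D34)).
  by apply: eq_Rintegral => y _; rewrite (thE y) cosD sinD; ring.
have mre := measurable_of_integrable (integrable_re x iC).
have mim := measurable_of_integrable (integrable_im x iC).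
have reZ : re_mode (fun xi => c%:C * cconv F H xi) x = fun xi => c * re_mode (cconv F H) x xi.
  by apply/funext => xi; rewrite /re_mode Re_mulC Im_mulC; ring.
have imZ : im_mode (fun xi => c%:C * cconv F H xi) x = fun xi => c * im_mode (cconv F H) x xi.
  by apply/funext => xi; rewrite /im_mode Re_mulC Im_mulC; ring.
rewrite reZ imZ (RintegralZl _ measurableT (integrable_re x iC)) (RintegralZl _ measurableT (integrable_im x iC)).
have -> : \int[mu]_xi re_mode (cconv F H) x xi = (\int[mu]_xi re_mode F x xi) * (\int[mu]_xi re_mode H x xi).
  transitivity (\int[mu]_xi (conv2 (re_mode F x) (re_mode H x) xi - conv2 (im_mode F x) (im_mode H x) xi)).
    apply: ae_eq_Rintegral => //; last by apply: filterS aeI => xi [].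
    by have := measurable_of_integrable (integrableB measurableT rr ii).
  by rewrite (RintegralB measurableT rr ii) err eii f2 mul0r subr0.
have -> : \int[mu]_xi im_mode (cconv F H) x xi = 0.
  transitivity (\int[mu]_xi (conv2 (re_mode F x) (im_mode H x) xi + conv2 (im_mode F x) (re_mode H x) xi)).
    apply: ae_eq_Rintegral => //; last by apply: filterS aeI => xi [].
    by have := measurable_of_integrable (integrableD measurableT ri ir).
  by rewrite (RintegralD measurableT ri ir) eri eir f2 g2 mul0r mulr0 addr0.
by rewrite mulr0 f1 g1; split=> //; ring.
Unshelve. all: by end_near.
Qed.

End synthesis.

Section instances.
Context (R : realType).
Local Open Scope complex_scope.

Lemma space_inj (F : R3 R -> R[i]) : cintegrable (leb3s R) setT F ->
  (forall x, cintegral (leb3s R) setT (fun xi => F xi * cis (dot (coord3 (T := R) xi) x)) = 0) ->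
  \forall xi \ae leb3s R, F xi = 0.
Proof.
move=> [iA iB] F0.
pose A xi := complex.Re (F xi); pose B xi := complex.Im (F xi).
pose th x (xi : R3 R) : R := dot (coord3 (T := R) xi) x.
have mth x : measurable_fun setT (th x).
  by apply: measurable_sum => k; apply: measurable_funM => //; exact: measurable_coord3.
have ic u x : (leb3s R).-integrable setT (EFin \o u) ->
    (leb3s R).-integrable setT (EFin \o (fun xi => u xi * cos (th x xi))).
  move=> iu; apply: (integrable_Rmul_bounded iu (K := 1)) => [|xi]; last exact: cos_max.
  by apply: (measurableT_comp (@measurable_cosR R)); exact: mth.
have is_ u x : (leb3s R).-integrable setT (EFin \o u) ->
    (leb3s R).-integrable setT (EFin \o (fun xi => u xi * sin (th x xi))).
  move=> iu; apply: (integrable_Rmul_bounded iu (K := 1)) => [|xi]; last exact: sin_max.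
  by apply: (measurableT_comp (@measurable_sinR R)); exact: mth.
pose Ac x := \int[leb3s R]_xi (A xi * cos (th x xi)).
pose As x := \int[leb3s R]_xi (A xi * sin (th x xi)).
pose Bc x := \int[leb3s R]_xi (B xi * cos (th x xi)).
pose Bs x := \int[leb3s R]_xi (B xi * sin (th x xi)).
have E1 x : Ac x - Bs x = 0.
  have := congr1 (@complex.Re R) (F0 x); rewrite /= => <-.
  rewrite -(RintegralB measurableT (ic A x iA) (is_ B x iB)).
  by apply: eq_Rintegral => xi _; rewrite Re_mul.
have E2 x : As x + Bc x = 0.
  have := congr1 (@complex.Im R) (F0 x); rewrite /= => <-.
  rewrite -(RintegralD measurableT (is_ A x iA) (ic B x iB)).
  by apply: eq_Rintegral => xi _; rewrite Im_mul.
(* In Ac - Bs = 0 the first term is even in x and the second odd, so comparing x with -x makes each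
   vanish; likewise in As + Bc = 0. This separates the real and imaginary parts of F. *)
pose opp (x : R3 R) : R3 R := (- (x.1.1 : R), - (x.1.2 : R), - (x.2 : R)).
have thN x xi : th (opp x) xi = - th x xi.
  rewrite /th /dot -sumrN; apply: eq_bigr => k _; rewrite -mulrN; congr (_ * _).
  by rewrite /coord3; case: (val k) => [|[|n]].
have AcN x : Ac (opp x) = Ac x by apply: eq_Rintegral => xi _; rewrite thN cosN.
have BcN x : Bc (opp x) = Bc x by apply: eq_Rintegral => xi _; rewrite thN cosN.
have AsN x : As (opp x) = - As x.
  rewrite -mulN1r -(RintegralZl _ measurableT (is_ A x iA)).
  by apply: eq_Rintegral => xi _; rewrite thN sinN; ring.
have BsN x : Bs (opp x) = - Bs x.
  rewrite -mulN1r -(RintegralZl _ measurableT (is_ B x iB)).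
  by apply: eq_Rintegral => xi _; rewrite thN sinN; ring.
have vec (x : 'I_3 -> R) : exists y : R3 R, forall k, coord3 (y : R * R * R) k = x k.
  exists (x (@Ordinal 3 0 isT), x (@Ordinal 3 1 isT), x (@Ordinal 3 2 isT)) => -[[|[|[|k]]] kk] //=;
    by rewrite /coord3/=; congr x; exact: val_inj.
have nt u : (leb3s R).-integrable setT (EFin \o u) ->
    (forall x, \int[leb3s R]_xi (u xi * cos (th x xi)) = 0) ->
    (forall x, \int[leb3s R]_xi (u xi * sin (th x xi)) = 0) ->
    null_transform (leb3s R) (fun k (xi : R3 R) => coord3 xi k : R) u.
  move=> iu uc us; split => // x c; have [y yE] := vec x.
  transitivity (\int[leb3s R]_xi ((u xi * cos (th y xi)) * cos c - (u xi * sin (th y xi)) * sin c)).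
    apply: eq_Rintegral => xi _; rewrite /phase.
    rewrite (_ : \sum_(k < 3) _ = th y xi); first by rewrite cosD; ring.
    by apply: eq_bigr => k _; rewrite -yE mulrC.
  have j1 := integrableZr measurableT (cos c) (ic u y iu).
  have j2 := integrableZr measurableT (sin c) (is_ u y iu).
  rewrite (RintegralB measurableT j1 j2) (RintegralZr _ measurableT (ic u y iu)).
  by rewrite (RintegralZr _ measurableT (is_ u y iu)) uc us !mul0r subrr.
have A0 : \forall xi \ae leb3s R, A xi = 0.
  apply/null_transform_eq0/nt => // x.
    by rewrite -/(Ac x); have := E1 x; have := E1 (opp x); rewrite AcN BsN; lra.
  by rewrite -/(As x); have := E2 x; have := E2 (opp x); rewrite AsN BcN; lra.
have B0 : \forall xi \ae leb3s R, B xi = 0.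
  apply/null_transform_eq0/nt => // x.
    by rewrite -/(Bc x); have := E2 x; have := E2 (opp x); rewrite AsN BcN; lra.
  by rewrite -/(Bs x); have := E1 x; have := E1 (opp x); rewrite AcN BsN; lra.
by apply: filterS2 A0 B0 => xi a0 b0; exact: complexP.
Qed.

Definition space_neg (x : R3 R) : R3 R := sub3 (@zero3 R) (x : R * R * R).

Lemma space_coord_neg (x : R3 R) k : (coord3 (space_neg x) k : R) = - coord3 x k.
Proof.
rewrite /space_neg (coord3_sub (@zero3 R)).
by rewrite [X in X - _](_ : _ = 0) ?sub0r// /coord3; case: (val k) => [|[|n]].
Qed.

Lemma twopi3_neq0 : (2 * pi : R) ^- 3 != 0.
Proof. by rewrite invr_eq0 expf_neq0// mulf_neq0// gt_eqF// pi_gt0. Qed.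

Definition space_fourier : fourier_group R :=
  @FourierGroup R (space_group R) (fun xi k => coord3 xi k) (@space_transform R)
    ((2 * pi) ^- 3) space_neg (@measurable_coord3 R)
    (fun x y k => coord3_sub (x : R * R * R) y k)
    (fun x => erefl) (preserving_sub3l (@zero3 R)) (@sub3_neg R) space_coord_neg
    twopi3_neq0 (fun f F => iff_refl _) space_inj.

Definition torus_neg (x : Z3) : Z3 := sub3 (@zero3 int) (x : int * int * int).

Lemma torus_coord_neg (x : Z3) k : Z3_coord R (torus_neg x) k = - Z3_coord R x k.
Proof.
rewrite /torus_neg /Z3_coord (coord3_sub (@zero3 int)) intrB.
by rewrite [X in X - _](_ : _ = 0) ?sub0r// /coord3; case: (val k) => [|[|n]].
Qed.

Lemma torus_coord_sub (x y : Z3) k :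
  Z3_coord R (sub3 (x : int * int * int) y) k = Z3_coord R x k - Z3_coord R y k.
Proof. by rewrite /Z3_coord (coord3_sub (x : int * int * int)) intrB. Qed.

Lemma torus_trP f F : torus_transform f F <->
  cintegrable (counting_Z3 R) setT F /\
  forall x, (f x)%:C = (1 : R)%:C *
    cintegral (counting_Z3 R) setT (fun xi => F xi * cis (dot (Z3_coord R xi) x)).
Proof.
split=> [[_ iF h]|[iF h]].
  by split => // x; rewrite h mul1r.
have h' x : (f x)%:C = cintegral (@counting Z3 R) setT (fun xi => F xi * cis (dot (Z3_coord R xi) x)).
  by rewrite h mul1r.
split => //; exact: torus_inversion.
Qed.

Lemma torus_inj (F : Z3 -> R[i]) : cintegrable (counting_Z3 R) setT F ->
  (forall x, cintegral (counting_Z3 R) setT (fun xi => F xi * cis (dot (Z3_coord R xi) x)) = 0) ->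
  \forall xi \ae counting_Z3 R, F xi = 0.
Proof.
move=> iF F0; apply: aeW => xi.
rewrite (@torus_inversion R (fun=> 0) F iF) => [|x]; last by rewrite [RHS]F0.
rewrite /fourier_coef (_ : cintegral _ _ _ = 0) ?mulr0//.
by apply: complexP; rewrite /cintegral/= /Rintegral integral0_eq// => x _;
  rewrite !mul0r ?subr0 ?addr0.
Qed.

Definition torus_fourier : fourier_group R :=
  @FourierGroup R (torus_group R) (Z3_coord R) (@torus_transform R) 1 torus_neg
    (fun k => fun _ _ _ => measurable_Z3 _) torus_coord_sub
    (fun x => erefl) (preserving_Z3_subl R (@zero3 int)) (@sub3_neg int) torus_coord_neg
    (oner_neq0 R) torus_trP torus_inj.

End instances.

(** * The Navier-Stokes-Fourier system *)

Section nsf_system.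
Context (R : realType) (X : fourier_group R).
Local Open Scope complex_scope.
Local Notation mu := (fg_measure X).
Local Notation S := (fo_setting X).
Local Notation coord := (fo_coord X).
Local Notation I := (option 'I_3 * bool)%type.
Implicit Types (a : option 'I_3) (b : bool) (C : I -> I -> R) (x : X).

Definition part b (z : R[i]) : R := if b then complex.Im z else complex.Re z.

(* [C] gives the convolutions of the real and imaginary parts of the components
   (None for the temperature); these are the parts of the transforms of the
   products of components. *)
Definition product_part b C a a' : R := fo_const X *
  (if b then C (a, false) (a', true) + C (a, true) (a', false)
   else C (a, false) (a', false) - C (a, true) (a', true)).

Definition product_hat C a a' : R[i] := product_part false C a a' +i* product_part true C a a'.

Definition real_leray (d : 'I_3 -> R) j x : R :=
  d j - (sqmod (X := S) x)^-1 * \sum_(k < 3) coord x j * coord x k * d k.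

Definition flux (p : option 'I_3 -> option 'I_3 -> R) a x : R :=
  match a with
  | Some j => real_leray (fun i => \sum_(k < 3) coord x k * p (Some i) (Some k)) j x
  | None => \sum_(k < 3) coord x k * p (Some k) None
  end.

(** The derivative is multiplication by i xi_k, which exchanges real and imaginary parts: a part of
    the source is built from the opposite part of the products, with sign (-1)^b. *)
Definition nsf_multiplier (i : I) x C : R :=
  (-1) ^+ i.2 * flux (product_part (~~ i.2) C) i.1 x.

Definition nsf_source a x C : R[i] :=
  match a with
  | Some j => QNS_hat (X := S) (fun i k _ => product_hat C (Some i) (Some k))
      (fun i k _ => product_hat C (Some i) (Some k)) j x
  | None => - div_hat (X := S) (fun k _ => product_hat C (Some k) None) x
  end.

Lemma fg_mod_sqr x : fg_mod x ^+ 2 = sqmod (X := S) x :> R.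
Proof. by rewrite fo_modE; exact: (@freq_mod_sqr R S). Qed.

Lemma fg_modE x : fg_mod x = freq_mod S x :> R.
Proof. by rewrite fo_modE. Qed.

Lemma coord_le x k : `|coord x k| <= fg_mod x.
Proof. by rewrite fg_modE; exact: (@freq_coord_le R S). Qed.

Lemma Re_sum (n : nat) (F : 'I_n -> R[i]) : complex.Re (\sum_k F k) = \sum_k complex.Re (F k).
Proof. by elim/big_ind2 : _ => // x1 x2 y1 y2 <- <-; rewrite ReD. Qed.

Lemma Im_sum (n : nat) (F : 'I_n -> R[i]) : complex.Im (\sum_k F k) = \sum_k complex.Im (F k).
Proof. by elim/big_ind2 : _ => // x1 x2 y1 y2 <- <-; rewrite ImD. Qed.

Lemma part_div_hat b (p : 'I_3 -> R[i]) x :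
  part b (div_hat (X := S) (fun k _ => p k) x) =
  (-1) ^+ (~~ b) * \sum_(k < 3) coord x k * part (~~ b) (p k).
Proof.
rewrite /div_hat /partial_hat; case: b => /=.
  rewrite Im_sum expr0 mul1r; apply: eq_bigr => k _.
  by rewrite Im_mul/= mul0r add0r.
rewrite Re_sum expr1 mulN1r -sumrN; apply: eq_bigr => k _.
by rewrite Re_mul/= mul0r sub0r.
Qed.

Lemma part_product b C a a' : part b (product_hat C a a') = product_part b C a a'.
Proof. by case: b. Qed.

Lemma part_mulC b (r : R) z : part b (r%:C * z) = r * part b z.
Proof. by case: b; rewrite /part ?Re_mulC ?Im_mulC. Qed.

Lemma partD b z w : part b (z + w) = part b z + part b w.
Proof. by case: b; rewrite /part ?ReD ?ImD. Qed.

Lemma partN b z : part b (- z) = - part b z.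
Proof. by case: b; rewrite /part ?ReN ?ImN. Qed.

Lemma part_sum b (F : 'I_3 -> R[i]) : part b (\sum_(k < 3) F k) = \sum_(k < 3) part b (F k).
Proof. by case: b; rewrite /part ?Re_sum ?Im_sum. Qed.

Lemma eq_real_leray (d d' : 'I_3 -> R) j x : (forall i, d i = d' i) ->
  real_leray d j x = real_leray d' j x.
Proof. by move=> dd'; rewrite (_ : d = d')//; exact/funext. Qed.

Lemma real_lerayZ r (d : 'I_3 -> R) j x :
  real_leray (fun i => r * d i) j x = r * real_leray d j x.
Proof.
rewrite /real_leray mulrBr mulrCA; congr (_ - _ * _).
by rewrite mulr_sumr; apply: eq_bigr => k _; ring.
Qed.

Lemma real_lerayB (d d' : 'I_3 -> R) j x :
  real_leray (fun i => d i - d' i) j x = real_leray d j x - real_leray d' j x.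
Proof.
rewrite /real_leray.
under eq_bigr do rewrite mulrBr.
rewrite sumrB; ring.
Qed.

Lemma part_leray b (D : 'I_3 -> R[i]) j x :
  part b (leray_hat (X := S) (fun i _ => D i) j x) = real_leray (fun i => part b (D i)) j x.
Proof.
rewrite /leray_hat partD partN part_mulC part_sum; congr (_ - _ * _).
by apply: eq_bigr => k _; rewrite part_mulC.
Qed.

Lemma flux_part b C a x : (-1) ^+ b * flux (product_part (~~ b) C) a x =
  match a with
  | Some j => - (2^-1 * real_leray (fun i => 2 * part b (div_hat (X := S) (fun k _ => product_hat C (Some i) (Some k)) x)) j x)
  | None => - part b (div_hat (X := S) (fun k _ => product_hat C (Some k) None) x)
  end.
Proof.
have H (u : 'I_3 -> option 'I_3 * option 'I_3) : part b (div_hat (X := S) (fun k _ => product_hat C (u k).1 (u k).2) x) =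
    - (-1) ^+ b * \sum_(k < 3) coord x k * product_part (~~ b) C (u k).1 (u k).2.
  rewrite part_div_hat; congr (_ * _); first by case: b; rewrite /= ?expr0 ?expr1 ?opprK.
  by apply: eq_bigr => k _; rewrite part_product.
case: a => [j|] /=; last by rewrite (H (fun k => (Some k, None))) mulNr opprK.
rewrite real_lerayZ mulrA mulVf// mul1r.
rewrite [X in _ = - X](_ : _ = real_leray (fun i => - (-1) ^+ b *
    \sum_(k < 3) coord x k * product_part (~~ b) C (Some i) (Some k)) j x).
  by rewrite real_lerayZ mulNr opprK.
by apply: eq_real_leray => i; exact: (H (fun k => (Some i, Some k))).
Qed.

Lemma part_source a b x C : part b (nsf_source a x C) = nsf_multiplier (a, b) x C.
Proof.
rewrite /nsf_multiplier flux_part; case: a => [j|] /=; last by rewrite partN.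
rewrite /QNS_hat mulNr partN part_mulC; congr (- (_ * _)).
rewrite part_leray; apply: eq_real_leray => i.
by rewrite partD mulrC mulr_natr mulr2n.
Qed.

Lemma nsf_multiplierB i x C C' :
  nsf_multiplier i x (fun j k => C j k - C' j k) = nsf_multiplier i x C - nsf_multiplier i x C'.
Proof.
case: i => a b; rewrite /nsf_multiplier -mulrBr; congr (_ * _) => /=.
have pB a1 a2 : product_part (~~ b) (fun j k => C j k - C' j k) a1 a2 =
    product_part (~~ b) C a1 a2 - product_part (~~ b) C' a1 a2.
  by rewrite /product_part; case: (~~ b); ring.
case: a => [j|] /=; last by rewrite -sumrB; apply: eq_bigr => k _; rewrite pB mulrBr.
rewrite -real_lerayB; apply: eq_real_leray => i.
by rewrite -sumrB; apply: eq_bigr => k _; rewrite pB mulrBr.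
Qed.

(** 24 = 4 * 6. A divergence has three terms, each made of two real products, whence 6; the gradient
    term of the Leray projector is bounded by three times as much again. *)
Lemma nsf_multiplier_le i x C :
  `|nsf_multiplier i x C| <= 24 * `|fo_const X| * fg_mod x * \sum_(p : I * I) `|C p.1 p.2|.
Proof.
case: i => a b; rewrite /nsf_multiplier normrM normrX normrN1 expr1n mul1r.
set T := \sum_(p : I * I) _; set c := fo_const X.
have T0 : 0 <= T by exact: sumr_ge0.
have CT i k : `|C i k| <= T by rewrite /T (bigD1 (i, k))//= lerDl sumr_ge0.
have x0 : 0 <= fg_mod x :> R by exact: fg_mod_ge0.
have c0 : 0 <= `|c| by [].
have pT b' a1 a2 : `|product_part b' C a1 a2| <= 2 * `|c| * T.
  rewrite normrM -/c (mulrC 2) -mulrA; apply: ler_wpM2l => //.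
  by case: b'; [apply: le_trans (ler_normD _ _) _|apply: le_trans (ler_normB _ _) _];
    rewrite mulrC mulr_natr mulr2n; exact: lerD.
have sT b' (u : 'I_3 -> option 'I_3 * option 'I_3) :
   `|\sum_(k < 3) coord x k * product_part b' C (u k).1 (u k).2| <= 6 * `|c| * fg_mod x * T.
  apply: le_trans (ler_norm_sum _ _ _) _.
  apply: (@le_trans _ _ (\sum_(k < 3) fg_mod x * (2 * `|c| * T))).
    by apply: ler_sum => k _; rewrite normrM; apply: ler_pM => //; exact: coord_le.
  by rewrite sumr_const card_ord -mulr_natl le_eqVlt; apply/orP; left; apply/eqP; ring.
have K0 : 0 <= 6 * `|c| * fg_mod x * T by rewrite !mulr_ge0.
case: a => [j|] /=; last first.
  apply: le_trans (sT _ (fun k => (Some k, None))) _.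
  rewrite (_ : 24 * _ * _ * _ = 4 * (6 * `|c| * fg_mod x * T)); [lra|ring].
pose d i := \sum_(k < 3) coord x k * product_part (~~ b) C (Some i) (Some k).
have dT i : `|d i| <= 6 * `|c| * fg_mod x * T by exact: (sT _ (fun k => (Some i, Some k))).
rewrite -/d /real_leray; apply: le_trans (ler_normB _ _) _.
have H : `|(sqmod (X := S) x)^-1 * \sum_(k < 3) coord x j * coord x k * d k| <= 3 * (6 * `|c| * fg_mod x * T).
  have [x2|x2] := eqVneq (sqmod (X := S) x) 0.
    by rewrite x2 invr0 mul0r normr0 mulr_ge0.
  have x2gt : 0 < sqmod (X := S) x by rewrite lt_def x2 sqmod_ge0.
  rewrite normrM normfV (gtr0_norm x2gt) mulrC ler_pdivrMr//.
  apply: le_trans (ler_norm_sum _ _ _) _.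
  apply: (@le_trans _ _ (\sum_(k < 3) sqmod (X := S) x * (6 * `|c| * fg_mod x * T))).
    apply: ler_sum => k _; rewrite normrM; apply: ler_pM => //.
    by rewrite normrM -fg_mod_sqr expr2; apply: ler_pM => //; exact: coord_le.
  by rewrite sumr_const card_ord -mulr_natl le_eqVlt; apply/orP; left; apply/eqP; ring.
apply: le_trans (lerD (dT j) H) _.
by rewrite le_eqVlt; apply/orP; left; apply/eqP; ring.
Qed.

Lemma jointly_nsf_multiplier i (C : I -> I -> R -> X -> R) :
  (forall j k, jointly (C j k)) -> jointly (fun t x => nsf_multiplier i x (fun j k => C j k t x)).
Proof.
move=> mC; case: i => a b.
have mc k : measurable_fun [set: measurableTypeR R * X] (fun z => coord z.2 k).
  exact: (measurableT_comp (measurable_fo_coord k) measurable_snd).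
have mp b' a1 a2 : measurable_fun [set: measurableTypeR R * X]
    (fun z => product_part b' (fun j k => C j k z.1 z.2) a1 a2).
  apply: measurable_funM => //; case: b'; [apply: measurable_funD|apply: measurable_funB]; exact: mC.
have ms b' (u : 'I_3 -> option 'I_3 * option 'I_3) : measurable_fun [set: measurableTypeR R * X]
    (fun z => \sum_(k < 3) coord z.2 k * product_part b' (fun j k => C j k z.1 z.2) (u k).1 (u k).2).
  by apply: measurable_sum => k; apply: measurable_funM.
apply: measurable_funM => //; case: a => [j|] /=; last exact: (ms _ (fun k => (Some k, None))).
apply: measurable_funB; first exact: (ms _ (fun k => (Some j, Some k))).
apply: measurable_funM.
  apply: measurableT_comp; first exact: measurable_invr.
  apply: (measurableT_comp (f := @sqmod R S)) => //; apply: measurable_sqmod.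
  exact: measurable_fo_coord.
apply: measurable_sum => k; apply: measurable_funM; first exact: measurable_funM.
exact: (ms _ (fun l => (Some k, Some l))).
Qed.

Lemma nsf_quadratic : quadratic_multiplier (24 * `|fo_const X|) nsf_multiplier.
Proof.
split; [exact: nsf_multiplierB|exact: nsf_multiplier_le|exact: jointly_nsf_multiplier].
Qed.

(** Hermitian symmetry in real terms: real parts are even, imaginary parts odd. *)
Definition nsf_sign (i : I) : R := (-1) ^+ i.2.

Lemma nsf_multiplier_neg i x C :
  nsf_multiplier i (fo_neg X x) (fun j k => nsf_sign j * nsf_sign k * C j k) =
  nsf_sign i * nsf_multiplier i x C.
Proof.
case: i => a b; rewrite /nsf_multiplier /nsf_sign/=; congr (_ * _).
have pE a1 a2 : product_part (~~ b) (fun j k => (-1) ^+ j.2 * (-1) ^+ k.2 * C j k) a1 a2 =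
    - (-1) ^+ b * product_part (~~ b) C a1 a2.
  by rewrite /product_part; case: b; rewrite /= ?expr0 ?expr1; ring.
have x2 : sqmod (X := S) (fo_neg X x) = sqmod (X := S) x.
  by apply: eq_bigr => k _; rewrite /= fo_coord_neg sqrrN.
case: a => [j|] /=; last first.
  by rewrite mulr_sumr; apply: eq_bigr => k _; rewrite pE fo_coord_neg; ring.
rewrite -real_lerayZ /real_leray x2; congr (_ - _ * _).
  by rewrite mulr_sumr; apply: eq_bigr => k _; rewrite pE fo_coord_neg; ring.
apply: eq_bigr => k _; rewrite !fo_coord_neg mulrNN; congr (_ * _).
by rewrite mulr_sumr; apply: eq_bigr => l _; rewrite pE fo_coord_neg; ring.
Qed.

(** The projected source is orthogonal to xi, also at frequencies with |xi| = 0, where all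
    coordinates vanish. This is how div u = 0 propagates from the data. *)
Lemma nsf_multiplier_div b x C :
  \sum_(j < 3) coord x j * nsf_multiplier (Some j, b) x C = 0.
Proof.
rewrite /nsf_multiplier/=.
under eq_bigr do rewrite mulrCA; rewrite -mulr_sumr.
set d := fun i => \sum_(k < 3) coord x k * product_part (~~ b) C (Some i) (Some k).
suff -> : \sum_(j < 3) coord x j * real_leray d j x = 0 by rewrite mulr0.
have [x2|x2] := eqVneq (sqmod (X := S) x) 0.
  rewrite big1// => j _; suff -> : coord x j = 0 by rewrite mul0r.
  apply/eqP; rewrite -normr_le0; apply: le_trans (coord_le x j) _.
  by rewrite fg_modE /freq_mod x2 sqrtr0.
rewrite /real_leray; under eq_bigr do rewrite mulrBr.
rewrite sumrB; set e := \sum_(k < 3) coord x k * d k.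
rewrite (_ : \sum_(j < 3) coord x j * (_ * _) = (sqmod (X := S) x)^-1 * (sqmod (X := S) x * e)).
  by rewrite mulKf// subrr.
under eq_bigr do rewrite mulrCA; rewrite -mulr_sumr; congr (_ * _).
rewrite /sqmod mulr_suml; apply: eq_bigr => j _; rewrite /e !mulr_sumr.
by apply: eq_bigr => k _ /=; ring.
Qed.

End nsf_system.

(** The last clause concerns the mean on the torus: kappa vanishes at zero frequency, so [a] is
    controlled there by the data alone, and mean-free data produce a mean-free solution. *)
Lemma system_exists (R : realType) (G : freq_group R) (I : finType) (nu0 c0 : R)
    (nu : I -> R) (L : I -> G -> (I -> I -> R) -> R) (W0 : I -> G -> R)
    (neg : G -> G) (sg : I -> R) (r : \bar R) (c : R) :
  let mu := fg_measure G in
  let e0 := fun x => 4 * \sum_i `|W0 i x| in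
  0 < nu0 -> (forall i, nu0 <= nu i) -> 0 < c0 -> (0 < #|I|)%N ->
  quadratic_multiplier c0 L -> (forall i, measurable_fun setT (W0 i)) ->
  preserving mu neg ->
  (forall x y, fg_sub (neg x) (neg y) = neg (fg_sub x y)) ->
  (forall x, fg_mod (neg x) = fg_mod x :> R) ->
  (forall i x c, L i (neg x) (fun j k => sg j * sg k * c j k) = sg i * L i x c) ->
  (forall i, \forall x \ae mu, W0 i (neg x) = sg i * W0 i x) ->
  (1 <= r)%E -> 0 < c -> J_bounded G r c r -> J_bounded G r c 1 ->
  ('N[mu]_r[EFin \o e0] <= ((4 * c * (#|I|%:R * (c0 * (64 / nu0))))^-1)%:E)%E ->
  ('N[mu]_1[EFin \o e0] < +oo)%E ->
  exists (W : I -> R -> G -> R) (a : G -> R),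
  [/\ dominated nu0 W a,
      forall i t, 0 <= t -> \forall x \ae mu, solves nu L W0 W i t x,
      forall i t, 0 <= t -> \forall x \ae mu, W i t (neg x) = sg i * W i t x,
      forall q, (1 <= q)%E -> J_bounded G r c q ->
        ('N[mu]_q[EFin \o a] <= 2%:E * 'N[mu]_q[EFin \o e0])%E
    & forall x, fg_mod x = 0 :> R -> a x <= e0 x].
Proof.
move=> mu e0 nu0_gt0 nu_ge c0_gt0 I_gt0 qL mW0 [mneg neg_int] neg_sub neg_mod L_neg W0_neg
  r1 c_gt0 Jr J1 e0_small e0_fin.
pose C : R := #|I|%:R * (c0 * (64 / nu0)).
have C_gt0 : 0 < C by rewrite !mulr_gt0 ?ltr0n ?invr_gt0.
have me0 : measurable_fun setT e0.
  apply: measurable_funM => //; apply: measurable_sum => i.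
  by apply: measurableT_comp => //; exact: mW0.
have e00 x : 0 <= e0 x by rewrite mulr_ge0// sumr_ge0.
have [a_ [a [D [mD muD [ma_ ma] [a_00 [a_ge0 [a_S [a_cvg aND]]]] [a_JE aJE a_conv aN]]]]] :=
  majorant_exists r1 c_gt0 C_gt0 me0 e00 Jr e0_small J1 e0_fin.
have a0 x : 0 <= a x by apply: (cvg_ge_cst (@a_cvg x)) => n; exact: a_ge0.
have aJoo x : D x -> (Jform a x < +oo)%E.
  move=> Dx; rewrite ltNge leye_eq; apply/eqP => Joo; move: (aJE x Dx).
  by rewrite Joo gt0_muley ?lte_fin// addey.
have aeD : \forall x \ae mu, D x.
  by exists (~` D); split => //; exact: measurableC.
have W0_le x : 4 * (\sum_i `|W0 i x|) <= e0 x by [].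
exists (picard_lim nu L W0 D), a; split=> //.
- exact: (picard_lim_dominated nu0_gt0 nu_ge (ltW c0_gt0) qL mW0 W0_le mD ma_ ma a_00 a_ge0 a_S a_cvg aND a_JE a_conv aJoo).
- move=> i t t0; apply: filterS aeD => x Dx.
  exact: (picard_lim_solves nu0_gt0 nu_ge (ltW c0_gt0) qL mW0 W0_le mD ma_ ma a_00 a_ge0 a_S a_cvg aND a_JE aJE a_conv aJoo).
- move=> i t t0.
  exact: (picard_lim_neg nu0_gt0 nu_ge (ltW c0_gt0) qL mW0 W0_le mD ma_ ma a_00 a_ge0 a_S a_cvg aND a_JE a_conv aJoo mneg neg_int neg_sub neg_mod L_neg W0_neg aeD).
- move=> x x0; have [Dx|Dx] := pselect (D x); last by rewrite aND.
  have := aJE x Dx; rewrite (_ : Jform a x = 0%E); first by rewrite mule0 adde0 => -[->].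
  by rewrite /Jform integral0_eq// => y _; rewrite /kappa x0 !mul0r.
Qed.

(** By Tonelli the double integral of the nonnegative f vanishes. Exchanging the quantifiers costs a
    null set of times at each frequency. *)
Lemma ae_swap (R : realType) (G : freq_group R) (f : measurableTypeR R * G -> R) :
  measurable_fun setT f -> (forall z, 0 <= f z) ->
  (forall t, \forall x \ae fg_measure G, f (t, x) = 0) ->
  \forall x \ae fg_measure G, \forall t \ae @lebesgue_measure R, f (t, x) = 0.
Proof.
move=> mf f0 fae; have mfE : measurable_fun setT (EFin \o f) by exact/measurable_EFinP.
have f0E z : (0 <= (EFin \o f) z)%E by rewrite lee_fin.
have I0 : (\int[fg_measure G]_x \int[@lebesgue_measure R]_t (f (t, x))%:E = 0)%E.
  rewrite -(fubini_tonelli (m1 := @lebesgue_measure R) (EFin \o f) mfE f0E).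
  apply: integral0_eq => t _; apply: ae0_integral.
    by apply: (measurableT_comp mfE (g := pair t)); exact: measurable_pair1.
  by apply: filterS (fae t) => x /= ->.
have mfS : measurable_fun setT (fun z : G * measurableTypeR R => (f (z.2, z.1))%:E).
  apply: (measurableT_comp mfE (g := fun z : G * measurableTypeR R => (z.2, z.1))).
  exact: measurable_fun_pair.
have H : \forall x \ae fg_measure G, (\int[@lebesgue_measure R]_t (f (t, x))%:E = 0)%E.
  apply: integral0_ae I0; first exact: (measurable_fun_integral_param (@lebesgue_measure R) mfS).
  by move=> x; apply: integral_ge0 => t _; exact: f0E.
apply: filterS H => x Ix.
have : \forall t \ae @lebesgue_measure R, (f (t, x))%:E = 0%E.
  apply: integral0_ae Ix; last by move=> t; exact: f0E.
  by apply: (measurableT_comp mfE (g := pair^~ x)); exact: measurable_pair2.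
by apply: filterS => t [].
Qed.

Section components.
Context (R : realType) (T : Type).
Local Open Scope complex_scope.
Implicit Types (S : state (T -> R[i])).

Definition component S (a : option 'I_3) : T -> R[i] :=
  if a is Some j then vel S j else temp S.

Lemma cmod_sqr (z : R[i]) : cmod z ^+ 2 = complex.Re z ^+ 2 + complex.Im z ^+ 2.
Proof. by case: z => u v; rewrite /cmod /= sqr_sqrtr// addr_ge0// sqr_ge0. Qed.

Lemma cmod_ge0 (z : R[i]) : 0 <= cmod z.
Proof. by case: z => u v; exact: sqrtr_ge0. Qed.

Lemma part_le_cmod b (z : R[i]) : `|part b z| <= cmod z.
Proof.
rewrite -ler_sqr ?nnegrE ?cmod_ge0// cmod_sqr real_normK ?num_real//.
by case: b => /=; rewrite ?lerDl ?lerDr sqr_ge0.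
Qed.

End components.

Lemma sumr_sqr_le (R : realType) (I : finType) (f : I -> R) : (forall i, 0 <= f i) ->
  \sum_i f i ^+ 2 <= (\sum_i f i) ^+ 2.
Proof.
move=> f0; rewrite [leRHS]expr2 mulr_suml; apply: ler_sum => i _.
by rewrite expr2 ler_wpM2l// (bigD1 i)//= lerDl sumr_ge0.
Qed.

Lemma Rintegral_sumZ d (T : measurableType d) (R : realType) (m : {measure set T -> \bar R}) (D : set T)
    (n : nat) (f : 'I_n -> T -> R) (k : 'I_n -> R) : measurable D ->
  (forall i, m.-integrable D (fun y => (f i y)%:E)) ->
  \sum_(i < n) k i * \int[m]_(y in D) f i y = \int[m]_(y in D) (\sum_(i < n) k i * f i y).
Proof.
move=> mD fi.
have H : \sum_(i < n) k i * \int[m]_(y in D) f i y = \int[m]_(y in D) (\sum_(i < n) k i * f i y) /\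
    m.-integrable D (EFin \o (fun y => \sum_(i < n) k i * f i y)).
  elim: (index_enum 'I_n) => [|i s [IH1 IH2]].
    rewrite big_nil; split; first by under eq_Rintegral do rewrite big_nil; rewrite /Rintegral integral0.
    rewrite (_ : EFin \o _ = cst 0%E); first exact: integrable0.
    by apply/funext => y /=; rewrite big_nil.
  have ik : m.-integrable D (EFin \o (fun y => k i * f i y)).
    rewrite (_ : EFin \o _ = fun y => ((k i)%:E * (f i y)%:E)%E)//.
    exact: integrableZl.
  split; last first.
    rewrite (_ : EFin \o _ = EFin \o ((fun y => k i * f i y) \+ (fun y => \sum_(j <- s) k j * f j y))).
      exact: (integrableD mD ik IH2).
    by apply/funext => y /=; rewrite big_cons.
  under [RHS]eq_Rintegral do rewrite big_cons.
  by rewrite big_cons IH1 (RintegralD mD ik IH2) (RintegralZl _ mD (fi i)).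
exact: H.1.
Qed.

(** * From the real system to mild solutions *)

Section evolution.
Context (R : realType) (X : fourier_group R).
Local Open Scope complex_scope.
Local Notation mu := (fg_measure X).
Local Notation leb := (@lebesgue_measure R).
Local Notation S_ := (fo_setting X).
Local Notation coord := (fo_coord X).
Local Notation I := (option 'I_3 * bool)%type.
Local Notation L := (@nsf_multiplier R X).
Implicit Types (W : I -> R -> X -> R) (U : R -> state (X -> R[i])) (t : R) (x : X).
Variables (nu1 nu2 : R).
Hypotheses (nu1_gt0 : 0 < nu1) (nu2_gt0 : 0 < nu2).

Definition nu_of (i : I) : R := if i.1 is Some _ then nu1 else nu2.
Definition nu_min : R := Num.min nu1 nu2.

Lemma nu_min_gt0 : 0 < nu_min. Proof. by rewrite lt_min nu1_gt0. Qed.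

Lemma nu_min_le i : nu_min <= nu_of i.
Proof. by case: i => [[j|] b]; rewrite ge_min lexx ?orbT. Qed.

(** The constraint on rho + theta is met by rho = - theta, to which it amounts at all nonzero
    frequencies. *)
Definition state_of W t : state (X -> R[i]) :=
  State (fun x => - (W (None, false) t x +i* W (None, true) t x))
    (fun j x => W (Some j, false) t x +i* W (Some j, true) t x)
    (fun x => W (None, false) t x +i* W (None, true) t x).

Definition field_of (S : state (X -> R[i])) : state (R3 R -> R) :=
  State (synth (rho S)) (fun j => synth (vel S j)) (synth (temp S)).

Definition initial_parts (S0 : state (X -> R[i])) (i : I) x : R := part i.2 (component S0 i.1 x).

Definition evolution_parts U (i : I) t x : R :=
  \1_(`[0, +oo[%classic) t * part i.2 (component (U t) i.1 x).

Lemma heatE nu t x : heat (X := S_) nu t x = heatk nu t x.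
Proof. by rewrite /heat /heatk fg_mod_sqr. Qed.

Lemma component_state_of W t a x :
  component (state_of W t) a x = W (a, false) t x +i* W (a, true) t x.
Proof. by case: a. Qed.

Lemma part_component W t a b x : part b (component (state_of W t) a x) = W (a, b) t x.
Proof. by rewrite component_state_of; case: b. Qed.

Lemma product_hat_conv W t a a' x :
  product_hat X (fun j k => conv2 (W j t) (W k t) x) a a' =
  (fo_const X)%:C * cconv (component (state_of W t) a) (component (state_of W t) a') x.
Proof.
have E (b : bool) : (fun y => part b (component (state_of W t) a y)) = W (a, b) t.
  by apply/funext => y; rewrite part_component.
have E' (b : bool) : (fun y => part b (component (state_of W t) a' y)) = W (a', b) t.
  by apply/funext => y; rewrite part_component.
rewrite /cconv -[X in conv2 X]/(fun y => part false _) -!/(part false _).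
have := E false; have := E true; have := E' false; have := E' true => /=.
move=> -> -> -> ->; apply: complexP; first by rewrite Re_mulC.
by rewrite Im_mulC.
Qed.

Lemma QNS_hat_ext (VU VU' UV UV' : 'I_3 -> 'I_3 -> X -> R[i]) j x :
  (forall i k, VU i k x = VU' i k x) -> (forall i k, UV i k x = UV' i k x) ->
  QNS_hat (X := S_) VU UV j x = QNS_hat (X := S_) VU' UV' j x.
Proof.
move=> h1 h2; have D i : div_hat (X := S_) (VU i) x + div_hat (X := S_) (UV i) x =
    div_hat (X := S_) (VU' i) x + div_hat (X := S_) (UV' i) x.
  by congr (_ + _); apply: eq_bigr => k _; rewrite /partial_hat ?h1 ?h2.
rewrite /QNS_hat /leray_hat D; congr (_ * (_ - _ * _)).
by apply: eq_bigr => k _; rewrite D.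
Qed.

Lemma duhamel_parts nu (F0 Ft : X -> R[i]) (G : R -> R[i]) t x :
  (cintegrable leb `[0, t] (fun tau => (heat (X := S_) nu (t - tau) x)%:C * G tau) /\
   Ft x = (heat (X := S_) nu t x)%:C * F0 x +
     cintegral leb `[0, t] (fun tau => (heat (X := S_) nu (t - tau) x)%:C * G tau)) <->
  (forall b, leb.-integrable `[0, t] (fun tau => (heatk nu (t - tau) x * part b (G tau))%:E) /\
    part b (Ft x) = heatk nu t x * part b (F0 x) +
      \int[leb]_(tau in `[0, t]) (heatk nu (t - tau) x * part b (G tau))).
Proof.
have Re_E tau : complex.Re ((heat (X := S_) nu (t - tau) x)%:C * G tau) =
    heatk nu (t - tau) x * part false (G tau) by rewrite Re_mulC heatE.
have Im_E tau : complex.Im ((heat (X := S_) nu (t - tau) x)%:C * G tau) =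
    heatk nu (t - tau) x * part true (G tau) by rewrite Im_mulC heatE.
rewrite /cintegrable /cintegral.
under [X in _.-integrable _ X /\ _]eq_fun do rewrite Re_E.
under [X in (_ /\ _.-integrable _ X) /\ _]eq_fun do rewrite Im_E.
under [X in _ = _ + (X +i* _)]eq_Rintegral do rewrite Re_E.
under [X in _ = _ + (_ +i* X)]eq_Rintegral do rewrite Im_E.
split=> [[[i1 i2] ->] b|h].
  by case: b; split => //; rewrite partD part_mulC heatE.
have [i1 e1] := h false; have [i2 e2] := h true; split => //.
apply: complexP.
  by rewrite ReD Re_mulC heatE.
by rewrite ImD Im_mulC heatE.
Qed.

Section mild_of_solves.
Variables (S0 : state (X -> R[i])) (W : I -> R -> X -> R) (a : X -> R).
Hypotheses (dW : dominated nu_min W a) (ia : mu.-integrable setT (EFin \o a)).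
Hypothesis W_solves : forall i t, 0 <= t ->
  \forall x \ae mu, solves nu_of L (initial_parts S0) W i t x.
Hypothesis W_neg : forall i t, 0 <= t ->
  \forall x \ae mu, W i t (fo_neg X x) = nsf_sign R i * W i t x.
Hypothesis div0 : \forall x \ae mu, div_hat (X := S_) (vel S0) x = 0.

Let W_le i t x : 0 <= t -> `|W i t x| <= a x.
Proof.
have [_ _ a0 Wa] := dW; move=> t0; apply: le_trans (le_nrm W i t x) _.
apply: le_trans (Wa t x t0) _.
by rewrite -[leRHS]mulr1 ler_wpM2l// profile_le1// nu_min_gt0.
Qed.

Let integrable_W i t : 0 <= t -> mu.-integrable setT (EFin \o W i t).
Proof.
move=> t0; have [mW _ a0 _] := dW; apply: le_integrable ia => //.
  by apply/measurable_EFinP; exact: jointlyl.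
by move=> x _; rewrite /= lee_fin (ger0_norm (a0 x)) W_le.
Qed.

Let cint_component t b : 0 <= t -> cintegrable mu setT (component (state_of W t) b).
Proof.
move=> t0; split.
  rewrite (_ : (fun x => _) = EFin \o W (b, false) t); first exact: integrable_W.
  by apply/funext => x; rewrite component_state_of.
rewrite (_ : (fun x => _) = EFin \o W (b, true) t); first exact: integrable_W.
by apply/funext => x; rewrite component_state_of.
Qed.

Let herm_component t b : 0 <= t -> \forall x \ae mu,
  component (state_of W t) b (fo_neg X x) = conjc (component (state_of W t) b x).
Proof.
move=> t0; apply: filterS2 (W_neg (b, false) t0) (W_neg (b, true) t0) => x h1 h2.
rewrite !component_state_of h1 h2 /nsf_sign/= expr0 expr1 mul1r mulN1r.
by [].
Qed.

Let tr_component t b : 0 <= t -> fo_tr X (synth (component (state_of W t) b)) (component (state_of W t) b).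
Proof. by move=> t0; apply: tr_synth; [exact: cint_component|exact: herm_component]. Qed.

Let tr_rho t : 0 <= t -> fo_tr X (synth (rho (state_of W t))) (rho (state_of W t)).
Proof.
move=> t0; apply: tr_synth.
  have [i1 i2] := cint_component None t0; split.
    rewrite (_ : (fun x => _) = (fun x => - (complex.Re (component (state_of W t) None x))%:E)%E).
      exact: integrableN.
    by apply/funext => x; rewrite /= .
  rewrite (_ : (fun x => _) = (fun x => - (complex.Im (component (state_of W t) None x))%:E)%E).
    exact: integrableN.
  by apply/funext => x; rewrite /= .
apply: filterS (herm_component None t0) => x /= ->.
by apply: complexP.
Qed.

Lemma mild_of_solves :
  mild_solution (X := S_) nu1 nu2 S0 (fun t => field_of (state_of W t)) (state_of W).
Proof.
have [mW ma a0 Wa] := dW.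
have jm (b : option 'I_3) : jointly_measurable (X := S_) (fun t => component (state_of W t) b).
  split; apply: measurable_funTS.
    rewrite (_ : (fun z => _) = fun z => W (b, false) z.1 z.2); first exact: mW.
    by apply/funext => z; rewrite component_state_of.
  rewrite (_ : (fun z => _) = fun z => W (b, true) z.1 z.2); first exact: mW.
  by apply/funext => z; rewrite component_state_of.
pose P (b b' : option 'I_3) t x := (fo_const X)%:C * cconv (component (state_of W t) b) (component (state_of W t) b') x.
have PE b b' t x : P b b' t x = product_hat X (fun j k => conv2 (W j t) (W k t) x) b b'.
  by rewrite product_hat_conv.
have jP b b' : jointly_measurable (X := S_) (fun t x => P b b' t x).
  have mp (c : bool) : jointly (fun t x => product_part X c (fun j k => conv2 (W j t) (W k t) x) b b').
    apply: measurable_funM => //.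
    by case: c; [apply: measurable_funD|apply: measurable_funB]; exact: jointly_conv2.
  split; apply: measurable_funTS.
    rewrite (_ : (fun z => _) = fun z => product_part X false (fun j k => conv2 (W j z.1) (W k z.1) z.2) b b'); first exact: mp.
    by apply/funext => z; rewrite PE.
  rewrite (_ : (fun z => _) = fun z => product_part X true (fun j k => conv2 (W j z.1) (W k z.1) z.2) b b'); first exact: mp.
  by apply/funext => z; rewrite PE.
split; [split|split].
- by move=> t t0; split; [exact: tr_rho|move=> j; exact: (tr_component (Some j))|exact: (tr_component None)].
- have [h1 h2] := jm None; split.
    rewrite (_ : (fun z => _) = (fun z => - complex.Re (component (state_of W z.1) None z.2))).
      exact: measurableT_comp.
    by apply/funext.
  rewrite (_ : (fun z => _) = (fun z => - complex.Im (component (state_of W z.1) None z.2))).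
    exact: measurableT_comp.
  by apply/funext.
- by move=> j; exact: (jm (Some j)).
- exact: (jm None).
- move=> t t0; split; last first.
    by move=> k; apply: aeW => x; rewrite /partial_hat /= addNr mulr0.
  have s b : \forall x \ae mu, forall j : 'I_3, solves nu_of L (initial_parts S0) W (Some j, b) t x.
    by apply: filter_forall => j; exact: W_solves.
  apply: filterS3 (s false) (s true) div0 => x s1 s2 d0.
  (* In the combination xi . u the sources cancel by [nsf_multiplier_div], and what remains is the
     heat flow of the divergence of the data, which is zero. All velocity components share the
     viscosity nu1, so the sum can be taken under the integral. *)
  have key b : \sum_(k < 3) coord x k * W (Some k, b) t x = 0.
    have sb j : solves nu_of L (initial_parts S0) W (Some j, b) t x by case: b.
    have init0 : \sum_(k < 3) coord x k * initial_parts S0 (Some k, b) x = 0.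
      have := @part_div_hat R X (~~ b) (fun k => vel S0 k x) x.
      rewrite negbK (_ : div_hat _ _ = 0); last exact: d0.
      have -> : part (~~ b) (0 : R[i]) = 0 by case: (~~ b).
      by move=> /esym/eqP; rewrite mulf_eq0 signr_eq0/= => /eqP; apply: etrans.
    transitivity (\sum_(k < 3) (heatk nu1 t x * (coord x k * initial_parts S0 (Some k, b) x)
       + coord x k * duhamel_term nu1 (source L W (Some k, b)) t x)).
      by apply: eq_bigr => k _; have [_ ->] := sb k; rewrite /nu_of/=; ring.
    rewrite big_split/= -mulr_sumr init0 mulr0 add0r /duhamel_term.
    rewrite (@Rintegral_sumZ _ _ _ leb `[0, t]%classic 3 (fun k tau => heatk nu1 (t - tau) x * source L W (Some k, b) tau x) (fun k => coord x k))//; last first.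
      by move=> k; have [i _] := sb k; exact: i.
    under eq_Rintegral => tau _.
      rewrite (_ : \sum_(k < 3) _ = heatk nu1 (t - tau) x * \sum_(k < 3) coord x k * source L W (Some k, b) tau x).
        rewrite nsf_multiplier_div mulr0; over.
      by rewrite mulr_sumr; apply: eq_bigr => k _; ring.
    by rewrite /Rintegral integral0.
  have dE b : part b (div_hat (X := S_) (vel (state_of W t)) x) = 0.
    rewrite (@part_div_hat R X b (fun k => vel (state_of W t) k x) x).
    rewrite (_ : \sum_(k < 3) _ = 0) ?mulr0// -[RHS](key (~~ b)).
    by apply: eq_bigr => k _; rewrite (part_component W t (Some k)).
  by apply: complexP; [exact: (dE false)|exact: (dE true)].
- exists (fun t j k => P (Some j) (Some k) t), (fun t k => P (Some k) None t); split.
  + move=> j k; split; first exact: jP.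
    by move=> t t0; apply: tr_mul; [exact: (tr_component (Some j))|exact: (tr_component (Some k))].
  + move=> k; split; first exact: jP.
    by move=> t t0; apply: tr_mul; [exact: (tr_component (Some k))|exact: (tr_component None)].
  + move=> j t t0; apply: filterS2 (W_solves (Some j, false) t0) (W_solves (Some j, true) t0) => x s1 s2.
    apply/duhamel_parts => b.
    have sb : solves nu_of L (initial_parts S0) W (Some j, b) t x by case: b.
    have GE tau : part b (QNS_hat (X := S_) (fun j k => P (Some j) (Some k) tau) (fun j k => P (Some j) (Some k) tau) j x)
        = source L W (Some j, b) tau x.
      by rewrite /source -part_source; congr (part b _); apply: QNS_hat_ext => i k; exact: PE.
    have [h1 h2] := sb; split.
      by rewrite (_ : (fun tau => _) = (fun tau => (heatk nu1 (t - tau) x * source L W (Some j, b) tau x)%:E))//; apply/funext => tau; rewrite GE.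
    rewrite (_ : \int[leb]_(tau in `[0, t]) _ = duhamel_term nu1 (source L W (Some j, b)) t x).
      by rewrite (part_component W t (Some j)) h2.
    by apply: eq_Rintegral => tau _; rewrite GE.
  + move=> t t0; apply: filterS2 (W_solves (None, false) t0) (W_solves (None, true) t0) => x s1 s2.
    apply/duhamel_parts => b.
    have sb : solves nu_of L (initial_parts S0) W (None, b) t x by case: b.
    have GE tau : part b (- div_hat (X := S_) (fun k => P (Some k) None tau) x) = source L W (None, b) tau x.
      rewrite /source -part_source; congr (part b (- _)); apply: eq_bigr => k _.
      by rewrite /partial_hat PE.
    have [h1 h2] := sb; split.
      by rewrite (_ : (fun tau => _) = (fun tau => (heatk nu2 (t - tau) x * source L W (None, b) tau x)%:E))//; apply/funext => tau; rewrite GE.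
    rewrite (_ : \int[leb]_(tau in `[0, t]) _ = duhamel_term nu2 (source L W (None, b)) t x).
      by rewrite (part_component W t None) h2.
    by apply: eq_Rintegral => tau _; rewrite GE.
Qed.

End mild_of_solves.

End evolution.

Lemma ae_integrable d (T : measurableType d) (R : realType) (mu : {measure set T -> \bar R})
    (D : set T) (f g : T -> \bar R) : measurable D -> measurable_fun D g ->
  (\forall x \ae mu, D x -> f x = g x) -> mu.-integrable D f -> mu.-integrable D g.
Proof.
move=> mD mg fg /integrableP[mf fi]; apply/integrableP; split => //.
suff <- : (\int[mu]_(x in D) `|f x| = \int[mu]_(x in D) `|g x|)%E by [].
apply: ae_eq_integral => //; [exact: measurableT_comp|exact: measurableT_comp|].
by apply: filterS fg => x h Dx; rewrite h.
Qed.

(** * From mild solutions to the real system *)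

Section solves_of_mild.
Context (R : realType) (X : fourier_group R).
Local Open Scope complex_scope.
Local Notation mu := (fg_measure X).
Local Notation leb := (@lebesgue_measure R).
Local Notation S_ := (fo_setting X).
Local Notation I := (option 'I_3 * bool)%type.
Local Notation L := (@nsf_multiplier R X).
Variables (nu1 nu2 : R).
Local Notation nu_of := (@nu_of R nu1 nu2).
Variables (S0 : state (X -> R[i])) (s : R -> state (R3 R -> R)) (S : R -> state (X -> R[i])).
Hypothesis mild : mild_solution (X := S_) nu1 nu2 S0 s S.
Local Notation U := (evolution_parts S).
Implicit Types (t : R) (x : X).

Let pos : set (measurableTypeR R * X) := [set z | 0 <= z.1].

Let m_pos : measurable pos.
Proof.
rewrite (_ : pos = fst @^-1` `[0, +oo[%classic).
  by rewrite -[X in measurable X]setTI; exact: measurable_fst.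
by apply/seteqP; split => z /=; rewrite in_itv/= andbT.
Qed.

Let jointly_part (F : R -> X -> R[i]) b : jointly_measurable (X := S_) F ->
  jointly (fun t x => \1_(`[0, +oo[%classic) t * part b (F t x)).
Proof.
move=> [m1 m2]; have mp : measurable_fun pos (fun z => part b (F z.1 z.2)) by case: b.
have := (measurable_restrictT _ m_pos).1 mp; apply: eq_measurable_fun => z _.
rewrite /patch; case: ifPn => [/set_mem z0|/negP z0].
  by rewrite indic_in ?mul1r//= in_itv/= andbT.
by rewrite indic_notin ?mul0r//= in_itv/= andbT => h; apply: z0; exact/mem_set.
Qed.

Lemma evolution_parts_pos a b t x : 0 <= t -> U (a, b) t x = part b (component (S t) a x).
Proof. by move=> t0; rewrite /evolution_parts indic_in ?mul1r//= in_itv/= t0. Qed.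

Lemma jointly_evolution_parts i : jointly (U i).
Proof.
case: i => a b; apply: jointly_part; have [[_ m1 m2 m3] _] := mild.
by case: a => [j|]; [exact: m2|exact: m3].
Qed.

Let tr_comp t a : 0 <= t -> fo_tr X
  (if a is Some j then vel (s t) j else temp (s t)) (component (S t) a).
Proof.
by move=> t0; have [[h _ _ _] _] := mild; have [_ h2 h3] := h t t0; case: a.
Qed.

Let product_hat_evolution t a a' x : 0 <= t ->
  product_hat X (fun j k => conv2 (U j t) (U k t) x) a a' =
  (fo_const X)%:C * cconv (component (S t) a) (component (S t) a') x.
Proof.
move=> t0; have E (c : option 'I_3) (b : bool) : U (c, b) t = (fun y => part b (component (S t) c y)).
  by apply/funext => y; rewrite evolution_parts_pos.
rewrite /cconv -[X in _ = _ * X]/(_ +i* _).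
apply: complexP; rewrite ?Re_mulC ?Im_mulC /= /product_part !E.
  by [].
by [].
Qed.

(** At each time the transform of a product is a convolution outside a null set of frequencies that
    depends on the time. Duhamel's formula at a fixed frequency needs the identity at almost every
    time, which joint measurability and [ae_swap] provide. *)
Let product_ae (F : R -> X -> R[i]) a a' : jointly_measurable (X := S_) F ->
  (forall t, 0 <= t -> \forall x \ae mu, F t x =
     (fo_const X)%:C * cconv (component (S t) a) (component (S t) a') x) ->
  \forall x \ae mu, \forall t \ae leb, 0 <= t ->
    F t x = product_hat X (fun j k => conv2 (U j t) (U k t) x) a a'.
Proof.
move=> mF Fae.
have H b : \forall x \ae mu, \forall t \ae leb, 0 <= t ->
    part b (F t x) = part b (product_hat X (fun j k => conv2 (U j t) (U k t) x) a a').
  pose P t x := product_part X b (fun j k => conv2 (U j t) (U k t) x) a a'.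
  have mP : jointly P.
    apply: measurable_funM => //.
    by case: b @P; [apply: measurable_funD|apply: measurable_funB];
      apply: jointly_conv2; exact: jointly_evolution_parts.
  pose f (z : measurableTypeR R * X) := `|\1_(`[0, +oo[%classic) z.1 * part b (F z.1 z.2) -
    \1_(`[0, +oo[%classic) z.1 * P z.1 z.2|.
  have mf : measurable_fun setT f.
    apply: measurableT_comp => //; apply: measurable_funB; first exact: jointly_part.
    apply: measurable_funM => //.
    exact: (measurableT_comp (f := \1_(`[0, +oo[%classic) : R -> R) _ measurable_fst).
  have f0 t : \forall x \ae mu, f (t, x) = 0.
    have [t0|t0] := leP 0 t; last first.
      apply: aeW => x; rewrite /f/= indic_notin ?mul0r ?subrr ?normr0//=.
      by rewrite in_itv/= andbT leNgt t0.
    apply: filterS (Fae t t0) => x; rewrite /f/= -(product_hat_evolution _ _ _ t0) => ->.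
    by rewrite part_product subrr normr0.
  apply: filterS (ae_swap mf (fun z => normr_ge0 _) f0) => x.
  apply: filterS => t; rewrite /f/= => /normr0P; rewrite subr_eq0 => /eqP + t0.
  by rewrite indic_in ?mul1r ?part_product//= in_itv/= t0.
apply: filterS2 (H false) (H true) => x; apply: filterS2 => t h1 h2 t0.
by apply: complexP; [exact: h1|exact: h2].
Qed.

Let solves_of_duhamel nu a b (F : R -> X -> R[i]) t x : 0 <= t -> nu_of (a, b) = nu ->
  cintegrable leb `[0, t] (fun tau => (heat (X := S_) nu (t - tau) x)%:C * F tau x) /\
   component (S t) a x = (heat (X := S_) nu t x)%:C * component S0 a x +
     cintegral leb `[0, t] (fun tau => (heat (X := S_) nu (t - tau) x)%:C * F tau x) ->
  (\forall tau \ae leb, 0 <= tau -> F tau x = nsf_source a x (fun j k => conv2 (U j tau) (U k tau) x)) ->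
  solves nu_of L (initial_parts S0) U (a, b) t x.
Proof.
move=> t0 nuE /duhamel_parts/(_ b)[iF eF] Fae.
have mS : measurable_fun `[0, t]%classic (fun tau => (heatk nu (t - tau) x * source L U (a, b) tau x)%:E).
  apply: measurable_funTS; apply/measurable_EFinP; apply: measurable_funM.
    apply: (measurableT_comp (jointlyr x (jointly_heatk nu)) (g := fun tau : R => t - tau)).
    exact: measurable_funB.
  apply: jointlyr; apply: (jointly_source (nsf_quadratic X)); exact: jointly_evolution_parts.
have FS : \forall tau \ae leb, `[0, t]%classic tau ->
    (heatk nu (t - tau) x * part b (F tau x))%:E = (heatk nu (t - tau) x * source L U (a, b) tau x)%:E.
  apply: filterS Fae => tau h /=; rewrite in_itv/= => /andP[tau0 _].
  by rewrite h// part_source.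
rewrite /solves nuE; split; first exact: (ae_integrable _ _ FS iF).
rewrite evolution_parts_pos// eF; congr (_ + _).
rewrite /duhamel_term /Rintegral; congr fine; apply: ae_eq_integral => //.
exact: measurable_int iF.
Qed.

Lemma solves_of_mild i t : 0 <= t ->
  \forall x \ae mu, solves nu_of L (initial_parts S0) U i t x.
Proof.
move=> t0; have [tS [_ [UU [UT [hUU hUT dU dT]]]]] := mild.
have aeUU j k : \forall x \ae mu, \forall tau \ae leb, 0 <= tau ->
    UU tau j k x = product_hat X (fun j k => conv2 (U j tau) (U k tau) x) (Some j) (Some k).
  have [m h] := hUU j k; apply: product_ae m _ => tau tau0.
  by apply: tr_inj (h tau tau0) _; apply: tr_mul; [exact: (tr_comp (Some j))|exact: (tr_comp (Some k))].
have aeUT k : \forall x \ae mu, \forall tau \ae leb, 0 <= tau ->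
    UT tau k x = product_hat X (fun j k => conv2 (U j tau) (U k tau) x) (Some k) None.
  have [m h] := hUT k; apply: product_ae m _ => tau tau0.
  by apply: tr_inj (h tau tau0) _; apply: tr_mul; [exact: (tr_comp (Some k))|exact: (tr_comp None)].
case: i => -[j|] b.
  have aeU : \forall x \ae mu, forall p : 'I_3 * 'I_3, \forall tau \ae leb, 0 <= tau ->
    UU tau p.1 p.2 x = product_hat X (fun j k => conv2 (U j tau) (U k tau) x) (Some p.1) (Some p.2).
    by apply: filter_forall => p; exact: aeUU.
  apply: filterS2 (dU j t t0) aeU => x dx h.
  apply: (@solves_of_duhamel nu1 (Some j) b (fun tau => QNS_hat (X := S_) (UU tau) (UU tau) j) t x) => //.
  have h' : \forall tau \ae leb, forall p : 'I_3 * 'I_3, 0 <= tau ->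
      UU tau p.1 p.2 x = product_hat X (fun j k => conv2 (U j tau) (U k tau) x) (Some p.1) (Some p.2).
    by apply: filter_forall => p; exact: h.
  by apply: filterS h' => tau h' tau0; apply: QNS_hat_ext => i k; exact: (h' (i, k) tau0).
have aeU : \forall x \ae mu, forall k : 'I_3, \forall tau \ae leb, 0 <= tau ->
  UT tau k x = product_hat X (fun j k => conv2 (U j tau) (U k tau) x) (Some k) None.
  by apply: filter_forall => k; exact: aeUT.
apply: filterS2 (dT t t0) aeU => x dx h.
apply: (@solves_of_duhamel nu2 None b (fun tau x => - div_hat (X := S_) (UT tau) x) t x) => //.
have h' : \forall tau \ae leb, forall k : 'I_3, 0 <= tau ->
    UT tau k x = product_hat X (fun j k => conv2 (U j tau) (U k tau) x) (Some k) None.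
  by apply: filter_forall => k; exact: h.
apply: filterS h' => tau h' tau0 /=; congr (- _); apply: eq_bigr => k _.
by rewrite /partial_hat (h' k tau0).
Qed.

End solves_of_mild.

(** * Mixed norms and bounds in time *)

Section amplitude_bounds.
Context (R : realType) (X : fourier_group R).
Local Open Scope complex_scope.
Local Notation mu := (fg_measure X).
Local Notation leb := (@lebesgue_measure R).
Local Notation S_ := (fo_setting X).
Local Notation I := (option 'I_3 * bool)%type.
Implicit Types (W : I -> R -> X -> R) (S : state (X -> R[i])) (t : R) (x : X) (w : X -> R).

Lemma amplitude_ge0 S x : 0 <= amplitude (X := S_) S x.
Proof. exact: sqrtr_ge0. Qed.

Lemma amplitude_sqr S x : amplitude (X := S_) S x ^+ 2 =
  cmod (rho S x) ^+ 2 + \sum_(j < 3) cmod (vel S j x) ^+ 2 + cmod (temp S x) ^+ 2.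
Proof. by rewrite sqr_sqrtr// !addr_ge0 ?sumr_ge0// => *; rewrite sqr_ge0. Qed.

Lemma cmod_le_amplitude S a x : cmod (component S a x) <= amplitude (X := S_) S x.
Proof.
rewrite -ler_sqr ?nnegrE ?cmod_ge0 ?amplitude_ge0// amplitude_sqr.
have h0 (z : R[i]) : 0 <= cmod z ^+ 2 by exact: sqr_ge0.
case: a => [j|] /=.
  rewrite (bigD1 j)//=; have : 0 <= \sum_(i < 3 | i != j) cmod (vel S i x) ^+ 2 by apply: sumr_ge0.
  by have := h0 (rho S x); have := h0 (temp S x); lra.
by rewrite lerDr addr_ge0 ?sumr_ge0.
Qed.

(** 8 counts the real and imaginary parts of three velocity components and the temperature. *)
Lemma sum_parts_le_amplitude S x :
  \sum_(i : I) `|part i.2 (component S i.1 x)| <= 8 * amplitude (X := S_) S x.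
Proof.
apply: (@le_trans _ _ (\sum_(i : I) amplitude (X := S_) S x)).
  apply: ler_sum => i _; apply: le_trans (part_le_cmod _ _) _; exact: cmod_le_amplitude.
by rewrite sumr_const card_prod card_option card_ord card_bool -[leLHS]mulr_natl.
Qed.

(** Since rho repeats theta up to sign, the squared amplitude is at most twice the sum of the
    squared parts; 2 is a generous square root of that factor. *)
Lemma amplitude_state_of W t x : amplitude (X := S_) (state_of W t) x <= 2 * nrm W t x.
Proof.
have n0 : 0 <= nrm W t x by exact: nrm_ge0.
rewrite -ler_sqr ?nnegrE ?amplitude_ge0 ?mulr_ge0// amplitude_sqr exprMn.
have c2 a : cmod (component (state_of W t) a x) ^+ 2 = W (a, false) t x ^+ 2 + W (a, true) t x ^+ 2.
  by rewrite component_state_of cmod_sqr.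
have -> : cmod (rho (state_of W t) x) ^+ 2 = cmod (component (state_of W t) None x) ^+ 2.
  by rewrite !cmod_sqr /= !sqrrN.
have n2 : \sum_(i : I) W i t x ^+ 2 <= nrm W t x ^+ 2.
  apply: le_trans (sumr_sqr_le (f := fun i => `|W i t x|) _) => //.
  by apply: ler_sum => i _; rewrite real_normK ?num_real.
have cE : \sum_(i : I) W i t x ^+ 2 = cmod (component (state_of W t) None x) ^+ 2 +
    \sum_(j < 3) cmod (component (state_of W t) (Some j) x) ^+ 2.
  transitivity (\sum_(a : option 'I_3) \sum_(b : bool) W (a, b) t x ^+ 2).
    by rewrite pair_big/=; apply: eq_bigr => -[].
  transitivity (\sum_(a : option 'I_3) cmod (component (state_of W t) a x) ^+ 2).
    by apply: eq_bigr => a _; rewrite c2 big_bool addrC.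
  rewrite (bigD1 None)//=; congr (_ + _).
  rewrite (reindex_omap Some id) => [|[]]//=.
  by apply: eq_bigl => j; rewrite eqxx.
set A := cmod (component _ None x) ^+ 2 in cE *.
rewrite (_ : \sum_(j < 3) cmod (vel (state_of W t) j x) ^+ 2 = \sum_(i : I) W i t x ^+ 2 - A); last first.
  by rewrite cE addrAC subrr add0r.
rewrite -/A.
have A_le : A <= \sum_(i : I) W i t x ^+ 2.
  by rewrite cE lerDl sumr_ge0// => j _; exact: sqr_ge0.
have A0 : 0 <= A by exact: sqr_ge0.
move: A_le n2; move: (\sum_(i : I) W i t x ^+ 2) (nrm W t x ^+ 2) => u v; lra.
Qed.

Lemma nrm_evolution_parts (U : R -> state (X -> R[i])) t x : 0 <= t ->
  nrm (evolution_parts U) t x <= 8 * amplitude (X := S_) (U t) x.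
Proof.
move=> t0; apply: le_trans (sum_parts_le_amplitude (U t) x).
by apply: ler_sum => -[a b] _; rewrite /evolution_parts indic_in ?mul1r//= in_itv/= t0.
Qed.

Lemma mixed_norm_sup_le (nu0 : R) W (a : X -> R) (q : \bar R) : 0 < nu0 -> (1 <= q)%E ->
  dominated nu0 W a ->
  (mixed_norm (X := S_) q +oo (fun=> 1%R) (state_of W) <= 2%:E * 'N[mu]_q[EFin \o a])%E.
Proof.
move=> nu0_gt0 q1 [mW ma a0 Wa]; have q0 : (0 < q)%E by apply: lt_le_trans q1; rewrite lte_fin.
rewrite -LnormZl//; last exact/measurable_EFinP.
apply: ge0_Lnorm_le_nomeas => // x; first exact: Lnorm_ge0.
have a20 : (0 <= 2%:E * (EFin \o a) x)%E by rewrite -EFinM lee_fin mulr_ge0.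
rewrite unlock; case: ifP => // _; apply/ess_supP; apply: aeW => t /=.
rewrite /patch; case: ifPn => [/set_mem/=|_]; last by rewrite abse0.
rewrite in_itv/= andbT => t0; rewrite mul1r ger0_norm ?amplitude_ge0// lee_fin.
apply: le_trans (amplitude_state_of W t x) _; rewrite ler_pM2l//.
apply: le_trans (Wa t x (ltW t0)) _.
by rewrite -[leRHS]mulr1 ler_wpM2l// profile_le1 ?ltW.
Qed.

(** |xi| times the profile has L^2_t norm at most nu0^{-1/2} by [integral_profile_le]. The weight is
    compared with |xi| after multiplication by [a], which admits the Japanese bracket on the torus,
    where [a] vanishes at frequency zero. *)
Lemma mixed_norm_L2_le (nu0 kap : R) W (a : X -> R) (q : \bar R) w : 0 < nu0 -> 0 < kap -> (1 <= q)%E ->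
  dominated nu0 W a -> (forall x, 0 <= w x) -> (forall x, w x * a x <= kap * fg_mod x * a x) ->
  (mixed_norm (X := S_) q 2%:E w (state_of W) <=
     (2 * kap / Num.sqrt nu0)%:E * 'N[mu]_q[EFin \o a])%E.
Proof.
move=> nu0_gt0 kap0 q1 [mW ma a0 Wa] w0 wa; have q0 : (0 < q)%E by apply: lt_le_trans q1; rewrite lte_fin.
have sn0 : 0 < Num.sqrt nu0 by rewrite sqrtr_gt0.
have K0 : 0 < 2 * kap / Num.sqrt nu0 by rewrite divr_gt0// mulr_gt0.
rewrite -LnormZl//; last exact/measurable_EFinP.
apply: ge0_Lnorm_le_nomeas => // x; first exact: Lnorm_ge0.
have Ka0 : 0 <= 2 * kap / Num.sqrt nu0 * a x by rewrite mulr_ge0// ltW.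
rewrite unlock -[leRHS]/((2 * kap / Num.sqrt nu0 * a x)%:E).
pose g := (fun t : R => (w x * amplitude (X := S_) (state_of W t) x)%:E) \_ `]0%R, +oo[.
pose h := (fun t : R => (profile nu0 (fg_mod x) t ^+ 2)%:E) \_ `[0%R, +oo[.
rewrite -[leLHS]/((\int[leb]_t `|g t| `^ 2) `^ 2^-1)%E.
have h0 t : (0 <= h t)%E by rewrite /h /patch; case: ifP => // _; rewrite lee_fin sqr_ge0.
have g_le t : (`|g t| `^ 2 <= (((2 * kap * fg_mod x * a x) ^+ 2)%:E * h t))%E.
  have [t0|t0] := boolP (t \in `]0%R, +oo[%classic); last first.
    by rewrite /g /patch (negbTE t0) abse0 poweR0r// mule_ge0// lee_fin sqr_ge0.
  rewrite /g /h /patch t0; move: t0 => /set_mem; rewrite /= in_itv/= andbT => t0.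
  rewrite ifT; last by apply/mem_set; rewrite /= in_itv/= ltW.
  rewrite -EFinM /= lee_fin powR_mulrn// -exprMn ler_sqr ?nnegrE//; last first.
    apply: mulr_ge0; last exact: profile_ge0.
    apply: mulr_ge0 => //; apply: mulr_ge0; last exact: fg_mod_ge0.
    by rewrite mulr_ge0 ?(ltW kap0).
  rewrite ger0_norm ?mulr_ge0 ?amplitude_ge0//.
  apply: (@le_trans _ _ (w x * (2 * (a x * profile nu0 (fg_mod x) t)))).
    apply: ler_wpM2l => //; apply: le_trans (amplitude_state_of W t x) _.
    by rewrite ler_pM2l//; exact: Wa (ltW t0).
  rewrite (_ : w x * _ = 2 * (w x * a x) * profile nu0 (fg_mod x) t); last by ring.
  by apply: ler_wpM2r; [exact: profile_ge0|have := wa x; lra].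
have -> : ((2 * kap / Num.sqrt nu0 * a x)%:E = ((2 * kap / Num.sqrt nu0 * a x) ^+ 2)%:E `^ 2^-1)%E.
  by rewrite poweR_EFin -powR_mulrn// -powRrM mulfV// powRr1.
apply: ge0_le_poweR; first by rewrite invr_ge0.
  by apply: integral_ge0 => t _; exact: poweR_ge0.
apply: (@le_trans _ _ (\int[leb]_t (((2 * kap * fg_mod x * a x) ^+ 2)%:E * h t))%E).
  by apply: ge0_le_integral_nomeas => t _; [exact: poweR_ge0|exact: g_le].
rewrite ge0_integralZl//; first last.
- by rewrite lee_fin sqr_ge0.
- apply/(measurable_restrictT _ _).1 => //; apply: measurable_funTS; apply/measurable_EFinP.
  apply: measurable_funX;
  apply: (measurableT_comp (measurable_profile2 nu0 (@measurable_fg_mod R X)) (g := fun t : measurableTypeR R => (t, x))).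
  exact: measurable_pair2.
rewrite -integral_mkcond.
have [x0|x0] := eqVneq (fg_mod x : R) 0.
  by rewrite x0 mulr0 mul0r expr0n mul0e lee_fin sqr_ge0.
have xgt : 0 < fg_mod x :> R by rewrite lt_def x0 fg_mod_ge0.
apply: le_trans (lee_wpmul2l _ (integral_profile_le nu0_gt0 xgt)) _; first by rewrite lee_fin sqr_ge0.
rewrite -EFinM lee_fin !exprMn exprVn sqr_sqrtr ?(ltW nu0_gt0)//.
rewrite le_eqVlt; apply/orP; left; apply/eqP; field.
by rewrite x0 gt_eqF.
Qed.

End amplitude_bounds.

(** B will be an essential supremum in t, whose measurability in x is not at hand. If a bounded set
    E of times with large integrals had positive measure, the averages over E of g(., x) would form
    a measurable function below B with integral at least M + 1, against the bound M. The extra 1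
    makes the contradiction strict. *)
Lemma ae_integral_le d (T : measurableType d) (R : realType)
    (m : {sigma_finite_measure set T -> \bar R}) (g : measurableTypeR R * T -> R)
    (B : T -> \bar R) (M : R) :
  measurable_fun setT g -> (forall z, 0 <= g z) -> (forall x, 0 <= B x)%E -> 0 <= M ->
  (forall x, \forall t \ae @lebesgue_measure R, ((g (t, x))%:E <= B x)%E) ->
  (\int[m]_x B x <= M%:E)%E ->
  \forall t \ae @lebesgue_measure R, (\int[m]_x (g (t, x))%:E <= (M + 1)%:E)%E.
Proof.
move=> mg g0 B0 M0 gB BM; pose leb := @lebesgue_measure R.
pose F (t : measurableTypeR R) := (\int[m]_x (g (t, x))%:E)%E.
have mgE : measurable_fun setT (EFin \o g) by exact/measurable_EFinP.
have mF : measurable_fun setT F by exact: (measurable_fun_integral_param m mgE).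
pose E (n : nat) : set (measurableTypeR R) := `[- n%:R, n%:R] `&` [set t | ((M + 1)%:E <= F t)%E].
have mE n : measurable (E n).
  apply: measurableI => //; rewrite -[X in measurable X]setTI.
  exact: emeasurable_fun_c_infty.
have E0 n : leb (E n) = 0%E.
  have Efin : leb (E n) \is a fin_num.
    rewrite ge0_fin_numE//; apply: (@le_lt_trans _ _ (leb `[- n%:R, n%:R]%classic)).
      by apply: le_measure; rewrite ?inE//; exact: subIsetl.
    by rewrite /leb lebesgue_measure_itv/=; case: ifP => // _; rewrite -EFinB ltry.
  apply: contrapT => /eqP En0.
  have [r rE] : exists r : R, leb (E n) = r%:E by exists (fine (leb (E n))); rewrite fineK.
  have r0 : 0 < r by rewrite -lte_fin -rE lt_neqAle eq_sym En0 measure_ge0.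
  have lo : ((M + 1)%:E * r%:E <= \int[leb]_(t in E n) F t)%E.
    rewrite -rE -integral_cst//; apply: ge0_le_integral_nomeas => t.
      by move=> _; rewrite lee_fin addr_ge0.
    by case.
  pose f (z : measurableTypeR R * T) := ((\1_(E n) z.1 * g z)%:E)%E.
  have mf : measurable_fun setT f.
    apply/measurable_EFinP; apply: measurable_funM => //.
    exact: (measurableT_comp (f := \1_(E n) : measurableTypeR R -> R) _ measurable_fst).
  have f0 z : (0 <= f z)%E by rewrite lee_fin mulr_ge0.
  have up : (\int[leb]_(t in E n) F t = \int[m]_x \int[leb]_t f (t, x))%E.
    rewrite -(fubini_tonelli (m1 := leb) f mf f0) integral_mkcond.
    apply: eq_integral => t _; rewrite /patch; case: ifPn => [/set_mem tE|tE].
      by apply: eq_integral => x _; rewrite /f/= indic_in ?mul1r.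
    by rewrite integral0_eq// => x _; rewrite /f/= indicE (negbTE tE) mul0r.
  have mI : measurable_fun setT (fun x => \int[leb]_t f (t, x))%E.
    apply: (@measurable_fun_integral_param _ _ T (measurableTypeR R) R leb (fun z => f (z.2, z.1))).
    apply: (measurableT_comp mf (g := fun z : T * measurableTypeR R => (z.2, z.1))).
    exact: measurable_fun_pair.
  have : ((r^-1)%:E * \int[leb]_(t in E n) F t <= M%:E)%E.
    rewrite up -ge0_integralZl//; last 2 first.
    - by move=> x _; apply: integral_ge0.
    - by rewrite lee_fin invr_ge0 ltW.
    apply: le_trans BM; apply: ge0_le_integral_nomeas => x _.
      by apply: mule_ge0; [rewrite lee_fin invr_ge0 ltW|exact: integral_ge0].
    rewrite lee_pdivrMl// muleC -rE -integral_cst//.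
    rewrite (_ : \int[leb]_t f (t, x) = \int[leb]_(t in E n) (g (t, x))%:E)%E; last first.
      rewrite [RHS]integral_mkcond; apply: eq_integral => t _.
      rewrite /patch /f/= indicE; case: (t \in E n); first by rewrite mul1r.
      by rewrite mul0r.
    have mgx : measurable_fun (E n) (fun t => (g (t, x))%:E).
      apply: measurable_funTS.
      by apply: (measurableT_comp mgE (g := pair^~ x)); exact: measurable_pair2.
    apply: ae_ge0_le_integral => //.
    - by move=> t _; rewrite lee_fin.
    - by move=> t _; exact: B0.
    - by apply: filterS (gB x) => t h _.
  move=> H; have := le_trans (lee_wpmul2l (_ : 0 <= (r^-1)%:E)%E lo) H.
  rewrite lee_fin invr_ge0 (ltW r0) => /(_ isT); rewrite -!EFinM lee_fin mulrCA mulVf ?gt_eqF// mulr1.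
  lra.
have H n : \forall t \ae leb, `[- n%:R, n%:R]%classic t -> (F t <= (M + 1)%:E)%E.
  exists (E n); split => // t /= /not_implyP[tn /negP]; rewrite -ltNge => h.
  by split => //; exact: ltW.
apply: filterS (ae_foralln H) => t h.
apply: (h (Num.truncn `|t|).+1); rewrite /= in_itv/= -ler_norml ltW//.
exact: truncnS_gt.
Qed.

Section bounded.
Context (R : realType) (X : fourier_group R).
Local Open Scope complex_scope.
Local Notation mu := (fg_measure X).
Local Notation leb := (@lebesgue_measure R).
Local Notation S_ := (fo_setting X).
Local Notation I := (option 'I_3 * bool)%type.
Variables (nu1 nu2 : R).
Implicit Types (t : R) (x : X).

Lemma mild_bounded (S0 : state (X -> R[i])) s (S : R -> state (X -> R[i])) :
  mild_solution (X := S_) nu1 nu2 S0 s S ->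
  (mixed_norm (X := S_) 1 +oo (fun=> 1%R) S < +oo)%E ->
  exists M : R, 0 <= M /\ \forall t \ae leb, (\int[mu]_x (nrm (evolution_parts S) t x)%:E <= M%:E)%E.
Proof.
move=> mS Soo; set U := evolution_parts S.
pose B x := Lnorm leb +oo ((fun t => (1 * amplitude (X := S_) (S t) x)%:E) \_ `]0%R, +oo[).
have B0 x : (0 <= B x)%E by exact: Lnorm_ge0.
have [M ME] : exists M : R, mixed_norm (X := S_) 1 +oo (fun=> 1%R) S = M%:E.
  by exists (fine (mixed_norm (X := S_) 1 +oo (fun=> 1%R) S)); rewrite fineK// ge0_fin_numE ?Lnorm_ge0.
have M0 : 0 <= M by rewrite -lee_fin -ME Lnorm_ge0.
pose g (z : measurableTypeR R * X) := 8^-1 * nrm U z.1 z.2.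
have mn : measurable_fun [set: measurableTypeR R * X] (fun z => nrm U z.1 z.2).
  apply: measurable_sum => i; apply: measurableT_comp => //.
  exact: (jointly_evolution_parts mS).
have mg : measurable_fun setT g by apply: measurable_funM.
have g0 z : 0 <= g z by rewrite mulr_ge0// nrm_ge0.
have BM : (\int[mu]_x B x <= M%:E)%E.
  rewrite -ME /mixed_norm Lnorm1 le_eqVlt; apply/orP; left; apply/eqP.
  by apply: eq_integral => x _; rewrite gee0_abs ?B0.
have leb_gt0 : (0 < leb setT)%E.
  apply: (@lt_le_trans _ _ (leb `[0, 1]%classic)); last by apply: le_measure; rewrite ?inE.
  by rewrite lebesgue_measure_itv/= lte01 oppr0 adde0.
(* The norm in time runs over ]0, oo[, while the parts are cut off at t < 0 only; time 0 is set
   aside as a null set. *)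
have ne0 : \forall t \ae leb, t != 0.
  exists [set 0]; split => //; first exact: lebesgue_measure_set1.
  by move=> t /= /negP; rewrite negbK => /eqP.
have gB x : \forall t \ae leb, ((g (t, x))%:E <= B x)%E.
  have : \forall t \ae leb, (`|((fun t => (1 * amplitude (X := S_) (S t) x)%:E) \_ `]0%R, +oo[) t| <= B x)%E.
    by rewrite /B unlock leb_gt0; exact: ess_sup_ge.
  apply: filterS2 ne0 => t t0; have [tgt|tle] := ltP 0 t.
    rewrite /patch ifT; last by apply/mem_set; rewrite /= in_itv/= tgt.
    rewrite mul1r gee0_abs ?lee_fin ?amplitude_ge0//; apply: le_trans.
    rewrite lee_fin /g/= ler_pdivrMl//.
    by apply: le_trans (nrm_evolution_parts S x (ltW tgt)) _.
  move=> _; rewrite (_ : g (t, x) = 0) ?B0// /g /nrm big1 ?mulr0// => i _.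
  rewrite /U /evolution_parts indic_notin ?mul0r ?normr0//=.
  by rewrite in_itv/= andbT leNgt lt_neqAle t0 tle.
exists (8 * (M + 1)); split; first by rewrite mulr_ge0// addr_ge0.
apply: filterS (ae_integral_le mg g0 B0 M0 gB BM) => t.
under eq_integral do rewrite /g/= EFinM.
rewrite ge0_integralZl//; last 2 first.
- apply/measurable_EFinP.
  by apply: (measurableT_comp mn (g := pair (t : measurableTypeR R))); exact: measurable_pair1.
- by move=> x _; rewrite lee_fin nrm_ge0.
by rewrite lee_pdivrMl// -EFinM mulrC.
Qed.

Lemma measurable_amplitude (S : state (X -> R[i])) :
  cintegrable mu setT (rho S) -> (forall j, cintegrable mu setT (vel S j)) ->
  cintegrable mu setT (temp S) -> measurable_fun setT (amplitude (X := S_) S).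
Proof.
have mc (F : X -> R[i]) : cintegrable mu setT F -> measurable_fun setT (fun x => cmod (F x) ^+ 2).
  move=> [i1 i2]; under eq_fun do rewrite cmod_sqr.
  by apply: measurable_funD; apply: measurable_funX; exact: measurable_of_integrable.
move=> h1 h2 h3; apply: measurableT_comp; first by apply: continuous_measurable_fun; exact: sqrt_continuous.
apply: measurable_funD; last exact: mc.
by apply: measurable_funD; [exact: mc|apply: measurable_sum => j; exact: mc].
Qed.

Hypotheses (nu1_gt0 : 0 < nu1) (nu2_gt0 : 0 < nu2).
Variables (r : \bar R) (c : R) (s0 : state (R3 R -> R)) (S0 : state (X -> R[i])).
Hypotheses (r_ge1 : (1 <= r)%E) (c_gt0 : 0 < c).
Hypotheses (Jr : J_bounded X r c r) (J1 : J_bounded X r c 1).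
Hypotheses (tr0 : transform_state (X := S_) s0 S0) (con0 : constraints (X := S_) S0).

(** The smallness 1 / (4 c C) that the scalar equation asks of e0, divided by 32 = 4 * 8: 4 from
    bounding the heat factor by the profile, 8 from the parts of the amplitude. *)
Definition nsf_threshold : R :=
  ((4 * c * (#|{: I}|%:R * ((24 * `|fo_const X|) * (64 / nu_min nu1 nu2))))^-1) / 32.

Lemma nsf_threshold_gt0 : 0 < nsf_threshold.
Proof.
have nm0 := nu_min_gt0 nu1_gt0 nu2_gt0.
rewrite /nsf_threshold divr_gt0// invr_gt0 !mulr_gt0 ?invr_gt0//.
  by rewrite ltr0n card_prod card_option card_ord card_bool.
by rewrite normr_gt0 fo_const_neq0.
Qed.

Hypotheses (small : (data_norm (X := S_) r S0 <= nsf_threshold%:E)%E)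
  (fin1 : (data_norm (X := S_) 1 S0 < +oo)%E).

Let S0_component a : cintegrable mu setT (component S0 a).
Proof. by have [_ h2 h3] := tr0; case: a => [j|]; apply: tr_integrable; [exact: h2|exact: h3]. Qed.

Let S0_amplitude : measurable_fun setT (amplitude (X := S_) S0).
Proof.
have [h1 h2 h3] := tr0.
by apply: measurable_amplitude => [|j|]; apply: tr_integrable; [exact: h1|exact: h2|exact: h3].
Qed.

Let e0 x := 4 * \sum_(i : I) `|initial_parts S0 i x|.

Let e0_le x : e0 x <= 32 * amplitude (X := S_) S0 x.
Proof. by have := sum_parts_le_amplitude S0 x; rewrite /e0 /initial_parts; lra. Qed.

Let Ne0 q : (1 <= q)%E -> ('N[mu]_q[EFin \o e0] <= 32%:E * data_norm (X := S_) q S0)%E.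
Proof.
move=> q1; have q0 : (0 < q)%E by apply: lt_le_trans q1; rewrite lte_fin.
rewrite -LnormZl//; last exact/measurable_EFinP.
apply: ge0_Lnorm_le_nomeas => // x.
by rewrite lee_fin mulr_ge0// sumr_ge0.
Qed.

Lemma nsf_exists : exists (W : I -> R -> X -> R) (a : X -> R),
  [/\ dominated (nu_min nu1 nu2) W a,
      mu.-integrable setT (EFin \o a),
      forall i t, 0 <= t -> \forall x \ae mu, solves (nu_of nu1 nu2) (@nsf_multiplier R X) (initial_parts S0) W i t x,
      mild_solution (X := S_) nu1 nu2 S0 (fun t => field_of (state_of W t)) (state_of W)
    & (forall q, (1 <= q)%E -> J_bounded X r c q ->
         ('N[mu]_q[EFin \o a] <= 64%:E * data_norm (X := S_) q S0)%E) /\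
      forall x, fg_mod x = 0 :> R -> a x <= 32 * amplitude (X := S_) S0 x].
Proof.
have nm0 := nu_min_gt0 nu1_gt0 nu2_gt0.
have cX0 : 0 < 24 * `|fo_const X| by rewrite mulr_gt0// normr_gt0 fo_const_neq0.
have I0 : (0 < #|{: I}|)%N by rewrite card_prod card_option card_ord card_bool.
have mW0 i : measurable_fun setT (initial_parts S0 i).
  have [i1 i2] := S0_component i.1.
  by case: i i1 i2 => a [] /= i1 i2; exact: measurable_of_integrable.
have negS i : \forall x \ae mu, initial_parts S0 i (fo_neg X x) = nsf_sign R i * initial_parts S0 i x.
  have H : \forall x \ae mu, component S0 i.1 (fo_neg X x) = conjc (component S0 i.1 x).
    have [_ h2 h3] := tr0.
    by case: i => -[j|] b /=; [exact: tr_hermitian (h2 j)|exact: tr_hermitian h3].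
  apply: filterS H => x; rewrite /initial_parts => ->; rewrite /nsf_sign.
  by case: i.2; rewrite /part ?Re_conj ?Im_conj ?expr1 ?mulN1r ?expr0 ?mul1r.
have mod_neg x : fg_mod (fo_neg X x) = fg_mod x :> R.
  by rewrite !fo_modE; congr Num.sqrt; apply: eq_bigr => k _; rewrite fo_coord_neg sqrrN.
have Nr : ('N[mu]_r[EFin \o e0] <= ((4 * c * (#|{: I}|%:R * ((24 * `|fo_const X|) * (64 / nu_min nu1 nu2))))^-1)%:E)%E.
  apply: le_trans (Ne0 r_ge1) _; apply: le_trans (lee_wpmul2l _ small) _; first by rewrite lee_fin.
  by rewrite -EFinM lee_fin /nsf_threshold mulrCA mulfV ?mulr1.
have N1 : ('N[mu]_1[EFin \o e0] < +oo)%E.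
  apply: le_lt_trans (Ne0 _) _; first by [].
  by rewrite lte_mul_pinfty.
have [W [a [dW sW nW aN aZ]]] := system_exists nm0 (@nu_min_le R nu1 nu2) cX0 I0 (nsf_quadratic X) mW0
  (fo_neg_preserving X) (@fo_neg_sub R X) mod_neg (@nsf_multiplier_neg R X) negS r_ge1 c_gt0 Jr J1 Nr N1.
have aN' q : (1 <= q)%E -> J_bounded X r c q ->
    ('N[mu]_q[EFin \o a] <= 64%:E * data_norm (X := S_) q S0)%E.
  move=> q1 Jq; apply: le_trans (aN q q1 Jq) _.
  apply: le_trans (lee_wpmul2l _ (Ne0 q1)) _; first by rewrite lee_fin.
  by rewrite muleA -EFinM (_ : 2 * 32 = 64 :> R)//; ring.
have [_ ma a0 _] := dW.
have ia : mu.-integrable setT (EFin \o a).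
  apply/integrableP; split; first exact/measurable_EFinP.
  rewrite -Lnorm1; apply: le_lt_trans (aN' 1%E _ J1) _; first by [].
  by rewrite lte_mul_pinfty.
exists W, a; split => //.
- exact: (mild_of_solves nu1_gt0 nu2_gt0 dW ia sW nW con0.1).
- by split => // x x0; apply: le_trans (aZ x x0) (e0_le x).
Qed.

(** u and theta agree through the real system. The constraint then gives rho = - theta at nonzero
    frequencies, and the hypothesis on [rho] supplies frequency zero; equality of transforms almost
    everywhere becomes equality of the functions at every x. *)
Lemma nsf_unique W (a : X -> R) (s : R -> state (R3 R -> R)) (S : R -> state (X -> R[i])) :
  dominated (nu_min nu1 nu2) W a -> mu.-integrable setT (EFin \o a) ->
  (forall i t, 0 <= t -> \forall x \ae mu, solves (nu_of nu1 nu2) (@nsf_multiplier R X) (initial_parts S0) W i t x) ->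
  mild_solution (X := S_) nu1 nu2 S0 (fun t => field_of (state_of W t)) (state_of W) ->
  mild_solution (X := S_) nu1 nu2 S0 s S ->
  (mixed_norm (X := S_) 1 +oo (fun=> 1%R) S < +oo)%E ->
  (forall t, 0 <= t -> \forall x \ae mu, fg_mod x = 0 :> R -> rho (S t) x = - temp (S t) x) ->
  forall t, 0 <= t -> s t = field_of (state_of W t).
Proof.
move=> dW ia sW mW mS Soo rho0 t t0.
have [_ _ a0 Wa] := dW; have nm0 := nu_min_gt0 nu1_gt0 nu2_gt0.
have [M [M0 bS]] := mild_bounded mS Soo.
have afin : (\int[mu]_x (a x)%:E)%E \is a fin_num by have := integrable_fin_num measurableT ia.
pose A := fine (\int[mu]_x (a x)%:E)%E.
have cX0 : 0 <= 24 * `|fo_const X| by rewrite mulr_ge0.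
have bW' : \forall t \ae leb, 0 <= t -> (\int[mu]_x (nrm W t x)%:E <= (Num.max M A)%:E)%E.
  apply: aeW => t' t'0; apply: (@le_trans _ _ (\int[mu]_x (a x)%:E)%E).
    apply: ge0_le_integral_nomeas => x _; rewrite lee_fin ?nrm_ge0//.
    apply: le_trans (Wa t' x t'0) _.
    by rewrite -[leRHS]mulr1 ler_wpM2l// profile_le1.
  by rewrite -(fineK afin) lee_fin le_max lexx orbT.
have bS' : \forall t \ae leb, 0 <= t -> (\int[mu]_x (nrm (evolution_parts S) t x)%:E <= (Num.max M A)%:E)%E.
  by apply: filterS bS => t' h _; apply: le_trans h _; rewrite lee_fin le_max lexx.
have MA0 : 0 <= Num.max M A by rewrite le_max M0.
have eqW i : \forall x \ae mu, W i t x = evolution_parts S i t x.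
  have [mWj _ _ _] := dW.
  exact: (solves_unique nm0 (@nu_min_le R nu1 nu2) cX0 (nsf_quadratic X) MA0 mWj
    (jointly_evolution_parts mS) bW' bS' sW (solves_of_mild mS)).
have eqC b : \forall x \ae mu, component (S t) b x = component (state_of W t) b x.
  apply: filterS2 (eqW (b, false)) (eqW (b, true)) => x.
  rewrite !evolution_parts_pos// => h1 h2.
  by apply: complexP; rewrite component_state_of /= ?h1 ?h2.
have [[trS _ _ _] [conS _]] := mS; have [[trW _ _ _] _] := mW.
have [tS1 tS2 tS3] := trS t t0; have [tW1 tW2 tW3] := trW t t0.
have e2 j : vel (s t) j = vel (field_of (state_of W t)) j.
  exact: (tr_ext (tS2 j) (tW2 j) (eqC (Some j))).
have e3 : temp (s t) = temp (field_of (state_of W t)).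
  exact: (tr_ext tS3 tW3 (eqC None)).
have e1 : rho (s t) = rho (field_of (state_of W t)).
  apply: (tr_ext tS1 tW1).
  have con : \forall x \ae mu, forall k, partial_hat (X := S_) k (fun x' => rho (S t) x' + temp (S t) x') x = 0.
    by apply: filter_forall => k; exact: ((conS t t0).2 k).
  apply: filterS3 (rho0 t t0) con (eqC None) => x r0 hx /= hT.
  suff -> : rho (S t) x = - temp (S t) x by rewrite hT.
  have [/r0//|x0] := eqVneq (fg_mod x : R) 0.
  have [k xk] : exists k, fo_coord X x k != 0.
    apply: contrapT => H; move: x0; rewrite fo_modE big1 ?sqrtr0 ?eqxx// => k _.
    have [->|xk] := eqVneq (fo_coord X x k) 0; first by rewrite expr0n.
    by exfalso; apply: H; exists k.
  have /eqP := hx k; rewrite /partial_hat mulf_eq0 => /orP[|].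
    by rewrite eq_complex/= eqxx (negbTE xk).
  by rewrite addr_eq0 => /eqP.
by case: (s t) e1 e2 e3 => r1 v1 th1 /= -> /funext -> ->.
Qed.

End bounded.

(** f^{3/2} is at most f where f <= 1 and at most f^p elsewhere, so for finite p its integral is at
    most eta + eta^p <= 2 eta; for p = oo it is at most eta, as f <= 1. The bound is the same for
    all p, so the threshold can be fixed before p. *)
Lemma Lnorm_three_halves_le d (T : measurableType d) (R : realType)
    (m : {measure set T -> \bar R}) (f : T -> R) (p : \bar R) (eta : R) :
  measurable_fun setT f -> (forall x, 0 <= f x) -> ((3 / 2)%:E < p)%E -> eta <= 1 ->
  ('N[m]_1[EFin \o f] <= eta%:E)%E -> ('N[m]_p[EFin \o f] <= eta%:E)%E ->
  ('N[m]_(3 / 2)%:E[EFin \o f] <= ((2 * eta) `^ (2 / 3))%:E)%E.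
Proof.
move=> mf f0 p32 eta1 N1 Np.
have eta0 : 0 <= eta by rewrite -lee_fin; apply: le_trans N1; exact: Lnorm_ge0.
have mfE : measurable_fun setT (EFin \o f) by exact/measurable_EFinP.
have I1 : (\int[m]_x (f x)%:E <= eta%:E)%E.
  by move: N1; rewrite Lnorm1; under eq_integral do rewrite /= ger0_norm//.
suff H : (\int[m]_x (f x `^ (3 / 2))%:E <= (2 * eta)%:E)%E.
  rewrite unlock; under eq_integral do rewrite /= ger0_norm//.
  rewrite (_ : (3 / 2)^-1 = 2 / 3 :> R); last by field.
  rewrite -poweR_EFin; apply: ge0_le_poweR => //.
  by apply: integral_ge0 => x _; rewrite lee_fin powR_ge0.
have mpow (q : R) : measurable_fun setT (fun x => (f x `^ q)%:E).
  by apply/measurable_EFinP; apply: (measurableT_comp (measurable_powR q) mf).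
case: p p32 Np => [p| |//].
  rewrite lte_fin => p32; rewrite unlock => Np; have p0 : 0 < p by lra.
  have Ip : (\int[m]_x (f x `^ p)%:E <= eta%:E)%E.
    apply: (@le_trans _ _ (eta `^ p)%:E); last first.
      have [->|e0] := eqVneq eta 0; first by rewrite powR0// gt_eqF.
      rewrite lee_fin -[leRHS]powRr1//; apply: ger_powR; last by lra.
      by rewrite lt_def e0 eta0.
    have := @ge0_le_poweR R p _ _ (ltW p0) (poweR_ge0 _ _) Np.
    rewrite -poweRrM mulVf ?gt_eqF// poweRe1; last by apply: integral_ge0 => x _; exact: poweR_ge0.
    by under eq_integral do rewrite /= ger0_norm//.
  apply: (@le_trans _ _ (\int[m]_x ((f x)%:E + (f x `^ p)%:E))%E).
    apply: ge0_le_integral_nomeas => x _; first by rewrite lee_fin powR_ge0.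
    rewrite -EFinD lee_fin; have [fx|fx] := leP (f x) 1.
      apply: (@le_trans _ _ (f x)); last by rewrite lerDl powR_ge0.
      have [->|fx0] := eqVneq (f x) 0; first by rewrite powR0//; lra.
      rewrite -[leRHS]powRr1//; apply: ger_powR; last by lra.
      by rewrite lt_def fx0 f0.
    apply: (@le_trans _ _ (f x `^ p)); last by rewrite lerDr.
    by apply: ler_powR; [exact: ltW|exact: ltW].
  rewrite ge0_integralD//; last 2 first.
  - by move=> x _; rewrite lee_fin.
  - by move=> x _; rewrite lee_fin powR_ge0.
  by rewrite (_ : 2 * eta = eta + eta) ?EFinD ?leeD//; ring.
move=> _ Np; have f1 : \forall x \ae m, f x <= 1.
  have [m0|m0] := ltP 0%E (m setT).
    move: Np; rewrite unlock m0 => /ess_supP; apply: filterS => x /=.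
    by rewrite lee_fin ger0_norm// => h; exact: le_trans eta1.
  exists setT; split => //; apply/eqP; rewrite eq_le m0; exact: measure_ge0.
apply: (@le_trans _ _ (\int[m]_x (f x)%:E)%E); last first.
  by apply: le_trans I1 _; rewrite lee_fin; lra.
apply: ae_ge0_le_integral => //.
- by move=> x _; rewrite lee_fin powR_ge0.
- by move=> x _; rewrite lee_fin.
- apply: filterS f1 => x fx _; rewrite lee_fin.
  have [->|fx0] := eqVneq (f x) 0; first by rewrite powR0//; lra.
  rewrite -[leRHS]powRr1//; apply: ger_powR; last by lra.
  by rewrite lt_def fx0 f0.
Qed.

(** * The torus *)

Section torus_case.
Context (R : realType).
Local Open Scope complex_scope.
Local Notation X := (torus_fourier R).
Local Notation z0 := ((0, 0, 0) : Z3).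

Lemma torus_mod0 (x : X) : fg_mod x = 0 :> R -> x = z0.
Proof.
move=> x0; have ck k : coord3 (x : int * int * int) k = 0.
  apply/eqP; rewrite -(@intr_eq0 R) -normr_le0 -[leRHS]x0; exact: (@coord_le R X x k).
move: (ck ord0) (ck (lift ord0 ord0)) (ck ord_max).
by rewrite /coord3 /=; case: x {x0 ck} => -[a b] c /= -> -> ->.
Qed.

Lemma fourier_coef0 (f : R3 R -> R) : fourier_coef f z0 = (torus_mean f)%:C.
Proof.
have d0 (x : R3 R) : dot (Z3_coord R z0) x = 0.
  by rewrite /dot big1// => k _; rewrite /Z3_coord /coord3; case: (val k) => [|[|n]]; rewrite mul0r.
apply: complexP.
  rewrite Re_mulC /torus_mean /=; congr (_ * _); apply: eq_Rintegral => x _.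
  by rewrite /= d0 oppr0 cos0 mulr1 mul0r subr0.
rewrite Im_mulC/= (_ : \int[_]_(x in _) _ = 0) ?mulr0//.
rewrite /Rintegral integral0_eq// => x _.
by rewrite /= d0 oppr0 sin0 mulr0 mul0r addr0.
Qed.

Lemma torus_transform0 f F : fo_tr X f F -> F z0 = (torus_mean f)%:C.
Proof. by move=> [h _ _]; rewrite h fourier_coef0. Qed.

Lemma torus_case (nu1 nu2 : R) : 0 < nu1 -> 0 < nu2 ->
  exists C : R, 0 < C /\
    forall (s0 : state (R3 R -> R)) (S0 : state (freq (torus R) -> R[i])),
      transform_state s0 S0 -> constraints S0 -> mean_free s0 ->
      (data_norm 1 S0 <= (nsf_threshold X nu1 nu2 2)%:E)%E ->
      exists (s : R -> state (R3 R -> R))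
             (S : R -> state (freq (torus R) -> R[i])),
        let admissible s' S' :=
          [/\ mild_solution nu1 nu2 S0 s' S',
              (mixed_norm 1 +oo (fun=> 1%R) S' < +oo)%E,
              (mixed_norm 1 2%:E (freq_japanese (torus R)) S' < +oo)%E
            & forall t : R, 0 <= t -> mean_free (s' t)] in
        [/\ admissible s S,
            (mixed_norm 1 +oo (fun=> 1%R) S
             + mixed_norm 1 2%:E (freq_japanese (torus R)) S
             <= C%:E * data_norm 1 S0)%E
          & forall s' S', admissible s' S' ->
              forall t : R, 0 <= t -> s' t = s t].
Proof.
move=> nu1_gt0 nu2_gt0; have nm0 := nu_min_gt0 nu1_gt0 nu2_gt0.
have sn0 : 0 < Num.sqrt (nu_min nu1 nu2) by rewrite sqrtr_gt0.
pose K := 2 * 2 / Num.sqrt (nu_min nu1 nu2).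
have K0 : 0 < K by rewrite divr_gt0.
exists ((2 + K) * 64); split; first by rewrite mulr_gt0// addr_gt0.
move=> s0 S0 tr0 con0 mf0 small.
have J1 := @J_bounded_torus R.
have fin1 : (data_norm 1 S0 < +oo)%E by apply: le_lt_trans small (ltry _).
have l11 : (1 <= 1 :> \bar R)%E by [].
have [W [a [dW ia sW mW [aN aZ]]]] :=
  @nsf_exists R X nu1 nu2 nu1_gt0 nu2_gt0 1%E 2 s0 S0 l11 (ltr0n _ 2) J1 J1 tr0 con0 small fin1.
have [_ _ a0 Wa] := dW.
(* The zero coefficient is the mean. Mean-free data make the majorant vanish at frequency zero,
   which gives both the zero mean of the solution and the weight <xi> in the norm. *)
have amp0 : amplitude S0 z0 = 0.
  have [h1 h2 h3] := tr0; have [m1 m2 m3] := mf0.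
  have cmod0 : cmod (0 : R)%:C = 0 by rewrite /cmod /= expr0n/= addr0 sqrtr0.
  rewrite /amplitude (torus_transform0 h1) m1 (torus_transform0 h3) m3 big1.
    by rewrite !cmod0 expr0n/= !addr0 sqrtr0.
  by move=> j _; rewrite (torus_transform0 (h2 j)) m2 cmod0 expr0n.
have az x : fg_mod (x : X) = 0 :> R -> a x = 0.
  move=> x0; apply/eqP; rewrite eq_le a0 andbT; apply: le_trans (aZ x x0) _.
  by rewrite (torus_mod0 x0) amp0 mulr0.
have z0mod : fg_mod (z0 : X) = 0 :> R.
  rewrite fo_modE big1 ?sqrtr0// => k _; rewrite /= /Z3_coord /coord3.
  by case: (val k) => [|[|n]]; rewrite expr0n.
have W0 i t : 0 <= t -> W i t z0 = 0.
  move=> t0; apply/eqP; rewrite -normr_le0; apply: le_trans (le_nrm W i t z0) _.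
  by apply: le_trans (Wa t z0 t0) _; rewrite az// mul0r.
(* Nonzero frequencies have |xi| >= 1, so 1 + |xi|^2 <= 4 |xi|^2; at zero both sides vanish. Hence
   the 2 in K. *)
have wa x : freq_japanese (torus R) x * a x <= 2 * fg_mod (x : X) * a x.
  have [x0|x0] := eqVneq (fg_mod (x : X) : R) 0; first by rewrite az// !mulr0.
  apply: ler_wpM2r; first exact: a0.
  have x1 := torus_mod_ge1 x0.
  rewrite -ler_sqr ?nnegrE ?sqrtr_ge0 ?mulr_ge0 ?fg_mod_ge0//.
  rewrite sqr_sqrtr ?addr_ge0 ?sqmod_ge0// exprMn.
  rewrite -(@fg_mod_sqr R X x).
  have : 1 <= fg_mod (x : X) ^+ 2 :> R by rewrite expr_ge1// fg_mod_ge0.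
  move: (fg_mod (x : X) ^+ 2) => u; lra.
have Dfin : data_norm 1 S0 \is a fin_num by rewrite ge0_fin_numE ?Lnorm_ge0.
have N1 : (mixed_norm (X := torus R) 1 +oo (fun=> 1%R) (state_of W) <= (2 * 64)%:E * data_norm 1 S0)%E.
  apply: le_trans (mixed_norm_sup_le nm0 l11 dW) _.
  by rewrite EFinM -muleA; apply: lee_wpmul2l; [rewrite lee_fin|exact: aN].
have N2 : (mixed_norm (X := torus R) 1 2%:E (freq_japanese (torus R)) (state_of W) <= (K * 64)%:E * data_norm 1 S0)%E.
  apply: le_trans (mixed_norm_L2_le nm0 (ltr0n _ 2) l11 dW _ wa) _.
    by move=> x; exact: sqrtr_ge0.
  rewrite (EFinM K) -muleA; apply: lee_wpmul2l; [by rewrite lee_fin ltW|exact: aN].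
exists (fun t => field_of (state_of W t)), (state_of W); split.
- split => //.
  + by apply: le_lt_trans N1 _; rewrite lte_mul_pinfty// lee_fin mulr_ge0.
  + by apply: le_lt_trans N2 _; rewrite lte_mul_pinfty// lee_fin mulr_ge0// ltW.
  + move=> t t0; have [[trW _ _ _] _] := mW; have [h1 h2 h3] := trW t t0.
    have Z f F : fo_tr X f F -> F z0 = 0 -> torus_mean f = 0.
      by move=> h; rewrite (torus_transform0 h) => -[].
    split; [apply: (Z _ _ h1)|move=> j; apply: (Z _ _ (h2 j))|apply: (Z _ _ h3)];
      by rewrite /= !W0//; apply: complexP; rewrite //= oppr0.
- rewrite (_ : ((2 + K) * 64)%:E = ((2 * 64)%:E + (K * 64)%:E)%E); last by rewrite -EFinD mulrDl.
  by rewrite ge0_muleDl ?lee_fin ?mulr_ge0 ?(ltW K0)//; exact: leeD.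
- move=> s' S' [mS' fS' _ mfS'] t t0.
  apply: (@nsf_unique R X nu1 nu2 nu1_gt0 nu2_gt0 S0 W a s' S') => // t' t'0.
  apply: aeW => x /torus_mod0 ->.
  have [[trS _ _ _] _] := mS'; have [h1 h2 h3] := trS t' t'0.
  have [m1 m2 m3] := mfS' t' t'0.
  by rewrite (torus_transform0 h1) (torus_transform0 h3) m1 m3 oppr0.
Qed.

End torus_case.

(** * The whole space *)

Section space_case.
Context (R : realType).
Local Open Scope complex_scope.
Local Notation X := (space_fourier R).

(** The exceptional set is the ball of radius 0, of measure zero by [integral_ball]. *)
Lemma ae_space_mod_neq0 : \forall x \ae fg_measure X, fg_mod x != 0 :> R.
Proof.
have mB : measurable [set x : X | fg_mod x <= 0 :> R].
  rewrite (_ : [set x | _] = fg_mod @^-1` `]-oo, 0]%classic).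
    by rewrite -[X in measurable X]setTI; exact: (@measurable_fg_mod R X).
  by apply/seteqP; split => x; rewrite /= in_itv.
exists [set x : X | fg_mod x <= 0 :> R]; split => //.
  apply/eqP; rewrite eq_le measure_ge0 andbT.
  have := @integral_ball R 0 (lexx _); rewrite mulr0 expr0n/=.
  by rewrite (integral_indic (fg_measure X) measurableT mB) setIT.
by move=> x /= /negP; rewrite negbK => /eqP ->.
Qed.

Lemma space_settingE : fo_setting X = whole_space R. Proof. by []. Qed.

Lemma space_case (nu1 nu2 : R) : 0 < nu1 -> 0 < nu2 ->
  exists eta : R, 0 < eta /\
  (forall p : \bar R, ((3 / 2)%:E < p)%E ->
   exists C : R, 0 < C /\
    forall (s0 : state (R3 R -> R)) (S0 : state (freq (fo_setting X) -> R[i])),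
      transform_state s0 S0 -> constraints S0 ->
      (data_norm p S0 < +oo)%E ->
      (data_norm 1 S0 + data_norm p S0 <= eta%:E)%E ->
      exists (s : R -> state (R3 R -> R))
             (S : R -> state (freq (fo_setting X) -> R[i])),
        let admissible s' S' :=
          [/\ mild_solution nu1 nu2 S0 s' S',
              (mixed_norm 1 +oo (fun=> 1%R) S' < +oo)%E,
              (mixed_norm 1 2%:E (freq_mod (fo_setting X)) S' < +oo)%E,
              (mixed_norm p +oo (fun=> 1%R) S' < +oo)%E
            & (mixed_norm p 2%:E (freq_mod (fo_setting X)) S' < +oo)%E] in
        [/\ admissible s S,
            (mixed_norm 1 +oo (fun=> 1%R) S
             + mixed_norm 1 2%:E (freq_mod (fo_setting X)) S
             + (mixed_norm p +oo (fun=> 1%R) S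
                + mixed_norm p 2%:E (freq_mod (fo_setting X)) S)
             <= C%:E * (data_norm 1 S0 + data_norm p S0))%E
          & forall s' S', admissible s' S' ->
              forall t : R, 0 <= t -> s' t = s t]).
Proof.
move=> nu1_gt0 nu2_gt0; have nm0 := nu_min_gt0 nu1_gt0 nu2_gt0.
have sn0 : 0 < Num.sqrt (nu_min nu1 nu2) by rewrite sqrtr_gt0.
pose K := 2 * 1 / Num.sqrt (nu_min nu1 nu2).
have K0 : 0 < K by rewrite divr_gt0// mulr1.
pose dl := nsf_threshold X nu1 nu2 32.
have dl0 : 0 < dl by exact: nsf_threshold_gt0.
(* Chosen for [Lnorm_three_halves_le]: eta <= 1, and (2 eta)^{2/3} <= dl, so that the data are below
   the threshold in L^{3/2} for every p. *)
pose eta := Num.min 1 (dl `^ (3 / 2) / 2).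
have eta0 : 0 < eta by rewrite lt_min ltr01 divr_gt0// powR_gt0.
exists eta; split => // p p32.
exists ((2 + K) * 64); split; first by rewrite mulr_gt0// addr_gt0.
move=> s0 S0 tr0 con0 finp small.
have D0 q : (0 <= data_norm q S0)%E by exact: Lnorm_ge0.
have small1 : (data_norm 1 S0 <= eta%:E)%E by apply: le_trans small; rewrite leeDl.
have smallp : (data_norm p S0 <= eta%:E)%E by apply: le_trans small; rewrite leeDr.
have l11 : (1 <= 1 :> \bar R)%E by [].
have p1 : (1 <= p)%E by apply: ltW; apply: lt_trans p32; rewrite lte_fin; lra.
have l32 : (1 <= (3 / 2)%:E :> \bar R)%E by rewrite lee_fin; lra.
have fin1 : (data_norm 1 S0 < +oo)%E by apply: le_lt_trans small1 (ltry _).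
have ma : measurable_fun setT (amplitude S0).
  have [h1 h2 h3] := tr0.
  by apply: (@measurable_amplitude R X) => [|j|]; apply: (@tr_integrable R X); [exact: h1|exact: h2|exact: h3].
have small32 : (data_norm (3 / 2)%:E S0 <= dl%:E)%E.
  apply: le_trans (Lnorm_three_halves_le ma _ p32 _ small1 smallp) _.
  - by move=> x; exact: sqrtr_ge0.
  - by rewrite ge_min lexx.
  rewrite lee_fin.
  apply: (@le_trans _ _ ((dl `^ (3 / 2)) `^ (2 / 3))).
    apply: ge0_ler_powR; rewrite ?nnegrE ?mulr_ge0 ?powR_ge0 ?(ltW eta0)//.
    have : eta <= dl `^ (3 / 2) / 2 by rewrite ge_min lexx orbT.
    lra.
  have E : 3 / 2 * (2 / 3) = 1 :> R by field.
  by rewrite -powRrM E powRr1// ltW.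
have [W [a [dW ia sW mW [aN _]]]] :=
  @nsf_exists R X nu1 nu2 nu1_gt0 nu2_gt0 (3 / 2)%:E 32 s0 S0 l32 (ltr0n _ 32)
   (J_bounded_space l32) (J_bounded_space l11) tr0 con0 small32 fin1.
have [_ _ a0 Wa] := dW.
have N1 q : (1 <= q)%E ->
  (mixed_norm (X := fo_setting X) q +oo (fun=> 1%R) (state_of W) <= (2 * 64)%:E * data_norm q S0)%E.
  move=> q1; apply: le_trans (mixed_norm_sup_le nm0 q1 dW) _.
  by rewrite EFinM -muleA; apply: lee_wpmul2l; [rewrite lee_fin|apply: aN => //; exact: J_bounded_space].
have N2 q : (1 <= q)%E ->
  (mixed_norm (X := fo_setting X) q 2%:E (freq_mod (fo_setting X)) (state_of W) <= (K * 64)%:E * data_norm q S0)%E.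
  move=> q1; have w0 (x : X) : 0 <= freq_mod (fo_setting X) x by exact: sqrtr_ge0.
  have wa (x : X) : freq_mod (fo_setting X) x * a x <= 1 * fg_mod x * a x by rewrite mul1r.
  apply: le_trans (@mixed_norm_L2_le R X _ 1 W a q (freq_mod (fo_setting X)) nm0 ltr01 q1 dW w0 wa) _.
  by rewrite (EFinM K) -muleA; apply: lee_wpmul2l; [rewrite lee_fin ltW|apply: aN => //; exact: J_bounded_space].
exists (fun t => field_of (state_of W t)), (state_of W); split.
- split => //.
  + by apply: le_lt_trans (N1 _ l11) _; rewrite lte_mul_pinfty// lee_fin mulr_ge0.
  + by apply: le_lt_trans (N2 _ l11) _; rewrite lte_mul_pinfty// lee_fin mulr_ge0// ltW.
  + by apply: le_lt_trans (N1 _ p1) _; rewrite lte_mul_pinfty// lee_fin mulr_ge0.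
  + by apply: le_lt_trans (N2 _ p1) _; rewrite lte_mul_pinfty// lee_fin mulr_ge0// ltW.
- have N q : (1 <= q)%E -> (mixed_norm (X := fo_setting X) q +oo (fun=> 1%R) (state_of W) +
      mixed_norm (X := fo_setting X) q 2%:E (freq_mod (fo_setting X)) (state_of W) <=
      ((2 + K) * 64)%:E * data_norm q S0)%E.
    move=> q1; rewrite (_ : ((2 + K) * 64)%:E = ((2 * 64)%:E + (K * 64)%:E)%E); last by rewrite -EFinD mulrDl.
    rewrite ge0_muleDl ?lee_fin ?mulr_ge0 ?(ltW K0)//.
    by apply: leeD; [exact: N1|exact: N2].
  rewrite ge0_muleDr ?D0//; apply: leeD; exact: N.
- move=> s' S' [mS' fS' _ _ _] t t0.
  apply: (@nsf_unique R X nu1 nu2 nu1_gt0 nu2_gt0 S0 W a s' S') => // t' t'0.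
  by apply: filterS ae_space_mod_neq0 => x /eqP.
Qed.

End space_case.

Theorem theorem2p2 (R : realType) (nu1 nu2 : R)
    (nu1_gt0 : 0 < nu1) (nu2_gt0 : 0 < nu2) :
  exists eta1 : R, 0 < eta1 /\
  (exists C : R, 0 < C /\
    forall (s0 : state (R3 R -> R)) (S0 : state (freq (torus R) -> R[i])),
      transform_state s0 S0 -> constraints S0 -> mean_free s0 ->
      (data_norm 1 S0 <= eta1%:E)%E ->
      exists (s : R -> state (R3 R -> R))
             (S : R -> state (freq (torus R) -> R[i])),
        let admissible s' S' :=
          [/\ mild_solution nu1 nu2 S0 s' S',
              (mixed_norm 1 +oo (fun=> 1%R) S' < +oo)%E,
              (mixed_norm 1 2%:E (freq_japanese (torus R)) S' < +oo)%E
            & forall t : R, 0 <= t -> mean_free (s' t)] in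
        [/\ admissible s S,
            (mixed_norm 1 +oo (fun=> 1%R) S
             + mixed_norm 1 2%:E (freq_japanese (torus R)) S
             <= C%:E * data_norm 1 S0)%E
          & forall s' S', admissible s' S' ->
              forall t : R, 0 <= t -> s' t = s t])
  /\
  (forall p : \bar R, ((3 / 2)%:E < p)%E ->
   exists C : R, 0 < C /\
    forall (s0 : state (R3 R -> R)) (S0 : state (freq (whole_space R) -> R[i])),
      transform_state s0 S0 -> constraints S0 ->
      (data_norm p S0 < +oo)%E ->
      (data_norm 1 S0 + data_norm p S0 <= eta1%:E)%E ->
      exists (s : R -> state (R3 R -> R))
             (S : R -> state (freq (whole_space R) -> R[i])),
        let admissible s' S' :=
          [/\ mild_solution nu1 nu2 S0 s' S',
              (mixed_norm 1 +oo (fun=> 1%R) S' < +oo)%E,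
              (mixed_norm 1 2%:E (freq_mod (whole_space R)) S' < +oo)%E,
              (mixed_norm p +oo (fun=> 1%R) S' < +oo)%E
            & (mixed_norm p 2%:E (freq_mod (whole_space R)) S' < +oo)%E] in
        [/\ admissible s S,
            (mixed_norm 1 +oo (fun=> 1%R) S
             + mixed_norm 1 2%:E (freq_mod (whole_space R)) S
             + (mixed_norm p +oo (fun=> 1%R) S
                + mixed_norm p 2%:E (freq_mod (whole_space R)) S)
             <= C%:E * (data_norm 1 S0 + data_norm p S0))%E
          & forall s' S', admissible s' S' ->
              forall t : R, 0 <= t -> s' t = s t]).
Proof.
have [C [C0 H1]] := torus_case nu1_gt0 nu2_gt0.
have [eta [eta0 H2]] := space_case nu1_gt0 nu2_gt0.
pose dl := nsf_threshold (torus_fourier R) nu1 nu2 2.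
have dl0 : 0 < dl by apply: nsf_threshold_gt0.
exists (Num.min dl eta); split; first by rewrite lt_min dl0.
split.
  exists C; split => // s0 S0 h1 h2 h3 h4; apply: H1 h1 h2 h3 _.
  by apply: le_trans h4 _; rewrite lee_fin ge_min lexx.
move=> p /H2[Cp [Cp0 Hp]]; exists Cp; split => //.
rewrite -space_settingE => s0 S0 h1 h2 h3 h4; apply: Hp h1 h2 h3 _.
by apply: le_trans h4 _; rewrite lee_fin ge_min lexx orbT.
Qed.
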